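(* Assume the Riemann Hypothesis. Let $0<a\le 3/2$ be fixed and let $\beta=\beta(T)=(\log T)^{3-2a}$. If $$F_\beta(x,T)\ll T\log T\qquad\text{uniformly for}\quad \frac{T^2}{\log^4T}\ll x\ll T^{(\log T)^{(2-a)/a}},$$ then, as $x\to\infty$, $$\mathcal{R}(x)\ll x^{1/2}\log^a x .$$
   Context: $\Lambda$ is the von Mangoldt function, $\psi(x)=\sum_{n\le x}\Lambda(n)$, and $\mathcal{R}(x)$ is defined by $\psi(x)=x+\mathcal{R}(x)$. For $x>0$, $T\ge 3$, and $\beta\ge 1$, $$F_\beta(x,T):=\sum_{0<\gamma,\gamma'\le T}x^{i(\gamma-\gamma')}w_\beta(\gamma-\gamma'),\qquad w_\beta(u)=\frac{4\beta^2}{4\beta^2+u^2},$$ where $\gamma,\gamma'$ run over the imaginary parts of the nontrivial zeros of the Riemann zeta-function, counted with multiplicity. Conventions. $f\ll g$ means $|f|\le Kg$ for some constant $K$; $\log^m x=(\log x)^m$. A bound ''uniformly for $f(T)\ll x\ll g(T)$'' means: for any fixed constants $c,C>0$ the bound holds, with an implied constant depending only on $c,C$ (and fixed parameters), for all $x\ge 2$ and $T\ge 3$ with $cf(T)\le x\le Cg(T)$. The implied constant in the conclusion may depend on $a$ and on the implied constants in the hypothesis. *)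

(* Defs.v *)
(* Stdlib real numbers with Coquelicot; mathcomp is used only for prime numbers. *)
From Stdlib Require Import Reals List ZArith ClassicalEpsilon.
From Coquelicot Require Import Coquelicot.
From mathcomp Require ssreflect ssrfun ssrbool eqtype ssrnat seq div bigop prime.
Import ListNotations.
Open Scope R_scope.

(* [prime.primes n] lists the distinct prime divisors of [n] and is empty for
   n = 0, 1, so it is a singleton exactly when [n] is a prime power p^k, k >= 1;
   see the two lemmas below. *)
Definition von_mangoldt (n : nat) : R :=
  match prime.primes n with
  | [p] => ln (INR p)
  | _ => 0
  end.

Section VonMangoldt.
Import ssreflect ssrfun ssrbool eqtype ssrnat seq div bigop prime.
Local Open Scope nat_scope.

Lemma von_mangoldt_prime_power (p k : nat) :
  prime p -> 0 < k -> von_mangoldt (p ^ k) = ln (INR p).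
Proof.
by move=> Hp; case: k => // k _; rewrite /von_mangoldt primesX // primes_prime.
Qed.

Lemma von_mangoldt_not_prime_power (n : nat) :
  (forall p k : nat, prime p -> 0 < k -> n <> p ^ k) -> von_mangoldt n = 0%R.
Proof.
move=> H; rewrite /von_mangoldt.
case E: (primes n) => [|p [|q s]] //; exfalso.
have Lp : p \in primes n by rewrite E mem_head.
move: (Lp); rewrite mem_primes => /and3P [Hp Hn _].
apply: (H p (logn p n) Hp); first by rewrite logn_gt0.
by have := prod_prime_decomp Hn; rewrite prime_decompE E /= big_seq1.
Qed.

End VonMangoldt.

Definition psi (x : R) : R := sum_f_R0 von_mangoldt (Z.to_nat (Int_part x)).

Definition psi_error (x : R) : R := psi x - x.

(* x^s = exp (s log x) for x > 0. *)
Definition cpow (x : R) (s : C) : C :=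
  (exp (Re s * ln x) * cos (Im s * ln x), exp (Re s * ln x) * sin (Im s * ln x)).

Definition C_differentiable_at (f : C -> C) (z : C) : Prop :=
  @ex_derive C_AbsRing C_NormedModule f z.

(* The analytic continuation of the Dirichlet series to C \ {1}. *)
Definition is_riemann_zeta (f : C -> C) : Prop :=
  (forall s : C, s <> RtoC 1 -> C_differentiable_at f s) /\
  (forall s : C, 1 < Re s ->
     @is_series C_AbsRing C_NormedModule
       (fun n : nat => cpow (INR (S n)) (Copp s)) (f s)).

(* [is_riemann_zeta] determines the function except at the pole s = 1, where the
   value is irrelevant. *)
Definition zeta : C -> C :=
  epsilon (inhabits (fun _ : C => RtoC 0)) is_riemann_zeta.

Definition nontrivial_zero (rho : C) : Prop :=
  0 < Re rho < 1 /\ zeta rho = RtoC 0.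

Definition riemann_hypothesis : Prop :=
  forall rho : C, nontrivial_zero rho -> Re rho = 1 / 2.

Definition is_zero_of_order (f : C -> C) (z : C) (m : nat) : Prop :=
  exists g : C -> C,
    g z <> RtoC 0 /\
    locally z (fun s : C =>
      C_differentiable_at g s /\ f s = Cmult (Cpow (Cminus s z) m) (g s)).

(* [l] lists the nontrivial zeros with 0 < gamma <= T, each repeated according to
   its multiplicity.  It is unique up to permutation. *)
Definition is_zero_list (T : R) (l : list C) : Prop :=
  forall rho : C,
    (nontrivial_zero rho /\ 0 < Im rho <= T ->
       is_zero_of_order zeta rho (count_occ Ceq_dec l rho)) /\
    (~ (nontrivial_zero rho /\ 0 < Im rho <= T) -> ~ In rho l).

Definition zero_list (T : R) : list C := epsilon (inhabits []) (is_zero_list T).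

Definition w (beta u : R) : R := 4 * beta ^ 2 / (4 * beta ^ 2 + u ^ 2).

Definition F (beta x T : R) : C :=
  fold_right Cplus (RtoC 0)
    (map (fun p : C * C =>
            let u := Im (fst p) - Im (snd p) in
            Cmult (cpow x (0, u)) (RtoC (w beta u)))
         (list_prod (zero_list T) (zero_list T))).

(* Main.v *)
(* Averaging over [x, x + h] with h about sqrt x, a truncated Perron integral and the partial fractions of the
   logarithmic derivative of (s - 1) zeta(s) give the explicit formula: psi(x) - x is, up to O(sqrt x), a sum over
   zeros of the averages of y^rho / rho.  Expanding |sum_gamma y^(i gamma)|^2 shows that F_beta(x, T) is a weighted
   mean square of S(y, T) = sum_(gamma <= T) y^(i gamma), so F bounds the mean square of S over
   log y in [log x, log x + 1/beta].  A Sobolev inequality turns this into a pointwise bound; the derivative of S is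
   handled by summation by parts in L^2, where the bound at every height u <= T enters.  The outcome is
   S(y, T) << T (log T)^(a-1) for exp(C (log x)^(a/2)) <= T <= sqrt x log x.  In the explicit formula, zeros below
   this range contribute sqrt x (log x)^a by counting, zeros above it O(sqrt x) thanks to the averaging, and those
   inside it sqrt x (log x)^a by dyadic summation by parts. *)
Require Import Defs.
From Stdlib Require Import Reals Lra Lia List ClassicalEpsilon Classical Permutation ZArith.
From Coquelicot Require Import Coquelicot.
Open Scope R_scope.

(** * Continuity and differentiability of complex functions *)

(** The upper limit on x in the hypothesis says log x <= (log T)^(2/a), that is T >= exp((log
    x)^(a/2)); the zeros below that height cost (log T)^2 = (log x)^a, exactly the error allowed. At
    the other end heights up to sqrt x log x suffice, since the averaged kernel makes the remaining
    tail (x^(3/2) / h) log Z / Z = O(sqrt x) for Z = sqrt x log x. In between, F bounds the integral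
    Q of |S|^2 over a window of length 1/beta = (log T)^(2a-3) by T (log T)^(2a-2); the derivative
    of S is about T times larger, so the Sobolev inequality with parameter T gives |S|^2 << T Q. The
    delicate range is u < exp((log x)^(a/2)) in the mean square of the derivative, where F says
    nothing: there S is bounded by counting zeros, and T is kept above a constant times the fourth
    power of that height, which changes only constants. RH lets the contour stop at Re s = 1/4, so
    Euler-Maclaurin continuation is enough, and Jensen's inequality supplies all zero counting,
    O(log T) per unit interval. The monotonicity of psi turns averages over [x - h, x] and
    [x, x + h] into a pointwise bound. *)

Lemma locally_C_iff (z : C) (P : C -> Prop) :
  locally z P <-> exists d : R, 0 < d /\ forall w : C, Cmod (w - z) < d -> P w.
Proof.
split.
- intros [d Hd]. exists d. split; [apply cond_pos|].
  intros w Hw. apply Hd. apply (C_NormedModule_mixin_compat1 z w d Hw).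
- intros [d [Hd H]]. assert (Hd2 : 0 < d / sqrt 2) by (apply Rdiv_lt_0_compat; [lra|apply sqrt_lt_R0; lra]).
  exists (mkposreal _ Hd2). intros w Hw. apply H.
  pose proof (C_NormedModule_mixin_compat2 z w (mkposreal _ Hd2) Hw) as H2.
  simpl in H2. replace d with (sqrt 2 * (d / sqrt 2)); [exact H2|].
  field. apply Rgt_not_eq, sqrt_lt_R0; lra.
Qed.

Lemma locally_R_iff (t : R) (P : R -> Prop) :
  locally t P <-> exists d : R, 0 < d /\ forall u : R, Rabs (u - t) < d -> P u.
Proof.
split.
- intros [d Hd]. exists d. split; [apply cond_pos|]. intros u Hu. apply Hd. exact Hu.
- intros [d [Hd H]]. exists (mkposreal _ Hd). intros u Hu. apply H. exact Hu.
Qed.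

Lemma C_ext (a b : C) : Re a = Re b -> Im a = Im b -> a = b.
Proof. destruct a, b; simpl; intros -> ->; reflexivity. Qed.

(** Continuity is phrased with [Cmod] over an arbitrary uniform domain, so that the same rules serve
    paths from R and functions on C; [locally_C_iff] translates between the modulus and the product
    topology of C. *)
Definition ccont {U : UniformSpace} (f : U -> C) (x : U) : Prop :=
  forall eps : R, 0 < eps -> locally x (fun y => Cmod (f y - f x) < eps).

Lemma Cmod_minus_sym (a b : C) : Cmod (a - b) = Cmod (b - a).
Proof. rewrite <- Cmod_opp. f_equal. ring. Qed.

Lemma Cmod_triangle_minus (a b c : C) : Cmod (a - c) <= Cmod (a - b) + Cmod (b - c).
Proof. replace (a - c)%C with ((a - b) + (b - c))%C by ring. apply Cmod_triangle. Qed.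

Lemma Cmod_le_minus (a b : C) : Cmod a <= Cmod b + Cmod (a - b).
Proof. replace a with (b + (a - b))%C at 1 by ring. apply Cmod_triangle. Qed.

Lemma Cmod_0_minus (a : C) : Cmod (a - a) = 0.
Proof. replace (a - a)%C with (RtoC 0) by ring. apply Cmod_0. Qed.

Section Cont.
Context {U : UniformSpace}.
Implicit Types f g : U -> C.

Lemma ccont_const (c : C) (x : U) : ccont (fun _ => c) x.
Proof.
intros e He. apply filter_forall. intros y. rewrite Cmod_0_minus. exact He.
Qed.

Lemma ccont_plus f g x : ccont f x -> ccont g x -> ccont (fun y => f y + g y)%C x.
Proof.
intros Hf Hg e He. assert (He2 : 0 < e / 2) by lra.
generalize (filter_and _ _ (Hf _ He2) (Hg _ He2)). apply filter_imp. intros y [H1 H2].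
replace (f y + g y - (f x + g x))%C with ((f y - f x) + (g y - g x))%C by ring.
eapply Rle_lt_trans; [apply Cmod_triangle|]. lra.
Qed.

Lemma ccont_opp f x : ccont f x -> ccont (fun y => - f y)%C x.
Proof.
intros Hf e He. generalize (Hf _ He). apply filter_imp. intros y H1.
replace (- f y - - f x)%C with (- (f y - f x))%C by ring. rewrite Cmod_opp. exact H1.
Qed.

Lemma ccont_minus f g x : ccont f x -> ccont g x -> ccont (fun y => f y - g y)%C x.
Proof. intros Hf Hg. apply ccont_plus; [exact Hf|apply ccont_opp, Hg]. Qed.

Lemma ccont_bound f x : ccont f x -> locally x (fun y => Cmod (f y) < Cmod (f x) + 1).
Proof.
intros Hf. generalize (Hf 1 Rlt_0_1). apply filter_imp. intros y H.
pose proof (Cmod_le_minus (f y) (f x)). lra.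
Qed.

Lemma ccont_mult f g x : ccont f x -> ccont g x -> ccont (fun y => f y * g y)%C x.
Proof.
intros Hf Hg e He.
set (M := Cmod (f x) + Cmod (g x) + 1).
assert (HM : 0 < M) by (unfold M; pose proof (Cmod_ge_0 (f x)); pose proof (Cmod_ge_0 (g x)); lra).
assert (He2 : 0 < e / (2 * M)) by (apply Rdiv_lt_0_compat; lra).
generalize (filter_and _ _ (ccont_bound f x Hf) (filter_and _ _ (Hf _ He2) (Hg _ He2))).
apply filter_imp. intros y [H0 [H1 H2]].
replace (f y * g y - f x * g x)%C with (f y * (g y - g x) + (f y - f x) * g x)%C by ring.
eapply Rle_lt_trans; [apply Cmod_triangle|]. rewrite !Cmod_mult.
assert (A : Cmod (f y) * Cmod (g y - g x) <= M * Cmod (g y - g x)).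
{ apply Rmult_le_compat_r; [apply Cmod_ge_0|]. unfold M. pose proof (Cmod_ge_0 (g x)). lra. }
assert (B : Cmod (f y - f x) * Cmod (g x) <= Cmod (f y - f x) * M).
{ apply Rmult_le_compat_l; [apply Cmod_ge_0|]. unfold M. pose proof (Cmod_ge_0 (f x)). lra. }
assert (A' : M * Cmod (g y - g x) < M * (e / (2 * M))) by (apply Rmult_lt_compat_l; assumption).
assert (B' : Cmod (f y - f x) * M < (e / (2 * M)) * M) by (apply Rmult_lt_compat_r; assumption).
replace e with (M * (e / (2 * M)) + (e / (2 * M)) * M) by (field; lra). lra.
Qed.

Lemma ccont_lower f x : ccont f x -> f x <> RtoC 0 -> locally x (fun y => Cmod (f x) / 2 < Cmod (f y)).
Proof.
intros Hf H0. apply Cmod_gt_0 in H0. assert (He : 0 < Cmod (f x) / 2) by lra.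
generalize (Hf _ He). apply filter_imp. intros y H.
pose proof (Cmod_le_minus (f x) (f y)). rewrite Cmod_minus_sym in H1. lra.
Qed.

Lemma ccont_inv f x : ccont f x -> f x <> RtoC 0 -> ccont (fun y => / f y)%C x.
Proof.
intros Hf H0 e He. pose proof H0 as H0'. apply Cmod_gt_0 in H0'.
set (m := Cmod (f x)) in *.
assert (He2 : 0 < e * (m * m / 2)) by (apply Rmult_lt_0_compat; [lra|]; nra).
generalize (filter_and _ _ (ccont_lower f x Hf H0) (Hf _ He2)). apply filter_imp.
fold m. intros y [H1 H2].
assert (Hy : f y <> RtoC 0) by (apply Cmod_gt_0; lra).
replace (/ f y - / f x)%C with ((f x - f y) * / (f y * f x))%C by (field; split; assumption).
rewrite Cmod_mult, Cmod_inv, Cmod_mult; [|apply Cmult_neq_0; assumption].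
fold m. rewrite Cmod_minus_sym.
assert (Hp : 0 < Cmod (f y) * m) by (apply Rmult_lt_0_compat; lra).
apply Rmult_lt_reg_r with (Cmod (f y) * m); [exact Hp|].
rewrite Rmult_assoc, Rinv_l, Rmult_1_r; [|lra].
eapply Rlt_le_trans; [exact H2|]. apply Rmult_le_compat_l; [lra|]. nra.
Qed.

Lemma ccont_div f g x : ccont f x -> ccont g x -> g x <> RtoC 0 -> ccont (fun y => f y / g y)%C x.
Proof. intros. apply ccont_mult; [|apply ccont_inv]; assumption. Qed.

Lemma ccont_ext_loc f g x : locally x (fun y => f y = g y) -> ccont f x -> ccont g x.
Proof.
intros H Hf e He. pose proof (locally_singleton _ _ H) as H0.
generalize (filter_and _ _ H (Hf _ He)). apply filter_imp. intros y [<- H2]. rewrite <- H0. exact H2.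
Qed.

Lemma ccont_pow f n x : ccont f x -> ccont (fun y => Cpow (f y) n) x.
Proof.
intros Hf. induction n as [|n IH]; [apply (ccont_const (RtoC 1))|].
apply (ccont_mult f (fun y => Cpow (f y) n)); assumption.
Qed.

Lemma ccont_pair (u v : U -> R) x :
  continuous u x -> continuous v x -> ccont (fun y => (u y, v y) : C) x.
Proof.
intros Hu Hv e He.
assert (He2 : 0 < e / 2) by lra.
assert (A : locally x (fun y => Rabs (u y - u x) < e / 2)).
{ apply (Hu (fun r => Rabs (r - u x) < e / 2)). apply locally_R_iff. exists (e/2). tauto. }
assert (B : locally x (fun y => Rabs (v y - v x) < e / 2)).
{ apply (Hv (fun r => Rabs (r - v x) < e / 2)). apply locally_R_iff. exists (e/2). tauto. }
generalize (filter_and _ _ A B). apply filter_imp. intros y [H1 H2].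
replace ((u y, v y) - (u x, v x))%C with (RtoC (u y - u x) + Ci * RtoC (v y - v x))%C.
2:{ apply C_ext; simpl; ring. }
eapply Rle_lt_trans; [apply Cmod_triangle|]. rewrite Cmod_mult, Cmod_Ci, !Cmod_R. lra.
Qed.

Lemma ccont_continuous f x : ccont f x -> continuous (f : U -> C_R_NormedModule) x.
Proof.
intros Hf P HP. destruct HP as [d Hd]. unfold filtermap.
generalize (Hf d (cond_pos d)). apply filter_imp. intros y Hy. apply Hd.
apply (C_NormedModule_mixin_compat1 (f x) (f y) d Hy).
Qed.

Lemma ccont_Re f x : ccont f x -> continuous (fun y => Re (f y)) x.
Proof.
intros Hf P [d Hd]. unfold filtermap. generalize (Hf d (cond_pos d)). apply filter_imp.
intros y Hy. apply Hd. change (Rabs (Re (f y) - Re (f x)) < d).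
pose proof (re_le_Cmod (f y - f x)). replace (Re (f y) - Re (f x)) with (Re (f y - f x)) by reflexivity. lra.
Qed.

Lemma im_le_Cmod (c : C) : Rabs (Im c) <= Cmod c.
Proof. eapply Rle_trans; [|apply Rmax_Cmod]. apply Rmax_r. Qed.

Lemma ccont_Im f x : ccont f x -> continuous (fun y => Im (f y)) x.
Proof.
intros Hf P [d Hd]. unfold filtermap. generalize (Hf d (cond_pos d)). apply filter_imp.
intros y Hy. apply Hd. change (Rabs (Im (f y) - Im (f x)) < d).
pose proof (im_le_Cmod (f y - f x)). replace (Im (f y) - Im (f x)) with (Im (f y - f x)) by reflexivity. lra.
Qed.

Lemma ccont_Cmod f x : ccont f x -> continuous (fun y => Cmod (f y)) x.
Proof.
intros Hf P [d Hd]. unfold filtermap. generalize (Hf d (cond_pos d)). apply filter_imp.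
intros y Hy. apply Hd. change (Rabs (Cmod (f y) - Cmod (f x)) < d).
pose proof (Cmod_le_minus (f y) (f x)). pose proof (Cmod_le_minus (f x) (f y)).
rewrite (Cmod_minus_sym (f x)) in H0. apply Rabs_def1; lra.
Qed.

Lemma ccont_RtoC (u : U -> R) x : continuous u x -> ccont (fun y => RtoC (u y)) x.
Proof. intros H. apply (ccont_pair u (fun _ => 0)); [exact H|apply continuous_const]. Qed.
End Cont.

Lemma ccont_id (z : C) : ccont (fun w : C => w) z.
Proof. intros e He. apply locally_C_iff. exists e. tauto. Qed.

Lemma ccont_comp {U : UniformSpace} (g : U -> C) (f : C -> C) (x : U) :
  ccont g x -> ccont f (g x) -> ccont (fun y => f (g y)) x.
Proof.
intros Hg Hf e He.
pose proof (proj1 (locally_C_iff _ _) (Hf e He)) as [d [Hd H]].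
generalize (Hg d Hd). apply filter_imp. intros y Hy. apply H, Hy.
Qed.

(* Caratheodory's form of complex differentiability. *)
Definition cder (f : C -> C) (z l : C) : Prop :=
  exists p : C -> C, ccont p z /\ p z = l /\
    locally z (fun w => f w - f z = p w * (w - z))%C.

Definition rder (f : R -> C) (t : R) (l : C) : Prop :=
  exists p : R -> C, ccont p t /\ p t = l /\
    locally t (fun u => f u - f t = p u * RtoC (u - t))%C.

Lemma cder_const (c z : C) : cder (fun _ => c) z 0.
Proof.
exists (fun _ => RtoC 0). split; [apply ccont_const|]. split; [reflexivity|].
apply filter_forall. intros w. ring.
Qed.

Lemma cder_id (z : C) : cder (fun w => w) z 1.
Proof.
exists (fun _ => RtoC 1). split; [apply ccont_const|]. split; [reflexivity|].
apply filter_forall. intros w. ring.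
Qed.

Lemma cder_ccont f z l : cder f z l -> ccont f z.
Proof.
intros [p [Hp [Hl H]]].
apply (ccont_ext_loc (fun w => f z + p w * (w - z))%C).
- generalize H. apply filter_imp. intros w Hw. rewrite <- Hw. ring.
- apply ccont_plus; [apply ccont_const|]. apply ccont_mult; [exact Hp|].
  apply ccont_minus; [apply ccont_id|apply ccont_const].
Qed.

Lemma cder_ext_loc f g z l : locally z (fun w => f w = g w) -> cder f z l -> cder g z l.
Proof.
intros H [p [Hp [Hl Hf]]]. exists p. split; [exact Hp|]. split; [exact Hl|].
pose proof (locally_singleton _ _ H) as H0. simpl in H0.
generalize (filter_and _ _ H Hf). apply filter_imp. intros w [<- Hw]. rewrite <- H0. exact Hw.
Qed.

Lemma cder_eq f z l l' : l = l' -> cder f z l -> cder f z l'.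
Proof. intros <-. exact (fun H => H). Qed.

Lemma cder_plus f g z l m : cder f z l -> cder g z m -> cder (fun w => f w + g w)%C z (l + m).
Proof.
intros [p [Hp [Hl Hf]]] [q [Hq [Hm Hg]]]. exists (fun w => p w + q w)%C.
split; [apply ccont_plus; assumption|]. split; [rewrite Hl, Hm; reflexivity|].
generalize (filter_and _ _ Hf Hg). apply filter_imp. intros w [H1 H2].
transitivity ((f w - f z) + (g w - g z))%C; [ring|]. rewrite H1, H2. ring.
Qed.

Lemma cder_mult f g z l m : cder f z l -> cder g z m -> cder (fun w => f w * g w)%C z (l * g z + f z * m).
Proof.
intros Hf' Hg'. pose proof (cder_ccont _ _ _ Hg') as Cg.
destruct Hf' as [p [Hp [Hl Hf]]]. destruct Hg' as [q [Hq [Hm Hg]]]. exists (fun w => p w * g w + f z * q w)%C.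
split; [apply ccont_plus; apply ccont_mult; try assumption; apply ccont_const|].
split; [rewrite Hl, Hm; reflexivity|].
generalize (filter_and _ _ Hf Hg). apply filter_imp. intros w [H1 H2].
transitivity ((f w - f z) * g w + f z * (g w - g z))%C; [ring|]. rewrite H1, H2. ring.
Qed.

Lemma cder_scal (c : C) f z l : cder f z l -> cder (fun w => c * f w)%C z (c * l).
Proof.
intros H. apply (cder_eq _ _ (0 * f z + c * l)%C); [ring|].
apply (cder_mult (fun _ => c)); [apply cder_const|exact H].
Qed.

Lemma cder_opp f z l : cder f z l -> cder (fun w => - f w)%C z (- l).
Proof.
intros H. apply (cder_ext_loc (fun w => (- (1)) * f w)%C).
- apply filter_forall. intros w. ring.
- apply (cder_eq _ _ (- (1) * l)%C); [ring|]. apply (cder_scal (- (1))%C), H.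
Qed.

Lemma cder_minus f g z l m : cder f z l -> cder g z m -> cder (fun w => f w - g w)%C z (l - m).
Proof. intros Hf Hg. apply cder_plus; [exact Hf|apply cder_opp, Hg]. Qed.

Lemma cder_inv f z l : cder f z l -> f z <> RtoC 0 -> cder (fun w => / f w)%C z (- l / (f z * f z)).
Proof.
intros Hf' H0. pose proof (cder_ccont _ _ _ Hf') as Cf. destruct Hf' as [p [Hp [Hl Hf]]].
exists (fun w => - p w * / (f w * f z))%C. split; [|split].
- apply ccont_mult; [apply ccont_opp, Hp|]. apply (ccont_inv (fun w => f w * f z)%C).
  + apply ccont_mult; [exact Cf|apply ccont_const].
  + apply Cmult_neq_0; assumption.
- rewrite Hl. reflexivity.
- generalize (filter_and _ _ Hf (ccont_lower f z Cf H0)). apply filter_imp. intros w [H1 H2].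
  assert (Hw : f w <> RtoC 0). { apply Cmod_gt_0. pose proof (Cmod_ge_0 (f z)). lra. }
  transitivity (- (f w - f z) / (f w * f z))%C; [field; split; assumption|]. rewrite H1. field. split; assumption.
Qed.

(** In Caratheodory's form the slopes simply multiply: p (g w) q w is a continuous slope for the
    composite, and points with g w = g z need no separate treatment. *)
Lemma cder_comp f g z l m : cder g z m -> cder f (g z) l -> cder (fun w => f (g w)) z (l * m).
Proof.
intros Hg' [p [Hp [Hl Hf]]]. pose proof (cder_ccont _ _ _ Hg') as Cg. destruct Hg' as [q [Hq [Hm Hg]]].
exists (fun w => p (g w) * q w)%C. split; [|split].
- apply ccont_mult; [|exact Hq]. apply (ccont_comp g p); assumption.
- rewrite Hl, Hm. reflexivity.
- apply locally_C_iff in Hf. destruct Hf as [d [Hd H]].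
  generalize (filter_and _ _ (Cg d Hd) Hg). apply filter_imp. intros w [H1 H2].
  rewrite (H _ H1), H2. ring.
Qed.

Lemma rder_comp f (g : R -> C) t l m : rder g t m -> cder f (g t) l -> rder (fun u => f (g u)) t (l * m).
Proof.
intros [q [Hq [Hm Hg]]] [p [Hp [Hl Hf]]].
assert (Cg : ccont g t).
{ apply (ccont_ext_loc (fun u => g t + q u * RtoC (u - t))%C).
  - generalize Hg. apply filter_imp. intros w Hw. rewrite <- Hw. ring.
  - apply ccont_plus; [apply ccont_const|]. apply ccont_mult; [exact Hq|].
    apply ccont_RtoC. apply (continuous_minus (fun u : R => u) (fun _ => t)); [apply continuous_id|apply continuous_const]. }
exists (fun w => p (g w) * q w)%C. split; [|split].
- apply ccont_mult; [|exact Hq]. apply (ccont_comp g p); assumption.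
- rewrite Hl, Hm. reflexivity.
- apply locally_C_iff in Hf. destruct Hf as [d [Hd H]].
  generalize (filter_and _ _ (Cg d Hd) Hg). apply filter_imp. intros w [H1 H2].
  rewrite (H _ H1), H2. ring.
Qed.

Lemma norm_C_R (x : C_R_NormedModule) : norm x = Cmod x.
Proof.
unfold norm. simpl. unfold prod_norm, norm. simpl. unfold abs. simpl. unfold Cmod.
f_equal. f_equal; apply pow2_abs.
Qed.

Lemma rder_is_derive (g : R -> C) t l : rder g t l -> is_derive (g : R -> C_R_NormedModule) t l.
Proof.
intros [q [Hq [Hm Hg]]]. split; [apply is_linear_scal_l|].
intros x Hx. assert (x = t) as -> by (symmetry; apply (is_filter_lim_locally_unique t x Hx)). clear Hx.
intros e. generalize (filter_and _ _ (Hq e (cond_pos e)) Hg). apply filter_imp.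
intros u [H1 H2]. rewrite <- Hm.
assert (E : minus (minus (g u : C_R_NormedModule) (g t)) (scal (minus u t) (q t)) = ((q u - q t) * RtoC (u - t))%C).
{ assert (E0 : ((g u - g t) - RtoC (u - t) * q t)%C = ((q u - q t) * RtoC (u - t))%C) by (rewrite H2; ring).
  rewrite scal_R_Cmult. exact E0. }
apply Rle_trans with (norm (((q u - q t) * RtoC (u - t))%C : C_R_NormedModule)); [right; f_equal; exact E|].
rewrite norm_C_R.
change (norm (minus u t)) with (Rabs (u - t)).
rewrite Cmod_mult, Cmod_R. apply Rmult_le_compat_r; [apply Rabs_pos|lra].
Qed.

Lemma rder_affine (a b : C) t : rder (fun u => a + b * RtoC u)%C t b.
Proof.
exists (fun _ => b). split; [apply ccont_const|]. split; [reflexivity|]. apply filter_forall.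
intros u. rewrite RtoC_minus. ring.
Qed.

Definition cdiff f z := exists l, cder f z l.

(** * Integrals along segments and rectangles *)

Definition CInt (f : R -> C) (a b : R) : C := RInt (f : R -> C_R_CompleteNormedModule) a b.

Definition ccont_on (f : R -> C) (a b : R) : Prop :=
  forall t, Rmin a b <= t <= Rmax a b -> ccont f t.

Lemma ccont_on_ex f a b : ccont_on f a b -> ex_RInt (f : R -> C_R_CompleteNormedModule) a b.
Proof.
intros H. apply (@ex_RInt_continuous C_R_CompleteNormedModule). intros z Hz. apply ccont_continuous, H, Hz.
Qed.

Lemma CInt_pair f a b : ccont_on f a b ->
  CInt f a b = (RInt (fun t => Re (f t)) a b, RInt (fun t => Im (f t)) a b).
Proof.
intros H. symmetry.
apply (RInt_fct_extend_pair (U := R_NormedModule) (V := R_NormedModule)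
  (fun f a b => RInt (f : R -> R_CompleteNormedModule) a b) (fun f a b => RInt (f : R -> R_CompleteNormedModule) a b)).
- intros; apply is_RInt_unique; assumption.
- intros; apply is_RInt_unique; assumption.
- apply (RInt_correct (V := C_R_CompleteNormedModule)). apply ccont_on_ex, H.
Qed.

Lemma ccont_on_Re f a b : ccont_on f a b -> ex_RInt (fun t => Re (f t)) a b.
Proof. intros H. apply (@ex_RInt_continuous R_CompleteNormedModule). intros z Hz. apply ccont_Re, H, Hz. Qed.
Lemma ccont_on_Im f a b : ccont_on f a b -> ex_RInt (fun t => Im (f t)) a b.
Proof. intros H. apply (@ex_RInt_continuous R_CompleteNormedModule). intros z Hz. apply ccont_Im, H, Hz. Qed.

Lemma CInt_ext f g a b :
  (forall t, Rmin a b <= t <= Rmax a b -> f t = g t) -> CInt f a b = CInt g a b.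
Proof. intros H. apply (RInt_ext (V := C_R_CompleteNormedModule)). intros x Hx. apply H. lra. Qed.

Lemma CInt_plus f g a b : ccont_on f a b -> ccont_on g a b ->
  CInt (fun t => f t + g t)%C a b = (CInt f a b + CInt g a b)%C.
Proof. intros Hf Hg. apply (RInt_plus (V := C_R_CompleteNormedModule)); apply ccont_on_ex; assumption. Qed.

(** The integral takes values in a real normed module, so linearity over complex scalars has to be
    checked on real and imaginary parts. *)
Lemma CInt_scal (c : C) f a b : ccont_on f a b -> CInt (fun t => c * f t)%C a b = (c * CInt f a b)%C.
Proof.
intros Hf. rewrite (CInt_pair f), (CInt_pair (fun t => c * f t)%C); try assumption.
2:{ intros t Ht. apply ccont_mult; [apply ccont_const|apply Hf, Ht]. }
pose proof (ccont_on_Re f a b Hf) as HR. pose proof (ccont_on_Im f a b Hf) as HI.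
apply C_ext; simpl.
- rewrite <- (RInt_scal (V := R_CompleteNormedModule)), <- (RInt_scal (V := R_CompleteNormedModule)) by assumption.
  rewrite <- (RInt_minus (V := R_CompleteNormedModule)); [reflexivity| |];
  apply (ex_RInt_scal (V := R_CompleteNormedModule)); assumption.
- rewrite <- (RInt_scal (V := R_CompleteNormedModule)), <- (RInt_scal (V := R_CompleteNormedModule)) by assumption.
  rewrite <- (RInt_plus (V := R_CompleteNormedModule)); [reflexivity| |];
  apply (ex_RInt_scal (V := R_CompleteNormedModule)); assumption.
Qed.

Lemma CInt_minus f g a b : ccont_on f a b -> ccont_on g a b ->
  CInt (fun t => f t - g t)%C a b = (CInt f a b - CInt g a b)%C.
Proof. intros Hf Hg. apply (RInt_minus (V := C_R_CompleteNormedModule)); apply ccont_on_ex; assumption. Qed.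

Lemma CInt_bound f a b M : a <= b -> ccont_on f a b ->
  (forall t, a <= t <= b -> Cmod (f t) <= M) -> Cmod (CInt f a b) <= (b - a) * M.
Proof.
intros Hab Hf HM. rewrite <- norm_C_R.
apply (norm_RInt_le_const (V := C_R_NormedModule) f a b _ M Hab).
- intros t Ht. rewrite norm_C_R. apply HM, Ht.
- apply (RInt_correct (V := C_R_CompleteNormedModule)). apply ccont_on_ex, Hf.
Qed.

Lemma CInt_bound_fun f (g : R -> R) a b : a <= b -> ccont_on f a b -> ex_RInt g a b ->
  (forall t, a <= t <= b -> Cmod (f t) <= g t) -> Cmod (CInt f a b) <= RInt g a b.
Proof.
intros Hab Hf Hg HM. rewrite <- norm_C_R.
apply (norm_RInt_le (V := C_R_NormedModule) f g a b _ _ Hab).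
- intros t Ht. rewrite norm_C_R. apply HM, Ht.
- apply (RInt_correct (V := C_R_CompleteNormedModule)). apply ccont_on_ex, Hf.
- apply (RInt_correct (V := R_CompleteNormedModule)), Hg.
Qed.

Lemma CInt_Chasles f a b c :
  (forall t, Rmin a (Rmin b c) <= t <= Rmax a (Rmax b c) -> ccont f t) ->
  (CInt f a b + CInt f b c = CInt f a c)%C.
Proof.
intros H. apply (RInt_Chasles (V := C_R_CompleteNormedModule)); apply ccont_on_ex; intros t Ht; apply H;
revert Ht; unfold Rmin, Rmax; repeat destruct Rle_dec; lra.
Qed.

Lemma CInt_FTC (F f : R -> C) a b :
  (forall t, Rmin a b <= t <= Rmax a b -> rder F t (f t) /\ ccont f t) ->
  CInt f a b = (F b - F a)%C.
Proof.
intros H. apply (is_RInt_unique (V := C_R_CompleteNormedModule)).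
apply (is_RInt_derive (V := C_R_CompleteNormedModule) F f).
- intros x Hx. apply rder_is_derive, H, Hx.
- intros x Hx. apply ccont_continuous, H, Hx.
Qed.

Lemma CInt_bound_abs f a b M : ccont_on f a b ->
  (forall t, Rmin a b <= t <= Rmax a b -> Cmod (f t) <= M) -> Cmod (CInt f a b) <= Rabs (b - a) * M.
Proof.
intros Hf HM. destruct (Rle_dec a b) as [h|h].
- rewrite Rabs_pos_eq by lra. rewrite Rmin_left, Rmax_right in HM by lra. apply CInt_bound; assumption.
- unfold CInt. rewrite <- (opp_RInt_swap (V := C_R_CompleteNormedModule)).
  2:{ apply (ex_RInt_swap (V := C_R_CompleteNormedModule)), ccont_on_ex, Hf. }
  change (Cmod (- CInt f b a) <= Rabs (b - a) * M). rewrite Cmod_opp.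
  rewrite Rabs_minus_sym, Rabs_pos_eq by lra. unfold ccont_on in Hf.
  rewrite Rmin_right, Rmax_left in Hf, HM by lra. apply CInt_bound; [lra| |assumption].
  intros t. rewrite Rmin_left, Rmax_right by lra. apply Hf.
Qed.

(* Integral over the boundary of the rectangle [a,b] x [c,d]; the sides are signed, so
   a > b or c > d is allowed. *)
Definition RI (f : C -> C) (a b c d : R) : C :=
  (CInt (fun x => f (x, c)) a b + Ci * CInt (fun y => f (b, y)) c d
   - CInt (fun x => f (x, d)) a b - Ci * CInt (fun y => f (a, y)) c d)%C.

Definition inrect (a b c d : R) (z : C) : Prop :=
  Rmin a b <= Re z <= Rmax a b /\ Rmin c d <= Im z <= Rmax c d.

Definition cont_rect (f : C -> C) a b c d := forall z, inrect a b c d z -> ccont f z.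

Lemma rder_hline (y t : R) : rder (fun x => (x, y) : C) t 1.
Proof.
exists (fun _ => RtoC 1). split; [apply ccont_const|]. split; [reflexivity|]. apply filter_forall.
intros u. apply C_ext; simpl; ring.
Qed.
Lemma rder_vline (x t : R) : rder (fun y => (x, y) : C) t Ci.
Proof.
exists (fun _ => Ci). split; [apply ccont_const|]. split; [reflexivity|]. apply filter_forall.
intros u. apply C_ext; simpl; ring.
Qed.

Lemma ccont_hline f (y t : R) : ccont f (t, y) -> ccont (fun x => f (x, y)) t.
Proof.
intros H. apply (ccont_comp (fun x : R => (x, y) : C) f); [|exact H].
apply (ccont_pair (fun x : R => x) (fun _ => y)); [apply continuous_id|apply continuous_const].
Qed.
Lemma ccont_vline f (x t : R) : ccont f (x, t) -> ccont (fun y => f (x, y)) t.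
Proof.
intros H. apply (ccont_comp (fun y : R => (x, y) : C) f); [|exact H].
apply (ccont_pair (fun _ : R => x) (fun y => y)); [apply continuous_const|apply continuous_id].
Qed.

(** Each side integrates to a difference of values of F at its end points, and the four differences
    cancel around the boundary. *)
Lemma RI_primitive (F f : C -> C) a b c d :
  (forall z, inrect a b c d z -> cder F z (f z)) -> cont_rect f a b c d -> RI f a b c d = 0.
Proof.
intros HF Hf. unfold RI.
assert (Hh : forall y, Rmin c d <= y <= Rmax c d -> CInt (fun x => f (x, y)) a b = (F (b, y) - F (a, y))%C).
{ intros y Hy. apply (CInt_FTC (fun x => F (x, y))). intros t Ht. split.
  - replace (f (t, y)) with (f (t, y) * 1)%C by ring. apply (rder_comp F (fun x => (x, y) : C)); [apply rder_hline|].
    apply HF. split; assumption.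
  - apply ccont_hline, Hf. split; assumption. }
assert (Hv : forall x, Rmin a b <= x <= Rmax a b -> (Ci * CInt (fun y => f (x, y)) c d = F (x, d) - F (x, c))%C).
{ intros x Hx. rewrite <- CInt_scal.
  2:{ intros t Ht. apply ccont_vline, Hf. split; assumption. }
  apply (CInt_FTC (fun y => F (x, y))). intros t Ht. split.
  - replace (Ci * f (x, t))%C with (f (x, t) * Ci)%C by ring. apply (rder_comp F (fun y => (x, y) : C)); [apply rder_vline|].
    apply HF. split; assumption.
  - apply ccont_mult; [apply ccont_const|]. apply ccont_vline, Hf. split; assumption. }
rewrite !Hh, !Hv; [ring| | | |]; unfold Rmin, Rmax; destruct Rle_dec; lra.
Qed.

Ltac rect_cont Hf := intros; first [apply ccont_hline | apply ccont_vline]; apply Hf;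
  unfold inrect in *; simpl in *; unfold Rmin, Rmax in *; repeat destruct Rle_dec; lra.

Lemma RI_plus f g a b c d : cont_rect f a b c d -> cont_rect g a b c d ->
  RI (fun z => f z + g z)%C a b c d = (RI f a b c d + RI g a b c d)%C.
Proof.
intros Hf Hg. unfold RI.
rewrite !CInt_plus; [ring| | | | | | | |]; intros ? ?; first [rect_cont Hf|rect_cont Hg].
Qed.

Lemma RI_ext f g a b c d : (forall z, inrect a b c d z -> f z = g z) -> RI f a b c d = RI g a b c d.
Proof.
intros H. unfold RI.
rewrite (CInt_ext (fun x => f (x, c)) (fun x => g (x, c)) a b), (CInt_ext (fun x => f (x, d)) (fun x => g (x, d)) a b),
  (CInt_ext (fun y => f (a, y)) (fun y => g (a, y)) c d), (CInt_ext (fun y => f (b, y)) (fun y => g (b, y)) c d);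
  [reflexivity| | | |]; intros; apply H;
unfold inrect in *; simpl in *; unfold Rmin, Rmax in *; repeat destruct Rle_dec; lra.
Qed.

Lemma RI_bound f a b c d M : cont_rect f a b c d ->
  (forall z, inrect a b c d z -> Cmod (f z) <= M) ->
  Cmod (RI f a b c d) <= 2 * (Rabs (b - a) + Rabs (d - c)) * M.
Proof.
intros Hf HM.
assert (Hh : forall y, Rmin c d <= y <= Rmax c d -> Cmod (CInt (fun x => f (x, y)) a b) <= Rabs (b - a) * M).
{ intros y Hy. apply CInt_bound_abs.
  - intros t Ht. rect_cont Hf.
  - intros t Ht. apply HM. split; assumption. }
assert (Hv : forall x, Rmin a b <= x <= Rmax a b -> Cmod (CInt (fun y => f (x, y)) c d) <= Rabs (d - c) * M).
{ intros y Hy. apply CInt_bound_abs.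
  - intros t Ht. rect_cont Hf.
  - intros t Ht. apply HM. split; assumption. }
assert (Ec : Rmin c d <= c <= Rmax c d) by (unfold Rmin, Rmax; destruct Rle_dec; lra).
assert (Ed : Rmin c d <= d <= Rmax c d) by (unfold Rmin, Rmax; destruct Rle_dec; lra).
assert (Ea : Rmin a b <= a <= Rmax a b) by (unfold Rmin, Rmax; destruct Rle_dec; lra).
assert (Eb : Rmin a b <= b <= Rmax a b) by (unfold Rmin, Rmax; destruct Rle_dec; lra).
unfold RI. unfold Cminus.
eapply Rle_trans; [apply Cmod_triangle|]. rewrite Cmod_opp, Cmod_mult, Cmod_Ci.
eapply Rle_trans; [apply Rplus_le_compat_r, Cmod_triangle|]. rewrite Cmod_opp.
eapply Rle_trans; [apply Rplus_le_compat_r, Rplus_le_compat_r, Cmod_triangle|]. rewrite Cmod_mult, Cmod_Ci.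
pose proof (Hh c Ec). pose proof (Hh d Ed). pose proof (Hv a Ea). pose proof (Hv b Eb). lra.
Qed.

Lemma RI_split_x f a b c d m :
  (forall z, Rmin a (Rmin m b) <= Re z <= Rmax a (Rmax m b) /\ Rmin c d <= Im z <= Rmax c d -> ccont f z) ->
  RI f a b c d = (RI f a m c d + RI f m b c d)%C.
Proof.
intros Hf.
assert (E1 : (CInt (fun x => f (x, c)) a m + CInt (fun x => f (x, c)) m b = CInt (fun x => f (x, c)) a b)%C)
  by (apply CInt_Chasles; intros t Ht; rect_cont Hf).
assert (E2 : (CInt (fun x => f (x, d)) a m + CInt (fun x => f (x, d)) m b = CInt (fun x => f (x, d)) a b)%C)
  by (apply CInt_Chasles; intros t Ht; rect_cont Hf).
unfold RI. rewrite <- E1, <- E2. ring.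
Qed.

Lemma RI_split_y f a b c d m :
  (forall z, Rmin a b <= Re z <= Rmax a b /\ Rmin c (Rmin m d) <= Im z <= Rmax c (Rmax m d) -> ccont f z) ->
  RI f a b c d = (RI f a b c m + RI f a b m d)%C.
Proof.
intros Hf.
assert (E1 : (CInt (fun y => f (a, y)) c m + CInt (fun y => f (a, y)) m d = CInt (fun y => f (a, y)) c d)%C)
  by (apply CInt_Chasles; intros t Ht; rect_cont Hf).
assert (E2 : (CInt (fun y => f (b, y)) c m + CInt (fun y => f (b, y)) m d = CInt (fun y => f (b, y)) c d)%C)
  by (apply CInt_Chasles; intros t Ht; rect_cont Hf).
unfold RI. rewrite <- E1, <- E2. ring.
Qed.

(** * Goursat's theorem *)

Lemma Rabs_half_lt_1 : Rabs (/ 2) < 1.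
Proof. rewrite Rabs_pos_eq; lra. Qed.

(** Gives the limit point in Goursat's bisection, one coordinate at a time; the rate W / 2^n is kept
    because the limit must lie within a fixed multiple of the size of every rectangle. *)
Lemma nested_limit (x : nat -> R) (W : R) :
  (forall n m, (n <= m)%nat -> Rabs (x m - x n) <= W / 2 ^ n) ->
  exists l, forall n, Rabs (l - x n) <= W / 2 ^ n.
Proof.
intros H.
assert (W0 : 0 <= W). { pose proof (H 0%nat 0%nat (Nat.le_refl _)). pose proof (Rabs_pos (x 0%nat - x 0%nat)). simpl in H0. lra. }
assert (HC : Cauchy_crit x).
{ intros e He. destruct (pow_lt_1_zero (/2) Rabs_half_lt_1 (e / (W + 1) / 2)) as [N HN].
  { apply Rdiv_lt_0_compat; [|lra]. apply Rdiv_lt_0_compat; lra. }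
  exists N. intros n m Hn Hm. unfold Rdist.
  pose proof (HN N (Nat.le_refl _)) as HNN. rewrite Rabs_pos_eq in HNN by (apply pow_le; lra).
  rewrite pow_inv in HNN.
  pose proof (H N n Hn) as A. pose proof (H N m Hm) as B.
  assert (W / 2 ^ N < e / 2).
  { unfold Rdiv at 1. apply Rle_lt_trans with ((W + 1) * / 2 ^ N).
    - apply Rmult_le_compat_r; [left; apply Rinv_0_lt_compat, pow_lt; lra|lra].
    - apply Rlt_le_trans with ((W + 1) * (e / (W + 1) / 2)); [apply Rmult_lt_compat_l; lra|]. right; field; lra. }
  replace (x n - x m) with ((x n - x N) - (x m - x N)) by ring.
  eapply Rle_lt_trans; [apply Rabs_triang|]. rewrite Rabs_Ropp. lra. }
destruct (Rcomplete.R_complete x HC) as [l Hl]. exists l. intros n.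
apply Rnot_lt_le. intros Hlt. destruct (Hl (Rabs (l - x n) - W / 2 ^ n)) as [N HN]; [lra|].
pose proof (HN (max n N) (Nat.le_max_r _ _)) as A. pose proof (H n (max n N) (Nat.le_max_l _ _)) as B.
unfold Rdist in A. rewrite Rabs_minus_sym in A.
replace (l - x n) with ((l - x (max n N)) + (x (max n N) - x n)) in A by ring.
pose proof (Rabs_triang (l - x (Nat.max n N)) (x (Nat.max n N) - x n)). lra.
Qed.

Lemma inrect_mid_sub a b c d (z : C) :
  let m := (a + b) / 2 in let k := (c + d) / 2 in
  inrect a m c k z \/ inrect m b c k z \/ inrect a m k d z \/ inrect m b k d z -> inrect a b c d z.
Proof.
simpl. unfold inrect, Rmin, Rmax. intros H; repeat destruct Rle_dec; decompose [or and] H; lra.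
Qed.

Lemma Cmod_sum4 (p q r s : C) : Cmod (p + q + (r + s)) <= Cmod p + Cmod q + Cmod r + Cmod s.
Proof.
pose proof (Cmod_triangle (p + q) (r + s)). pose proof (Cmod_triangle p q). pose proof (Cmod_triangle r s). lra.
Qed.

Definition rectangle : Type := ((R * R) * (R * R))%type.
Definition qx (q : rectangle) := fst (fst q).
Definition qx' (q : rectangle) := snd (fst q).
Definition qy (q : rectangle) := fst (snd q).
Definition qy' (q : rectangle) := snd (snd q).
Definition qin (q : rectangle) (z : C) := inrect (qx q) (qx' q) (qy q) (qy' q) z.
Definition qRI f (q : rectangle) := RI f (qx q) (qx' q) (qy q) (qy' q).
Definition qsize (q : rectangle) := Rabs (qx' q - qx q) + Rabs (qy' q - qy q).
Definition half_of (p q : rectangle) : Prop :=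
  (forall z, qin p z -> qin q z) /\ qsize p = qsize q / 2.

(** A rectangle is bad when its integral exceeds e times its squared size. Halving both sides
    divides the squared size by 4, while the four quarter integrals add up to the whole, so one
    quarter is again bad. *)
Lemma bisect_bad f (q : rectangle) (e : R) :
  (forall z, qin q z -> ccont f z) -> e * qsize q ^ 2 < Cmod (qRI f q) ->
  exists p, half_of p q /\ e * qsize p ^ 2 < Cmod (qRI f p).
Proof.
destruct q as [[a b] [c d]]. unfold half_of, qin, qRI, qsize, qx, qx', qy, qy'; cbn [fst snd]. intros Hf Hbad.
set (m := (a + b) / 2). set (k := (c + d) / 2).
assert (Hx : Rabs (m - a) = Rabs (b - a) / 2 /\ Rabs (b - m) = Rabs (b - a) / 2).
{ unfold m. split; [replace ((a + b) / 2 - a) with ((b - a) * / 2) by field|replace (b - (a + b) / 2) with ((b - a) * / 2) by field];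
  rewrite Rabs_mult, (Rabs_pos_eq (/2)) by lra; field. }
assert (Hy : Rabs (k - c) = Rabs (d - c) / 2 /\ Rabs (d - k) = Rabs (d - c) / 2).
{ unfold k. split; [replace ((c + d) / 2 - c) with ((d - c) * / 2) by field|replace (d - (c + d) / 2) with ((d - c) * / 2) by field];
  rewrite Rabs_mult, (Rabs_pos_eq (/2)) by lra; field. }
destruct Hx as [X1 X2]. destruct Hy as [Y1 Y2].
assert (E : RI f a b c d = (RI f a m c k + RI f m b c k + (RI f a m k d + RI f m b k d))%C).
{ rewrite (RI_split_y f a b c d k). 2:{ intros z Hz. apply Hf. revert Hz. unfold inrect, k, Rmin, Rmax; repeat destruct Rle_dec; lra. }
  rewrite (RI_split_x f a b c k m). 2:{ intros z Hz. apply Hf. revert Hz. unfold inrect, k, m, Rmin, Rmax; repeat destruct Rle_dec; lra. }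
  rewrite (RI_split_x f a b k d m). 2:{ intros z Hz. apply Hf. revert Hz. unfold inrect, k, m, Rmin, Rmax; repeat destruct Rle_dec; lra. }
  reflexivity. }
assert (Hsub := fun z => inrect_mid_sub a b c d z). cbn zeta in Hsub. fold m k in Hsub.
pose proof (Cmod_sum4 (RI f a m c k) (RI f m b c k) (RI f a m k d) (RI f m b k d)) as H4. rewrite <- E in H4.
set (s := Rabs (b - a) + Rabs (d - c)) in *.
assert (Hs : e * s ^ 2 = 4 * (e * (s / 2) ^ 2)) by field.
assert (Hq : forall a' b' c' d', (forall z, inrect a' b' c' d' z -> inrect a b c d z) -> Rabs (b' - a') = Rabs (b - a) / 2 -> Rabs (d' - c') = Rabs (d - c) / 2 ->
  e * (s / 2) ^ 2 < Cmod (RI f a' b' c' d') ->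
  exists p : rectangle, ((forall z, qin p z -> inrect a b c d z) /\ qsize p = s / 2) /\ e * qsize p ^ 2 < Cmod (qRI f p)).
{ intros a' b' c' d' H1 H2 H3 H. exists ((a', b'), (c', d')). assert (Eq : qsize ((a', b'), (c', d')) = s / 2) by (unfold qsize, s, qx, qx', qy, qy'; cbn [fst snd]; rewrite H2, H3; field).
  rewrite Eq. split; [split; [exact H1|reflexivity]|exact H]. }
destruct (Rlt_dec (e * (s / 2) ^ 2) (Cmod (RI f a m c k))) as [h1|h1].
{ apply (Hq a m c k); auto. }
destruct (Rlt_dec (e * (s / 2) ^ 2) (Cmod (RI f m b c k))) as [h2|h2].
{ apply (Hq m b c k); auto. }
destruct (Rlt_dec (e * (s / 2) ^ 2) (Cmod (RI f a m k d))) as [h3|h3].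
{ apply (Hq a m k d); auto. }
destruct (Rlt_dec (e * (s / 2) ^ 2) (Cmod (RI f m b k d))) as [h4|h4].
{ apply (Hq m b k d); auto 6. }
exfalso. lra.
Qed.

Lemma Cmod_le_Re_Im (z : C) : Cmod z <= Rabs (Re z) + Rabs (Im z).
Proof.
replace z with (RtoC (Re z) + Ci * RtoC (Im z))%C at 1.
- eapply Rle_trans; [apply Cmod_triangle|]. rewrite Cmod_mult, Cmod_Ci, !Cmod_R. lra.
- apply C_ext; simpl; ring.
Qed.

Lemma qin_corner q : qin q (qx q, qy q).
Proof. unfold qin, inrect, Rmin, Rmax. simpl. repeat destruct Rle_dec; lra. Qed.

Lemma qin_dist q z w : qin q z -> qin q w -> Rabs (Re z - Re w) <= qsize q /\ Rabs (Im z - Im w) <= qsize q.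
Proof.
unfold qin, qsize, inrect. intros [H1 H2] [H3 H4].
revert H1 H2 H3 H4. unfold Rmin, Rmax, Rabs. repeat destruct Rle_dec; repeat destruct Rcase_abs; intros; lra.
Qed.

Lemma cder_eps f z l : cder f z l -> forall e, 0 < e ->
  exists del, 0 < del /\ forall w, Cmod (w - z) < del -> Cmod (f w - f z - l * (w - z)) <= e * Cmod (w - z).
Proof.
intros [p [Hp [Hl H]]] e He.
destruct (proj1 (locally_C_iff _ _) (filter_and _ _ (Hp e He) H)) as [d [Hd H2]].
exists d. split; [exact Hd|]. intros w Hw. destruct (H2 w Hw) as [A B]. rewrite B, <- Hl.
replace (p w * (w - z) - p z * (w - z))%C with ((p w - p z) * (w - z))%C by ring. rewrite Cmod_mult.
apply Rmult_le_compat_r; [apply Cmod_ge_0|lra].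
Qed.

Lemma cdiff_ccont f z : cdiff f z -> ccont f z.
Proof. intros [l H]. exact (cder_ccont _ _ _ H). Qed.

Lemma RI_affine a b c d (p l z0 : C) : RI (fun z => p + l * (z - z0))%C a b c d = 0.
Proof.
apply (RI_primitive (fun z => p * z + l * / RtoC 2 * ((z - z0) * (z - z0)))%C).
- intros z _. eapply cder_eq; [|apply cder_plus; [apply cder_scal, cder_id|apply cder_scal, cder_mult; (apply cder_minus; [apply cder_id|apply cder_const])]].
  cbv beta. field.
- intros z _. apply ccont_plus; [apply ccont_const|]. apply ccont_mult; [apply ccont_const|]. apply ccont_minus; [apply ccont_id|apply ccont_const].
Qed.

Lemma qRI_bound f (q : rectangle) M : (forall z, qin q z -> ccont f z) -> (forall z, qin q z -> Cmod (f z) <= M) -> Cmod (qRI f q) <= 2 * qsize q * M.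
Proof. apply RI_bound. Qed.

(** Repeated bisection of a bad rectangle closes in on a point where f is differentiable. There f
    differs from an affine function, whose integral vanishes, by a small multiple of the distance,
    which contradicts the badness of small rectangles. *)
Lemma goursat_q f (q : rectangle) : (forall z, qin q z -> cdiff f z) -> qRI f q = 0.
Proof.
intros Hf. apply Cmod_eq_0.
assert (Hc : forall z, qin q z -> ccont f z) by (intros z Hz; apply cdiff_ccont, Hf, Hz).
set (S := qsize q). assert (HS : 0 <= S) by (unfold S, qsize; pose proof (Rabs_pos (qx' q - qx q)); pose proof (Rabs_pos (qy' q - qy q)); lra).
apply Rle_antisym; [|apply Cmod_ge_0]. apply Rnot_lt_le. intros Hpos.
(* The squared size is enlarged by 1 in the denominator so that a degenerate rectangle of size 0 is
   covered as well. *)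
assert (He : exists e, 0 < e /\ e * S ^ 2 < Cmod (qRI f q)).
{ exists (Cmod (qRI f q) / (2 * (S ^ 2 + 1))). assert (0 < S ^ 2 + 1) by nra. split; [apply Rdiv_lt_0_compat; lra|].
  unfold Rdiv. rewrite Rmult_assoc. rewrite <- (Rmult_1_r (Cmod (qRI f q))) at 2. apply Rmult_lt_compat_l; [exact Hpos|].
  apply Rmult_lt_reg_l with (2 * (S ^ 2 + 1)); [lra|]. rewrite <- Rmult_assoc, Rinv_r by lra. lra. }
destruct He as [e [He Hbad]].
set (good := fun p : rectangle => (forall z, qin p z -> qin q z) /\ e * qsize p ^ 2 < Cmod (qRI f p)).
(* Rectangles that are not good are sent to themselves; this makes the bisection step a total
   function that can be iterated. *)
assert (Hstep : forall p : rectangle, exists p', good p -> good p' /\ half_of p' p).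
{ intros p. destruct (classic (good p)) as [[G1 G2]|G].
  - destruct (bisect_bad f p e) as [p' [[A1 A2] B]]; [intros z Hz; apply Hc, G1, Hz|exact G2|].
    exists p'. intros _. split; [split; [intros z Hz; apply G1, A1, Hz|exact B]|split; assumption].
  - exists p. tauto. }
pose (step := fun p => proj1_sig (constructive_indefinite_description _ (Hstep p))).
assert (Hst : forall p, good p -> good (step p) /\ half_of (step p) p).
{ intros p. exact (proj2_sig (constructive_indefinite_description _ (Hstep p))). }
pose (s := fix s n := match n with O => q | Datatypes.S m => step (s m) end).
assert (Hgood : forall n, good (s n)).
{ induction n as [|n IH]; [split; [tauto|exact Hbad]|]. simpl. apply Hst, IH. }
assert (Hsize : forall n, qsize (s n) = S / 2 ^ n).
{ induction n as [|n IH]; [simpl; unfold S; field|]. simpl. destruct (Hst (s n) (Hgood n)) as [_ [_ ->]]. rewrite IH. field. apply pow_nonzero; lra. }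
assert (Hsub : forall n m, (n <= m)%nat -> forall z, qin (s m) z -> qin (s n) z).
{ intros n m Hnm. induction Hnm as [|m Hnm IH]; [tauto|]. intros z Hz. apply IH.
  destruct (Hst (s m) (Hgood m)) as [_ [H _]]. apply H, Hz. }
assert (Hdist : forall n m, (n <= m)%nat -> Rabs (qx (s m) - qx (s n)) <= S / 2 ^ n /\ Rabs (qy (s m) - qy (s n)) <= S / 2 ^ n).
{ intros n m Hnm. rewrite <- Hsize. apply (qin_dist (s n) (qx (s m), qy (s m)) (qx (s n), qy (s n))).
  - apply (Hsub n m Hnm), qin_corner.
  - apply qin_corner. }
destruct (nested_limit (fun n => qx (s n)) S) as [X HX]; [intros n m H; apply (Hdist n m H)|].
destruct (nested_limit (fun n => qy (s n)) S) as [Y HY]; [intros n m H; apply (Hdist n m H)|].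
assert (Hsmall : forall eta, 0 < eta -> exists n, S / 2 ^ n < eta).
{ intros eta Heta. destruct (pow_lt_1_zero (/2) Rabs_half_lt_1 (eta / (S + 1))) as [N HN].
  { apply Rdiv_lt_0_compat; lra. }
  exists N. pose proof (HN N (Nat.le_refl _)) as HNN. rewrite Rabs_pos_eq in HNN by (apply pow_le; lra). rewrite pow_inv in HNN.
  apply Rle_lt_trans with ((S + 1) * / 2 ^ N).
  - apply Rmult_le_compat_r; [left; apply Rinv_0_lt_compat, pow_lt; lra|lra].
  - apply Rlt_le_trans with ((S + 1) * (eta / (S + 1))); [apply Rmult_lt_compat_l; lra|]. right; field; lra. }
assert (HZ : qin q (X, Y)).
{ assert (forall eta, 0 < eta -> Rmin (qx q) (qx' q) - eta <= X <= Rmax (qx q) (qx' q) + eta /\ Rmin (qy q) (qy' q) - eta <= Y <= Rmax (qy q) (qy' q) + eta).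
  { intros eta Heta. destruct (Hsmall eta Heta) as [n Hn].
    pose proof (HX n) as A. pose proof (HY n) as B. simpl in A, B.
    pose proof (proj1 (Hgood n) _ (qin_corner (s n))) as [A' B']. simpl in A', B'.
    apply Rabs_le_between in A. apply Rabs_le_between in B. lra. }
  split; simpl; split; apply Rnot_lt_le; intros Hlt.
  - pose proof (H _ (Rlt_Rminus _ _ Hlt)). unfold Rminus in *. destruct (H ((Rmin (qx q) (qx' q) - X) / 2)); lra.
  - destruct (H ((X - Rmax (qx q) (qx' q)) / 2)); lra.
  - destruct (H ((Rmin (qy q) (qy' q) - Y) / 2)); lra.
  - destruct (H ((Y - Rmax (qy q) (qy' q)) / 2)); lra. }
destruct (Hf _ HZ) as [l Hl].
(* Points of the n-th rectangle lie within 4 S / 2^n of the limit, so the integral will be at most 2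
   (e/16) 4 = e/2 times the squared size. *)
destruct (cder_eps _ _ _ Hl (e / 16)) as [del [Hdel Hd]]; [lra|].
destruct (Hsmall (del / 4)) as [n Hn]; [lra|].
assert (Hnear : forall z, qin (s n) z -> Cmod (z - (X, Y)) <= 4 * (S / 2 ^ n)).
{ intros z Hz. eapply Rle_trans; [apply Cmod_le_Re_Im|].
  destruct (qin_dist (s n) z _ Hz (qin_corner (s n))) as [A B]. rewrite Hsize in A, B. simpl in A, B.
  pose proof (HX n) as A2. pose proof (HY n) as B2. simpl in A2, B2.
  assert (Ex : Rabs (Re (z - (X, Y))) <= 2 * (S / 2 ^ n)).
  { replace (Re (z - (X, Y))) with ((Re z - qx (s n)) + (- (X - qx (s n)))) by (simpl; unfold Re; ring).
    eapply Rle_trans; [apply Rabs_triang|]. rewrite Rabs_Ropp. lra. }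
  assert (Ey : Rabs (Im (z - (X, Y))) <= 2 * (S / 2 ^ n)).
  { replace (Im (z - (X, Y))) with ((Im z - qy (s n)) + (- (Y - qy (s n)))) by (simpl; unfold Im; ring).
    eapply Rle_trans; [apply Rabs_triang|]. rewrite Rabs_Ropp. lra. }
  lra. }
set (g := fun z => (f z - f (X, Y) - l * (z - (X, Y)))%C).
assert (Cg : forall z, qin (s n) z -> ccont g z).
{ intros z Hz. apply ccont_minus; [apply ccont_minus; [apply Hc, (proj1 (Hgood n)), Hz|apply ccont_const]|].
  apply ccont_mult; [apply ccont_const|apply ccont_minus; [apply ccont_id|apply ccont_const]]. }
assert (EE : qRI f (s n) = qRI g (s n)).
{ unfold qRI. rewrite (RI_ext f (fun z => g z + (f (X, Y) + l * (z - (X, Y))))%C).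
  2:{ intros z _. unfold g. ring. }
  rewrite RI_plus, RI_affine; [ring|exact Cg|].
  intros z _. apply ccont_plus; [apply ccont_const|]. apply ccont_mult; [apply ccont_const|]. apply ccont_minus; [apply ccont_id|apply ccont_const]. }
pose proof (proj2 (Hgood n)) as Hb. rewrite EE, Hsize in Hb.
assert (Hub : Cmod (qRI g (s n)) <= 2 * (S / 2 ^ n) * (e / 16 * (4 * (S / 2 ^ n)))).
{ rewrite <- (Hsize n) at 1. apply qRI_bound; [exact Cg|]. intros z Hz. pose proof (Hnear z Hz) as Hz2.
  eapply Rle_trans; [apply Hd|].
  - lra.
  - apply Rmult_le_compat_l; lra. }
assert (0 <= S / 2 ^ n). { rewrite <- Hsize. unfold qsize. pose proof (Rabs_pos (qx' (s n) - qx (s n))); pose proof (Rabs_pos (qy' (s n) - qy (s n))); lra. }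
set (r := S / 2 ^ n) in *. nra.
Qed.

Lemma goursat f a b c d : (forall z, inrect a b c d z -> cdiff f z) -> RI f a b c d = 0.
Proof. intros H. apply (goursat_q f ((a, b), (c, d))). exact H. Qed.

Lemma CInt_point f a : CInt f a a = 0.
Proof. unfold CInt. exact (RInt_point (V := C_R_CompleteNormedModule) a f). Qed.

Lemma RI_swap_x f a b c d : cont_rect f a b c d -> RI f b a c d = (- RI f a b c d)%C.
Proof.
intros Hf. assert (E : (RI f a b c d + RI f b a c d)%C = 0).
{ rewrite <- RI_split_x.
  - unfold RI. rewrite !CInt_point. ring.
  - intros z Hz. apply Hf. revert Hz. unfold inrect, Rmin, Rmax; repeat destruct Rle_dec; lra. }
transitivity ((RI f a b c d + RI f b a c d) - RI f a b c d)%C; [ring|]. rewrite E. ring.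
Qed.

Lemma RI_swap_y f a b c d : cont_rect f a b c d -> RI f a b d c = (- RI f a b c d)%C.
Proof.
intros Hf. assert (E : (RI f a b c d + RI f a b d c)%C = 0).
{ rewrite <- RI_split_y.
  - unfold RI. rewrite !CInt_point. ring.
  - intros z Hz. apply Hf. revert Hz. unfold inrect, Rmin, Rmax; repeat destruct Rle_dec; lra. }
transitivity ((RI f a b c d + RI f a b d c) - RI f a b c d)%C; [ring|]. rewrite E. ring.
Qed.

Lemma Cmod_arb_small (z : C) (K : R) : 0 <= K -> (exists e0, 0 < e0 /\ forall e, 0 < e < e0 -> Cmod z <= e * K) -> z = 0.
Proof.
intros HK [e0 [He0 H]]. apply Cmod_eq_0. apply Rle_antisym; [|apply Cmod_ge_0].
apply Rnot_lt_le. intros Hp.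
set (e := Rmin (e0 / 2) (Cmod z / (2 * (K + 1)))).
assert (0 < Cmod z / (2 * (K + 1))) by (apply Rdiv_lt_0_compat; lra).
assert (He : 0 < e < e0). { unfold e. split; [apply Rmin_glb_lt; lra|]. eapply Rle_lt_trans; [apply Rmin_l|lra]. }
pose proof (H e He). assert (e <= Cmod z / (2 * (K + 1))) by apply Rmin_r.
assert (e * K <= Cmod z / (2 * (K + 1)) * K) by (apply Rmult_le_compat_r; assumption).
assert (Cmod z / (2 * (K + 1)) * K < Cmod z).
{ apply Rmult_lt_reg_r with (2 * (K + 1)); [lra|]. replace (Cmod z / (2 * (K + 1)) * K * (2 * (K + 1))) with (Cmod z * K) by (field; lra). nra. }
lra.
Qed.

(** Cutting off a small rectangle at the corner (u, v) leaves two rectangles that avoid the corner,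
    where Goursat applies. The small one contributes at most its perimeter times a local bound of f,
    and it can be shrunk at will. *)
Lemma goursat_corner (f : C -> C) u b v d :
  (forall z, inrect u b v d z -> ccont f z) ->
  (forall z, inrect u b v d z -> z <> (u, v) -> cdiff f z) -> RI f u b v d = 0.
Proof.
intros Hc Hf.
set (S := Rabs (b - u) + Rabs (d - v)).
assert (HS : 0 <= S) by (unfold S; pose proof (Rabs_pos (b - u)); pose proof (Rabs_pos (d - v)); lra).
destruct (Req_dec b u) as [->|Hb]; [unfold RI; rewrite !CInt_point; ring|].
destruct (Req_dec d v) as [->|Hd]; [unfold RI; rewrite !CInt_point; ring|].
assert (Hin : inrect u b v d (u, v)) by (unfold inrect, Rmin, Rmax; simpl; repeat destruct Rle_dec; lra).
set (M := Cmod (f (u, v)) + 1). assert (HM : 0 <= M) by (unfold M; pose proof (Cmod_ge_0 (f (u, v))); lra).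
destruct (proj1 (locally_C_iff _ _) (ccont_bound f _ (Hc _ Hin))) as [del [Hdel HB]].
apply (Cmod_arb_small _ (2 * S * M)). { apply Rmult_le_pos; [lra|exact HM]. }
exists (Rmin 1 (del / (S + 1))). split; [apply Rmin_glb_lt; [lra|apply Rdiv_lt_0_compat; lra]|].
intros e [He1 He2].
assert (He3 : e < 1) by (eapply Rlt_le_trans; [exact He2|apply Rmin_l]).
assert (He4 : e * S < del).
{ apply Rle_lt_trans with (e * (S + 1)); [apply Rmult_le_compat_l; lra|].
  replace del with (del / (S + 1) * (S + 1)) by (field; lra). apply Rmult_lt_compat_r; [lra|].
  eapply Rlt_le_trans; [exact He2|apply Rmin_r]. }
set (m := u + e * (b - u)). set (k := v + e * (d - v)).
assert (Hm : forall x, (Rmin u m <= x <= Rmax u m -> Rmin u b <= x <= Rmax u b /\ Rabs (x - u) <= e * Rabs (b - u)) /\ (Rmin m b <= x <= Rmax m b -> Rmin u b <= x <= Rmax u b /\ x <> u)).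
{ intros x. unfold m. destruct (Rlt_dec b u) as [h|h].
  - rewrite (Rabs_left (b - u)) by lra. assert (e * (b - u) < 0) by nra. assert (b - u < e * (b - u)) by nra. split; unfold Rmin, Rmax, Rabs; repeat destruct Rle_dec; try destruct Rcase_abs; intros; lra.
  - rewrite (Rabs_right (b - u)) by lra. assert (0 < e * (b - u)) by nra. assert (e * (b - u) < b - u) by nra. split; unfold Rmin, Rmax, Rabs; repeat destruct Rle_dec; try destruct Rcase_abs; intros; lra. }
assert (Hk : forall x, (Rmin v k <= x <= Rmax v k -> Rmin v d <= x <= Rmax v d /\ Rabs (x - v) <= e * Rabs (d - v)) /\ (Rmin k d <= x <= Rmax k d -> Rmin v d <= x <= Rmax v d /\ x <> v)).
{ intros x. unfold k. destruct (Rlt_dec d v) as [h|h].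
  - rewrite (Rabs_left (d - v)) by lra. assert (e * (d - v) < 0) by nra. assert (d - v < e * (d - v)) by nra. split; unfold Rmin, Rmax, Rabs; repeat destruct Rle_dec; try destruct Rcase_abs; intros; lra.
  - rewrite (Rabs_right (d - v)) by lra. assert (0 < e * (d - v)) by nra. assert (e * (d - v) < d - v) by nra. split; unfold Rmin, Rmax, Rabs; repeat destruct Rle_dec; try destruct Rcase_abs; intros; lra. }
assert (E : RI f u b v d = RI f u m v k).
{ assert (Hmu : Rmin u b <= m <= Rmax u b) by (apply (Hm m); unfold Rmin, Rmax; destruct Rle_dec; lra).
  assert (Hkv : Rmin v d <= k <= Rmax v d) by (apply (Hk k); unfold Rmin, Rmax; destruct Rle_dec; lra).
  rewrite (RI_split_x f u b v d m). 2:{ intros z Hz. apply Hc. revert Hz Hmu. unfold inrect, Rmin, Rmax; repeat destruct Rle_dec; lra. }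
  rewrite (RI_split_y f u m v d k). 2:{ intros z Hz. apply Hc. revert Hz Hmu Hkv. unfold inrect, Rmin, Rmax; repeat destruct Rle_dec; lra. }
  rewrite (goursat f m b v d), (goursat f u m k d); [ring| |].
  - intros z [Hx Hy]. pose proof (proj1 (Hm (Re z)) Hx) as [A _]. pose proof (proj2 (Hk (Im z)) Hy) as [B B2]. apply Hf; [split; assumption|].
    intros ->. apply B2. reflexivity.
  - intros z [Hx Hy]. pose proof (proj2 (Hm (Re z)) Hx) as [A A2]. apply Hf; [split; assumption|].
    intros ->. apply A2. reflexivity. }
rewrite E.
apply Rle_trans with (2 * (Rabs (m - u) + Rabs (k - v)) * M).
- apply RI_bound.
  + intros z [Hx Hy]. apply Hc. split; [exact (proj1 (proj1 (Hm (Re z)) Hx))|exact (proj1 (proj1 (Hk (Im z)) Hy))].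
  + intros z [Hx Hy]. left. apply HB. pose proof (proj2 (proj1 (Hm (Re z)) Hx)). pose proof (proj2 (proj1 (Hk (Im z)) Hy)).
    eapply Rle_lt_trans; [apply Cmod_le_Re_Im|]. simpl.
    eapply Rle_lt_trans; [|exact He4]. unfold S. replace (fst z + - u) with (Re z - u) by (unfold Re; ring). replace (snd z + - v) with (Im z - v) by (unfold Im; ring). lra.
- right. unfold m, k, S. replace (u + e * (b - u) - u) with (e * (b - u)) by ring. replace (v + e * (d - v) - v) with (e * (d - v)) by ring.
  rewrite !Rabs_mult, (Rabs_pos_eq e) by lra. ring.
Qed.

(** Cutting through p gives four rectangles with p as a corner. Because the sides in [RI] are
    signed, each is a case of [goursat_corner] up to [RI_swap_x] and [RI_swap_y]. *)
Lemma goursat_exc (f : C -> C) a b c d (p : C) :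
  (forall z, inrect a b c d z -> ccont f z) ->
  (forall z, inrect a b c d z -> z <> p -> cdiff f z) -> RI f a b c d = 0.
Proof.
intros Hc Hf. destruct (classic (inrect a b c d p)) as [Hp|Hp].
2:{ apply goursat. intros z Hz. apply Hf; [exact Hz|]. intros ->. tauto. }
destruct p as [u v]. destruct Hp as [Hu Hv]. simpl in Hu, Hv.
assert (Sub : forall a' c' z, (a' = a \/ a' = b) -> (c' = c \/ c' = d) -> inrect u a' v c' z -> inrect a b c d z).
{ intros a' c' z Ha Hc'. destruct Ha as [->| ->]; destruct Hc' as [->| ->]; revert Hu Hv; unfold inrect, Rmin, Rmax; repeat destruct Rle_dec; intros; lra. }
assert (Z : forall a' c', (a' = a \/ a' = b) -> (c' = c \/ c' = d) -> RI f u a' v c' = 0).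
{ intros a' c' Ha Hc'. apply goursat_corner; intros z Hz; [apply Hc|apply Hf]; apply (Sub a' c'); assumption. }
rewrite (RI_split_x f a b c d u). 2:{ intros z Hz. apply Hc. revert Hz Hu. unfold inrect, Rmin, Rmax; repeat destruct Rle_dec; lra. }
rewrite (RI_split_y f a u c d v). 2:{ intros z Hz. apply Hc. revert Hz Hu Hv. unfold inrect, Rmin, Rmax; repeat destruct Rle_dec; lra. }
rewrite (RI_split_y f u b c d v). 2:{ intros z Hz. apply Hc. revert Hz Hu Hv. unfold inrect, Rmin, Rmax; repeat destruct Rle_dec; lra. }
assert (E1 : RI f u b v d = 0) by (apply Z; tauto).
assert (E2 : RI f u b c v = 0).
{ rewrite RI_swap_y, Z; [ring|tauto|tauto|]. intros z Hz. apply Hc, (Sub b c); tauto. }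
assert (E3 : RI f a u v d = 0).
{ rewrite RI_swap_x, Z; [ring|tauto|tauto|]. intros z Hz. apply Hc, (Sub a d); tauto. }
assert (E4 : RI f a u c v = 0).
{ rewrite RI_swap_x, RI_swap_y, Z; [ring|tauto|tauto| |]; intros z Hz; apply Hc, (Sub a c); try tauto.
  revert Hz. unfold inrect, Rmin, Rmax; repeat destruct Rle_dec; intros; lra. }
rewrite E1, E2, E3, E4. ring.
Qed.

(** * Difference quotients and primitives in discs *)

Definition quot (f : C -> C) (z l w : C) : C :=
  if Ceq_dec w z then l else ((f w - f z) / (w - z))%C.

Lemma Cminus_neq_0 (a b : C) : a <> b -> (a - b)%C <> 0.
Proof. apply Cminus_eq_contra. Qed.

Lemma cder_of_eps f z l : (forall e, 0 < e ->
  exists del, 0 < del /\ forall w, Cmod (w - z) < del -> Cmod (f w - f z - l * (w - z)) <= e * Cmod (w - z)) -> cder f z l.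
Proof.
intros H. exists (quot f z l). split; [|split].
- intros e He. destruct (H (e / 2)) as [del [Hdel Hd]]; [lra|]. apply locally_C_iff. exists del. split; [exact Hdel|].
  intros w Hw. unfold quot. destruct (Ceq_dec z z) as [_|]; [|congruence]. destruct (Ceq_dec w z) as [->|Hn].
  + rewrite Cmod_0_minus. exact He.
  + pose proof (Cminus_neq_0 _ _ Hn) as Hn'. replace ((f w - f z) / (w - z) - l)%C with ((f w - f z - l * (w - z)) / (w - z))%C by (field; exact Hn').
    rewrite Cmod_div by exact Hn'. pose proof (proj1 (Cmod_gt_0 _) Hn') as Hp. apply Rle_lt_trans with (e / 2); [|lra].
    apply Rmult_le_reg_r with (Cmod (w - z)); [exact Hp|]. unfold Rdiv at 1. rewrite Rmult_assoc, Rinv_l, Rmult_1_r by lra. apply Hd, Hw.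
- unfold quot. destruct (Ceq_dec z z); congruence.
- apply filter_forall. intros w. unfold quot. destruct (Ceq_dec w z) as [->|Hn]; [ring|]. field. apply Cminus_neq_0, Hn.
Qed.

Lemma cder_unique f z l l' : cder f z l -> cder f z l' -> l = l'.
Proof.
intros H H'. apply Ceq_minus. apply (Cmod_arb_small _ 2); [lra|]. exists 1. split; [lra|]. intros e [He _].
destruct (cder_eps _ _ _ H e He) as [d [Hd A]]. destruct (cder_eps _ _ _ H' e He) as [d' [Hd' A']].
set (h := Rmin d d' / 2). assert (Hh : 0 < h) by (unfold h; assert (0 < Rmin d d') by (apply Rmin_glb_lt; assumption); lra).
assert (Hh2 : h < d /\ h < d') by (unfold h, Rmin in *; destruct Rle_dec; lra).
set (w := (z + RtoC h)%C). assert (Ew : (w - z)%C = RtoC h) by (unfold w; ring).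
assert (Ec : Cmod (w - z) = h) by (rewrite Ew, Cmod_R, Rabs_pos_eq; lra).
pose proof (A w) as B. pose proof (A' w) as B'. rewrite Ec in B, B'.
replace (l - l')%C with (((f w - f z - l' * (w - z)) - (f w - f z - l * (w - z))) / RtoC h)%C.
2:{ rewrite Ew. field. intro E. apply RtoC_inj in E. lra. }
assert (Hh0 : RtoC h <> 0) by (intro E; apply RtoC_inj in E; lra).
rewrite Cmod_div by exact Hh0. rewrite Cmod_R, Rabs_pos_eq by lra.
apply Rmult_le_reg_r with h; [exact Hh|]. unfold Rdiv. rewrite Rmult_assoc, Rinv_l, Rmult_1_r by lra.
unfold Cminus at 1. eapply Rle_trans; [apply Cmod_triangle|]. rewrite Cmod_opp. pose proof (B (proj1 Hh2)). pose proof (B' (proj2 Hh2)). lra.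
Qed.

Definition disc (c : C) (r : R) (z : C) : Prop := Cmod (z - c) < r.

Lemma disc_locally c r z : disc c r z -> locally z (disc c r).
Proof.
intros H. apply locally_C_iff. exists (r - Cmod (z - c)). split; [unfold disc in H; lra|].
intros w Hw. unfold disc. pose proof (Cmod_triangle_minus w z c). lra.
Qed.

Lemma Cmod_shrink (a b : C) : Rabs (Re a) <= Rabs (Re b) -> Rabs (Im a) <= Rabs (Im b) -> Cmod a <= Cmod b.
Proof.
intros H1 H2. unfold Cmod. apply sqrt_le_1_alt. apply Rplus_le_compat.
- rewrite <- (pow2_abs (fst a)), <- (pow2_abs (fst b)). apply pow_incr. split; [apply Rabs_pos|exact H1].
- rewrite <- (pow2_abs (snd a)), <- (pow2_abs (snd b)). apply pow_incr. split; [apply Rabs_pos|exact H2].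
Qed.

Lemma between_Rabs (x a b m : R) : Rmin a b <= x <= Rmax a b -> Rabs (x - a) <= Rabs (b - a).
Proof. unfold Rmin, Rmax, Rabs. repeat destruct Rle_dec; repeat destruct Rcase_abs; intros; lra. Qed.

Lemma CInt_const (k : C) a b : CInt (fun _ => k) a b = (k * RtoC (b - a))%C.
Proof.
transitivity (scal (b - a) (k : C_R_CompleteNormedModule)).
- exact (RInt_const (V := C_R_CompleteNormedModule) a b k).
- rewrite scal_R_Cmult. apply Cmult_comm.
Qed.

Lemma primitive_disc (f : C -> C) (c : C) (r : R) :
  (forall z, disc c r z -> ccont f z) ->
  (forall a b k d, (forall z, inrect a b k d z -> disc c r z) -> RI f a b k d = 0) ->
  exists F, forall z, disc c r z -> cder F z (f z).
Proof.
intros Hc HR.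
exists (fun z => CInt (fun x => f (x, Im c)) (Re c) (Re z) + Ci * CInt (fun y => f (Re z, y)) (Im c) (Im z))%C.
intros z Hz. apply cder_of_eps. intros e He.
destruct (proj1 (locally_C_iff _ _) (Hc z Hz (e / 2) ltac:(lra))) as [del [Hdel Hd]].
assert (Hr : 0 < r - Cmod (z - c)) by (unfold disc in Hz; lra).
exists (Rmin (del / 2) ((r - Cmod (z - c)) / 2)). split; [apply Rmin_glb_lt; lra|].
intros w Hw.
assert (Hw1 : 2 * Cmod (w - z) < del) by (pose proof (Rmin_l (del / 2) ((r - Cmod (z - c)) / 2)); lra).
assert (Hw2 : 2 * Cmod (w - z) < r - Cmod (z - c)) by (pose proof (Rmin_r (del / 2) ((r - Cmod (z - c)) / 2)); lra).
set (a := Re z) in *. set (b := Im z) in *. set (a' := Re w). set (b' := Im w).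
assert (Hda : Rabs (a' - a) <= Cmod (w - z)) by (replace (a' - a) with (Re (w - z)) by reflexivity; apply re_le_Cmod).
assert (Hdb : Rabs (b' - b) <= Cmod (w - z)) by (replace (b' - b) with (Im (w - z)) by reflexivity; apply im_le_Cmod).
assert (D1 : forall x y, Rabs (x - a) <= Cmod (w - z) -> Rabs (y - Im c) <= Rabs (b - Im c) -> disc c r (x, y)).
{ intros x y Hx Hy. unfold disc. pose proof (Cmod_triangle_minus (x, y) (a, y) c) as T.
  assert (Cmod ((a, y) - c) <= Cmod (z - c)) by (apply Cmod_shrink; [right; reflexivity|exact Hy]).
  assert (Cmod ((x, y) - (a, y)) <= Cmod (w - z)).
  { eapply Rle_trans; [apply Cmod_le_Re_Im|]. simpl. replace (y + - y) with 0 by ring. rewrite Rabs_R0. unfold Rminus in Hx. lra. }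
  lra. }
assert (D2 : forall x y, Rabs (x - a) <= Cmod (w - z) -> Rabs (y - b) <= Cmod (w - z) -> Cmod ((x, y) - z) <= 2 * Cmod (w - z)).
{ intros x y Hx Hy. eapply Rle_trans; [apply Cmod_le_Re_Im|]. simpl. unfold a, b, Re, Im, Rminus in Hx, Hy. lra. }
assert (D3 : forall x y, Rabs (x - a) <= Cmod (w - z) -> Rabs (y - b) <= Cmod (w - z) -> disc c r (x, y)).
{ intros x y Hx Hy. unfold disc. pose proof (Cmod_triangle_minus (x, y) z c) as T. pose proof (D2 x y Hx Hy). lra. }
assert (D4 : forall x, Rabs (x - Re c) <= Rabs (a - Re c) -> disc c r (x, Im c)).
{ intros x Hx. unfold disc. apply Rle_lt_trans with (Cmod (z - c)); [|exact Hz]. apply Cmod_shrink; [exact Hx|].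
  simpl. unfold Im. replace (snd c + - snd c) with 0 by ring. rewrite Rabs_R0. apply Rabs_pos. }
(* This rectangle trades the change along the horizontal line through c for a short segment at the
   height of z, so the increment of the primitive becomes an integral near z only. *)
assert (E0 : RI f a a' (Im c) b = 0).
{ apply HR. intros [x y] [Hx Hy]. simpl in Hx, Hy. apply D1.
  - eapply Rle_trans; [apply (between_Rabs _ _ a'); assumption|exact Hda].
  - apply (between_Rabs _ _ b); assumption. }
assert (E1 : (CInt (fun x => f (x, Im c)) (Re c) a + CInt (fun x => f (x, Im c)) a a' = CInt (fun x => f (x, Im c)) (Re c) a')%C).
{ apply CInt_Chasles. intros t Ht. apply ccont_hline, Hc.
  destruct (Rle_dec (Rabs (t - Re c)) (Rabs (a - Re c))) as [h|h]; [apply D4, h|].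
  apply D1; [|replace (Im c - Im c) with 0 by ring; rewrite Rabs_R0; apply Rabs_pos].
  eapply Rle_trans; [|exact Hda]. revert Ht h. unfold Rmin, Rmax, Rabs. repeat destruct Rle_dec; repeat destruct Rcase_abs; intros; lra. }
assert (E2 : (CInt (fun y => f (a', y)) (Im c) b + CInt (fun y => f (a', y)) b b' = CInt (fun y => f (a', y)) (Im c) b')%C).
{ apply CInt_Chasles. intros t Ht. apply ccont_vline, Hc.
  destruct (Rle_dec (Rabs (t - Im c)) (Rabs (b - Im c))) as [h|h]; [apply D1; [exact Hda|exact h]|].
  apply D3; [exact Hda|].
  eapply Rle_trans; [|exact Hdb]. revert Ht h. unfold Rmin, Rmax, Rabs. repeat destruct Rle_dec; repeat destruct Rcase_abs; intros; lra. }
assert (Ccont1 : ccont_on (fun x => f (x, b)) a a').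
{ intros t Ht. apply ccont_hline, Hc, D3.
  - eapply Rle_trans; [apply (between_Rabs _ _ a'); assumption|exact Hda].
  - replace (b - b) with 0 by ring. rewrite Rabs_R0. apply Cmod_ge_0. }
assert (Ccont2 : ccont_on (fun y => f (a', y)) b b').
{ intros t Ht. apply ccont_vline, Hc, D3; [exact Hda|].
  eapply Rle_trans; [apply (between_Rabs _ _ b'); assumption|exact Hdb]. }
assert (E3 : ((CInt (fun x => f (x, Im c)) (Re c) a' + Ci * CInt (fun y => f (a', y)) (Im c) b')
  - (CInt (fun x => f (x, Im c)) (Re c) a + Ci * CInt (fun y => f (a, y)) (Im c) b)
  = CInt (fun x => f (x, b)) a a' + Ci * CInt (fun y => f (a', y)) b b')%C).
{ rewrite <- E1, <- E2. unfold RI in E0.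
  match type of E0 with ?A = _ => transitivity (CInt (fun x => f (x, b)) a a' + Ci * CInt (fun y => f (a', y)) b b' + A)%C; [ring|rewrite E0; ring] end. }
rewrite E3.
replace (w - z)%C with (RtoC (a' - a) + Ci * RtoC (b' - b))%C at 1 by (apply C_ext; simpl; unfold a, a', b, b', Re, Im; ring).
replace (CInt (fun x => f (x, b)) a a' + Ci * CInt (fun y => f (a', y)) b b' - f z * (RtoC (a' - a) + Ci * RtoC (b' - b)))%C
 with (CInt (fun x => f (x, b) - f z)%C a a' + Ci * CInt (fun y => f (a', y) - f z)%C b b')%C.
2:{ rewrite !CInt_minus, !CInt_const; [ring|assumption|intros ? ?; apply ccont_const|assumption|intros ? ?; apply ccont_const]. }
eapply Rle_trans; [apply Cmod_triangle|]. rewrite Cmod_mult, Cmod_Ci, Rmult_1_l.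
assert (B1 : Cmod (CInt (fun x => f (x, b) - f z)%C a a') <= Rabs (a' - a) * (e / 2)).
{ apply CInt_bound_abs.
  - intros t Ht. apply ccont_minus; [apply Ccont1, Ht|apply ccont_const].
  - intros t Ht. left. apply Hd. eapply Rle_lt_trans; [apply D2|exact Hw1].
    + eapply Rle_trans; [apply (between_Rabs _ _ a'); assumption|exact Hda].
    + replace (b - b) with 0 by ring. rewrite Rabs_R0. apply Cmod_ge_0. }
assert (B2 : Cmod (CInt (fun y => f (a', y) - f z)%C b b') <= Rabs (b' - b) * (e / 2)).
{ apply CInt_bound_abs.
  - intros t Ht. apply ccont_minus; [apply Ccont2, Ht|apply ccont_const].
  - intros t Ht. left. apply Hd. eapply Rle_lt_trans; [apply D2|exact Hw1]; [exact Hda|].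
    eapply Rle_trans; [apply (between_Rabs _ _ b'); assumption|exact Hdb]. }
nra.
Qed.

(** * The exponential and Cauchy's formula *)

Lemma RtoC_neq_0 (x : R) : x <> 0 -> RtoC x <> 0.
Proof. intros H E. apply RtoC_inj in E. lra. Qed.

Lemma rder_pair (u v : R -> R) t u' v' :
  is_derive u t u' -> is_derive v t v' -> rder (fun s => (u s, v s) : C) t (u', v').
Proof.
intros Hu Hv. apply is_derive_Reals in Hu. apply is_derive_Reals in Hv.
exists (fun s => if Req_dec_T s t then (u', v') else ((u s - u t) / (s - t), (v s - v t) / (s - t))).
split; [|split].
- intros e He. destruct (Hu (e / 2)) as [d1 H1]; [lra|]. destruct (Hv (e / 2)) as [d2 H2]; [lra|].
  apply locally_R_iff. exists (Rmin d1 d2). split; [apply Rmin_glb_lt; apply cond_pos|]. intros s Hs.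
  destruct (Req_dec_T t t) as [_|]; [|congruence]. destruct (Req_dec_T s t) as [->|Hn]; [rewrite Cmod_0_minus; exact He|].
  assert (Hst : s - t <> 0) by lra.
  pose proof (H1 (s - t) Hst (Rlt_le_trans _ _ _ Hs (Rmin_l _ _))) as A.
  pose proof (H2 (s - t) Hst (Rlt_le_trans _ _ _ Hs (Rmin_r _ _))) as B.
  replace (t + (s - t)) with s in A, B by ring.
  eapply Rle_lt_trans; [apply Cmod_le_Re_Im|]. simpl. unfold Rminus in *. lra.
- destruct (Req_dec_T t t); congruence.
- apply filter_forall. intros s. destruct (Req_dec_T s t) as [->|Hn].
  + apply C_ext; simpl; ring.
  + apply C_ext; simpl; field; lra.
Qed.

Lemma rder_eq f t l l' : l = l' -> rder f t l -> rder f t l'.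
Proof. intros <-. exact (fun H => H). Qed.

Lemma rder_ccont f t l : rder f t l -> ccont f t.
Proof.
intros [p [Hp [Hl H]]].
apply (ccont_ext_loc (fun w => f t + p w * RtoC (w - t))%C).
- generalize H. apply filter_imp. intros w Hw. rewrite <- Hw. ring.
- apply ccont_plus; [apply ccont_const|]. apply ccont_mult; [exact Hp|].
  apply ccont_RtoC. apply (continuous_minus (fun u : R => u) (fun _ => t)); [apply continuous_id|apply continuous_const].
Qed.

Definition Cexp (z : C) : C := (exp (Re z) * cos (Im z), exp (Re z) * sin (Im z)).

Lemma Cexp_plus z w : Cexp (z + w) = (Cexp z * Cexp w)%C.
Proof.
unfold Cexp. rewrite re_plus, im_plus, exp_plus, cos_plus, sin_plus. apply C_ext; simpl; ring.
Qed.

Lemma Cmod_cos_sin (t : R) : Cmod (cos t, sin t) = 1.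
Proof.
unfold Cmod. simpl. replace (cos t * (cos t * 1) + sin t * (sin t * 1)) with 1; [apply sqrt_1|].
pose proof (sin2_cos2 t) as H. unfold Rsqr in H. lra.
Qed.

Lemma Cmod_Cexp z : Cmod (Cexp z) = exp (Re z).
Proof.
unfold Cexp. replace ((exp (Re z) * cos (Im z), exp (Re z) * sin (Im z)) : C) with (RtoC (exp (Re z)) * (cos (Im z), sin (Im z)))%C.
- rewrite Cmod_mult, Cmod_R, Cmod_cos_sin, Rabs_pos_eq; [ring|left; apply exp_pos].
- apply C_ext; simpl; ring.
Qed.

Lemma Cexp_0 : Cexp 0 = 1.
Proof. unfold Cexp. simpl. rewrite exp_0, cos_0, sin_0. apply C_ext; simpl; ring. Qed.

Lemma Cexp_neq_0 z : Cexp z <> 0.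
Proof. apply Cmod_gt_0. rewrite Cmod_Cexp. apply exp_pos. Qed.

Lemma Cexp_opp z : Cexp (- z) = (/ Cexp z)%C.
Proof.
assert (H : (Cexp (- z) * Cexp z)%C = 1) by (rewrite <- Cexp_plus, <- Cexp_0; f_equal; ring).
transitivity (Cexp (- z) * Cexp z * / Cexp z)%C; [field; apply Cexp_neq_0|]. rewrite H. ring.
Qed.

Lemma rder_Cexp_line (h : C) t : rder (fun u => Cexp (RtoC u * h)) t (h * Cexp (RtoC t * h)).
Proof.
assert (H : rder (fun u => (exp (u * Re h) * cos (u * Im h), exp (u * Re h) * sin (u * Im h)) : C) t
  (Re h * exp (t * Re h) * cos (t * Im h) - Im h * exp (t * Re h) * sin (t * Im h),
   Re h * exp (t * Re h) * sin (t * Im h) + Im h * exp (t * Re h) * cos (t * Im h))).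
{ apply (rder_pair (fun u => exp (u * Re h) * cos (u * Im h)) (fun u => exp (u * Re h) * sin (u * Im h))); auto_derive; trivial; ring. }
assert (E : forall u, Cexp (RtoC u * h) = (exp (u * Re h) * cos (u * Im h), exp (u * Re h) * sin (u * Im h))).
{ intros u. unfold Cexp. rewrite re_scal_l, im_scal_l. reflexivity. }
destruct H as [p [A [B D]]]. exists p. split; [exact A|]. split.
- rewrite B, E. apply C_ext; simpl; unfold Re, Im; ring.
- generalize D. apply filter_imp. intros u Hu. rewrite !E. exact Hu.
Qed.

Lemma Re_scal_le (t : R) (h : C) : 0 <= t <= 1 -> Re (RtoC t * h) <= Cmod h.
Proof.
intros Ht. rewrite re_scal_l. pose proof (re_le_Cmod h). pose proof (Cmod_ge_0 h).
apply Rabs_le_between in H. nra.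
Qed.

Lemma Cmod_Cexp_line t h : 0 <= t <= 1 -> Cmod (Cexp (RtoC t * h)) <= exp (Cmod h).
Proof.
intros Ht. rewrite Cmod_Cexp. destruct (Re_scal_le t h Ht) as [H|H]; [left; apply exp_increasing, H|right; rewrite H; reflexivity].
Qed.

Lemma Cexp_line_cont (k h : C) a b : ccont_on (fun t => k * Cexp (RtoC t * h))%C a b.
Proof. intros t Ht. apply ccont_mult; [apply ccont_const|]. apply (rder_ccont _ _ _ (rder_Cexp_line h t)). Qed.

Lemma Cexp_minus_1 h : Cmod (Cexp h - 1) <= Cmod h * exp (Cmod h).
Proof.
assert (E : (Cexp h - 1)%C = CInt (fun t => h * Cexp (RtoC t * h))%C 0 1).
{ rewrite (CInt_FTC (fun t => Cexp (RtoC t * h))).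
  - f_equal; [f_equal; ring|]. f_equal. rewrite <- Cexp_0. f_equal. ring.
  - intros t Ht. split; [apply rder_Cexp_line|]. apply (Cexp_line_cont h h 0 1 t Ht). }
rewrite E. replace (Cmod h * exp (Cmod h)) with ((1 - 0) * (Cmod h * exp (Cmod h))) by ring.
apply CInt_bound; [lra|apply Cexp_line_cont|]. intros t Ht. rewrite Cmod_mult.
apply Rmult_le_compat_l; [apply Cmod_ge_0|apply Cmod_Cexp_line, Ht].
Qed.

Lemma Cexp_taylor1 h : Cmod (Cexp h - 1 - h) <= Cmod h ^ 2 * exp (Cmod h).
Proof.
assert (E : (Cexp h - 1 - h)%C = CInt (fun t => h * Cexp (RtoC t * h) - h)%C 0 1).
{ rewrite (CInt_FTC (fun t => Cexp (RtoC t * h) - RtoC t * h)%C).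
  - replace (RtoC 1 * h)%C with h by ring. replace (RtoC 0 * h)%C with (RtoC 0) by ring. rewrite Cexp_0. ring.
  - intros t Ht. split.
    + destruct (rder_Cexp_line h t) as [p [A [B D]]]. exists (fun u => p u - h)%C. split; [apply ccont_minus; [exact A|apply ccont_const]|].
      split; [rewrite B; reflexivity|]. generalize D. apply filter_imp. intros u Hu.
      transitivity (Cexp (RtoC u * h) - Cexp (RtoC t * h) - RtoC (u - t) * h)%C; [rewrite RtoC_minus; ring|]. rewrite Hu. ring.
    + apply ccont_minus; [apply (Cexp_line_cont h h 0 1 t Ht)|apply ccont_const]. }
rewrite E. replace (Cmod h ^ 2 * exp (Cmod h)) with ((1 - 0) * (Cmod h * (Cmod h * exp (Cmod h)))) by ring.
apply CInt_bound; [lra| |].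
- intros t Ht. apply ccont_minus; [apply (Cexp_line_cont h h 0 1 t Ht)|apply ccont_const].
- intros t Ht. replace (h * Cexp (RtoC t * h) - h)%C with (h * (Cexp (RtoC t * h) - 1))%C by ring. rewrite Cmod_mult.
  apply Rmult_le_compat_l; [apply Cmod_ge_0|]. eapply Rle_trans; [apply Cexp_minus_1|].
  assert (Cmod (RtoC t * h) <= Cmod h). { rewrite Cmod_mult, Cmod_R, Rabs_pos_eq by lra. rewrite <- (Rmult_1_l (Cmod h)) at 2. apply Rmult_le_compat_r; [apply Cmod_ge_0|lra]. }
  apply Rmult_le_compat; [apply Cmod_ge_0|left; apply exp_pos|exact H|].
  destruct H as [H|H]; [left; apply exp_increasing, H|right; rewrite H; reflexivity].
Qed.

Lemma cder_Cexp z : cder Cexp z (Cexp z).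
Proof.
apply cder_of_eps. intros e He.
assert (Hp : 0 < Cmod (Cexp z) * exp 1) by (apply Rmult_lt_0_compat; [apply Cmod_gt_0, Cexp_neq_0|apply exp_pos]).
exists (Rmin 1 (e / (Cmod (Cexp z) * exp 1))). split; [apply Rmin_glb_lt; [lra|apply Rdiv_lt_0_compat; lra]|].
intros w Hw. set (h := (w - z)%C) in *.
replace (Cexp w) with (Cexp z * Cexp h)%C by (rewrite <- Cexp_plus; f_equal; unfold h; ring).
replace (Cexp z * Cexp h - Cexp z - Cexp z * h)%C with (Cexp z * (Cexp h - 1 - h))%C by ring.
rewrite Cmod_mult.
assert (H1 : Cmod h < 1) by (eapply Rlt_le_trans; [exact Hw|apply Rmin_l]).
assert (H2 : Cmod h < e / (Cmod (Cexp z) * exp 1)) by (eapply Rlt_le_trans; [exact Hw|apply Rmin_r]).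
apply Rle_trans with (Cmod (Cexp z) * (Cmod h ^ 2 * exp 1)).
- apply Rmult_le_compat_l; [apply Cmod_ge_0|]. eapply Rle_trans; [apply Cexp_taylor1|].
  apply Rmult_le_compat_l; [apply pow_le, Cmod_ge_0|]. left. apply exp_increasing, H1.
- replace (Cmod (Cexp z) * (Cmod h ^ 2 * exp 1)) with ((Cmod (Cexp z) * exp 1) * Cmod h * Cmod h) by ring.
  apply Rmult_le_compat_r; [apply Cmod_ge_0|]. left. apply Rlt_div_r in H2; [|exact Hp]. lra.
Qed.

(** * Integrals over circles and Cauchy's formula *)

Definition ce (t : R) : C := (cos t, sin t).
Definition cpt (c : C) (r t : R) : C := (c + RtoC r * ce t)%C.
Definition circ (f : C -> C) (c : C) (r : R) : C :=
  CInt (fun t => f (cpt c r t) * (Ci * (RtoC r * ce t)))%C 0 (2 * PI).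

Lemma Cmod_ce t : Cmod (ce t) = 1.
Proof. apply Cmod_cos_sin. Qed.

Lemma Cmod_cpt c r t : 0 <= r -> Cmod (cpt c r t - c) = r.
Proof.
intros Hr. unfold cpt. replace (c + RtoC r * ce t - c)%C with (RtoC r * ce t)%C by ring.
rewrite Cmod_mult, Cmod_R, Cmod_ce, Rabs_pos_eq by exact Hr. ring.
Qed.

Lemma rder_ce t : rder ce t (Ci * ce t).
Proof.
apply (rder_eq _ _ (- sin t, cos t)); [apply C_ext; simpl; ring|].
apply (rder_pair cos sin); auto_derive; trivial; ring.
Qed.

Lemma rder_cpt c r t : rder (cpt c r) t (Ci * (RtoC r * ce t)).
Proof.
apply (rder_eq _ _ ((RtoC r) * (Ci * ce t))%C); [ring|].
apply (rder_comp (fun w => c + RtoC r * w)%C ce); [apply rder_ce|].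
eapply cder_eq; [|apply cder_plus; [apply cder_const|apply cder_scal, cder_id]]. ring.
Qed.

Lemma ccont_cpt c r t : ccont (cpt c r) t.
Proof. exact (rder_ccont _ _ _ (rder_cpt c r t)). Qed.
Lemma ccont_ce t : ccont ce t.
Proof. exact (rder_ccont _ _ _ (rder_ce t)). Qed.

Lemma ccont_circ f c r t : ccont f (cpt c r t) -> ccont (fun t => f (cpt c r t) * (Ci * (RtoC r * ce t)))%C t.
Proof.
intros H. apply ccont_mult; [apply (ccont_comp (cpt c r) f); [apply ccont_cpt|exact H]|].
apply ccont_mult; [apply ccont_const|]. apply ccont_mult; [apply ccont_const|apply ccont_ce].
Qed.

Lemma circ_primitive F f c r : (forall t, cder F (cpt c r t) (f (cpt c r t))) ->
  (forall t, ccont f (cpt c r t)) -> circ f c r = 0.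
Proof.
intros HF Hf. unfold circ. rewrite (CInt_FTC (fun t => F (cpt c r t))).
- unfold cpt, ce. rewrite cos_2PI, sin_2PI, cos_0, sin_0. ring.
- intros t _. split; [apply (rder_comp F (cpt c r)); [apply rder_cpt|apply HF]|]. apply ccont_circ, Hf.
Qed.

Lemma circ_bound f c r M : 0 <= r -> (forall t, ccont f (cpt c r t)) ->
  (forall t, 0 <= t <= 2 * PI -> Cmod (f (cpt c r t)) <= M) -> Cmod (circ f c r) <= 2 * PI * (M * r).
Proof.
intros Hr Hf HM. unfold circ. replace (2 * PI * (M * r)) with ((2 * PI - 0) * (M * r)) by ring.
apply CInt_bound; [pose proof PI_RGT_0; lra|intros t _; apply ccont_circ, Hf|].
intros t Ht. rewrite !Cmod_mult, Cmod_Ci, Cmod_R, Cmod_ce, Rabs_pos_eq, Rmult_1_l, Rmult_1_r by exact Hr.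
apply Rmult_le_compat_r; [exact Hr|apply HM, Ht].
Qed.

Lemma ccont_sub_id (p z : C) : ccont (fun w => w - p)%C z.
Proof. apply ccont_minus; [apply ccont_id|apply ccont_const]. Qed.

Lemma cder_sub_id (p z : C) : cder (fun w => w - p)%C z 1.
Proof. eapply cder_eq; [|apply cder_minus; [apply cder_id|apply cder_const]]. ring. Qed.

Lemma cder_pow f z l n : cder f z l -> cder (fun w => Cpow (f w) n) z (RtoC (INR n) * Cpow (f z) (pred n) * l).
Proof.
intros H. induction n as [|n IH].
- simpl. eapply cder_eq; [|apply (cder_const (RtoC 1))]. ring.
- apply (cder_ext_loc (fun w => f w * Cpow (f w) n)%C); [apply filter_forall; intros; reflexivity|].
  eapply cder_eq; [|apply (cder_mult f (fun w => Cpow (f w) n)); [exact H|exact IH]]. simpl pred.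
  rewrite S_INR, RtoC_plus. destruct n as [|n]; [simpl; ring|]. simpl pred. rewrite (Cpow_S (f z) n). ring.
Qed.

Section CauchyKernel.
Variables (c : C) (r : R) (z : C).
Hypothesis Hz : Cmod (z - c) < r.

Let r_pos : 0 < r.
Proof. pose proof (Cmod_ge_0 (z - c)). lra. Qed.

Lemma cpt_minus_center t : Cmod (cpt c r t - c) = r.
Proof. apply Cmod_cpt. lra. Qed.

Lemma cpt_minus_lower t : r - Cmod (z - c) <= Cmod (cpt c r t - z).
Proof.
pose proof (Cmod_triangle_minus (cpt c r t) z c). rewrite cpt_minus_center in H. lra.
Qed.

Lemma cpt_minus_neq t : (cpt c r t - z)%C <> 0.
Proof. apply Cmod_gt_0. pose proof (cpt_minus_lower t). lra. Qed.

Lemma cpt_center_neq t : (cpt c r t - c)%C <> 0.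
Proof. apply Cmod_gt_0. rewrite cpt_minus_center. exact r_pos. Qed.

Let K (n : nat) (w : C) : C := (/ (Cpow (w - c) n * (w - z)))%C.

Let K_cont n t : ccont (K n) (cpt c r t).
Proof.
unfold K. apply (ccont_inv (fun w => Cpow (w - c) n * (w - z))%C).
- apply ccont_mult; [apply (ccont_pow (fun w => w - c)%C)|]; apply ccont_sub_id.
- apply Cmult_neq_0; [apply Cpow_nz, cpt_center_neq|apply cpt_minus_neq].
Qed.

Let pw_cont n t : ccont (fun w => / Cpow (w - c) n)%C (cpt c r t).
Proof.
apply (ccont_inv (fun w => Cpow (w - c) n)); [apply (ccont_pow (fun w => w - c)%C), ccont_sub_id|apply Cpow_nz, cpt_center_neq].
Qed.

Let circ_pow1 : circ (fun w => / Cpow (w - c) 1)%C c r = (RtoC (2 * PI) * Ci)%C.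
Proof.
unfold circ. rewrite (CInt_ext _ (fun _ => Ci)).
- rewrite CInt_const. rewrite Rminus_0_r. ring.
- intros t _. pose proof (cpt_center_neq t) as H. replace (RtoC r * ce t)%C with (cpt c r t - c)%C by (unfold cpt; ring). rewrite Cpow_1_r. field. exact H.
Qed.

Let circ_pow n : circ (fun w => / Cpow (w - c) (S (S n)))%C c r = 0.
Proof.
apply (circ_primitive (fun w => - / RtoC (INR (S n)) * / Cpow (w - c) (S n))%C); [|intros t; apply pw_cont].
intros t. pose proof (cpt_center_neq t) as H.
assert (HS : RtoC (INR (S n)) <> 0) by (apply RtoC_neq_0, not_0_INR; discriminate).
eapply cder_eq; [|apply cder_scal, (cder_inv (fun w => Cpow (w - c) (S n))); [apply (cder_pow (fun w => w - c)%C), cder_sub_id|apply Cpow_nz, H]].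
simpl pred. set (q := (cpt c r t - c)%C) in *. rewrite !Cpow_S. field. repeat split; try assumption. apply Cpow_nz, H.
Qed.

Let circ_plus f g : (forall t, ccont f (cpt c r t)) -> (forall t, ccont g (cpt c r t)) ->
  circ (fun w => f w + g w)%C c r = (circ f c r + circ g c r)%C.
Proof.
intros Hf Hg. unfold circ. rewrite <- CInt_plus; [|intros t _; apply ccont_circ; auto|intros t _; apply ccont_circ; auto].
apply CInt_ext. intros t _. ring.
Qed.

Let circ_K n : circ (K n) c r = (circ (fun w => / Cpow (w - c) (S n)) c r + (z - c) * circ (K (S n)) c r)%C.
Proof.
assert (E : ((z - c) * circ (K (S n)) c r)%C = circ (fun w => (z - c) * K (S n) w)%C c r).
{ unfold circ. rewrite <- CInt_scal; [|intros t _; apply ccont_circ, K_cont]. apply CInt_ext. intros t _. ring. }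
rewrite E, <- circ_plus; [|intros; apply pw_cont|intros; apply ccont_mult; [apply ccont_const|apply K_cont]].
unfold circ. apply CInt_ext. intros t _. f_equal. unfold K.
pose proof (cpt_center_neq t). pose proof (cpt_minus_neq t).
rewrite Cpow_S. assert (Cpow (cpt c r t - c) n <> 0)%C by (apply Cpow_nz, H). field. repeat split; assumption.
Qed.

Let circ_K_S n : circ (K 1) c r = (Cpow (z - c) n * circ (K (S n)) c r)%C.
Proof.
induction n as [|n IH]; [simpl; ring|]. rewrite IH, circ_K, circ_pow, Cpow_S. ring.
Qed.

(** Since 1/(w - z) = 1/(w - c) + (z - c) / ((w - c)(w - z)), it remains to see that the last
    integral vanishes. Further expansion produces powers (w - c)^(-n) with n >= 2, which have
    primitives, and a remainder bounded by a multiple of (|z - c| / r)^n. *)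
Lemma circ_winding : circ (fun w => / (w - z))%C c r = (RtoC (2 * PI) * Ci)%C.
Proof.
assert (E1 : circ (K 1) c r = 0).
{ apply Cmod_eq_0. apply Rle_antisym; [|apply Cmod_ge_0].
  set (q := Cmod (z - c) / r). set (B := 2 * PI * (/ (r - Cmod (z - c)))).
  assert (Hq : 0 <= q < 1). { unfold q. pose proof (Cmod_ge_0 (z - c)). split; [apply Rdiv_le_0_compat; lra|apply Rlt_div_l; lra]. }
  assert (HB : 0 < B). { unfold B. apply Rmult_lt_0_compat; [pose proof PI_RGT_0; lra|apply Rinv_0_lt_compat; lra]. }
  assert (Hn : forall n, Cmod (circ (K 1) c r) <= q ^ n * B).
  { intros n. rewrite (circ_K_S n), Cmod_mult, Cmod_pow.
    assert (Cmod (circ (K (S n)) c r) <= 2 * PI * (/ (r ^ (S n) * (r - Cmod (z - c))) * r)).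
    { apply circ_bound; [lra|apply K_cont|]. intros t _. unfold K.
      rewrite Cmod_inv; [|apply Cmult_neq_0; [apply Cpow_nz, cpt_center_neq|apply cpt_minus_neq]].
      rewrite Cmod_mult, Cmod_pow, cpt_minus_center.
      apply Rinv_le_contravar; [apply Rmult_lt_0_compat; [apply pow_lt; lra|lra]|].
      apply Rmult_le_compat_l; [apply pow_le; lra|apply cpt_minus_lower]. }
    apply Rle_trans with (Cmod (z - c) ^ n * (2 * PI * (/ (r ^ S n * (r - Cmod (z - c))) * r))).
    - apply Rmult_le_compat_l; [apply pow_le, Cmod_ge_0|exact H].
    - right. unfold q, B, Rdiv. rewrite Rpow_mult_distr, pow_inv. simpl pow. field. repeat split; try lra. apply pow_nonzero; lra. }
  apply Rnot_lt_le. intros Hp.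
  destruct (pow_lt_1_zero q ltac:(rewrite Rabs_pos_eq; lra) (Cmod (circ (K 1) c r) / B)) as [N HN]; [apply Rdiv_lt_0_compat; lra|].
  pose proof (HN N (Nat.le_refl _)) as A. rewrite Rabs_pos_eq in A by (apply pow_le; lra).
  pose proof (Hn N). apply Rlt_div_r in A; [lra|exact HB]. }
transitivity (circ (K 0) c r).
- unfold circ. apply CInt_ext. intros t _. f_equal. unfold K. f_equal. simpl. ring.
- rewrite circ_K, E1, circ_pow1. ring.
Qed.
End CauchyKernel.

Definition holo (U : C -> Prop) (f : C -> C) : Prop := forall z, U z -> cdiff f z.

(** The derivative as a total function; its value carries information only where [cdiff] holds. *)
Definition dC (f : C -> C) (z : C) : C := epsilon (inhabits (RtoC 0)) (cder f z).

Lemma dC_cder f z : cdiff f z -> cder f z (dC f z).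
Proof. intros H. unfold dC. apply epsilon_spec, H. Qed.

Lemma dC_eq f z l : cder f z l -> dC f z = l.
Proof. intros H. apply (cder_unique f z); [|exact H]. apply dC_cder. exists l. exact H. Qed.

Lemma quot_cont f z w l : cder f z l -> ccont f w -> ccont (quot f z l) w.
Proof.
intros Hl Hf. destruct (Ceq_dec w z) as [->|Hn].
- intros e He. destruct (cder_eps f z l Hl (e / 2)) as [del [Hd H]]; [lra|]. apply locally_C_iff. exists del. split; [exact Hd|].
  intros w Hw. unfold quot. destruct (Ceq_dec z z) as [_|]; [|congruence]. destruct (Ceq_dec w z) as [->|Hn]; [rewrite Cmod_0_minus; exact He|].
  pose proof (Cminus_neq_0 _ _ Hn) as Hn'. replace ((f w - f z) / (w - z) - l)%C with ((f w - f z - l * (w - z)) / (w - z))%C by (field; exact Hn').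
  rewrite Cmod_div by exact Hn'. pose proof (proj1 (Cmod_gt_0 _) Hn') as Hp. apply Rle_lt_trans with (e / 2); [|lra].
  apply Rle_div_l; [lra|]. apply H, Hw.
- apply (ccont_ext_loc (fun w => (f w - f z) / (w - z))%C).
  + apply locally_C_iff. exists (Cmod (w - z)). split; [apply Cmod_gt_0, Cminus_neq_0, Hn|]. intros v Hv. unfold quot.
    destruct (Ceq_dec v z) as [->|]; [|reflexivity]. rewrite Cmod_minus_sym in Hv. lra.
  + apply ccont_div; [apply ccont_minus; [exact Hf|apply ccont_const]|apply ccont_sub_id|apply Cminus_neq_0, Hn].
Qed.

Lemma quot_cdiff f z w l : cdiff f w -> w <> z -> cdiff (quot f z l) w.
Proof.
intros [m Hf] Hn. eexists. apply (cder_ext_loc (fun w => (f w - f z) * / (w - z))%C).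
- apply locally_C_iff. exists (Cmod (w - z)). split; [apply Cmod_gt_0, Cminus_neq_0, Hn|]. intros v Hv. unfold quot.
  destruct (Ceq_dec v z) as [->|]; [|reflexivity]. rewrite Cmod_minus_sym in Hv. lra.
- apply cder_mult; [apply cder_minus; [exact Hf|apply cder_const]|]. apply (cder_inv (fun w => w - z)%C); [apply cder_sub_id|apply Cminus_neq_0, Hn].
Qed.

Lemma cpt_in_disc c r r' t : 0 <= r < r' -> disc c r' (cpt c r t).
Proof. intros H. unfold disc. rewrite Cmod_cpt; lra. Qed.

(** The difference quotient of f at z is continuous on the disc and differentiable off z, so Goursat
    with one exceptional point gives it a primitive and its circle integral is 0. What is left is f
    z times the winding integral. *)
Lemma cauchy_formula f c R0 r z : holo (disc c R0) f -> r < R0 -> Cmod (z - c) < r ->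
  circ (fun w => f w / (w - z))%C c r = (RtoC (2 * PI) * Ci * f z)%C.
Proof.
intros Hf Hr Hz.
assert (Hr0 : 0 <= r) by (pose proof (Cmod_ge_0 (z - c)); lra).
assert (Hz' : disc c R0 z) by (unfold disc; lra).
set (g := quot f z (dC f z)).
assert (Hgc : forall w, disc c R0 w -> ccont g w).
{ intros w Hw. apply quot_cont; [apply dC_cder, Hf, Hz'|apply cdiff_ccont, Hf, Hw]. }
destruct (primitive_disc g c R0) as [F HF]; [exact Hgc| |].
{ intros a b k d Hin. apply (goursat_exc g a b k d z).
  - intros w Hw. apply Hgc, Hin, Hw.
  - intros w Hw Hn. apply quot_cdiff; [apply Hf, Hin, Hw|exact Hn]. }
assert (E : circ g c r = 0).
{ apply (circ_primitive F); intros t; [apply HF|apply Hgc]; apply cpt_in_disc; lra. }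
assert (E2 : circ (fun w => f w / (w - z))%C c r = (circ g c r + f z * circ (fun w => / (w - z))%C c r)%C).
{ assert (C1 : forall t, ccont (fun w => / (w - z))%C (cpt c r t)).
  { intros t. apply (ccont_inv (fun w => w - z)%C); [apply ccont_sub_id|apply cpt_minus_neq, Hz]. }
  unfold circ. rewrite <- CInt_scal; [|intros t _; apply (ccont_circ (fun w => / (w - z))%C), C1].
  rewrite <- CInt_plus.
  - apply CInt_ext. intros t _. unfold g, quot. pose proof (cpt_minus_neq c r z Hz t) as Hn.
    destruct (Ceq_dec (cpt c r t) z) as [E0|_]; [exfalso; apply Hn; rewrite E0; ring|]. field. exact Hn.
  - intros t _. apply (ccont_circ g), Hgc, cpt_in_disc. lra.
  - intros t _. apply ccont_mult; [apply ccont_const|apply (ccont_circ (fun w => / (w - z))%C), C1]. }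
rewrite E2, E, (circ_winding c r z Hz). ring.
Qed.

(** * Consequences of Cauchy's formula *)

Lemma cont_bounded (f : R -> C) a b : a <= b -> (forall t, a <= t <= b -> ccont f t) ->
  exists M, 0 <= M /\ forall t, a <= t <= b -> Cmod (f t) <= M.
Proof.
intros Hab Hf.
destruct (continuity_ab_maj (fun t => Cmod (f t)) a b Hab) as [m [Hm _]].
- intros t Ht. apply continuity_pt_filterlim. apply (ccont_Cmod f), Hf, Ht.
- exists (Cmod (f m)). split; [apply Cmod_ge_0|exact Hm].
Qed.

Section CauchyIntegral.
Variables (phi : R -> C) (c : C) (r : R).
Hypothesis Hphi : forall t, ccont phi t.

Let I1 (z : C) : C := CInt (fun t => phi t / (cpt c r t - z))%C 0 (2 * PI).
Let I2 (z : C) : C := CInt (fun t => phi t / ((cpt c r t - z) * (cpt c r t - z)))%C 0 (2 * PI).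
Let I3 (z : C) : C := CInt (fun t => RtoC 2 * (phi t / ((cpt c r t - z) * (cpt c r t - z) * (cpt c r t - z))))%C 0 (2 * PI).

Let cont1 z t : Cmod (z - c) < r -> ccont (fun t => cpt c r t - z)%C t.
Proof. intros. apply ccont_minus; [apply ccont_cpt|apply ccont_const]. Qed.

Let near (z w : C) : Cmod (z - c) < r -> Cmod (w - z) < (r - Cmod (z - c)) / 2 ->
  Cmod (w - c) < r /\ forall t, (r - Cmod (z - c)) / 2 <= Cmod (cpt c r t - w).
Proof.
intros Hz Hw. pose proof (Cmod_triangle_minus w z c) as T. split; [lra|]. intros t.
pose proof (cpt_minus_lower c r w ltac:(lra) t). lra.
Qed.

Let expand (p z w : C) : (p - z)%C <> 0 -> (p - w)%C <> 0 ->
  (/ (p - w) - / (p - z) - / ((p - z) * (p - z)) * (w - z) = (w - z) * (w - z) * / ((p - z) * (p - z) * (p - w)))%C.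
Proof. intros. field. split; assumption. Qed.

Let expand2 (p z w : C) : (p - z)%C <> 0 -> (p - w)%C <> 0 ->
  (/ ((p - w) * (p - w)) - / ((p - z) * (p - z)) - RtoC 2 * / ((p - z) * (p - z) * (p - z)) * (w - z)
   = (w - z) * (w - z) * ((RtoC 3 * (p - z) - RtoC 2 * (w - z)) * / ((p - z) * (p - z) * (p - z) * ((p - w) * (p - w)))))%C.
Proof. intros. field. split; assumption. Qed.

(** Differentiation under the integral sign from a pointwise quadratic bound on the Taylor
    remainder; [expand] and [expand2] give that remainder as exact rational identities for the first
    two powers of the Cauchy kernel. *)
Let der_general (A B : C -> C) (z : C) (a b : C -> R -> C) (K : R) :
  0 < r - Cmod (z - c) -> 0 <= K ->
  (forall w, Cmod (w - z) < (r - Cmod (z - c)) / 2 -> A w = CInt (a w) 0 (2 * PI) /\ (forall t, ccont (a w) t)) ->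
  B z = CInt (b z) 0 (2 * PI) -> (forall t, ccont (b z) t) ->
  (forall w t, 0 <= t <= 2 * PI -> Cmod (w - z) < (r - Cmod (z - c)) / 2 -> Cmod (a w t - a z t - b z t * (w - z)) <= K * Cmod (w - z) ^ 2) ->
  cder A z (B z).
Proof.
intros Hd HK HA HB Hb Hest. pose proof PI_RGT_0 as HPI. apply cder_of_eps. intros e He.
set (d := r - Cmod (z - c)) in *.
exists (Rmin (d / 2) (e / (2 * PI * K + 1))). split.
{ apply Rmin_glb_lt; [lra|]. apply Rdiv_lt_0_compat; [exact He|]. assert (0 <= 2 * PI * K) by (apply Rmult_le_pos; lra). lra. }
intros w Hw.
assert (Hw1 : Cmod (w - z) < d / 2) by (eapply Rlt_le_trans; [exact Hw|apply Rmin_l]).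
assert (Hw2 : Cmod (w - z) < e / (2 * PI * K + 1)) by (eapply Rlt_le_trans; [exact Hw|apply Rmin_r]).
assert (Hz0 : Cmod (z - z) < d / 2) by (rewrite Cmod_0_minus; lra).
destruct (HA w Hw1) as [EA CA]. destruct (HA z Hz0) as [EZ CZ].
rewrite EA, EZ, HB.
assert (E : (CInt (a w) 0 (2 * PI) - CInt (a z) 0 (2 * PI) - CInt (b z) 0 (2 * PI) * (w - z)
   = CInt (fun t => a w t - a z t - (w - z) * b z t) 0 (2 * PI))%C).
{ rewrite CInt_minus, CInt_minus, CInt_scal; [ring|..]; intros t _; auto; [apply ccont_minus; auto|apply ccont_mult; [apply ccont_const|auto]]. }
rewrite E. apply Rle_trans with ((2 * PI - 0) * (K * Cmod (w - z) ^ 2)).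
- apply CInt_bound; [lra| |].
  + intros t _. apply ccont_minus; [apply ccont_minus; auto|apply ccont_mult; [apply ccont_const|auto]].
  + intros t Ht. replace ((w - z) * b z t)%C with (b z t * (w - z))%C by ring. apply Hest; assumption.
- replace ((2 * PI - 0) * (K * Cmod (w - z) ^ 2)) with ((2 * PI * K) * Cmod (w - z) * Cmod (w - z)) by ring.
  apply Rmult_le_compat_r; [apply Cmod_ge_0|].
  assert (0 <= 2 * PI * K) by (apply Rmult_le_pos; lra).
  apply Rlt_div_r in Hw2; [|lra]. pose proof (Cmod_ge_0 (w - z)). nra.
Qed.

Lemma cauchy_integral_der1 z : Cmod (z - c) < r -> cder I1 z (I2 z).
Proof.
intros Hz. pose proof PI_RGT_0 as HPI.
destruct (cont_bounded phi 0 (2 * PI)) as [M [HM0 HM]]; [lra|auto|].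
set (d := r - Cmod (z - c)). assert (Hd : 0 < d) by (unfold d; lra).
assert (HKd : 0 < d * d * (d / 2)) by (repeat apply Rmult_lt_0_compat; lra).
apply (der_general I1 I2 z (fun z t => phi t / (cpt c r t - z))%C (fun z t => phi t / ((cpt c r t - z) * (cpt c r t - z)))%C (M * / (d * d * (d / 2)))).
- exact Hd.
- apply Rmult_le_pos; [exact HM0|left; apply Rinv_0_lt_compat, HKd].
- intros w Hw. split; [reflexivity|]. intros t. destruct (near z w Hz Hw) as [Hwc _].
  apply ccont_div; [auto|apply cont1, Hwc|apply cpt_minus_neq, Hwc].
- reflexivity.
- intros t. apply ccont_div; [auto|apply ccont_mult; apply cont1, Hz|apply Cmult_neq_0; apply cpt_minus_neq, Hz].
- intros w t Ht Hw. destruct (near z w Hz Hw) as [Hwc Hwl].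
  pose proof (cpt_minus_neq c r z Hz t) as N1. pose proof (cpt_minus_neq c r w Hwc t) as N2.
  pose proof (cpt_minus_lower c r z Hz t) as L1. specialize (Hwl t). fold d in L1, Hwl.
  set (p := cpt c r t) in *.
  replace (phi t / (p - w) - phi t / (p - z) - phi t / ((p - z) * (p - z)) * (w - z))%C with
    (phi t * (/ (p - w) - / (p - z) - / ((p - z) * (p - z)) * (w - z)))%C by (field; split; assumption).
  rewrite (expand p z w N1 N2), !Cmod_mult, Cmod_inv, !Cmod_mult; [|repeat apply Cmult_neq_0; assumption].
  replace (M * / (d * d * (d / 2)) * Cmod (w - z) ^ 2) with (M * (Cmod (w - z) * Cmod (w - z) * / (d * d * (d / 2)))) by ring.
  apply Rmult_le_compat; [apply Cmod_ge_0| |apply HM, Ht|].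
  + apply Rmult_le_pos; [apply Rmult_le_pos; apply Cmod_ge_0|]. left. apply Rinv_0_lt_compat. repeat apply Rmult_lt_0_compat; lra.
  + apply Rmult_le_compat_l; [apply Rmult_le_pos; apply Cmod_ge_0|]. apply Rinv_le_contravar; [exact HKd|].
    apply Rmult_le_compat; [nra|lra| |lra]. apply Rmult_le_compat; lra.
Qed.

Lemma cauchy_integral_der2 z : Cmod (z - c) < r -> cder I2 z (I3 z).
Proof.
intros Hz. pose proof PI_RGT_0 as HPI.
destruct (cont_bounded phi 0 (2 * PI)) as [M [HM0 HM]]; [lra|auto|].
set (d := r - Cmod (z - c)). assert (Hd : 0 < d) by (unfold d; lra).
assert (Hr : d <= r) by (unfold d; pose proof (Cmod_ge_0 (z - c)); lra).
assert (HKd : 0 < d * d * d * (d / 2 * (d / 2))) by (repeat apply Rmult_lt_0_compat; lra).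
apply (der_general I2 I3 z (fun z t => phi t / ((cpt c r t - z) * (cpt c r t - z)))%C (fun z t => RtoC 2 * (phi t / ((cpt c r t - z) * (cpt c r t - z) * (cpt c r t - z))))%C (M * ((6 * r + d) * / (d * d * d * (d / 2 * (d / 2)))))).
- exact Hd.
- apply Rmult_le_pos; [exact HM0|]. apply Rmult_le_pos; [lra|left; apply Rinv_0_lt_compat, HKd].
- intros w Hw. split; [reflexivity|]. intros t. destruct (near z w Hz Hw) as [Hwc _].
  apply ccont_div; [auto|apply ccont_mult; apply cont1, Hwc|apply Cmult_neq_0; apply cpt_minus_neq, Hwc].
- reflexivity.
- intros t. apply ccont_mult; [apply ccont_const|]. apply ccont_div; [auto|repeat apply ccont_mult; apply cont1, Hz|repeat apply Cmult_neq_0; apply cpt_minus_neq, Hz].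
- intros w t Ht Hw. destruct (near z w Hz Hw) as [Hwc Hwl].
  pose proof (cpt_minus_neq c r z Hz t) as N1. pose proof (cpt_minus_neq c r w Hwc t) as N2.
  pose proof (cpt_minus_lower c r z Hz t) as L1. specialize (Hwl t). fold d in L1, Hwl.
  assert (U1 : Cmod (cpt c r t - z) <= 2 * r).
  { pose proof (Cmod_triangle_minus (cpt c r t) c z). rewrite (cpt_minus_center c r z Hz), (Cmod_minus_sym c z) in H. lra. }
  set (p := cpt c r t) in *.
  replace (phi t / ((p - w) * (p - w)) - phi t / ((p - z) * (p - z)) - RtoC 2 * (phi t / ((p - z) * (p - z) * (p - z))) * (w - z))%C with
    (phi t * (/ ((p - w) * (p - w)) - / ((p - z) * (p - z)) - RtoC 2 * / ((p - z) * (p - z) * (p - z)) * (w - z)))%C by (field; split; assumption).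
  rewrite (expand2 p z w N1 N2), Cmod_mult, Cmod_mult, Cmod_mult, (Cmod_mult (_ - _)%C), Cmod_inv, !Cmod_mult; [|repeat apply Cmult_neq_0; assumption].
  replace (M * ((6 * r + d) * / (d * d * d * (d / 2 * (d / 2)))) * Cmod (w - z) ^ 2) with (M * (Cmod (w - z) * Cmod (w - z) * ((6 * r + d) * / (d * d * d * (d / 2 * (d / 2)))))) by ring.
  assert (P1 : 0 < Cmod (p - z) * Cmod (p - z) * Cmod (p - z) * (Cmod (p - w) * Cmod (p - w))) by (repeat apply Rmult_lt_0_compat; lra).
  apply Rmult_le_compat; [apply Cmod_ge_0| |apply HM, Ht|].
  + apply Rmult_le_pos; [apply Rmult_le_pos; apply Cmod_ge_0|]. apply Rmult_le_pos; [apply Cmod_ge_0|]. left. apply Rinv_0_lt_compat, P1.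
  + apply Rmult_le_compat_l; [apply Rmult_le_pos; apply Cmod_ge_0|]. apply Rmult_le_compat; [apply Cmod_ge_0|left; apply Rinv_0_lt_compat, P1| |].
    * unfold Cminus at 1. eapply Rle_trans; [apply Cmod_triangle|]. rewrite Cmod_opp, !Cmod_mult, !Cmod_R, !Rabs_pos_eq by lra. fold d in Hw. lra.
    * apply Rinv_le_contravar; [exact HKd|].
      assert (d * d <= Cmod (p - z) * Cmod (p - z)) by (apply Rmult_le_compat; lra).
      assert (0 <= d * d) by nra. assert (0 <= d / 2 * (d / 2)) by nra.
      apply Rmult_le_compat; [nra|nra| |].
      -- apply Rmult_le_compat; lra.
      -- apply Rmult_le_compat; lra.
Qed.
End CauchyIntegral.

(** Inside a smaller circle f is a Cauchy integral, so f' is the integral with the squared kernel,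
    which can be differentiated once more. *)
Lemma dC_cdiff_subdisc c R0 r f z : holo (disc c R0) f -> Cmod (z - c) < r -> r < R0 ->
  cdiff (dC f) z.
Proof.
intros Hf Hz Hr. pose proof PI_RGT_0.
set (phi := fun t => (f (cpt c r t) * (Ci * (RtoC r * ce t)))%C).
assert (Hr0 : 0 <= r) by (pose proof (Cmod_ge_0 (z - c)); lra).
assert (Hphi : forall t, ccont phi t).
{ intros t. apply (ccont_circ f). apply cdiff_ccont, Hf, cpt_in_disc. lra. }
set (k := (/ (RtoC (2 * PI) * Ci))%C).
assert (Hk : (RtoC (2 * PI) * Ci)%C <> 0) by (apply Cmult_neq_0; [apply RtoC_neq_0; lra|apply Ci_nz]).
assert (Hrep : forall w, Cmod (w - c) < r -> f w = (k * CInt (fun t => phi t / (cpt c r t - w)) 0 (2 * PI))%C).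
{ intros w Hw. pose proof (cauchy_formula f c R0 r w Hf Hr Hw) as E.
  transitivity (k * (RtoC (2 * PI) * Ci * f w))%C; [unfold k; field; split; [apply Ci_nz|apply RtoC_neq_0; lra]|].
  rewrite <- E. f_equal. unfold circ. apply CInt_ext. intros t _. unfold phi. unfold Cdiv. ring. }
pose proof (cauchy_integral_der1 phi c r Hphi) as D1. pose proof (cauchy_integral_der2 phi c r Hphi) as D2.
assert (Hloc : forall w, Cmod (w - c) < r -> cder f w (k * CInt (fun t => phi t / ((cpt c r t - w) * (cpt c r t - w))) 0 (2 * PI))%C).
{ intros w Hw. apply (cder_ext_loc (fun w => (k * CInt (fun t => phi t / (cpt c r t - w)) 0 (2 * PI))%C)).
  - generalize (disc_locally c r w Hw). apply filter_imp. intros v Hv. symmetry. apply Hrep, Hv.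
  - apply cder_scal. apply D1, Hw. }
eexists. apply (cder_ext_loc (fun w => (k * CInt (fun t => phi t / ((cpt c r t - w) * (cpt c r t - w))) 0 (2 * PI))%C)).
- generalize (disc_locally c r z Hz). apply filter_imp. intros v Hv. symmetry. apply dC_eq, Hloc, Hv.
- apply cder_scal. apply D2, Hz.
Qed.

Lemma dC_holo_disc c R0 f : holo (disc c R0) f -> holo (disc c R0) (dC f).
Proof.
intros Hf z Hz. unfold disc in Hz.
apply (dC_cdiff_subdisc c R0 ((Cmod (z - c) + R0) / 2) f z Hf); lra.
Qed.

(** Morera's argument: rectangle integrals vanish by [goursat_exc], so f has a primitive F, and f =
    F' is holomorphic because derivatives of holomorphic functions are. *)
Lemma removable c R0 (f : C -> C) p : (forall z, disc c R0 z -> ccont f z) ->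
  (forall z, disc c R0 z -> z <> p -> cdiff f z) -> holo (disc c R0) f.
Proof.
intros Hc Hf.
destruct (primitive_disc f c R0 Hc) as [F HF].
{ intros a b k d Hin. apply (goursat_exc f a b k d p); intros w Hw; [apply Hc|apply Hf]; apply Hin, Hw. }
assert (HF' : holo (disc c R0) F) by (intros z Hz; eexists; apply HF, Hz).
intros z Hz. destruct (dC_holo_disc c R0 F HF' z Hz) as [l Hl]. exists l.
apply (cder_ext_loc (dC F)); [|exact Hl]. generalize (disc_locally c R0 z Hz). apply filter_imp.
intros w Hw. apply dC_eq, HF, Hw.
Qed.

Lemma quot_holo c R0 f p : holo (disc c R0) f -> disc c R0 p -> holo (disc c R0) (quot f p (dC f p)).
Proof.
intros Hf Hp. apply (removable c R0 _ p).
- intros z Hz. apply quot_cont; [apply dC_cder, Hf, Hp|apply cdiff_ccont, Hf, Hz].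
- intros z Hz Hn. apply quot_cdiff; [apply Hf, Hz|exact Hn].
Qed.

Lemma quot_eq f p l z : f z = (f p + (z - p) * quot f p l z)%C.
Proof.
unfold quot. destruct (Ceq_dec z p) as [->|Hn]; [ring|]. field. apply Cminus_neq_0, Hn.
Qed.

Lemma divide_root c R0 f p : holo (disc c R0) f -> disc c R0 p -> f p = 0 ->
  exists g, holo (disc c R0) g /\ forall z, f z = ((z - p) * g z)%C.
Proof.
intros Hf Hp H0. exists (quot f p (dC f p)). split; [apply quot_holo; assumption|].
intros z. rewrite (quot_eq f p (dC f p) z) at 1. rewrite H0. ring.
Qed.

(** * Maximum principle, Borel-Caratheodory, logarithms and the identity theorem *)

Lemma pow_bound_le (x M K : R) : 0 <= x -> 0 <= M -> (forall n, x ^ n <= K * M ^ n) -> x <= M.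
Proof.
intros Hx HM H. apply Rnot_lt_le. intros Hlt.
set (m := (x + M) / 2). assert (Hm : 0 < m /\ M <= m < x) by (unfold m; lra).
assert (HK : 1 <= K) by (pose proof (H 0%nat); simpl in *; lra).
assert (H' : forall n, (x / m) ^ n <= K).
{ intros n. unfold Rdiv. rewrite Rpow_mult_distr, pow_inv. apply Rle_div_l; [apply pow_lt; lra|].
  eapply Rle_trans; [apply H|]. apply Rmult_le_compat_l; [lra|]. apply pow_incr. lra. }
assert (Hq : 1 < x / m) by (apply Rlt_div_r; lra).
destruct (Pow_x_infinity (x / m) ltac:(rewrite Rabs_pos_eq; lra) (K + 1)) as [N HN].
pose proof (HN N (Nat.le_refl _)) as A. rewrite Rabs_pos_eq in A by (apply pow_le; lra). pose proof (H' N). lra.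
Qed.

Lemma cdiff_const k z : cdiff (fun _ => k) z.
Proof. eexists. apply cder_const. Qed.
Lemma cdiff_plus f g z : cdiff f z -> cdiff g z -> cdiff (fun w => f w + g w)%C z.
Proof. intros [l H] [m H']. eexists. apply cder_plus; eassumption. Qed.
Lemma cdiff_minus f g z : cdiff f z -> cdiff g z -> cdiff (fun w => f w - g w)%C z.
Proof. intros [l H] [m H']. eexists. apply cder_minus; eassumption. Qed.
Lemma cdiff_mult f g z : cdiff f z -> cdiff g z -> cdiff (fun w => f w * g w)%C z.
Proof. intros [l H] [m H']. eexists. apply cder_mult; eassumption. Qed.
Lemma cdiff_div f g z : cdiff f z -> cdiff g z -> g z <> 0 -> cdiff (fun w => f w / g w)%C z.
Proof. intros [l H] [m H'] H0. eexists. apply (cder_mult f (fun w => / g w)%C); [eassumption|apply cder_inv; eassumption]. Qed.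
Lemma cdiff_pow f n z : cdiff f z -> cdiff (fun w => Cpow (f w) n) z.
Proof. intros [l H]. eexists. apply cder_pow; eassumption. Qed.
Lemma cdiff_id z : cdiff (fun w => w) z.
Proof. eexists. apply cder_id. Qed.
Lemma cdiff_sub_id p z : cdiff (fun w => w - p)%C z.
Proof. eexists. apply cder_sub_id. Qed.
Lemma cdiff_ext_loc f g z : locally z (fun w => f w = g w) -> cdiff f z -> cdiff g z.
Proof. intros H [l Hl]. exists l. apply (cder_ext_loc f); assumption. Qed.
Lemma cdiff_comp f g z : cdiff g z -> cdiff f (g z) -> cdiff (fun w => f (g w)) z.
Proof. intros [l H] [m H']. eexists. apply cder_comp; eassumption. Qed.

(** Cauchy's formula for f^n loses only the fixed factor r / (r - |z - c|), and this factor
    disappears on taking n-th roots, by [pow_bound_le]. *)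
Lemma max_modulus_cpt f c R0 r M : holo (disc c R0) f -> 0 < r < R0 -> 0 <= M ->
  (forall t, 0 <= t <= 2 * PI -> Cmod (f (cpt c r t)) <= M) -> forall z, Cmod (z - c) < r -> Cmod (f z) <= M.
Proof.
intros Hf Hr HM0 HM z Hz. pose proof PI_RGT_0 as HPI.
apply (pow_bound_le _ _ (r / (r - Cmod (z - c)))); [apply Cmod_ge_0|exact HM0|]. intros n.
assert (Hn : holo (disc c R0) (fun w => Cpow (f w) n)) by (intros w Hw; apply cdiff_pow, Hf, Hw).
pose proof (cauchy_formula _ c R0 r z Hn (proj2 Hr) Hz) as E.
assert (HC : Cmod (RtoC (2 * PI) * Ci * Cpow (f z) n) = 2 * PI * Cmod (f z) ^ n).
{ rewrite !Cmod_mult, Cmod_Ci, Cmod_R, Cmod_pow, Rabs_pos_eq by lra. ring. }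
assert (HB : Cmod (circ (fun w => Cpow (f w) n / (w - z))%C c r) <= 2 * PI * ((M ^ n / (r - Cmod (z - c))) * r)).
{ apply circ_bound; [lra| |].
  - intros t. apply (ccont_div (fun w => Cpow (f w) n) (fun w => w - z)%C).
    + apply cdiff_ccont, Hn, cpt_in_disc. lra.
    + apply ccont_sub_id.
    + apply cpt_minus_neq, Hz.
  - intros t Ht. rewrite Cmod_div by (apply cpt_minus_neq, Hz). rewrite Cmod_pow. unfold Rdiv.
    apply Rmult_le_compat; [apply pow_le, Cmod_ge_0|left; apply Rinv_0_lt_compat, Cmod_gt_0, cpt_minus_neq, Hz| |].
    + apply pow_incr. split; [apply Cmod_ge_0|]. apply HM, Ht.
    + apply Rinv_le_contravar; [lra|apply cpt_minus_lower, Hz]. }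
rewrite E, HC in HB. apply Rmult_le_reg_l with (2 * PI); [lra|]. eapply Rle_trans; [exact HB|].
right. field. lra.
Qed.

Lemma max_modulus f c R0 r M : holo (disc c R0) f -> 0 < r < R0 -> 0 <= M ->
  (forall w, Cmod (w - c) = r -> Cmod (f w) <= M) -> forall z, Cmod (z - c) <= r -> Cmod (f z) <= M.
Proof.
intros Hf Hr HM0 HM z [Hz|Hz]; [|apply HM, Hz].
apply (max_modulus_cpt f c R0 r); try assumption. intros t _. apply HM, Cmod_cpt. lra.
Qed.

(** The maximum principle is applied to the difference quotient at z, whose value at z is the
    derivative; on the circle of radius d it is at most 2 M / d. *)
Lemma dC_bound f c R0 d M z : holo (disc c R0) f -> 0 < d -> Cmod (z - c) + d < R0 -> 0 <= M ->
  (forall w, Cmod (w - z) <= d -> Cmod (f w) <= M) -> Cmod (dC f z) <= 2 * M / d.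
Proof.
intros Hf Hd Hz HM0 HM.
assert (Hzd : disc c R0 z) by (unfold disc; lra).
set (g := quot f z (dC f z)).
assert (Hg : holo (disc z (R0 - Cmod (z - c))) g).
{ intros w Hw. apply (quot_holo c R0 f z Hf Hzd). unfold disc in *. pose proof (Cmod_triangle_minus w z c). lra. }
replace (dC f z) with (g z) by (unfold g, quot; destruct (Ceq_dec z z); congruence).
apply (max_modulus g z (R0 - Cmod (z - c)) d); [exact Hg|lra|apply Rdiv_le_0_compat; lra| |rewrite Cmod_0_minus; lra].
intros w Hw. unfold g, quot. destruct (Ceq_dec w z) as [->|Hn]; [rewrite Cmod_0_minus in Hw; lra|].
rewrite Cmod_div by (apply Cminus_neq_0, Hn). rewrite Hw. apply Rmult_le_compat_r; [left; apply Rinv_0_lt_compat, Hd|].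
unfold Cminus at 1. eapply Rle_trans; [apply Cmod_triangle|]. rewrite Cmod_opp.
pose proof (HM w ltac:(lra)). pose proof (HM z ltac:(rewrite Cmod_0_minus; lra)). lra.
Qed.

(** The map phi = L / (2A - L) sends the half-plane Re L <= A into the unit disc and vanishes at c,
    so Schwarz's lemma gives |phi| <= r2 / r, and L is recovered from L = phi (2A - L). *)
Lemma borel_caratheodory L c R0 A r r2 : holo (disc c R0) L -> 0 < A -> L c = 0 ->
  (forall z, disc c R0 z -> Re (L z) <= A) -> 0 <= r2 < r -> r < R0 ->
  forall z, Cmod (z - c) <= r2 -> Cmod (L z) <= 2 * A * r2 / (r - r2).
Proof.
intros HL HA H0 HRe Hr2 Hr z Hz.
assert (Hnz : forall w, disc c R0 w -> (RtoC (2 * A) - L w)%C <> 0).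
{ intros w Hw E. apply (f_equal Re) in E. simpl in E. pose proof (HRe w Hw). unfold Re in *. lra. }
set (phi := fun w => (L w / (RtoC (2 * A) - L w))%C).
assert (Hphi : holo (disc c R0) phi).
{ intros w Hw. apply cdiff_div; [apply HL, Hw|apply cdiff_minus; [apply cdiff_const|apply HL, Hw]|apply Hnz, Hw]. }
assert (Hp1 : forall w, disc c R0 w -> Cmod (phi w) <= 1).
{ intros w Hw. unfold phi. rewrite Cmod_div by (apply Hnz, Hw). apply Rle_div_l; [apply Cmod_gt_0, Hnz, Hw|]. rewrite Rmult_1_l.
  unfold Cmod. apply sqrt_le_1_alt. simpl. pose proof (HRe w Hw). unfold Re in *. nra. }
assert (Hcd : disc c R0 c) by (unfold disc; rewrite Cmod_0_minus; lra).
destruct (divide_root c R0 phi c Hphi Hcd) as [chi [Hchi E]].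
{ unfold phi. rewrite H0. unfold Cdiv. ring. }
assert (Hchi1 : Cmod (chi z) <= / r).
{ apply (max_modulus chi c R0 r); [exact Hchi|lra|left; apply Rinv_0_lt_compat; lra| |lra].
  intros w Hw. assert (Hwd : disc c R0 w) by (unfold disc; lra). pose proof (Hp1 w Hwd) as B. rewrite E, Cmod_mult, Hw in B.
  apply Rmult_le_reg_l with r; [lra|]. rewrite Rinv_r by lra. exact B. }
assert (Hzd : disc c R0 z) by (unfold disc; lra).
assert (Hpz : Cmod (phi z) <= r2 / r).
{ rewrite E, Cmod_mult. unfold Rdiv. apply Rmult_le_compat; [apply Cmod_ge_0|apply Cmod_ge_0|exact Hz|exact Hchi1]. }
assert (EL : L z = (phi z * (RtoC (2 * A) - L z))%C) by (unfold phi; field; apply Hnz, Hzd).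
assert (HLz : Cmod (L z) <= r2 / r * (2 * A + Cmod (L z))).
{ rewrite EL at 1. rewrite Cmod_mult. apply Rmult_le_compat; [apply Cmod_ge_0|apply Cmod_ge_0|exact Hpz|].
  unfold Cminus. eapply Rle_trans; [apply Cmod_triangle|]. rewrite Cmod_opp, Cmod_R, Rabs_pos_eq by lra. lra. }
apply Rle_div_r; [lra|].
apply (Rmult_le_compat_l r) in HLz; [|lra].
replace (r * (r2 / r * (2 * A + Cmod (L z)))) with (r2 * (2 * A + Cmod (L z))) in HLz by (field; lra). lra.
Qed.

Lemma cder_zero_const f c R0 : (forall z, disc c R0 z -> cder f z 0) -> forall z, disc c R0 z -> f z = f c.
Proof.
intros H z Hz. apply Ceq_minus.
assert (E : (f (c + (z - c) * RtoC 1) - f (c + (z - c) * RtoC 0) = CInt (fun _ => 0) 0 1)%C).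
{ symmetry. apply (CInt_FTC (fun t => f (c + (z - c) * RtoC t)%C)). intros t Ht. split; [|apply ccont_const].
  apply (rder_eq _ _ (0 * (z - c))%C); [ring|]. apply (rder_comp f (fun t => c + (z - c) * RtoC t)%C); [apply rder_affine|].
  apply H. unfold disc. replace (c + (z - c) * RtoC t - c)%C with ((z - c) * RtoC t)%C by ring. rewrite Cmod_mult, Cmod_R.
  rewrite Rmin_left, Rmax_right in Ht by lra. rewrite Rabs_pos_eq by lra.
  unfold disc in Hz. pose proof (Cmod_ge_0 (z - c)). nra. }
rewrite CInt_const in E. replace (c + (z - c) * RtoC 1)%C with z in E by ring. replace (c + (z - c) * RtoC 0)%C with c in E by ring. rewrite E. ring.
Qed.

(** L is a primitive of g'/g vanishing at c, and g exp(-L) has derivative 0. The identity g = g(c)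
    exp(L) serves in place of a branch of the logarithm. *)
Lemma log_exists g c R0 : 0 < R0 -> holo (disc c R0) g -> (forall z, disc c R0 z -> g z <> 0) ->
  exists L : C -> C, L c = RtoC 0 /\ (forall z, disc c R0 z -> cder L z (dC g z / g z)%C /\ g z = (g c * Cexp (L z))%C).
Proof.
intros HR0 Hg Hnz.
assert (Hcd : disc c R0 c) by (unfold disc; rewrite Cmod_0_minus; lra).
assert (Hq : holo (disc c R0) (fun z => dC g z / g z)%C).
{ intros z Hz. apply cdiff_div; [apply (dC_holo_disc c R0 g Hg z Hz)|apply Hg, Hz|apply Hnz, Hz]. }
destruct (primitive_disc (fun z => dC g z / g z)%C c R0) as [F HF].
- intros z Hz. apply cdiff_ccont, Hq, Hz.
- intros a b k d Hin. apply goursat. intros z Hz. apply Hq, Hin, Hz.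
- set (L := fun z => (F z - F c)%C).
  assert (HLd : forall z, disc c R0 z -> cder L z (dC g z / g z)%C).
  { intros z Hz. eapply cder_eq; [|apply cder_minus; [apply HF, Hz|apply cder_const]]. ring. }
  assert (HL0 : L c = 0) by (unfold L; ring).
  exists L. split; [exact HL0|]. intros z Hz. split; [apply HLd, Hz|].
  assert (E : (g z * Cexp (- L z))%C = (g c * Cexp (- L c))%C).
  { apply (cder_zero_const (fun z => g z * Cexp (- L z))%C c R0); [|exact Hz].
    intros w Hw. eapply cder_eq; [|apply cder_mult; [apply dC_cder, Hg, Hw|apply (cder_comp Cexp (fun w => - L w)%C); [apply cder_opp, HLd, Hw|apply cder_Cexp]]].
    cbv beta. field. apply Hnz, Hw. }
  rewrite HL0 in E. replace (- 0)%C with (RtoC 0) in E by ring. rewrite Cexp_0, Cexp_opp in E.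
  transitivity (g z * / Cexp (L z) * Cexp (L z))%C; [field; apply Cexp_neq_0|]. rewrite E. ring.
Qed.

(** Because f vanishes near c, f(w) / (w - c)^n stays holomorphic for every n when extended by 0.
    The maximum principle on a circle of radius r then gives |f(z)| <= (|z - c| / r)^n M for all
    n. *)
Lemma identity_disc f c R0 : holo (disc c R0) f -> locally c (fun z => f z = 0) ->
  forall z, disc c R0 z -> f z = 0.
Proof.
intros Hf Hloc z Hz.
destruct (Ceq_dec z c) as [->|Hzc]; [exact (locally_singleton _ _ Hloc)|].
set (r := (Cmod (z - c) + R0) / 2). unfold disc in Hz.
assert (Hzp : 0 < Cmod (z - c)) by (apply Cmod_gt_0, Cminus_neq_0, Hzc).
assert (Hr : Cmod (z - c) < r < R0) by (unfold r; lra).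
set (g := fun n w => if Ceq_dec w c then RtoC 0 else (f w / Cpow (w - c) n)%C).
assert (Hg : forall n, holo (disc c R0) (g n)).
{ intros n w Hw. destruct (Ceq_dec w c) as [->|Hn].
  - apply (cdiff_ext_loc (fun _ => RtoC 0)); [|apply cdiff_const]. generalize Hloc. apply filter_imp.
    intros v Hv. unfold g. destruct (Ceq_dec v c); [reflexivity|]. rewrite Hv. unfold Cdiv. ring.
  - apply (cdiff_ext_loc (fun w => f w / Cpow (w - c) n)%C).
    + apply locally_C_iff. exists (Cmod (w - c)). split; [apply Cmod_gt_0, Cminus_neq_0, Hn|]. intros v Hv. unfold g.
      destruct (Ceq_dec v c) as [->|]; [|reflexivity]. rewrite Cmod_minus_sym in Hv. lra.
    + apply cdiff_div; [apply Hf, Hw|apply (cdiff_pow (fun w => w - c)%C), cdiff_sub_id|apply Cpow_nz, Cminus_neq_0, Hn]. }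
destruct (cont_bounded (fun t => f (cpt c r t)) 0 (2 * PI)) as [M [HM0 HM]]; [pose proof PI_RGT_0; lra| |].
{ intros t _. apply (ccont_comp (cpt c r) f); [apply ccont_cpt|]. apply cdiff_ccont, Hf, cpt_in_disc. lra. }
assert (Hb : forall n, Cmod (f z) <= (Cmod (z - c) / r) ^ n * M).
{ intros n. assert (B : Cmod (g n z) <= M / r ^ n).
  { apply (max_modulus_cpt (g n) c R0 r); [apply Hg|lra|apply Rdiv_le_0_compat; [exact HM0|apply pow_lt; lra]| |lra].
    intros t Ht. assert (Ec : Cmod (cpt c r t - c) = r) by (apply Cmod_cpt; lra).
    unfold g. destruct (Ceq_dec (cpt c r t) c) as [E0|Hn]; [rewrite E0, Cmod_0_minus in Ec; lra|].
    rewrite Cmod_div by (apply Cpow_nz, Cminus_neq_0, Hn). rewrite Cmod_pow, Ec. apply Rmult_le_compat_r; [left; apply Rinv_0_lt_compat, pow_lt; lra|apply HM, Ht]. }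
  assert (Ef : f z = (g n z * Cpow (z - c) n)%C).
  { unfold g. destruct (Ceq_dec z c) as [E0|_]; [contradiction|]. field. apply Cpow_nz, Cminus_neq_0, Hzc. }
  rewrite Ef, Cmod_mult, Cmod_pow. unfold Rdiv. rewrite Rpow_mult_distr, pow_inv.
  apply Rle_trans with (M / r ^ n * Cmod (z - c) ^ n); [apply Rmult_le_compat_r; [apply pow_le; lra|exact B]|]. right. unfold Rdiv. ring. }
apply Cmod_eq_0. apply Rle_antisym; [|apply Cmod_ge_0]. apply Rnot_lt_le. intros Hp.
assert (HMp : 0 < M). { pose proof (Hb 0%nat). simpl in *. lra. }
assert (Hq : Rabs (Cmod (z - c) / r) < 1). { rewrite Rabs_pos_eq by (apply Rdiv_le_0_compat; lra). apply Rlt_div_l; lra. }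
destruct (pow_lt_1_zero _ Hq (Cmod (f z) / M)) as [N HN]; [apply Rdiv_lt_0_compat; lra|].
pose proof (HN N (Nat.le_refl _)) as A. rewrite Rabs_pos_eq in A by (apply pow_le, Rdiv_le_0_compat; lra).
apply Rlt_div_r in A; [|exact HMp]. pose proof (Hb N). lra.
Qed.

(** * Series of complex numbers and functions *)

Lemma C_differentiable_iff f z : C_differentiable_at f z <-> cdiff f z.
Proof.
split.
- intros [l [_ H]]. exists l. apply cder_of_eps. intros e He.
  destruct (H z (fun P HP => HP) (mkposreal e He)) as [d Hd]. exists d. split; [apply cond_pos|].
  intros w Hw. specialize (Hd w Hw).
  change (Cmod ((f w - f z) - (w - z) * l) <= e * Cmod (w - z)) in Hd.
  replace (f w - f z - l * (w - z))%C with ((f w - f z) - (w - z) * l)%C by ring. exact Hd.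
- intros [l H]. exists l. split; [apply is_linear_scal_l|].
  intros x Hx. assert (Ex : x = z).
  { symmetry. exact (is_filter_lim_locally_unique (K := C_AbsRing) (V := AbsRing_NormedModule C_AbsRing) z x Hx). }
  subst x. intros e. destruct (cder_eps f z l H e (cond_pos e)) as [d [Hd A]].
  exists (mkposreal d Hd). intros w Hw.
  change (Cmod ((f w - f z) - (w - z) * l) <= e * Cmod (w - z)).
  replace ((f w - f z) - (w - z) * l)%C with (f w - f z - l * (w - z))%C by ring. apply A. exact Hw.
Qed.

Lemma cpow_Cexp x s : cpow x s = Cexp (s * RtoC (ln x)).
Proof. unfold cpow, Cexp. rewrite re_scal_r, im_scal_r. reflexivity. Qed.

Fixpoint csum (a : nat -> C) (n : nat) : C :=
  match n with O => RtoC 0 | S k => (csum a k + a k)%C end.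
Fixpoint rsum (a : nat -> R) (n : nat) : R :=
  match n with O => 0 | S k => rsum a k + a k end.

Definition clim (u : nat -> C) (l : C) : Prop :=
  forall e, 0 < e -> exists N, forall n, (N <= n)%nat -> Cmod (u n - l) < e.

Definition cser (a : nat -> C) (l : C) : Prop := clim (csum a) l.

Lemma csum_sum_n a n : sum_n (a : nat -> C_NormedModule) n = csum a (S n).
Proof.
induction n as [|n IH].
- rewrite sum_O. simpl. symmetry. apply Cplus_0_l.
- rewrite sum_Sn, IH. reflexivity.
Qed.

Lemma is_series_cser a l : is_series (a : nat -> C_NormedModule) l <-> cser a l.
Proof.
split.
- intros H e He. assert (HL : locally (l : C_NormedModule) (fun z : C => Cmod (z - l) < e)).
  { apply (proj2 (locally_C_iff l (fun z => Cmod (z - l) < e))). exists e. tauto. }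
  destruct (H _ HL) as [N HN]. exists (S N). intros [|n] Hn; [lia|]. rewrite <- csum_sum_n. apply HN. lia.
- intros H P HP. apply (locally_C_iff l P) in HP. destruct HP as [d [Hd HP]]. destruct (H d Hd) as [N HN].
  exists N. intros n Hn. apply HP. rewrite csum_sum_n. apply HN. lia.
Qed.

Lemma clim_unique u l l' : clim u l -> clim u l' -> l = l'.
Proof.
intros H H'. apply Ceq_minus. apply (Cmod_arb_small _ 2); [lra|]. exists 1. split; [lra|]. intros e [He _].
destruct (H e He) as [N HN]. destruct (H' e He) as [N' HN'].
pose proof (HN (max N N') (Nat.le_max_l _ _)). pose proof (HN' (max N N') (Nat.le_max_r _ _)).
pose proof (Cmod_triangle_minus l (u (max N N')) l'). rewrite (Cmod_minus_sym l (u _)) in H2. lra.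
Qed.

Lemma clim_plus u v l m : clim u l -> clim v m -> clim (fun n => u n + v n)%C (l + m).
Proof.
intros H H' e He. destruct (H (e/2) ltac:(lra)) as [N HN]. destruct (H' (e/2) ltac:(lra)) as [N' HN'].
exists (max N N'). intros n Hn. replace (u n + v n - (l + m))%C with ((u n - l) + (v n - m))%C by ring.
eapply Rle_lt_trans; [apply Cmod_triangle|]. pose proof (HN n ltac:(lia)). pose proof (HN' n ltac:(lia)). lra.
Qed.

Lemma clim_const l : clim (fun _ => l) l.
Proof. intros e He. exists O. intros n _. rewrite Cmod_0_minus. exact He. Qed.

Lemma clim_scal k u l : clim u l -> clim (fun n => k * u n)%C (k * l).
Proof.
intros H e He. assert (Hk : 0 < Cmod k + 1) by (pose proof (Cmod_ge_0 k); lra).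
destruct (H (e / (Cmod k + 1))) as [N HN]; [apply Rdiv_lt_0_compat; lra|]. exists N. intros n Hn.
replace (k * u n - k * l)%C with (k * (u n - l))%C by ring. rewrite Cmod_mult.
pose proof (HN n Hn) as A. apply Rlt_div_r in A; [|exact Hk]. pose proof (Cmod_ge_0 (u n - l)). nra.
Qed.

Lemma clim_ext u v l : (forall n, u n = v n) -> clim u l -> clim v l.
Proof. intros E H e He. destruct (H e He) as [N HN]. exists N. intros n Hn. rewrite <- E. apply HN, Hn. Qed.

Lemma clim_opp u l : clim u l -> clim (fun n => - u n)%C (- l).
Proof.
intros H. apply (clim_ext (fun n => (- (1)) * u n)%C); [intros; ring|].
replace (- l)%C with (- (1) * l)%C by ring. apply clim_scal, H.
Qed.

Lemma clim_minus u v l m : clim u l -> clim v m -> clim (fun n => u n - v n)%C (l - m).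
Proof. intros H H'. apply clim_plus; [exact H|apply clim_opp, H']. Qed.

Lemma clim_bound u l M : clim u l -> (forall n, Cmod (u n) <= M) -> Cmod l <= M.
Proof.
intros H HM. apply Rnot_lt_le. intros Hlt. destruct (H (Cmod l - M)) as [N HN]; [lra|].
pose proof (HN N (Nat.le_refl _)). pose proof (HM N). pose proof (Cmod_le_minus l (u N)). rewrite Cmod_minus_sym in H2. lra.
Qed.

Lemma csum_plus a b n : csum (fun k => a k + b k)%C n = (csum a n + csum b n)%C.
Proof. induction n as [|n IH]; simpl; [ring|rewrite IH; ring]. Qed.
Lemma csum_minus a b n : csum (fun k => a k - b k)%C n = (csum a n - csum b n)%C.
Proof. induction n as [|n IH]; simpl; [ring|rewrite IH; ring]. Qed.
Lemma csum_scal k a n : csum (fun j => k * a j)%C n = (k * csum a n)%C.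
Proof. induction n as [|n IH]; simpl; [ring|rewrite IH; ring]. Qed.
Lemma csum_ext a b n : (forall k, (k < n)%nat -> a k = b k) -> csum a n = csum b n.
Proof. induction n as [|n IH]; simpl; intros H; [reflexivity|]. rewrite IH, H; auto. Qed.
Lemma csum_telescope (f : nat -> C) n : csum (fun k => f (S k) - f k)%C n = (f n - f O)%C.
Proof. induction n as [|n IH]; simpl; [ring|rewrite IH; ring]. Qed.
Lemma csum_bound a b n : (forall k, (k < n)%nat -> Cmod (a k) <= b k) -> Cmod (csum a n) <= rsum b n.
Proof.
induction n as [|n IH]; simpl; intros H; [rewrite Cmod_0; lra|].
eapply Rle_trans; [apply Cmod_triangle|]. apply Rplus_le_compat; [apply IH; auto|apply H; lia].
Qed.
Lemma rsum_le a b n : (forall k, (k < n)%nat -> a k <= b k) -> rsum a n <= rsum b n.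
Proof. induction n as [|n IH]; simpl; intros H; [lra|]. apply Rplus_le_compat; [apply IH; auto|apply H; lia]. Qed.
Lemma rsum_scal k a n : rsum (fun j => k * a j) n = k * rsum a n.
Proof. induction n as [|n IH]; simpl; [ring|rewrite IH; ring]. Qed.
Lemma rsum_ext a b n : (forall k, (k < n)%nat -> a k = b k) -> rsum a n = rsum b n.
Proof. induction n as [|n IH]; simpl; intros H; [reflexivity|]. rewrite IH, H; auto. Qed.
Lemma rsum_telescope (f : nat -> R) n : rsum (fun k => f (S k) - f k) n = f n - f O.
Proof. induction n as [|n IH]; simpl; [ring|rewrite IH; ring]. Qed.
Lemma rsum_mono a n m : (n <= m)%nat -> (forall k, 0 <= a k) -> rsum a n <= rsum a m.
Proof. intros Hnm Ha. induction Hnm; [lra|]. simpl. pose proof (Ha m). lra. Qed.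
Lemma csum_tail_bound a b n m : (n <= m)%nat -> (forall k, Cmod (a k) <= b k) ->
  Cmod (csum a m - csum a n) <= rsum b m - rsum b n.
Proof.
intros Hnm H. induction Hnm; [rewrite Cmod_0_minus; lra|]. simpl.
replace (csum a m + a m - csum a n)%C with ((csum a m - csum a n) + a m)%C by ring.
eapply Rle_trans; [apply Cmod_triangle|]. pose proof (H m). lra.
Qed.

Lemma rsum_bounded_cv (b : nat -> R) M : (forall k, 0 <= b k) -> (forall n, rsum b n <= M) ->
  exists l, (forall n, rsum b n <= l) /\ l <= M /\ forall e, 0 < e -> exists N, forall n, (N <= n)%nat -> l - e < rsum b n.
Proof.
intros Hb HM.
destruct (completeness (fun x => exists n, x = rsum b n)) as [l [Hl1 Hl2]].
- exists M. intros x [n ->]. apply HM.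
- exists 0. exists O. reflexivity.
- exists l. split; [intros n; apply Hl1; exists n; reflexivity|]. split; [apply Hl2; intros x [n ->]; apply HM|].
  intros e He. apply NNPP. intros Hn. assert (l <= l - e); [|lra]. apply Hl2. intros x [n ->].
  apply Rnot_lt_le. intros Hlt. apply Hn. exists n. intros m Hm. eapply Rlt_le_trans; [exact Hlt|apply rsum_mono; assumption].
Qed.

Lemma cauchy_clim (u : nat -> C) :
  (forall e, 0 < e -> exists N, forall n m, (N <= n)%nat -> (n <= m)%nat -> Cmod (u m - u n) < e) -> exists l, clim u l.
Proof.
intros H.
assert (HR : forall g : C -> R, (forall z w, Rabs (g z - g w) <= Cmod (z - w)) -> Cauchy_crit (fun n => g (u n))).
{ intros g Hg e He. destruct (H e He) as [N HN]. exists N. intros n m Hn Hm. unfold Rdist.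
  destruct (Nat.le_ge_cases n m) as [h|h].
  - rewrite Rabs_minus_sym. eapply Rle_lt_trans; [apply Hg|]. apply HN; assumption.
  - eapply Rle_lt_trans; [apply Hg|]. apply HN; assumption. }
destruct (Rcomplete.R_complete _ (HR Re (fun z w => re_le_Cmod (z - w)))) as [x Hx].
destruct (Rcomplete.R_complete _ (HR Im (fun z w => im_le_Cmod (z - w)))) as [y Hy].
exists (x, y). intros e He. destruct (Hx (e / 2)) as [N HN]; [lra|]. destruct (Hy (e / 2)) as [N' HN']; [lra|].
exists (max N N'). intros n Hn. eapply Rle_lt_trans; [apply Cmod_le_Re_Im|].
pose proof (HN n ltac:(lia)) as A. pose proof (HN' n ltac:(lia)) as B. unfold Rdist in A, B. simpl. unfold Re, Im, Rminus in A, B. lra.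
Qed.

Lemma cser_dominated (a : nat -> C) (b : nat -> R) M :
  (forall k, Cmod (a k) <= b k) -> (forall n, rsum b n <= M) -> exists l, cser a l /\ Cmod l <= M.
Proof.
intros Hab HM. assert (Hb : forall k, 0 <= b k) by (intros k; eapply Rle_trans; [apply Cmod_ge_0|apply Hab]).
destruct (rsum_bounded_cv b M Hb HM) as [L [HL1 [_ HL]]].
destruct (cauchy_clim (csum a)) as [l Hl].
- intros e He. destruct (HL e He) as [N HN]. exists N. intros n m Hn Hm.
  eapply Rle_lt_trans; [apply (csum_tail_bound a b n m Hm Hab)|]. pose proof (HN n Hn). pose proof (HL1 m). lra.
- exists l. split; [exact Hl|]. apply (clim_bound _ _ _ Hl). intros n. eapply Rle_trans; [apply csum_bound; intros; apply Hab|apply HM].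
Qed.

(** Termwise differentiation at a single point: the quadratic remainders sum to at most M |w - z|^2,
    so the sum of the derivatives is the derivative of the sum. *)
Lemma cser_der (a : nat -> C -> C) (a' : nat -> C) (A : C -> C) (A' z : C) (b : nat -> R) M del :
  0 < del ->
  (forall w, Cmod (w - z) < del -> cser (fun n => a n w) (A w)) -> cser a' A' ->
  (forall n w, Cmod (w - z) < del -> Cmod (a n w - a n z - a' n * (w - z)) <= b n * Cmod (w - z) ^ 2) ->
  (forall n, rsum b n <= M) -> cder A z A'.
Proof.
intros Hdel HA HA' Hb HM.
assert (HM0 : 0 <= M) by exact (HM O).
apply cder_of_eps. intros e He. exists (Rmin del (e / (M + 1))). split; [apply Rmin_glb_lt; [exact Hdel|apply Rdiv_lt_0_compat; lra]|].
intros w Hw. assert (Hw1 : Cmod (w - z) < del) by (eapply Rlt_le_trans; [exact Hw|apply Rmin_l]).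
assert (Hw2 : Cmod (w - z) < e / (M + 1)) by (eapply Rlt_le_trans; [exact Hw|apply Rmin_r]).
apply Rle_trans with (M * Cmod (w - z) ^ 2).
- apply (clim_bound (fun n => csum (fun k => a k w - a k z - a' k * (w - z))%C n)).
  + apply (clim_ext (fun n => csum (fun k => a k w) n - csum (fun k => a k z) n - (w - z) * csum a' n)%C).
    * intros n. induction n as [|n IH]; simpl; [ring|]. rewrite <- IH. ring.
    * replace (A' * (w - z))%C with ((w - z) * A')%C by ring.
      apply clim_minus; [apply clim_minus; apply HA|apply clim_scal, HA']; [exact Hw1|rewrite Cmod_0_minus; exact Hdel].
  + intros n. eapply Rle_trans; [apply (csum_bound _ (fun k => Cmod (w - z) ^ 2 * b k)); intros k _; rewrite Rmult_comm; apply Hb, Hw1|].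
    rewrite rsum_scal, Rmult_comm. apply Rmult_le_compat_r; [apply pow_le, Cmod_ge_0|apply HM].
- apply Rlt_div_r in Hw2; [|lra]. pose proof (Cmod_ge_0 (w - z)).
  replace (M * Cmod (w - z) ^ 2) with (M * Cmod (w - z) * Cmod (w - z)) by ring. apply Rmult_le_compat_r; [exact H|]. nra.
Qed.

(* x^p = Rpower x p, written out so that it matches [Cexp]. *)
Lemma pseries_step p (n : nat) : 0 < p ->
  exp (- (p + 1) * ln (INR (S (S n)))) <= / p * (exp (- p * ln (INR (S n))) - exp (- p * ln (INR (S (S n))))).
Proof.
intros Hp. set (a := ln (INR (S n))). set (b := ln (INR (S (S n)))).
assert (Hn : 0 < INR (S n)) by (apply lt_0_INR; lia). assert (Hn2 : 0 < INR (S (S n))) by (apply lt_0_INR; lia).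
assert (Hab : / INR (S (S n)) <= b - a).
{ assert (E : exp (a - b) = INR (S n) / INR (S (S n))).
  { unfold Rminus. rewrite exp_plus, exp_Ropp. unfold a, b. rewrite !exp_ln by assumption. reflexivity. }
  pose proof (exp_ineq1_le (a - b)) as H. rewrite E in H. rewrite (S_INR (S n)) in H.
  assert (INR (S n) / (INR (S n) + 1) = 1 - / (INR (S n) + 1)) by (field; lra). rewrite H0 in H. rewrite (S_INR (S n)). lra. }
assert (Eb : exp (- (p + 1) * b) = exp (- p * b) * / INR (S (S n))).
{ replace (- (p + 1) * b) with (- p * b + - b) by ring. rewrite exp_plus, (exp_Ropp b). f_equal. f_equal. apply exp_ln, Hn2. }
assert (Ea : exp (- p * a) = exp (- p * b) * exp (p * (b - a))) by (rewrite <- exp_plus; f_equal; ring).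
rewrite Eb, Ea. pose proof (exp_ineq1_le (p * (b - a))). pose proof (exp_pos (- p * b)).
apply Rmult_le_reg_l with p; [exact Hp|]. rewrite <- (Rmult_assoc p (/ p)), Rinv_r, Rmult_1_l by lra.
replace (exp (- p * b) * exp (p * (b - a)) - exp (- p * b)) with (exp (- p * b) * (exp (p * (b - a)) - 1)) by ring.
rewrite <- Rmult_assoc, (Rmult_comm p), Rmult_assoc. apply Rmult_le_compat_l; [lra|]. nra.
Qed.

Lemma pseries_tail p (n m : nat) : 0 < p ->
  rsum (fun k => exp (- (p + 1) * ln (INR (S (S (n + k)))))) m <= / p * exp (- p * ln (INR (S n))).
Proof.
intros Hp.
apply Rle_trans with (rsum (fun k => - / p * (exp (- p * ln (INR (S (n + S k)))) - exp (- p * ln (INR (S (n + k)))))) m).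
- apply rsum_le. intros k _. eapply Rle_trans; [apply pseries_step, Hp|]. right. rewrite Nat.add_succ_r. ring.
- rewrite rsum_scal, (rsum_telescope (fun k => exp (- p * ln (INR (S (n + k)))))). rewrite Nat.add_0_r.
  pose proof (exp_pos (- p * ln (INR (S (n + m))))). assert (0 < / p) by (apply Rinv_0_lt_compat, Hp). nra.
Qed.

Lemma rsum_shift b n : rsum b (S n) = b O + rsum (fun k => b (S k)) n.
Proof. induction n as [|n IH]; [simpl; ring|]. change (rsum b (S n) + b (S n) = b O + (rsum (fun k => b (S k)) n + b (S n))). rewrite IH. ring. Qed.

Lemma pseries_bound p (n : nat) : 0 < p -> rsum (fun k => exp (- (p + 1) * ln (INR (S k)))) n <= 1 + / p.
Proof.
intros Hp. assert (0 < / p) by (apply Rinv_0_lt_compat, Hp). destruct n as [|n]; [simpl; lra|]. rewrite rsum_shift. apply Rplus_le_compat.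
- simpl INR. rewrite ln_1, Rmult_0_r, exp_0. lra.
- pose proof (pseries_tail p 0 n Hp) as H0. simpl INR in H0 at 2. rewrite ln_1, Rmult_0_r, exp_0, Rmult_1_r in H0. exact H0.
Qed.

Lemma pseries_bound_gt1 q (n : nat) : 1 < q -> rsum (fun k => exp (- q * ln (INR (S k)))) n <= 1 + / (q - 1).
Proof.
intros Hq. replace (rsum (fun k => exp (- q * ln (INR (S k)))) n) with (rsum (fun k => exp (- ((q - 1) + 1) * ln (INR (S k)))) n).
- apply pseries_bound. lra.
- apply rsum_ext. intros k _. f_equal. ring.
Qed.

(** * Analytic continuation of the zeta function *)

Lemma exp_le (x y : R) : x <= y -> exp x <= exp y.
Proof. intros [H|H]; [left; apply exp_increasing, H|right; rewrite H; reflexivity]. Qed.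

Lemma lin_le_exp (del L : R) : 0 < del -> 0 <= L -> L <= / del * exp (del * L).
Proof.
intros Hd HL. pose proof (exp_ineq1_le (del * L)). apply Rmult_le_reg_l with del; [exact Hd|].
rewrite <- Rmult_assoc, Rinv_r by lra. lra.
Qed.

Lemma sq_le_exp (del L : R) : 0 < del -> 0 <= L -> L ^ 2 <= 4 / del ^ 2 * exp (del * L).
Proof.
intros Hd HL. pose proof (lin_le_exp (del / 2) L ltac:(lra) HL) as H.
replace (exp (del * L)) with (exp (del / 2 * L) ^ 2).
2:{ simpl. rewrite Rmult_1_r, <- exp_plus. f_equal. field. }
replace (4 / del ^ 2 * exp (del / 2 * L) ^ 2) with ((/ (del / 2) * exp (del / 2 * L)) ^ 2) by (field; lra).
apply pow_incr. split; assumption.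
Qed.

Lemma Cmod_Cexp_opp (w : C) (L : R) : Cmod (Cexp (- w * RtoC L)) = exp (- Re w * L).
Proof. rewrite Cmod_Cexp, re_scal_r, re_opp. reflexivity. Qed.

Lemma Cexp_power_der_est (w h : C) (L del : R) : 0 <= L -> 0 < del -> Cmod h <= del ->
  Cmod (Cexp (- (w + h) * RtoC L) - Cexp (- w * RtoC L) - - RtoC L * Cexp (- w * RtoC L) * h)
   <= 4 / del ^ 2 * exp (- (Re w - 2 * del) * L) * Cmod h ^ 2.
Proof.
intros HL Hd Hh.
replace (Cexp (- (w + h) * RtoC L)) with (Cexp (- w * RtoC L) * Cexp (- h * RtoC L))%C by (rewrite <- Cexp_plus; f_equal; ring).
replace (Cexp (- w * RtoC L) * Cexp (- h * RtoC L) - Cexp (- w * RtoC L) - - RtoC L * Cexp (- w * RtoC L) * h)%C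
  with (Cexp (- w * RtoC L) * (Cexp (- h * RtoC L) - 1 - - h * RtoC L))%C by ring.
rewrite Cmod_mult, Cmod_Cexp_opp.
assert (E : Cmod (- h * RtoC L) = Cmod h * L) by (rewrite Cmod_mult, Cmod_opp, Cmod_R, Rabs_pos_eq by exact HL; reflexivity).
pose proof (Cexp_taylor1 (- h * RtoC L)) as T. rewrite E in T.
assert (T2 : (Cmod h * L) ^ 2 * exp (Cmod h * L) <= Cmod h ^ 2 * (4 / del ^ 2 * exp (del * L) * exp (del * L))).
{ rewrite Rpow_mult_distr, Rmult_assoc. apply Rmult_le_compat_l; [apply pow_le, Cmod_ge_0|].
  apply Rmult_le_compat; [apply pow_le, HL|left; apply exp_pos|apply sq_le_exp; assumption|apply exp_le; nra]. }
replace (exp (- (Re w - 2 * del) * L)) with (exp (- Re w * L) * (exp (del * L) * exp (del * L))) by (rewrite <- !exp_plus; f_equal; ring).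
eapply Rle_trans; [apply Rmult_le_compat_l; [left; apply exp_pos|eapply Rle_trans; [exact T|exact T2]]|]. right; ring.
Qed.

(* Bernoulli polynomials divided by m!: primitives of each other with mean 0 on [0, 1]. *)
Fixpoint bq (m : nat) : R -> R :=
  match m with
  | O => fun _ => 1
  | S k => fun t => RInt (bq k) 0 t - RInt (fun u => RInt (bq k) 0 u) 0 1
  end.

Lemma bq_facts m : (forall t, continuous (bq m) t) /\ (forall t, is_derive (bq (S m)) t (bq m t)).
Proof.
assert (A : forall k, (forall t, continuous (bq k) t) -> forall t, is_derive (bq (S k)) t (bq k t)).
{ intros k Hk t. simpl. replace (bq k t) with (minus (bq k t) 0) by (unfold minus, plus, opp; simpl; ring).
  apply (is_derive_minus (fun t => RInt (bq k) 0 t) (fun _ => RInt (fun u => RInt (bq k) 0 u) 0 1)); [|apply (is_derive_const (V := R_NormedModule))].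
  apply (is_derive_RInt (V := R_NormedModule) (bq k) (fun t => RInt (bq k) 0 t) 0 t); [|apply Hk].
  apply filter_forall. intros u. apply (RInt_correct (V := R_CompleteNormedModule)). apply (ex_RInt_continuous (V := R_CompleteNormedModule)). intros; apply Hk. }
induction m as [|m [IH1 IH2]].
- split; [intros t; apply continuous_const|apply A; intros t; apply continuous_const].
- assert (C1 : forall t, continuous (bq (S m)) t) by (intros t; apply (ex_derive_continuous (V := R_NormedModule) (bq (S m))); eexists; apply IH2).
  split; [exact C1|apply A, C1].
Qed.

Lemma bq_cont m t : continuous (bq m) t.
Proof. apply bq_facts. Qed.
Lemma bq_der m t : is_derive (bq (S m)) t (bq m t).
Proof. apply bq_facts. Qed.

Lemma bq_ex m a b : ex_RInt (bq m) a b.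
Proof. apply (ex_RInt_continuous (V := R_CompleteNormedModule)). intros; apply bq_cont. Qed.

Lemma bq_int0 m : RInt (bq (S m)) 0 1 = 0.
Proof.
simpl. rewrite (RInt_minus (V := R_CompleteNormedModule)).
- rewrite (RInt_const (V := R_CompleteNormedModule)).
  match goal with |- minus ?a (scal _ ?b) = _ => change (b + - ((1 - 0) * b) = 0) end. ring.
- apply (ex_RInt_ext (fun t => bq (S m) t + RInt (fun u => RInt (bq m) 0 u) 0 1)); [intros u _; change (RInt (bq m) 0 u - RInt (fun v => RInt (bq m) 0 v) 0 1 + RInt (fun v => RInt (bq m) 0 v) 0 1 = RInt (bq m) 0 u); generalize (RInt (bq m) 0 u) (RInt (fun v => RInt (bq m) 0 v) 0 1); intros A0 B0; change (A0 - B0 + B0 = A0 :> R); ring|].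
  apply (ex_RInt_plus (V := R_NormedModule)); [apply bq_ex|apply (ex_RInt_const (V := R_NormedModule))].
- apply (ex_RInt_const (V := R_NormedModule)).
Qed.

(** The increment over [0, 1] is the integral of the preceding polynomial, which vanishes from index
    1 on. Hence the statement starts at index 2; bq_1 itself jumps by 1 at the integers. *)
Lemma bq_periodic m : bq (S (S m)) 1 = bq (S (S m)) 0.
Proof.
change (RInt (bq (S m)) 0 1 - RInt (fun u => RInt (bq (S m)) 0 u) 0 1 = RInt (bq (S m)) 0 0 - RInt (fun u => RInt (bq (S m)) 0 u) 0 1).
rewrite bq_int0, (RInt_point (V := R_CompleteNormedModule)). reflexivity.
Qed.

Lemma bq_1 t : bq 1 t = t - / 2.
Proof.
simpl. assert (E : forall u, RInt (fun _ : R => 1) 0 u = u).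
{ intros u. rewrite (RInt_const (V := R_CompleteNormedModule)). change ((u - 0) * 1 = u). ring. }
rewrite E. rewrite (RInt_ext (V := R_CompleteNormedModule) _ (fun u => u)) by (intros; apply E).
rewrite (is_RInt_unique (V := R_CompleteNormedModule) (fun u : R => u) 0 1 (1 ^ 2 / 2 - 0 ^ 2 / 2)).
- change (t - (1 ^ 2 / 2 - 0 ^ 2 / 2) = t - / 2). field.
- apply (is_RInt_derive (V := R_CompleteNormedModule) (fun u : R => u ^ 2 / 2)); intros x _; [auto_derive; trivial; field|apply continuous_id].
Qed.

Lemma bq_bound m : exists B, 0 < B /\ forall t, 0 <= t <= 1 -> Rabs (bq m t) <= B.
Proof.
destruct (cont_bounded (fun t => RtoC (bq m t)) 0 1) as [M [HM H]]; [lra|intros t _; apply ccont_RtoC, bq_cont|].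
exists (M + 1). split; [lra|]. intros t Ht. specialize (H t Ht). rewrite Cmod_R in H. lra.
Qed.

(** The power (n + 1 + t)^(-w), that is y^(-w) moved to the unit interval that starts at n + 1. *)
Definition ypw (n : nat) (w : C) (t : R) : C := Cexp (- w * RtoC (ln (INR (S n) + t))).

Lemma Sn_t_pos n t : 0 <= t -> 0 < INR (S n) + t.
Proof. intros. assert (0 < INR (S n)) by (apply lt_0_INR; lia). lra. Qed.

Lemma is_derive_ln_shift (k t : R) : 0 < k + t -> is_derive (fun t => ln (k + t)) t (/ (k + t)).
Proof. intros H. auto_derive; [exact H|]. field. lra. Qed.

Lemma rder_ypw n w t : 0 <= t -> rder (ypw n w) t (- w * ypw n (w + 1) t).
Proof.
intros Ht. pose proof (Sn_t_pos n t Ht) as Hy.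
eapply rder_eq; [|apply (rder_comp (fun z => Cexp (- w * z)) (fun t => RtoC (ln (INR (S n) + t))));
 [apply (rder_pair (fun t => ln (INR (S n) + t)) (fun _ => 0) t (/ (INR (S n) + t)) 0)|
  apply (cder_comp Cexp (fun z => - w * z)%C); [apply cder_scal, cder_id|apply cder_Cexp]]].
- unfold ypw. replace (- (w + 1) * RtoC (ln (INR (S n) + t)))%C with (- w * RtoC (ln (INR (S n) + t)) + RtoC (- ln (INR (S n) + t)))%C by (rewrite RtoC_opp; ring).
  rewrite Cexp_plus. replace (Cexp (RtoC (- ln (INR (S n) + t)))) with (RtoC (/ (INR (S n) + t))).
  + change ((/ (INR (S n) + t), 0) : C) with (RtoC (/ (INR (S n) + t))). ring.
  + unfold Cexp. simpl. rewrite exp_Ropp, exp_ln by exact Hy. rewrite cos_0, sin_0. apply C_ext; simpl; ring.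
- exact (is_derive_ln_shift _ t Hy).
- apply (is_derive_const (V := R_NormedModule)).
Qed.

Lemma ypw_cont n w t : 0 <= t -> ccont (ypw n w) t.
Proof. intros. eapply rder_ccont, rder_ypw, H. Qed.

Lemma ln_Sn_le n t : 0 <= t -> 0 <= ln (INR (S n)) <= ln (INR (S n) + t).
Proof.
intros Ht. assert (1 <= INR (S n)) by (rewrite S_INR; pose proof (pos_INR n); lra). split.
- rewrite <- ln_1. apply ln_le; lra.
- apply ln_le; lra.
Qed.

Lemma ypw_bound n w t : 0 <= t -> 0 <= Re w -> Cmod (ypw n w t) <= exp (- Re w * ln (INR (S n))).
Proof.
intros Ht Hw. unfold ypw. rewrite Cmod_Cexp_opp. apply exp_le. pose proof (ln_Sn_le n t Ht). nra.
Qed.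

(* [Jf m w] is the integral over [1, oo) of bq_m(frac t) t^(-w), computed interval by interval. *)
Definition Jterm (m n : nat) (w : C) : C := CInt (fun t => RtoC (bq m t) * ypw n w t)%C 0 1.
Definition Jf (m : nat) (w : C) : C := epsilon (inhabits (RtoC 0)) (cser (fun n => Jterm m n w)).

Lemma cont01 (f : R -> C) : (forall t, 0 <= t -> ccont f t) -> ccont_on f 0 1.
Proof. intros H t Ht. rewrite Rmin_left in Ht by lra. apply H. lra. Qed.

Lemma Jterm_cont m n w t : 0 <= t -> ccont (fun t => RtoC (bq m t) * ypw n w t)%C t.
Proof. intros Ht. apply ccont_mult; [apply ccont_RtoC, bq_cont|apply ypw_cont, Ht]. Qed.

Lemma Jterm_bound m n w B : 0 <= Re w -> 0 < B -> (forall t, 0 <= t <= 1 -> Rabs (bq m t) <= B) ->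
  Cmod (Jterm m n w) <= B * exp (- Re w * ln (INR (S n))).
Proof.
intros Hw HB0 HB. unfold Jterm. replace (B * exp (- Re w * ln (INR (S n)))) with ((1 - 0) * (B * exp (- Re w * ln (INR (S n))))) by ring.
apply CInt_bound; [lra|apply cont01, Jterm_cont|]. intros t Ht. rewrite Cmod_mult, Cmod_R.
apply Rmult_le_compat; [apply Rabs_pos|apply Cmod_ge_0|apply HB, Ht|apply ypw_bound; lra].
Qed.

Lemma Jf_spec m w : 1 < Re w -> cser (fun n => Jterm m n w) (Jf m w).
Proof.
intros Hw. unfold Jf. apply epsilon_spec. destruct (bq_bound m) as [B [HB0 HB]].
destruct (cser_dominated (fun n => Jterm m n w) (fun n => B * exp (- Re w * ln (INR (S n)))) (B * (1 + / (Re w - 1)))) as [l [Hl _]].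
- intros n. apply Jterm_bound; try assumption. lra.
- intros n. rewrite rsum_scal. apply Rmult_le_compat_l; [lra|]. apply pseries_bound_gt1, Hw.
- exists l. exact Hl.
Qed.

Lemma Jf_bound m w B : 1 < Re w -> 0 < B -> (forall t, 0 <= t <= 1 -> Rabs (bq m t) <= B) ->
  Cmod (Jf m w) <= B * (1 + / (Re w - 1)).
Proof.
intros Hw HB0 HB. apply (clim_bound _ _ _ (Jf_spec m w Hw)). intros n.
eapply Rle_trans; [apply csum_bound; intros k _; apply (Jterm_bound m k w B); [lra|assumption|assumption]|].
rewrite (rsum_scal B (fun k => exp (- Re w * ln (INR (S k))))). apply Rmult_le_compat_l; [lra|]. apply pseries_bound_gt1, Hw.
Qed.

Lemma Jf_cdiff m w : 1 < Re w -> cdiff (Jf m) w.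
Proof.
intros Hw. destruct (bq_bound m) as [B [HB0 HB]].
(* Differentiating costs a logarithm or its square, paid for by at most n^(2 del); with these values
   Re w - 2 del = 1 + p, so the series still converges. *)
set (del := (Re w - 1) / 4). set (p := (Re w - 1) / 2). assert (Hdel : 0 < del) by (unfold del; lra). assert (Hp : 0 < p) by (unfold p; lra).
set (T' := fun n => CInt (fun t => RtoC (bq m t) * (- RtoC (ln (INR (S n) + t)) * ypw n w t))%C 0 1).
assert (Cln : forall n t, 0 <= t -> ccont (fun t => RtoC (ln (INR (S n) + t))) t).
{ intros n t Ht. apply ccont_RtoC. apply (ex_derive_continuous (V := R_NormedModule) (fun t => ln (INR (S n) + t))). eexists. apply is_derive_ln_shift, Sn_t_pos, Ht. }
assert (CT' : forall n t, 0 <= t -> ccont (fun t => RtoC (bq m t) * (- RtoC (ln (INR (S n) + t)) * ypw n w t))%C t).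
{ intros n t Ht. apply ccont_mult; [apply ccont_RtoC, bq_cont|]. apply ccont_mult; [apply ccont_opp, Cln, Ht|apply ypw_cont, Ht]. }
assert (Hmono : forall n t q, 0 <= t -> 0 <= q -> exp (- q * ln (INR (S n) + t)) <= exp (- q * ln (INR (S n)))).
{ intros n t q Ht Hq. apply exp_le. pose proof (ln_Sn_le n t Ht). nra. }
destruct (cser_dominated T' (fun n => (B * / del) * exp (- (p + 1) * ln (INR (S n)))) ((B * / del) * (1 + / p))) as [l' [Hl' _]].
- intros n. unfold T'. replace (B * / del * exp (- (p + 1) * ln (INR (S n)))) with ((1 - 0) * (B * (/ del * exp (- (p + 1) * ln (INR (S n)))))) by ring.
  apply CInt_bound; [lra|apply cont01, CT'|]. intros t Ht. rewrite Cmod_mult, Cmod_R.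
  apply Rmult_le_compat; [apply Rabs_pos|apply Cmod_ge_0|apply HB, Ht|].
  rewrite Cmod_mult, Cmod_opp, Cmod_R. pose proof (ln_Sn_le n t (proj1 Ht)) as HL. rewrite Rabs_pos_eq by lra.
  unfold ypw. rewrite Cmod_Cexp_opp. pose proof (lin_le_exp del _ Hdel (Rle_trans _ _ _ (proj1 HL) (proj2 HL))) as HLe.
  apply Rle_trans with ((/ del * exp (del * ln (INR (S n) + t))) * exp (- Re w * ln (INR (S n) + t))).
  + apply Rmult_le_compat_r; [left; apply exp_pos|exact HLe].
  + rewrite Rmult_assoc, <- exp_plus. apply Rmult_le_compat_l; [left; apply Rinv_0_lt_compat, Hdel|].
    eapply Rle_trans; [|apply (Hmono n t (p + 1)); lra]. apply exp_le. unfold p, del. nra.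
- intros n. rewrite rsum_scal. apply Rmult_le_compat_l; [apply Rmult_le_pos; [lra|left; apply Rinv_0_lt_compat, Hdel]|]. apply pseries_bound, Hp.
- exists l'. apply (cser_der (fun n z => Jterm m n z) T' (Jf m) l' w (fun n => (B * (4 / del ^ 2)) * exp (- (p + 1) * ln (INR (S n)))) ((B * (4 / del ^ 2)) * (1 + / p)) del Hdel).
  + intros v Hv. apply Jf_spec. pose proof (re_le_Cmod (v - w)) as A. apply Rabs_le_between in A.
    unfold Cminus in A. rewrite re_plus, re_opp in A. fold (v - w)%C in A. unfold del in Hv. lra.
  + exact Hl'.
  + intros n v Hv. set (h := (v - w)%C) in *.
    assert (E : (Jterm m n v - Jterm m n w - T' n * h)%C = CInt (fun t => RtoC (bq m t) * (Cexp (- (w + h) * RtoC (ln (INR (S n) + t))) - Cexp (- w * RtoC (ln (INR (S n) + t))) - - RtoC (ln (INR (S n) + t)) * Cexp (- w * RtoC (ln (INR (S n) + t))) * h))%C 0 1).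
    { rewrite (Cmult_comm (T' n)). unfold Jterm, T'. rewrite <- CInt_scal by (apply cont01, CT').
      rewrite <- CInt_minus by (apply cont01; intros; apply Jterm_cont; assumption).
      rewrite <- CInt_minus.
      - apply CInt_ext. intros t _. unfold ypw. replace v with (w + h)%C by (unfold h; ring). ring.
      - apply cont01. intros t Ht. apply ccont_minus; apply Jterm_cont, Ht.
      - apply cont01. intros t Ht. apply ccont_mult; [apply ccont_const|apply CT', Ht]. }
    rewrite E. replace (B * (4 / del ^ 2) * exp (- (p + 1) * ln (INR (S n))) * Cmod h ^ 2) with ((1 - 0) * (B * (4 / del ^ 2 * exp (- (p + 1) * ln (INR (S n))) * Cmod h ^ 2))) by ring.
    apply CInt_bound; [lra| |].
    * apply cont01. intros t Ht. apply ccont_mult; [apply ccont_RtoC, bq_cont|].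
      apply ccont_minus; [apply ccont_minus; apply ypw_cont, Ht|]. apply ccont_mult; [|apply ccont_const]. apply ccont_mult; [apply ccont_opp, Cln, Ht|apply ypw_cont, Ht].
    * intros t Ht. rewrite Cmod_mult, Cmod_R. apply Rmult_le_compat; [apply Rabs_pos|apply Cmod_ge_0|apply HB, Ht|].
      pose proof (ln_Sn_le n t (proj1 Ht)) as HL.
      eapply Rle_trans; [apply (Cexp_power_der_est w h _ del); lra|]. apply Rmult_le_compat_r; [apply pow_le, Cmod_ge_0|].
      apply Rmult_le_compat_l; [left; apply Rdiv_lt_0_compat; [lra|apply pow_lt, Hdel]|].
      eapply Rle_trans; [|apply (Hmono n t (p + 1)); lra]. apply exp_le. right. unfold p, del. field.
  + intros n. rewrite rsum_scal. apply Rmult_le_compat_l; [|apply pseries_bound, Hp]. apply Rmult_le_pos; [lra|]. left; apply Rdiv_lt_0_compat; [lra|apply pow_lt, Hdel].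
Qed.

Lemma ypw_at_1 n w : ypw n w 1 = ypw (S n) w 0.
Proof. unfold ypw. rewrite (S_INR (S n)), Rplus_0_r. reflexivity. Qed.

Lemma ypw_0_0 w : ypw 0 w 0 = 1.
Proof. unfold ypw. simpl INR. rewrite Rplus_0_r, ln_1, Cmult_0_r. apply Cexp_0. Qed.

Lemma Jterm_parts m n w : Jterm m n w =
  (RtoC (bq (S m) 1) * ypw (S n) w 0 - RtoC (bq (S m) 0) * ypw n w 0 + w * Jterm (S m) n (w + 1))%C.
Proof.
assert (E : (Jterm m n w - w * Jterm (S m) n (w + 1))%C = (RtoC (bq (S m) 1) * ypw n w 1 - RtoC (bq (S m) 0) * ypw n w 0)%C).
{ unfold Jterm. rewrite <- CInt_scal by (apply cont01, Jterm_cont).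
  rewrite <- CInt_minus.
  - apply (CInt_FTC (fun t => RtoC (bq (S m) t) * ypw n w t)%C). intros t Ht. rewrite Rmin_left in Ht by lra. split.
    + destruct (rder_pair (bq (S m)) (fun _ => 0) t (bq m t) 0 (bq_der m t) (is_derive_const (V := R_NormedModule) 0 t)) as [p [Hp [Ep Hp']]].
      destruct (rder_ypw n w t (proj1 Ht)) as [q [Hq [Eq Hq']]].
      exists (fun u => p u * ypw n w u + RtoC (bq (S m) t) * q u)%C. split; [|split].
      * apply ccont_plus; apply ccont_mult; [exact Hp|apply ypw_cont; lra|apply ccont_const|exact Hq].
      * rewrite Ep, Eq. change ((bq m t, 0) : C) with (RtoC (bq m t)). ring.
      * generalize (filter_and _ _ Hp' Hq'). apply filter_imp. intros u [H1 H2].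
        change ((bq (S m) u, 0) - (bq (S m) t, 0))%C with (RtoC (bq (S m) u) - RtoC (bq (S m) t))%C in H1.
        transitivity ((RtoC (bq (S m) u) - RtoC (bq (S m) t)) * ypw n w u + RtoC (bq (S m) t) * (ypw n w u - ypw n w t))%C; [ring|].
        rewrite H1, H2. ring.
    + apply ccont_minus; [apply Jterm_cont; lra|]. apply ccont_mult; [apply ccont_const|apply Jterm_cont; lra].
  - apply cont01, Jterm_cont.
  - apply cont01. intros t Ht. apply ccont_mult; [apply ccont_const|apply Jterm_cont, Ht]. }
rewrite <- ypw_at_1. transitivity ((Jterm m n w - w * Jterm (S m) n (w + 1)) + w * Jterm (S m) n (w + 1))%C; [ring|]. rewrite E. ring.
Qed.

Lemma ypw_to_0 w : 0 < Re w -> clim (fun n => ypw n w 0) 0.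
Proof.
intros Hw e He. destruct (archimed (exp (- ln e / Re w))) as [HN _].
set (N := Z.to_nat (up (exp (- ln e / Re w)))). exists N. intros n Hn.
replace (ypw n w 0 - 0)%C with (ypw n w 0) by ring. unfold ypw. rewrite Cmod_Cexp_opp, Rplus_0_r.
apply Rlt_le_trans with (exp (ln e)); [|right; apply exp_ln, He]. apply exp_increasing.
assert (H1 : exp (- ln e / Re w) < INR (S n)).
{ eapply Rlt_le_trans; [exact HN|]. rewrite S_INR. apply Rle_trans with (INR N).
  - unfold N. rewrite INR_IZR_INZ. apply IZR_le. lia.
  - apply le_INR in Hn. lra. }
apply ln_increasing in H1; [|apply exp_pos]. rewrite ln_exp in H1.
apply (Rmult_lt_compat_l (Re w)) in H1; [|exact Hw]. replace (Re w * (- ln e / Re w)) with (- ln e) in H1 by (field; lra). lra.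
Qed.

(** Integration by parts on each unit interval; the boundary terms telescope because bq_(m+2) takes
    equal values at 0 and 1, and only the one at the start survives, the far one tending to 0. The
    exponent grows by 1, which is what continues the integral to the left. *)
Lemma Jf_rec m w : 1 < Re w -> Jf (S m) w = (- RtoC (bq (S (S m)) 0) + w * Jf (S (S m)) (w + 1))%C.
Proof.
intros Hw. apply (clim_unique _ _ _ (Jf_spec (S m) w Hw)).
assert (Hw1 : 1 < Re (w + 1)) by (rewrite re_plus; simpl; lra).
apply (clim_ext (fun n => RtoC (bq (S (S m)) 0) * (ypw n w 0 - 1) + w * csum (fun k => Jterm (S (S m)) k (w + 1)) n)%C).
- intros n.
  assert (E1 : csum (fun k => ypw (S k) w 0 - ypw k w 0)%C n = (ypw n w 0 - 1)%C) by (rewrite (csum_telescope (fun k => ypw k w 0)), ypw_0_0; reflexivity).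
  rewrite <- E1, <- !csum_scal, <- csum_plus.
  apply csum_ext. intros k _. rewrite (Jterm_parts (S m) k w), bq_periodic. ring.
- replace (- RtoC (bq (S (S m)) 0) + w * Jf (S (S m)) (w + 1))%C with (RtoC (bq (S (S m)) 0) * (0 - 1) + w * Jf (S (S m)) (w + 1))%C by ring.
  apply clim_plus; [apply clim_scal; apply clim_minus; [apply ypw_to_0; lra|apply clim_const]|]. apply clim_scal, (Jf_spec (S (S m)) (w + 1) Hw1).
Qed.

(* Each integration by parts raises the exponent by one, so [Jx d 0] continues the integral of bq_1 to Re w > 1 - d. *)
Fixpoint Jx (d m : nat) (w : C) : C :=
  match d with
  | O => Jf (S m) w
  | S d' => (- RtoC (bq (S (S m)) 0) + w * Jx d' (S m) (w + 1))%C
  end.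

Lemma Re_plus_1 w : Re (w + 1) = Re w + 1.
Proof. rewrite re_plus. reflexivity. Qed.

Lemma Jx_S d : forall m w, 1 - INR d < Re w -> Jx (S d) m w = Jx d m w.
Proof.
induction d as [|d IH]; intros m w Hw.
- simpl in *. symmetry. apply Jf_rec. lra.
- change (Jx (S (S d)) m w) with (- RtoC (bq (S (S m)) 0) + w * Jx (S d) (S m) (w + 1))%C.
  rewrite IH; [reflexivity|]. rewrite Re_plus_1. rewrite S_INR in Hw. lra.
Qed.

Lemma Jx_le d d' m w : (d <= d')%nat -> 1 - INR d < Re w -> Jx d' m w = Jx d m w.
Proof.
intros H Hw. induction H as [|d' H IH]; [reflexivity|]. rewrite Jx_S; [exact IH|]. apply le_INR in H. lra.
Qed.

Lemma Jx_cdiff d : forall m w, 1 - INR d < Re w -> cdiff (Jx d m) w.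
Proof.
induction d as [|d IH]; intros m w Hw.
- apply Jf_cdiff. simpl in Hw. lra.
- apply cdiff_plus; [apply cdiff_const|]. apply cdiff_mult; [apply cdiff_id|].
  apply (cdiff_comp (Jx d (S m)) (fun w => w + 1)%C); [apply cdiff_plus; [apply cdiff_id|apply cdiff_const]|].
  apply IH. rewrite Re_plus_1. rewrite S_INR in Hw. lra.
Qed.

Definition depth (w : C) : nat := Z.to_nat (up (1 - Re w)).

Lemma depth_spec w : 1 - INR (depth w) < Re w.
Proof.
unfold depth. destruct (archimed (1 - Re w)) as [H _]. rewrite INR_IZR_INZ.
assert (IZR (up (1 - Re w)) <= IZR (Z.of_nat (Z.to_nat (up (1 - Re w))))) by (apply IZR_le; lia). lra.
Qed.

(** The continuation to the whole plane, evaluated at a depth that is large enough for w; [J1_eq]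
    shows that every sufficient depth gives the same value. *)
Definition J1 (w : C) : C := Jx (depth w) 0 w.

Lemma J1_eq d w : 1 - INR d < Re w -> J1 w = Jx d 0 w.
Proof.
intros Hw. unfold J1. pose proof (depth_spec w). destruct (Nat.le_ge_cases d (depth w)); [apply Jx_le; assumption|symmetry; apply Jx_le; assumption].
Qed.

Lemma J1_cdiff w : cdiff J1 w.
Proof.
pose proof (depth_spec w) as Hw. set (d := depth w) in *.
apply (cdiff_ext_loc (Jx d 0)); [|apply Jx_cdiff, Hw]. apply locally_C_iff. exists (Re w - (1 - INR d)). split; [lra|].
intros v Hv. symmetry. apply J1_eq. pose proof (re_le_Cmod (v - w)) as A. apply Rabs_le_between in A.
unfold Cminus in A. rewrite re_plus, re_opp in A. fold (v - w)%C in A. lra.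
Qed.

(* Euler-Maclaurin: zeta(s) = 1/2 + 1/(s-1) - s * (integral over [1, oo) of (frac t - 1/2) t^(-s-1)). *)
Definition zetaE (s : C) : C := (/ RtoC 2 + / (s - 1) - s * J1 (s + 1))%C.

Lemma zetaE_cdiff (s : C) : s <> 1 -> cdiff zetaE s.
Proof.
intros Hs. assert (Hs' : (s - 1)%C <> 0) by (apply Cminus_neq_0, Hs).
apply cdiff_minus; [apply cdiff_plus; [apply cdiff_const|]|].
- eexists. apply (cder_inv (fun s => s - 1)%C); [apply cder_sub_id|exact Hs'].
- apply cdiff_mult; [apply cdiff_id|]. apply (cdiff_comp J1 (fun s => s + 1)%C); [apply cdiff_plus; [apply cdiff_id|apply cdiff_const]|apply J1_cdiff].
Qed.

(** Euler-Maclaurin at a finite stage. In the induction step [Jterm 0] is computed once directly and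
    once by parts; bq_1 equals 1/2 and -1/2 at the two ends, which produces the halved boundary
    terms. *)
Lemma zeta_partial_sum (s : C) n : s <> 1 ->
  csum (fun k => ypw k s 0) n = (/ RtoC 2 - / RtoC 2 * ypw n s 0 + (1 - ypw n (s - 1) 0) / (s - 1) - s * csum (fun k => Jterm 1 k (s + 1)) n)%C.
Proof.
intros Hs. assert (Hs' : (s - 1)%C <> 0) by (apply Cminus_neq_0, Hs).
induction n as [|n IH].
- simpl. rewrite !ypw_0_0. field. exact Hs'.
- change (csum (fun k => ypw k s 0) (S n)) with (csum (fun k => ypw k s 0) n + ypw n s 0)%C.
  change (csum (fun k => Jterm 1 k (s + 1)) (S n)) with (csum (fun k => Jterm 1 k (s + 1)) n + Jterm 1 n (s + 1))%C. rewrite IH.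
  pose proof (Jterm_parts 0 n s) as P. rewrite !bq_1 in P.
  assert (Q : Jterm 0 n s = ((ypw n (s - 1) 0 - ypw (S n) (s - 1) 0) / (s - 1))%C).
  { assert (E : (CInt (fun t => - (s - 1) * ypw n (s - 1 + 1) t) 0 1 = ypw n (s - 1) 1 - ypw n (s - 1) 0)%C).
    { apply (CInt_FTC (ypw n (s - 1))). intros t Ht. rewrite Rmin_left in Ht by lra. split; [apply rder_ypw; lra|].
      apply ccont_mult; [apply ccont_const|apply ypw_cont; lra]. }
    rewrite CInt_scal in E by (apply cont01, ypw_cont). rewrite ypw_at_1 in E.
    assert (E2 : Jterm 0 n s = CInt (ypw n (s - 1 + 1)) 0 1).
    { unfold Jterm. apply CInt_ext. intros t _. simpl. replace (s - 1 + 1)%C with s by ring. ring. }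
    rewrite E2. transitivity (- (- (s - 1) * CInt (ypw n (s - 1 + 1)) 0 1) / (s - 1))%C; [field; exact Hs'|]. rewrite E. field. exact Hs'. }
  rewrite Q in P.
  assert (P' : (s * Jterm 1 n (s + 1))%C = ((ypw n (s - 1) 0 - ypw (S n) (s - 1) 0) / (s - 1) - (RtoC (1 - / 2) * ypw (S n) s 0 - RtoC (0 - / 2) * ypw n s 0))%C) by (rewrite P; ring).
  replace (RtoC (1 - / 2)) with (/ RtoC 2)%C in P' by (rewrite <- RtoC_inv by lra; f_equal; field).
  replace (RtoC (0 - / 2)) with (- / RtoC 2)%C in P' by (rewrite <- RtoC_inv, <- RtoC_opp by lra; f_equal; field).
  rewrite Cmult_plus_distr_l, P'. field. exact Hs'.
Qed.

Lemma zetaE_series s : 1 < Re s -> cser (fun k => ypw k s 0) (zetaE s).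
Proof.
intros Hs. assert (Hs1 : s <> 1) by (intros ->; simpl in Hs; lra).
assert (Hs' : (s - 1)%C <> 0) by (apply Cminus_neq_0, Hs1).
apply (clim_ext (fun n => / RtoC 2 - / RtoC 2 * ypw n s 0 + / (s - 1) * (1 - ypw n (s - 1) 0) - s * csum (fun k => Jterm 1 k (s + 1)) n)%C).
- intros n. rewrite zeta_partial_sum by exact Hs1. unfold Cdiv. ring.
- replace (zetaE s) with (/ RtoC 2 - / RtoC 2 * 0 + / (s - 1) * (1 - 0) - s * J1 (s + 1))%C by (unfold zetaE; ring).
  apply clim_minus; [apply clim_plus; [apply clim_minus|]|].
  + apply clim_const.
  + apply clim_scal, ypw_to_0. lra.
  + apply clim_scal. apply clim_minus; [apply clim_const|apply ypw_to_0]. unfold Cminus. rewrite re_plus, re_opp. simpl. lra.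
  + apply clim_scal. rewrite (J1_eq 0); [|rewrite Re_plus_1; simpl; lra]. apply (Jf_spec 1). rewrite Re_plus_1. lra.
Qed.

Lemma zeta_exists : is_riemann_zeta zetaE.
Proof.
split.
- intros s Hs. apply C_differentiable_iff, zetaE_cdiff, Hs.
- intros s Hs. apply is_series_cser. apply (clim_ext (csum (fun k => ypw k s 0))); [|apply zetaE_series, Hs].
  intros n. apply csum_ext. intros k _. unfold ypw. rewrite cpow_Cexp, Rplus_0_r. reflexivity.
Qed.

(** * Uniqueness of the continuation of zeta *)

Lemma zeta_spec : is_riemann_zeta zeta.
Proof. unfold zeta. apply epsilon_spec. exists zetaE. exact zeta_exists. Qed.

(** Two applications of the identity theorem. A disc of radius tau about 2 + i e tau avoids 1 and
    has its centre in Re s > 1; it contains a point c straight above or below s whose distance to 1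
    exceeds its distance to s, so the disc about c reaching to 1 contains s. *)
Lemma identity_off_1 (h : C -> C) : (forall s : C, s <> 1 -> cdiff h s) -> (forall s : C, 1 < Re s -> h s = 0) ->
  forall s : C, s <> 1 -> h s = 0.
Proof.
intros Hh H0 s Hs.
(* The sign e puts both centres on the side of the real axis on which s lies. *)
set (e := if Rle_dec 0 (Im s) then 1 else -1).
assert (He : e * Im s = Rabs (Im s) /\ (e = 1 \/ e = -1)).
{ unfold e. destruct (Rle_dec 0 (Im s)); [rewrite Rabs_pos_eq by assumption|rewrite Rabs_left by lra]; split; try ring; auto. }
destruct He as [He1 He2]. assert (Ee : e * e = 1) by (destruct He2 as [-> | ->]; ring).
set (tau := Rabs (Re s - 1) + Rabs (Im s) + 2).
pose proof (Rabs_pos (Re s - 1)) as P1. pose proof (Rabs_pos (Im s)) as P2.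
set (c1 := (2, e * tau) : C). set (c := (Re s, e * tau) : C).
assert (Z1 : forall z, disc c1 tau z -> h z = 0).
{ apply identity_disc.
  - intros z Hz. apply Hh. intros ->. unfold disc in Hz.
    pose proof (im_le_Cmod (1 - c1)) as A. simpl in A. replace (0 + - (e * tau)) with (- (e * tau)) in A by ring. rewrite Rabs_Ropp, Rabs_mult in A.
    assert (Rabs e = 1) by (destruct He2 as [-> | ->]; [apply Rabs_R1|rewrite Rabs_left by lra; ring]). rewrite H, (Rabs_pos_eq tau) in A by (unfold tau; lra). lra.
  - apply locally_C_iff. exists 1. split; [lra|]. intros z Hz. apply H0.
    pose proof (re_le_Cmod (z - c1)) as A. apply Rabs_le_between in A. simpl in A. unfold Re in *. lra. }
assert (Z2 : locally c (fun z => h z = 0)).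
{ assert (Hc : disc c1 tau c).
  { unfold disc. eapply Rle_lt_trans; [apply Cmod_le_Re_Im|]. simpl. replace (e * tau + - (e * tau)) with 0 by ring. rewrite Rabs_R0.
    unfold tau. unfold Rabs at 1. destruct Rcase_abs; unfold Rabs in *; repeat destruct Rcase_abs; lra. }
  generalize (disc_locally c1 tau c Hc). apply filter_imp. exact Z1. }
apply (identity_disc h c (Cmod (1 - c))); [|exact Z2|].
- intros z Hz. apply Hh. intros ->. unfold disc in Hz. lra.
- unfold disc, Cmod. apply sqrt_lt_1_alt. simpl. split.
  + pose proof (pow2_ge_0 (fst s + - Re s)). pose proof (pow2_ge_0 (snd s + - (e * tau))). simpl in *. lra.
  + unfold Re, Im in *.
    assert (Hne : Rabs (fst s - 1) <> 0 \/ Rabs (snd s) <> 0).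
    { destruct (Req_dec (Rabs (fst s - 1)) 0) as [E1|E1]; [|left; exact E1]. right. intro E2. apply Hs.
      apply Rabs_eq_0 in E1. apply Rabs_eq_0 in E2. apply C_ext; simpl; unfold Re, Im; lra. }
    assert (X1 : (fst s - 1) * (fst s - 1) = Rabs (fst s - 1) * Rabs (fst s - 1)) by (rewrite <- Rabs_mult, Rabs_pos_eq; [reflexivity|apply Rle_0_sqr]).
    assert (X2 : snd s * snd s = Rabs (snd s) * Rabs (snd s)) by (rewrite <- Rabs_mult, Rabs_pos_eq; [reflexivity|apply Rle_0_sqr]).
    set (A := Rabs (fst s - 1)) in *. set (B := Rabs (snd s)) in *.
    replace ((fst s + - fst s) * ((fst s + - fst s) * 1) + (snd s + - (e * tau)) * ((snd s + - (e * tau)) * 1))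
     with (snd s * snd s - 2 * tau * (e * snd s) + (e * e) * (tau * tau)) by ring.
    replace ((1 + - fst s) * ((1 + - fst s) * 1) + (0 + - (e * tau)) * ((0 + - (e * tau)) * 1)) with ((fst s - 1) * (fst s - 1) + (e * e) * (tau * tau)) by ring.
    rewrite X1, X2, He1, Ee. assert (tau = A + B + 2) by reflexivity.
    assert (0 < A * A + B * (2 * tau - B)); [|lra].
    assert (Pa : 0 <= A * A) by (apply Rmult_le_pos; assumption).
    destruct Hne as [h1|h1].
    + assert (0 < A * A) by (apply Rmult_lt_0_compat; lra). assert (0 <= B * (2 * tau - B)) by (apply Rmult_le_pos; lra). lra.
    + assert (0 < B * (2 * tau - B)) by (apply Rmult_lt_0_compat; lra). lra.
Qed.

Lemma zeta_eq (s : C) : s <> 1 -> zeta s = zetaE s.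
Proof.
intros Hs. apply Ceq_minus. apply (identity_off_1 (fun s => zeta s - zetaE s)%C); [| |exact Hs].
- intros z Hz. apply cdiff_minus; [apply C_differentiable_iff, (proj1 zeta_spec), Hz|apply zetaE_cdiff, Hz].
- intros z Hz. apply (proj1 (Ceq_minus _ _)).
  pose proof (proj1 (is_series_cser _ _) (proj2 zeta_spec z Hz)) as A. pose proof (proj1 (is_series_cser _ _) (proj2 zeta_exists z Hz)) as B.
  exact (clim_unique _ _ _ A B).
Qed.

(* (s - 1) zeta(s), with the pole at 1 removed. *)
Definition Dz (s : C) : C := (1 + (s - 1) * (/ RtoC 2 - s * J1 (s + 1)))%C.

(** * Growth, lower bounds and symmetry of (s - 1) zeta(s) *)

Lemma Dz_zetaE (s : C) : s <> 1 -> Dz s = ((s - 1) * zetaE s)%C.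
Proof. intros Hs. unfold Dz, zetaE. field. apply Cminus_neq_0, Hs. Qed.

Lemma Dz_cdiff s : cdiff Dz s.
Proof.
apply cdiff_plus; [apply cdiff_const|]. apply cdiff_mult; [apply cdiff_sub_id|]. apply cdiff_minus; [apply cdiff_const|].
apply cdiff_mult; [apply cdiff_id|]. apply (cdiff_comp J1 (fun s => s + 1)%C); [apply cdiff_plus; [apply cdiff_id|apply cdiff_const]|apply J1_cdiff].
Qed.

Lemma Dz_1 : Dz 1 = 1.
Proof. unfold Dz. ring. Qed.

(** In this half-plane [J1 (s + 1)] is an absolutely convergent integral bounded by a constant, so
    the growth is quadratic. The circles of radius 37/20 about 2 + it, on which the bound is used,
    lie inside it. *)
Lemma Dz_upper s : / 20 <= Re s -> Cmod (Dz s) <= 12 * (Cmod s + 1) ^ 2.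
Proof.
intros Hs. unfold Dz.
assert (HJ : Cmod (J1 (s + 1)) <= 21 / 2).
{ rewrite (J1_eq 0); [|rewrite Re_plus_1; simpl; lra].
  eapply Rle_trans; [apply (Jf_bound 1 (s + 1) (/ 2)); [rewrite Re_plus_1; lra|lra|]|].
  - intros t Ht. rewrite bq_1. apply Rabs_le. lra.
  - rewrite Re_plus_1. replace (Re s + 1 - 1) with (Re s) by ring.
    assert (/ Re s <= 20) by (replace 20 with (/ / 20) by field; apply Rinv_le_contravar; lra). lra. }
pose proof (Cmod_ge_0 s) as Ps.
eapply Rle_trans; [apply Cmod_triangle|]. rewrite Cmod_1, Cmod_mult.
assert (A : Cmod (s - 1) <= Cmod s + 1) by (unfold Cminus; eapply Rle_trans; [apply Cmod_triangle|]; rewrite Cmod_opp, Cmod_1; lra).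
assert (B : Cmod (/ RtoC 2 - s * J1 (s + 1)) <= / 2 + Cmod s * (21 / 2)).
{ unfold Cminus. eapply Rle_trans; [apply Cmod_triangle|]. rewrite Cmod_opp, Cmod_mult, <- RtoC_inv, Cmod_R, Rabs_pos_eq by lra.
  apply Rplus_le_compat_l. apply Rmult_le_compat_l; assumption. }
assert (Cmod (s - 1) * Cmod (/ RtoC 2 - s * J1 (s + 1)) <= (Cmod s + 1) * (/ 2 + Cmod s * (21 / 2))) by (apply Rmult_le_compat; try apply Cmod_ge_0; assumption).
nra.
Qed.

(** The terms after the first are at most 1/4 for n = 2 and 1/2 in total for n >= 3, which leaves 1
    - 3/4. *)
Lemma zetaE_lower s : 2 <= Re s -> / 4 <= Cmod (zetaE s).
Proof.
intros Hs. assert (Hz : cser (fun k => ypw k s 0) (zetaE s)) by (apply zetaE_series; lra).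
assert (H1 : Cmod (zetaE s - 1) <= 3 / 4).
{ apply (clim_bound (fun n => csum (fun k => ypw k s 0) (S (S n)) - 1)%C).
  - apply clim_minus; [|apply clim_const]. intros e He. destruct (Hz e He) as [N HN]. exists N. intros n Hn. apply HN. lia.
  - intros n. assert (Hb : forall k, Cmod (ypw k s 0) <= exp (- (1 + 1) * ln (INR (S k)))).
    { intros k. eapply Rle_trans; [apply ypw_bound; lra|]. apply exp_le. pose proof (ln_Sn_le k 0 (Rle_refl 0)). nra. }
    replace (RtoC 1) with (csum (fun k => ypw k s 0) 1) by (simpl; rewrite ypw_0_0; ring).
    eapply Rle_trans; [apply (csum_tail_bound (fun k => ypw k s 0) (fun k => exp (- (1 + 1) * ln (INR (S k)))) 1 (S (S n))); [lia|exact Hb]|].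
    rewrite rsum_shift. simpl (rsum _ 1). rewrite rsum_shift.
    pose proof (pseries_tail 1 1 n Rlt_0_1) as T.
    replace (exp (- (1 + 1) * ln (INR 2))) with (/ 4).
    2:{ replace (- (1 + 1) * ln (INR 2)) with (- (ln (INR 2) + ln (INR 2))) by ring. rewrite exp_Ropp, exp_plus, exp_ln by (apply lt_0_INR; lia). simpl. field. }
    replace (/ 1 * exp (- (1) * ln (INR 2))) with (/ 2) in T.
    2:{ replace (- (1) * ln (INR 2)) with (- ln (INR 2)) by ring. rewrite exp_Ropp, exp_ln by (apply lt_0_INR; lia). simpl. field. }
    change (rsum (fun k => exp (- (1 + 1) * ln (INR (S (S (S k)))))) n) with (rsum (fun k => exp (- (1 + 1) * ln (INR (S (S (1 + k)))))) n).
    change (INR 1) with 1. lra. }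
pose proof (Cmod_le_minus 1 (zetaE s)) as T. rewrite Cmod_1, Cmod_minus_sym in T. lra.
Qed.

Lemma Dz_lower s : 2 <= Re s -> Cmod (s - 1) / 4 <= Cmod (Dz s).
Proof.
intros Hs. rewrite Dz_zetaE by (intros ->; simpl in Hs; lra). rewrite Cmod_mult. pose proof (zetaE_lower s Hs). pose proof (Cmod_ge_0 (s - 1)). nra.
Qed.

Lemma CInt_conj f a b : ccont_on f a b -> CInt (fun t => Cconj (f t)) a b = Cconj (CInt f a b).
Proof.
intros Hf. rewrite (CInt_pair f a b Hf), CInt_pair.
- apply C_ext; simpl; [reflexivity|].
  rewrite <- (RInt_opp (V := R_CompleteNormedModule)); [reflexivity|apply ccont_on_Im, Hf].
- intros t Ht. specialize (Hf t Ht). intros e He. generalize (Hf e He). apply filter_imp. intros y Hy.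
  rewrite <- Cminus_conj, Cmod_conj. exact Hy.
Qed.

Lemma Cexp_conj z : Cexp (Cconj z) = Cconj (Cexp z).
Proof. unfold Cexp. rewrite re_conj, im_conj, cos_neg, sin_neg. apply C_ext; simpl; ring. Qed.

Lemma Cconj_RtoC (x : R) : Cconj (RtoC x) = RtoC x.
Proof. apply C_ext; simpl; ring. Qed.

Lemma clim_conj u l : clim u l -> clim (fun n => Cconj (u n)) (Cconj l).
Proof. intros H e He. destruct (H e He) as [N HN]. exists N. intros n Hn. rewrite <- Cminus_conj, Cmod_conj. apply HN, Hn. Qed.

Lemma csum_conj a n : csum (fun k => Cconj (a k)) n = Cconj (csum a n).
Proof. induction n as [|n IH]; simpl; [symmetry; apply Cconj_RtoC|]. rewrite IH, Cplus_conj. reflexivity. Qed.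

Lemma Jterm_conj m n w : Jterm m n (Cconj w) = Cconj (Jterm m n w).
Proof.
unfold Jterm. rewrite <- CInt_conj by (apply cont01, Jterm_cont). apply CInt_ext. intros t _. unfold ypw.
rewrite Cmult_conj, Cconj_RtoC, <- Cexp_conj, Cmult_conj, Cconj_RtoC, Copp_conj. reflexivity.
Qed.

Lemma Jf_conj m w : 1 < Re w -> Jf m (Cconj w) = Cconj (Jf m w).
Proof.
intros Hw. apply (clim_unique (csum (fun n => Jterm m n (Cconj w)))); [apply Jf_spec; rewrite re_conj; exact Hw|].
apply (clim_ext (fun n => Cconj (csum (fun n => Jterm m n w) n))).
- intros n. rewrite <- csum_conj. apply csum_ext. intros k _. symmetry. apply Jterm_conj.
- apply clim_conj, Jf_spec, Hw.
Qed.

Lemma Dz_conj s : 0 < Re s -> Dz (Cconj s) = Cconj (Dz s).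
Proof.
intros Hs. unfold Dz. rewrite !(J1_eq 0); [|rewrite Re_plus_1; simpl; lra|rewrite Re_plus_1, re_conj; simpl; lra].
simpl Jx. replace (Cconj s + 1)%C with (Cconj (s + 1)) by (rewrite Cplus_conj, Cconj_RtoC; reflexivity).
rewrite Jf_conj by (rewrite Re_plus_1; lra).
rewrite Cplus_conj, Cmult_conj, !Cminus_conj, Cmult_conj, !Cconj_RtoC, <- RtoC_inv, Cconj_RtoC by lra. reflexivity.
Qed.

Lemma zetaE_der_series s : 1 < Re s -> exists l, cder zetaE s l /\ cser (fun n => - RtoC (ln (INR (S n))) * ypw n s 0)%C l.
Proof.
intros Hs. set (del := (Re s - 1) / 4). set (p := (Re s - 1) / 2). assert (Hdel : 0 < del) by (unfold del; lra). assert (Hp : 0 < p) by (unfold p; lra).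
assert (HL : forall n, 0 <= ln (INR (S n))) by (intros n; apply (ln_Sn_le n 0); lra).
destruct (cser_dominated (fun n => - RtoC (ln (INR (S n))) * ypw n s 0)%C (fun n => / del * exp (- (p + 1) * ln (INR (S n)))) (/ del * (1 + / p))) as [l [Hl _]].
- intros n. rewrite Cmod_mult, Cmod_opp, Cmod_R, Rabs_pos_eq by apply HL. unfold ypw. rewrite Cmod_Cexp_opp, Rplus_0_r.
  apply Rle_trans with ((/ del * exp (del * ln (INR (S n)))) * exp (- Re s * ln (INR (S n)))).
  + apply Rmult_le_compat_r; [left; apply exp_pos|apply lin_le_exp; auto].
  + rewrite Rmult_assoc, <- exp_plus. apply Rmult_le_compat_l; [left; apply Rinv_0_lt_compat, Hdel|]. apply exp_le. pose proof (HL n). unfold p, del. nra.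
- intros n. rewrite rsum_scal. apply Rmult_le_compat_l; [left; apply Rinv_0_lt_compat, Hdel|apply pseries_bound, Hp].
- exists l. split; [|exact Hl].
  apply (cser_der (fun n z => ypw n z 0) (fun n => - RtoC (ln (INR (S n))) * ypw n s 0)%C zetaE l s (fun n => (4 / del ^ 2) * exp (- (p + 1) * ln (INR (S n)))) ((4 / del ^ 2) * (1 + / p)) del Hdel).
  + intros v Hv. apply zetaE_series. pose proof (re_le_Cmod (v - s)) as A. apply Rabs_le_between in A.
    unfold Cminus in A. rewrite re_plus, re_opp in A. fold (v - s)%C in A. unfold del in Hv. lra.
  + exact Hl.
  + intros n v Hv. set (h := (v - s)%C) in *. unfold ypw. rewrite Rplus_0_r. replace v with (s + h)%C by (unfold h; ring).
    eapply Rle_trans; [apply (Cexp_power_der_est s h _ del); [apply HL|exact Hdel|lra]|]. right. f_equal. f_equal. f_equal. unfold p, del. field.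
  + intros n. rewrite rsum_scal. apply Rmult_le_compat_l; [left; apply Rdiv_lt_0_compat; [lra|apply pow_lt, Hdel]|apply pseries_bound, Hp].
Qed.

(** * Zeros and logarithmic derivatives in discs *)

Definition sumR {A : Type} (f : A -> R) (l : list A) : R := fold_right (fun a s => f a + s) 0 l.

Section SumR.
Context {A : Type}.
Implicit Types (f g : A -> R) (l : list A).

Lemma sumR_le f g l : (forall a, In a l -> f a <= g a) -> sumR f l <= sumR g l.
Proof. induction l as [|a l IH]; simpl; intros H; [lra|]. apply Rplus_le_compat; [apply H; auto|apply IH; auto]. Qed.
Lemma sumR_const (K : R) l : sumR (fun _ => K) l = INR (length l) * K.
Proof. induction l as [|a l IH]; [simpl; ring|]. simpl length. rewrite S_INR. simpl. rewrite IH. ring. Qed.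
Lemma sumR_scal (K : R) f l : sumR (fun a => K * f a) l = K * sumR f l.
Proof. induction l as [|a l IH]; simpl; [ring|rewrite IH; ring]. Qed.
Lemma sumR_nonneg f l : (forall a, In a l -> 0 <= f a) -> 0 <= sumR f l.
Proof. induction l as [|a l IH]; simpl; intros H; [lra|]. apply Rplus_le_le_0_compat; [apply H; auto|apply IH; auto]. Qed.
Lemma sumR_partition f (p : A -> bool) l : sumR f l = sumR f (filter p l) + sumR f (filter (fun a => negb (p a)) l).
Proof. induction l as [|a l IH]; simpl; [ring|]. rewrite IH. destruct (p a); simpl; ring. Qed.
End SumR.

Definition sumC {A : Type} (f : A -> C) (l : list A) : C := fold_right (fun a s => (f a + s)%C) (RtoC 0) l.

Section SumC.
Context {A : Type}.
Implicit Types (f g : A -> C) (l : list A).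
Lemma sumC_bound f (b : A -> R) l : (forall a, In a l -> Cmod (f a) <= b a) -> Cmod (sumC f l) <= sumR b l.
Proof.
induction l as [|a l IH]; simpl; intros H; [rewrite Cmod_0; lra|].
eapply Rle_trans; [apply Cmod_triangle|]. apply Rplus_le_compat; [apply H; auto|apply IH; auto].
Qed.
Lemma sumC_perm f l l' : Permutation l l' -> sumC f l = sumC f l'.
Proof. intros H. induction H; simpl; [reflexivity|congruence|ring|congruence]. Qed.
Lemma sumC_ext f g l : (forall a, In a l -> f a = g a) -> sumC f l = sumC g l.
Proof. induction l as [|a l IH]; simpl; intros H; [reflexivity|]. rewrite H, IH; auto. Qed.
Lemma sumC_partition f (p : A -> bool) l : sumC f l = (sumC f (filter p l) + sumC f (filter (fun a => negb (p a)) l))%C.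
Proof. induction l as [|a l IH]; simpl; [ring|]. rewrite IH. destruct (p a); simpl; ring. Qed.
Lemma sumC_conj f l : sumC (fun a => Cconj (f a)) l = Cconj (sumC f l).
Proof. induction l as [|a l IH]; simpl; [symmetry; apply Cconj_RtoC|]. rewrite IH, Cplus_conj. reflexivity. Qed.
Lemma sumC_scal k f l : sumC (fun a => k * f a)%C l = (k * sumC f l)%C.
Proof. induction l as [|a l IH]; simpl; [ring|rewrite IH; ring]. Qed.
Lemma sumC_plus f g l : sumC (fun a => f a + g a)%C l = (sumC f l + sumC g l)%C.
Proof. induction l as [|a l IH]; simpl; [ring|rewrite IH; ring]. Qed.
Lemma sumC_filter_if f (p : A -> bool) l : sumC (fun a => if p a then f a else RtoC 0) l = sumC f (filter p l).
Proof. induction l as [|a l IH]; simpl; [reflexivity|]. rewrite IH. destruct (p a); simpl; ring. Qed.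
End SumC.

Lemma sumC_map {A B} (h : A -> B) (f : B -> C) l : sumC f (map h l) = sumC (fun a => f (h a)) l.
Proof. induction l as [|a l IH]; simpl; [reflexivity|rewrite IH; reflexivity]. Qed.

Definition lprod (h : C -> C -> C) (l : list C) (z : C) : C := fold_right (fun a p => (h a z * p)%C) (RtoC 1) l.

Lemma lprod_neq_0 (h : C -> C -> C) l z : (forall a, In a l -> h a z <> 0) -> lprod h l z <> 0.
Proof.
induction l as [|a l IH]; simpl; intros H; [apply C1_nz|]. apply Cmult_neq_0; [apply H; auto|apply IH; auto].
Qed.

Lemma lprod_cder (h : C -> C -> C) (h' : C -> C) l z : (forall a, In a l -> cder (h a) z (h' a) /\ h a z <> 0) ->
  cder (lprod h l) z (lprod h l z * sumC (fun a => h' a / h a z) l)%C.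
Proof.
induction l as [|a l IH]; intros H.
- apply (cder_eq _ _ 0%C); [simpl; ring|apply cder_const].
- destruct (H a (or_introl eq_refl)) as [D N].
  eapply cder_eq; [|apply (cder_mult (h a) (lprod h l)); [exact D|apply IH; intros; apply H; right; assumption]].
  simpl. field. exact N.
Qed.

Lemma lprod_cdiff h l z : (forall a, In a l -> cdiff (h a) z) -> cdiff (lprod h l) z.
Proof.
induction l as [|a l IH]; intros H; [apply cdiff_const|].
apply (cdiff_mult (h a) (lprod h l)); [apply H; left; reflexivity|apply IH; intros; apply H; right; assumption].
Qed.

Lemma lprod_Cmod_le h l z K : 0 <= K -> (forall a, In a l -> Cmod (h a z) <= K) -> Cmod (lprod h l z) <= K ^ length l.
Proof.
intros HK. induction l as [|a l IH]; simpl; intros H; [rewrite Cmod_1; lra|]. rewrite Cmod_mult.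
apply Rmult_le_compat; try apply Cmod_ge_0; [apply H; auto|apply IH; auto].
Qed.

Lemma lprod_Cmod_ext h k l z : (forall a, In a l -> Cmod (h a z) = Cmod (k a z)) -> Cmod (lprod h l z) = Cmod (lprod k l z).
Proof.
induction l as [|a l IH]; simpl; intros H; [reflexivity|]. rewrite !Cmod_mult, IH, H; auto.
Qed.

Definition lin (a z : C) : C := (z - a)%C.

(* Conjugate Blaschke factor: it has the same modulus as [z - a] on |z - c| = R. *)
Definition refl (c : C) (R : R) (a z : C) : C := (RtoC R - Cconj (a - c) * (z - c) / RtoC R)%C.

Lemma refl_Cmod c R a z : 0 < R -> Cmod (z - c) = R -> Cmod (refl c R a z) = Cmod (lin a z).
Proof.
intros HR Hz. set (u := (z - c)%C) in *. set (b := (a - c)%C).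
assert (HR0 : RtoC R <> 0) by (apply RtoC_neq_0; lra).
assert (E : refl c R a z = (u * Cconj (u - b) / RtoC R)%C).
{ unfold refl. fold u b. rewrite Cminus_conj.
  assert (EE : (u * Cconj u)%C = (RtoC R * RtoC R)%C) by (rewrite <- Cmod2_conj, Hz, <- RtoC_mult; f_equal; simpl; ring).
  transitivity ((RtoC R * RtoC R - Cconj b * u) / RtoC R)%C; [field; exact HR0|]. rewrite <- EE. field. exact HR0. }
rewrite E, Cmod_div, Cmod_mult, Cmod_conj, Cmod_R, Rabs_pos_eq, Hz by (try lra; exact HR0).
unfold lin. replace (z - a)%C with (u - b)%C by (unfold u, b; ring). field. lra.
Qed.

Lemma refl_lower c R a z r1 : 0 < R -> 0 <= r1 < R -> Cmod (a - c) <= r1 -> Cmod (z - c) <= R -> R - r1 <= Cmod (refl c R a z).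
Proof.
intros HR Hr Ha Hz. unfold refl.
assert (HR0 : RtoC R <> 0) by (apply RtoC_neq_0; lra).
assert (B : Cmod (Cconj (a - c) * (z - c) / RtoC R) <= r1).
{ rewrite Cmod_div, Cmod_mult, Cmod_conj, Cmod_R, Rabs_pos_eq by (try lra; exact HR0). apply Rle_div_l; [lra|].
  apply Rmult_le_compat; try apply Cmod_ge_0; assumption. }
pose proof (Cmod_le_minus (RtoC R) (RtoC R - Cconj (a - c) * (z - c) / RtoC R)) as T.
rewrite Cmod_R, Rabs_pos_eq in T by lra.
replace (RtoC R - (RtoC R - Cconj (a - c) * (z - c) / RtoC R))%C with (Cconj (a - c) * (z - c) / RtoC R)%C in T by ring. lra.
Qed.

Lemma refl_cder c R a z : R <> 0 -> cder (refl c R a) z (- (Cconj (a - c) / RtoC R)).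
Proof.
intros HR. unfold refl.
apply (cder_ext_loc (fun z => RtoC R - (Cconj (a - c) / RtoC R) * (z - c))%C).
- apply filter_forall. intros w. field. apply RtoC_neq_0, HR.
- eapply cder_eq; [|apply cder_minus; [apply cder_const|apply cder_scal, cder_sub_id]]. ring.
Qed.

Section LocalFactor.
Variables (f g : C -> C) (l : list C) (c : C) (R0 Rb r1 M : R).
Hypothesis HR : 0 < r1 < Rb /\ Rb < R0.
Hypothesis Hg : holo (disc c R0) g.
Hypothesis Hfg : forall z, disc c R0 z -> f z = (lprod lin l z * g z)%C.
Hypothesis Hl : forall a, In a l -> Cmod (a - c) <= r1.
Hypothesis HM : forall t, 0 <= t <= 2 * PI -> Cmod (f (cpt c Rb t)) <= M.
Hypothesis Hfc : f c <> 0.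

(** Each zero a is replaced by its reflected factor [refl]: on |z - c| = Rb the modulus is still
    that of f, and inside the circle no zeros are introduced. *)
Let gs (z : C) : C := (g z * lprod (refl c Rb) l z)%C.

Let HM0 : 0 <= M.
Proof. pose proof PI_RGT_0. pose proof (HM 0 ltac:(lra)). pose proof (Cmod_ge_0 (f (cpt c Rb 0))). lra. Qed.

Let refl_nz a z : In a l -> Cmod (z - c) <= Rb -> refl c Rb a z <> 0.
Proof. intros Ha Hz. apply Cmod_gt_0. pose proof (refl_lower c Rb a z r1 ltac:(lra) ltac:(lra) (Hl a Ha) Hz). lra. Qed.

Let gs_holo : holo (disc c R0) gs.
Proof.
intros z Hz. apply cdiff_mult; [apply Hg, Hz|]. apply lprod_cdiff. intros a _. eexists. apply refl_cder. lra.
Qed.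

Let gs_bound z : Cmod (z - c) < Rb -> Cmod (gs z) <= M.
Proof.
apply (max_modulus_cpt gs c R0 Rb); [exact gs_holo|lra|exact HM0|].
intros t Ht. eapply Rle_trans; [|apply (HM t Ht)]. right.
assert (Hc : Cmod (cpt c Rb t - c) = Rb) by (apply Cmod_cpt; lra).
rewrite Hfg by (unfold disc; lra). unfold gs. rewrite !Cmod_mult, Rmult_comm. f_equal.
apply lprod_Cmod_ext. intros a _. apply refl_Cmod; [lra|exact Hc].
Qed.

Let fc_pos : 0 < Cmod (f c).
Proof. apply Cmod_gt_0, Hfc. Qed.

Let gs_center : Cmod (f c) * (Rb / r1) ^ length l <= Cmod (gs c).
Proof.
assert (Hd : disc c R0 c) by (unfold disc; rewrite Cmod_0_minus; lra).
rewrite Hfg by exact Hd. unfold gs. rewrite !Cmod_mult.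
assert (E : lprod (refl c Rb) l c = RtoC (Rb ^ length l)).
{ clear. induction l as [|a l' IH]; [reflexivity|]. simpl. rewrite IH. unfold refl at 1.
  rewrite RtoC_mult. f_equal. unfold Cdiv. ring. }
rewrite E, Cmod_R, Rabs_pos_eq by (apply pow_le; lra).
assert (B : Cmod (lprod lin l c) <= r1 ^ length l).
{ apply lprod_Cmod_le; [lra|]. intros a Ha. unfold lin. rewrite Cmod_minus_sym. apply Hl, Ha. }
unfold Rdiv. rewrite Rpow_mult_distr, pow_inv.
assert (0 < r1 ^ length l) by (apply pow_lt; lra). assert (0 < Rb ^ length l) by (apply pow_lt; lra).
replace (Cmod (lprod lin l c) * Cmod (g c) * (Rb ^ length l * / r1 ^ length l)) with (Cmod (g c) * Rb ^ length l * (Cmod (lprod lin l c) * / r1 ^ length l)) by ring.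
rewrite <- (Rmult_1_r (Cmod (g c) * Rb ^ length l)) at 2. apply Rmult_le_compat_l; [apply Rmult_le_pos; [apply Cmod_ge_0|lra]|].
apply Rle_div_l; lra.
Qed.

(** Jensen's inequality through the maximum principle for [gs]: at the centre every reflected factor
    equals Rb, whereas |c - a| <= r1, so each zero gains a factor Rb / r1. *)
Lemma jensen_pow : Cmod (f c) * (Rb / r1) ^ length l <= M.
Proof. eapply Rle_trans; [apply gs_center|]. apply gs_bound. rewrite Cmod_0_minus. lra. Qed.

Lemma ln_ratio_pos : 0 < ln (Rb / r1).
Proof. rewrite <- ln_1. apply ln_increasing; [lra|]. apply Rlt_div_r; lra. Qed.

Lemma jensen_count : INR (length l) * ln (Rb / r1) <= ln (M / Cmod (f c)).
Proof.
assert (Hq : 0 < Rb / r1) by (apply Rdiv_lt_0_compat; lra).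
rewrite <- ln_pow by exact Hq. apply ln_le; [apply pow_lt, Hq|]. apply Rle_div_r; [exact fc_pos|]. rewrite Rmult_comm. exact jensen_pow.
Qed.

Hypothesis Hgnz : forall z, Cmod (z - c) < r1 -> g z <> 0.
Variable r2 : R.
Hypothesis Hr2 : 0 <= r2 < r1.
Hypothesis HMe : exp 1 * Cmod (f c) <= M.

(** Borel-Caratheodory bounds the logarithm of gs / gs(c), whose real part is at most log (M /
    |f(c)|), and a Cauchy estimate then bounds gs'/gs. The reflected factors are removed at the end:
    each contributes at most r1 / (Rb (Rb - r1)), and Jensen bounds their number. *)
Lemma logder_remainder z : Cmod (z - c) <= r2 ->
  Cmod (dC g z / g z) <= (36 * r1 / (r1 - r2) ^ 2 + r1 / (Rb * (Rb - r1)) / ln (Rb / r1)) * ln (M / Cmod (f c)).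
Proof.
intros Hz. set (A := ln (M / Cmod (f c))).
assert (HA : 1 <= A).
{ unfold A. rewrite <- (ln_exp 1). apply ln_le; [apply exp_pos|]. apply Rle_div_r; [exact fc_pos|exact HMe]. }
(* The radii r2 < r2 + d < r2 + 2d < r1 leave one step of d for the derivative, one for
   Borel-Caratheodory and one to stay inside the disc where L exists. *)
set (d := (r1 - r2) / 3). assert (Hd : 0 < d) by (unfold d; lra).
assert (Hsub : forall w, disc c r1 w -> disc c R0 w) by (unfold disc; intros; lra).
assert (Hgsnz : forall w, disc c r1 w -> gs w <> 0).
{ intros w Hw. unfold disc in Hw. apply Cmult_neq_0; [apply Hgnz, Hw|]. apply lprod_neq_0. intros a Ha. apply refl_nz; [exact Ha|lra]. }
destruct (log_exists gs c r1) as [L [HL0 HL]]; [lra|intros w Hw; apply gs_holo, Hsub, Hw|exact Hgsnz|].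
assert (Hgsc : Cmod (f c) <= Cmod (gs c)).
{ eapply Rle_trans; [|apply gs_center]. rewrite <- (Rmult_1_r (Cmod (f c))) at 1. apply Rmult_le_compat_l; [lra|].
  apply pow_R1_Rle. apply Rle_div_r; lra. }
assert (HRe : forall w, disc c r1 w -> Re (L w) <= A).
{ intros w Hw. destruct (HL w Hw) as [_ E]. apply (f_equal Cmod) in E. rewrite Cmod_mult, Cmod_Cexp in E.
  assert (B : Cmod (gs w) <= M) by (apply gs_bound; unfold disc in Hw; lra).
  rewrite <- (ln_exp (Re (L w))). apply ln_le; [apply exp_pos|]. apply Rle_div_r; [exact fc_pos|].
  eapply Rle_trans; [|exact B]. rewrite E, Rmult_comm. apply Rmult_le_compat_r; [left; apply exp_pos|exact Hgsc]. }
assert (HLh : holo (disc c r1) L) by (intros w Hw; eexists; apply (HL w Hw)).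
assert (HLb : forall w, Cmod (w - c) <= r2 + d -> Cmod (L w) <= 2 * A * (r2 + d) / d).
{ intros w Hw. replace d with ((r2 + 2 * d) - (r2 + d)) at 2 by ring.
  apply (borel_caratheodory L c r1 A (r2 + 2 * d) (r2 + d)); try assumption; unfold d in *; try lra. }
assert (HdL : Cmod (dC L z) <= 2 * (2 * A * (r2 + d) / d) / d).
{ apply (dC_bound L c r1 d); [exact HLh|exact Hd|unfold d; lra| |].
  - apply Rdiv_le_0_compat; [|exact Hd]. apply Rmult_le_pos; lra.
  - intros w Hw. apply HLb. pose proof (Cmod_triangle_minus w z c). lra. }
assert (Hz1 : disc c r1 z) by (unfold disc; lra).
destruct (HL z Hz1) as [Ld _]. rewrite (dC_eq _ _ _ Ld) in HdL.
assert (Hlp : lprod (refl c Rb) l z <> 0) by (apply lprod_neq_0; intros a Ha; apply refl_nz; [exact Ha|lra]).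
assert (Hgz : g z <> 0) by (apply Hgnz; exact Hz1).
assert (Egs : dC gs z = (dC g z * lprod (refl c Rb) l z + g z * (lprod (refl c Rb) l z * sumC (fun a => - (Cconj (a - c) / RtoC Rb) / refl c Rb a z) l))%C).
{ apply dC_eq. apply (cder_mult g (lprod (refl c Rb) l)); [apply dC_cder, Hg, Hsub, Hz1|].
  apply (lprod_cder (refl c Rb)). intros a Ha. split; [apply refl_cder; lra|apply refl_nz; [exact Ha|lra]]. }
set (S := sumC (fun a => - (Cconj (a - c) / RtoC Rb) / refl c Rb a z)%C l) in *.
assert (E : (dC g z / g z)%C = (dC gs z / gs z - S)%C).
{ rewrite Egs. unfold gs. field. split; assumption. }
assert (HS : Cmod S <= INR (length l) * (r1 / (Rb * (Rb - r1)))).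
{ rewrite <- sumR_const. apply sumC_bound. intros a Ha.
  pose proof (refl_lower c Rb a z r1 ltac:(lra) ltac:(lra) (Hl a Ha) ltac:(lra)) as Lo.
  rewrite Cmod_div by (apply refl_nz; [exact Ha|lra]). rewrite Cmod_opp, Cmod_div, Cmod_conj, Cmod_R, Rabs_pos_eq by (try lra; apply RtoC_neq_0; lra).
  unfold Rdiv. rewrite Rinv_mult, <- Rmult_assoc. apply Rmult_le_compat.
  - apply Rmult_le_pos; [apply Cmod_ge_0|left; apply Rinv_0_lt_compat; lra].
  - left; apply Rinv_0_lt_compat; lra.
  - apply Rmult_le_compat_r; [left; apply Rinv_0_lt_compat; lra|apply Hl, Ha].
  - apply Rinv_le_contravar; lra. }
assert (HS2 : Cmod S <= r1 / (Rb * (Rb - r1)) / ln (Rb / r1) * A).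
{ eapply Rle_trans; [exact HS|]. pose proof jensen_count as J. fold A in J. pose proof ln_ratio_pos as P.
  assert (0 < r1 / (Rb * (Rb - r1))) by (apply Rdiv_lt_0_compat; [lra|apply Rmult_lt_0_compat; lra]).
  replace (r1 / (Rb * (Rb - r1)) / ln (Rb / r1) * A) with (A / ln (Rb / r1) * (r1 / (Rb * (Rb - r1)))) by (unfold Rdiv; ring).
  apply Rmult_le_compat_r; [lra|]. apply Rle_div_r; assumption. }
rewrite E. unfold Cminus. eapply Rle_trans; [apply Cmod_triangle|]. rewrite Cmod_opp.
rewrite Rmult_plus_distr_r. apply Rplus_le_compat; [|exact HS2].
eapply Rle_trans; [exact HdL|].
replace (36 * r1 / (r1 - r2) ^ 2 * A) with (2 * (2 * A * r1 / d) / d) by (unfold d; field; lra).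
unfold Rdiv. repeat apply Rmult_le_compat_r; try (left; apply Rinv_0_lt_compat; exact Hd).
apply Rmult_le_compat_l; [lra|]. apply Rmult_le_compat_r; [left; apply Rinv_0_lt_compat; exact Hd|].
apply Rmult_le_compat_l; [lra|unfold d; lra].
Qed.
End LocalFactor.

(** If dividing out zeros never stopped, there would be factorisations with arbitrarily many zeros
    in |z - c| <= r, contradicting [jensen_pow]. Finiteness is thus obtained with multiplicities. *)
Lemma factor_zeros f c R0 r : holo (disc c R0) f -> f c <> 0 -> 0 < r < R0 ->
  exists l g, (forall a, In a l -> Cmod (a - c) <= r /\ f a = 0) /\ holo (disc c R0) g /\
    (forall z, f z = (lprod lin l z * g z)%C) /\ (forall z, Cmod (z - c) <= r -> g z <> 0).
Proof.
intros Hf Hfc Hr. apply NNPP. intros Hno.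
assert (P : forall n, exists l g, length l = n /\ (forall a, In a l -> Cmod (a - c) <= r /\ f a = 0) /\ holo (disc c R0) g /\
    (forall z, f z = (lprod lin l z * g z)%C)).
{ induction n as [|n IH].
  - exists nil, f. split; [reflexivity|]. split; [intros a []|]. split; [exact Hf|]. intros z. simpl. ring.
  - destruct IH as [l [g [Hn [Hl [Hg E]]]]].
    assert (Hz : exists z, Cmod (z - c) <= r /\ g z = 0).
    { apply NNPP. intros H. apply Hno. exists l, g. split; [exact Hl|]. split; [exact Hg|]. split; [exact E|]. intros z Hz E0. apply H. exists z. tauto. }
    destruct Hz as [p [Hp E0]]. destruct (divide_root c R0 g p Hg) as [g' [Hg' E']]; [unfold disc; lra|exact E0|].
    exists (p :: l), g'. split; [simpl; rewrite Hn; reflexivity|]. split.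
    + intros a [<-|Ha]; [|apply Hl, Ha]. split; [exact Hp|]. rewrite E, E0. ring.
    + split; [exact Hg'|]. intros z. rewrite E, E'. simpl. unfold lin at 2. ring. }
set (R := (r + R0) / 2).
destruct (cont_bounded (fun t => f (cpt c R t)) 0 (2 * PI)) as [M [HM0 HM]]; [pose proof PI_RGT_0; lra| |].
{ intros t _. apply (ccont_comp (cpt c R) f); [apply ccont_cpt|]. apply cdiff_ccont, Hf, cpt_in_disc. unfold R. lra. }
assert (Hq : 1 < R / r) by (apply Rlt_div_r; unfold R; lra).
assert (Hfp : 0 < Cmod (f c)) by (apply Cmod_gt_0, Hfc).
destruct (Pow_x_infinity (R / r) ltac:(rewrite Rabs_pos_eq; lra) (M / Cmod (f c) + 1)) as [N HN].
destruct (P N) as [l [g [Hn [Hl [Hg E]]]]].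
pose proof (jensen_pow f g l c R0 R r M ltac:(unfold R; lra) Hg (fun z _ => E z) (fun a Ha => proj1 (Hl a Ha)) HM) as J.
rewrite Hn in J. pose proof (HN N (Nat.le_refl _)) as A. rewrite Rabs_pos_eq in A by (apply pow_le; lra).
assert (B : (R / r) ^ N <= M / Cmod (f c)) by (apply Rle_div_r; [exact Hfp|lra]). lra.
Qed.

Lemma lprod_partition (h : C -> C -> C) (p : C -> bool) l z :
  lprod h l z = (lprod h (filter p l) z * lprod h (filter (fun a => negb (p a)) l) z)%C.
Proof.
induction l as [|a l IH]; simpl; [ring|]. rewrite IH. destruct (p a); simpl; ring.
Qed.

Definition in_box (H : R) (z : C) : Prop := / 10 <= Re z <= 4 /\ Rabs (Im z) <= H.

(** L may list zeros outside the box too; what matters is that G has no zeros in the box, so that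
    there the multiplicity of a point in L is its order of vanishing. *)
Definition zero_factor (H : R) (L : list C) (G : C -> C) : Prop :=
  (forall a, In a L -> Dz a = 0 /\ 0 < Re a) /\
  (forall z, Dz z = (lprod lin L z * G z)%C) /\
  (forall z, in_box H z -> cdiff G z /\ G z <> 0).

Lemma zero_factor_exists H : 0 <= H -> exists L G, zero_factor H L G.
Proof.
(* A disc with a far centre on the real axis looks flat near its left end: with A of order H^2 the
   disc of radius A - 1/50 contains the whole box, while the radius A - 1/100 stays in Re s > 0. *)
intros HH. set (A := 10 * H ^ 2 + 10). assert (HA : 10 <= A) by (unfold A; nra).
set (c := RtoC A).
assert (Hc : Dz c <> 0).
{ apply Cmod_gt_0. eapply Rlt_le_trans; [|apply Dz_lower; simpl; lra]. unfold c. rewrite <- RtoC_minus, Cmod_R, Rabs_pos_eq; lra. }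
destruct (factor_zeros Dz c (A - / 100) (A - / 50)) as [L [G [HL [HG [E Hnz]]]]]; [intros z _; apply Dz_cdiff|exact Hc|lra|].
assert (Hbox : forall z, in_box H z -> Cmod (z - c) <= A - / 50).
{ intros z [[Hz1 Hz2] Hz3]. unfold Cmod. rewrite <- (sqrt_pow2 (A - / 50)) by lra. apply sqrt_le_1_alt.
  assert (Hy : Im z ^ 2 <= H ^ 2) by (rewrite <- (pow2_abs (Im z)); apply pow_incr; split; [apply Rabs_pos|exact Hz3]).
  simpl. unfold Re, Im in *. replace (snd z + - 0) with (snd z) by ring. simpl in Hy. unfold A in *. nra. }
exists L, G. split; [|split; [exact E|]].
- intros a Ha. destruct (HL a Ha) as [H1 H2]. split; [exact H2|].
  pose proof (re_le_Cmod (a - c)) as B. apply Rabs_le_between in B. simpl in B. unfold Re. lra.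
- intros z Hz. split; [apply HG; unfold disc; pose proof (Hbox z Hz); lra|apply Hnz, Hbox, Hz].
Qed.

Definition near_zeros (t : R) (L : list C) : list C :=
  filter (fun a => if Rle_dec (Cmod (a - (2, t))) (9 / 5) then true else false) L.

Lemma near_zeros_In t L a : In a (near_zeros t L) <-> In a L /\ Cmod (a - (2, t)) <= 9 / 5.
Proof.
unfold near_zeros. rewrite filter_In. destruct (Rle_dec (Cmod (a - (2, t))) (9 / 5)); intuition; discriminate.
Qed.

Lemma exp_1_lt_3 : exp 1 <= 3.
Proof. apply exp_le_3. Qed.

Lemma ln_pow_bound t : ln (144 * (Rabs t + 5) ^ 2) <= 6 * ln (Rabs t + 5).
Proof.
pose proof (Rabs_pos t). replace (6 * ln (Rabs t + 5)) with (INR 6 * ln (Rabs t + 5)) by (simpl; ring). rewrite <- ln_pow by lra.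
set (x := Rabs t + 5) in *. assert (Hx : 5 <= x) by (unfold x; lra).
apply ln_le; [apply Rmult_lt_0_compat; [lra|apply pow_lt; lra]|].
replace (x ^ 6) with (x ^ 4 * x ^ 2) by ring. apply Rmult_le_compat_r; [apply pow_le; lra|].
apply Rle_trans with (5 ^ 4); [lra|]. apply pow_incr. lra.
Qed.

(* Bounds both the number of zeros within 9/5 of 2 + it and the remainder of the partial fraction of the logarithmic derivative there; see [local_zeros]. *)
Definition Kloc : R := 6 * (/ ln ((37 / 20) / (9 / 5)) + (36 * (9 / 5) / (9 / 5 - 7 / 4) ^ 2 + 9 / 5 / ((37 / 20) * (37 / 20 - 9 / 5)) / ln ((37 / 20) / (9 / 5)))).

Lemma Kloc_facts : 0 < ln ((37 / 20) / (9 / 5)) /\ 0 < Kloc.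
Proof.
assert (P : 0 < ln ((37 / 20) / (9 / 5))) by (apply (ln_ratio_pos 2 (37 / 20) (9 / 5)); lra).
split; [exact P|]. unfold Kloc. set (i := ln (37 / 20 / (9 / 5))) in *.
assert (0 < / i) by (apply Rinv_0_lt_compat, P).
assert (0 < 9 / 5 / (37 / 20 * (37 / 20 - 9 / 5)) / i) by (apply Rdiv_lt_0_compat; [lra|exact P]).
assert (0 < 36 * (9 / 5) / (9 / 5 - 7 / 4) ^ 2) by (apply Rdiv_lt_0_compat; [lra|apply pow_lt; lra]).
lra.
Qed.

(** The general estimates around 2 + it with radii 7/4 < 9/5 < 37/20 < 19/10: the first reaches the
    contour edge Re s = 1/4, the second encloses the zeros that are split off, the third is the
    circle carrying the growth bound, and the last disc remains in Re s > 1/10. *)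
Lemma local_zeros H L G t : zero_factor H L G -> Rabs t + 2 <= H ->
  INR (length (near_zeros t L)) <= Kloc * ln (Rabs t + 5) /\
  forall z : C, Cmod (z - (2, t)) <= 7 / 4 -> (forall a : C, In a L -> z <> a) ->
    Cmod (dC Dz z / Dz z - sumC (fun a => / (z - a))%C (near_zeros t L)) <= Kloc * ln (Rabs t + 5).
Proof.
intros [HL [E HG]] Ht. set (c := (2, t) : C).
set (far := filter (fun a => negb (if Rle_dec (Cmod (a - (2, t))) (9 / 5) then true else false)) L).
set (g := fun z => (lprod lin far z * G z)%C).
assert (Hfar : forall a, In a far -> In a L /\ 9 / 5 < Cmod (a - c)).
{ intros a Ha. unfold far in Ha. rewrite filter_In in Ha. destruct Ha as [H1 H2]. split; [exact H1|].
  fold c in H2. destruct (Rle_dec (Cmod (a - c)) (9 / 5)); [discriminate|lra]. }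
assert (Hbox : forall z, disc c (19 / 10) z -> in_box H z).
{ intros z Hz. unfold disc in Hz. pose proof (re_le_Cmod (z - c)) as B1. pose proof (im_le_Cmod (z - c)) as B2.
  apply Rabs_le_between in B1. simpl in B1, B2. split; [unfold Re; lra|].
  pose proof (Rabs_triang (snd z + - t) t) as T. replace (snd z + - t + t) with (Im z) in T by (unfold Im; ring). lra. }
assert (Hg : holo (disc c (19 / 10)) g).
{ intros z Hz. apply cdiff_mult; [apply lprod_cdiff; intros; apply cdiff_sub_id|apply HG, Hbox, Hz]. }
assert (Efg : forall z, Dz z = (lprod lin (near_zeros t L) z * g z)%C).
{ intros z. rewrite E, (lprod_partition lin (fun a => if Rle_dec (Cmod (a - (2, t))) (9 / 5) then true else false) L z). unfold g, far, near_zeros. ring. }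
assert (Hgnz : forall z, Cmod (z - c) < 9 / 5 -> g z <> 0).
{ intros z Hz. apply Cmult_neq_0; [|apply HG, Hbox; unfold disc; lra]. apply lprod_neq_0. intros a Ha E0.
  destruct (Hfar a Ha) as [_ H2]. unfold lin in E0. apply Ceq_minus in E0. subst a. lra. }
assert (Hnear : forall a, In a (near_zeros t L) -> Cmod (a - c) <= 9 / 5) by (intros a Ha; apply near_zeros_In in Ha; tauto).
set (M := 36 * (Rabs t + 5) ^ 2). pose proof (Rabs_pos t) as Pt.
assert (HM : forall u, 0 <= u <= 2 * PI -> Cmod (Dz (cpt c (37 / 20) u)) <= M).
{ intros u _. set (s := cpt c (37 / 20) u). assert (Hs : Cmod (s - c) = 37 / 20) by (apply Cmod_cpt; lra).
  pose proof (re_le_Cmod (s - c)) as B1. rewrite Hs in B1. apply Rabs_le_between in B1. change (Re (s - c)) with (Re s + - (2)) in B1.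
  eapply Rle_trans; [apply Dz_upper; lra|]. unfold M.
  assert (Cmod s <= Rabs t + 4).
  { pose proof (Cmod_le_minus s c). pose proof (Cmod_le_Re_Im c). simpl in H1. rewrite (Rabs_pos_eq 2) in H1 by lra. lra. }
  pose proof (Cmod_ge_0 s). assert ((Cmod s + 1) ^ 2 <= (Rabs t + 5) ^ 2) by (apply pow_incr; lra). nra. }
assert (Hlow : / 4 <= Cmod (Dz c)).
{ eapply Rle_trans; [|apply Dz_lower; simpl; lra]. pose proof (re_le_Cmod (c - 1)) as B. simpl in B. replace (2 + - (1)) with 1 in B by ring. rewrite Rabs_R1 in B. lra. }
assert (Hfc : Dz c <> 0) by (apply Cmod_gt_0; lra).
assert (HMe : exp 1 * Cmod (Dz c) <= M).
{ assert (Cmod (Dz c) <= 12 * (Rabs t + 5) ^ 2).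
  { eapply Rle_trans; [apply Dz_upper; simpl; lra|]. pose proof (Cmod_le_Re_Im c) as B. simpl in B. rewrite (Rabs_pos_eq 2) in B by lra.
    pose proof (Cmod_ge_0 c). assert ((Cmod c + 1) ^ 2 <= (Rabs t + 5) ^ 2) by (apply pow_incr; lra). lra. }
  unfold M. pose proof exp_1_lt_3. pose proof (exp_pos 1). pose proof (Cmod_ge_0 (Dz c)). nra. }
assert (HA : ln (M / Cmod (Dz c)) <= 6 * ln (Rabs t + 5)).
{ eapply Rle_trans; [|apply ln_pow_bound]. apply ln_le.
  - apply Rdiv_lt_0_compat; [unfold M; apply Rmult_lt_0_compat; [lra|apply pow_lt; lra]|lra].
  - apply Rle_div_l; [lra|]. unfold M. assert (0 <= (Rabs t + 5) ^ 2) by (apply pow_le; lra). nra. }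
assert (HA0 : 0 <= ln (Rabs t + 5)) by (rewrite <- ln_1; apply ln_le; lra).
pose proof (jensen_count Dz g (near_zeros t L) c (19 / 10) (37 / 20) (9 / 5) M ltac:(lra) Hg (fun z _ => Efg z) Hnear HM Hfc) as J.
pose proof (logder_remainder Dz g (near_zeros t L) c (19 / 10) (37 / 20) (9 / 5) M ltac:(lra) Hg (fun z _ => Efg z) Hnear HM Hfc Hgnz (7 / 4) ltac:(lra) HMe) as LR.
destruct Kloc_facts as [K1 _]. unfold Kloc.
set (i := ln (37 / 20 / (9 / 5))) in *. set (B := 36 * (9 / 5) / (9 / 5 - 7 / 4) ^ 2 + 9 / 5 / (37 / 20 * (37 / 20 - 9 / 5)) / i) in *.
assert (HB : 0 <= B).
{ unfold B. assert (0 < 9 / 5 / (37 / 20 * (37 / 20 - 9 / 5)) / i) by (apply Rdiv_lt_0_compat; [lra|exact K1]). lra. }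
assert (Hi : 0 < / i) by (apply Rinv_0_lt_compat, K1).
split.
- apply Rle_trans with (6 * ln (Rabs t + 5) / i).
  + apply Rle_div_r; [exact K1|]. lra.
  + unfold Rdiv. nra.
- intros z Hz Hza.
  assert (Hn : forall a, In a (near_zeros t L) -> cder (lin a) z 1 /\ lin a z <> 0).
  { intros a Ha. split; [apply cder_sub_id|]. apply Cminus_neq_0, Hza. apply near_zeros_In in Ha. tauto. }
  assert (Hzd : disc c (19 / 10) z) by (unfold disc; fold c in Hz; lra).
  assert (Hgz : g z <> 0) by (apply Hgnz; fold c in Hz; lra).
  assert (Ep : lprod lin (near_zeros t L) z <> 0) by (apply lprod_neq_0; intros a Ha; apply (Hn a Ha)).
  assert (Ed : dC Dz z = (lprod lin (near_zeros t L) z * sumC (fun a => 1 / lin a z) (near_zeros t L) * g z + lprod lin (near_zeros t L) z * dC g z)%C).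
  { apply dC_eq. apply (cder_ext_loc (fun z => lprod lin (near_zeros t L) z * g z)%C).
    - apply filter_forall. intros w. symmetry. apply Efg.
    - apply (cder_mult (lprod lin (near_zeros t L)) g); [|apply dC_cder, Hg, Hzd]. apply (lprod_cder lin (fun _ => RtoC 1)). exact Hn. }
  assert (Es : sumC (fun a => 1 / lin a z)%C (near_zeros t L) = sumC (fun a => / (z - a))%C (near_zeros t L)).
  { clear. induction (near_zeros t L) as [|a l IH]; [reflexivity|]. simpl. rewrite IH. unfold lin, Cdiv. ring. }
  rewrite Ed, (Efg z), Es.
  match goal with |- Cmod (_ / _ - ?S) <= _ => replace ((lprod lin (near_zeros t L) z * S * g z + lprod lin (near_zeros t L) z * dC g z) / (lprod lin (near_zeros t L) z * g z) - S)%C with (dC g z / g z)%C by (field; split; assumption) end.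
  eapply Rle_trans; [apply LR, Hz|]. apply Rle_trans with (B * (6 * ln (Rabs t + 5))); [apply Rmult_le_compat_l; assumption|]. nra.
Qed.

(** * The von Mangoldt function *)

Definition single (d0 : nat) (x : R) (d : nat) : R := if Nat.eq_dec d d0 then x else 0.

Lemma rsum_indicator (d0 n : nat) (x : R) : (d0 < n)%nat -> rsum (single d0 x) n = x.
Proof.
induction n as [|n IH]; intros H; [lia|]. simpl. unfold single at 2. destruct (Nat.eq_dec n d0) as [E|E].
- subst n. replace (rsum (single d0 x) d0) with (rsum (fun _ => 0) d0).
  + replace (rsum (fun _ => 0) d0) with 0; [ring|]. clear. induction d0; simpl; lra.
  + apply rsum_ext. intros k Hk. unfold single. destruct (Nat.eq_dec k d0); [lia|reflexivity].
- rewrite IH by lia. ring.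
Qed.

Lemma rsum_minus a b n : rsum (fun k => a k - b k) n = rsum a n - rsum b n.
Proof. induction n as [|n IH]; simpl; [ring|rewrite IH; ring]. Qed.

Definition mangoldt_at (n d : nat) : R := if div.dvdn d n then von_mangoldt d else 0.

Section MangoldtDivisors.
Import ssreflect ssrfun ssrbool eqtype ssrnat seq div bigop prime.
Local Open Scope nat_scope.

Lemma von_mangoldt_cases d : von_mangoldt d = 0%R \/ exists q j, prime q /\ (0 < j)%N /\ d = q ^ j.
Proof.
case: (Classical_Prop.classic (exists q j, prime q /\ (0 < j)%N /\ d = q ^ j)) => H; [by right|left].
apply: von_mangoldt_not_prime_power => q j Hq Hj E. by apply: H; exists q, j.
Qed.

(** Passing from m to p m creates just one new prime power divisor, the power of p one above the
    exact power dividing m. *)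
Lemma mangoldt_step p m d : prime p -> 0 < m ->
  Rminus (mangoldt_at (p * m) d) (mangoldt_at m d) = single (p ^ (logn p m).+1) (ln (INR p)) d.
Proof.
move=> Hp Hm. rewrite /mangoldt_at /single.
have Hpm : 0 < p * m by rewrite muln_gt0 prime_gt0.
have Hlog : logn p (p * m) = (logn p m).+1 by rewrite lognM ?(prime_gt0 Hp) // logn_prime // eqxx add1n.
case: Nat.eq_dec => [Hd|Hd] /=.
- rewrite Hd !pfactor_dvdn // Hlog leqnn ltnn von_mangoldt_prime_power //. exact: Rminus_0_r.
- case Ed : (d %| m).
  + rewrite (dvdn_mull p Ed). exact: Rminus_diag_eq.
  + rewrite Rminus_0_r. case Ed2 : (d %| p * m) => //.
    case: (von_mangoldt_cases d) => [//|[q [j [Hq [Hj E]]]]]. exfalso.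
    case Eqp : (q == p).
    * move/eqP: Eqp => Eqp. subst q d. move: Ed Ed2. rewrite !pfactor_dvdn // Hlog => A B. apply: Hd. congr (_ ^ _).
      apply/eqP. rewrite eqn_leq B /=. by rewrite ltnNge A.
    * move: Ed2. rewrite E Gauss_dvdr; last first.
      { rewrite coprimeXl // prime_coprime // dvdn_prime2 //. by rewrite Eqp. }
      by rewrite -E Ed.
Qed.

Lemma mangoldt_at_large n d : 0 < n -> (n < d)%nat -> mangoldt_at n d = 0%R.
Proof.
move=> Hn Hd. rewrite /mangoldt_at. case E : (d %| n) => //. move: (dvdn_leq Hn E) => Hle.
by move: Hd; rewrite ltnNge Hle.
Qed.

Lemma mangoldt_at_extend n N : 0 < n -> (n <= N)%nat -> rsum (mangoldt_at n) (S N) = rsum (mangoldt_at n) (S n).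
Proof.
move=> Hn. elim: N => [|N IH] HN.
- by move: HN Hn; case: n.
- move: HN. rewrite leq_eqVlt => /orP [/eqP ->//|HN].
  change (rsum (mangoldt_at n) N.+2) with (Rplus (rsum (mangoldt_at n) N.+1) (mangoldt_at n N.+1)).
  rewrite (mangoldt_at_large n N.+1 Hn HN) IH //. exact: Rplus_0_r.
Qed.

(** Strong induction, splitting off the least prime factor p: the sum grows by log p by
    [mangoldt_step]. Divisor sums run over all d up to a common bound so that those of n and n/p can
    be subtracted. *)
Lemma sum_mangoldt_divisors n : 0 < n -> rsum (mangoldt_at n) (S n) = ln (INR n).
Proof.
elim/ltn_ind: n => n IH Hn. case: (leqP n 1) => Hn1.
- have -> : n = 1 by apply/eqP; rewrite eqn_leq Hn1 Hn.
  have V0 : von_mangoldt 0 = 0%R by [].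
  have V1 : von_mangoldt 1 = 0%R by [].
  rewrite /= /mangoldt_at dvdnn V0 V1. rewrite ln_1. case: (0 %| 1); rewrite !Rplus_0_l; reflexivity.
- set p := pdiv n. have Hp : prime p by apply: pdiv_prime.
  have Hpn : p %| n by apply: pdiv_dvd.
  set m := n %/ p. have En : n = p * m by rewrite mulnC divnK.
  have Hm : 0 < m by move: Hn; rewrite En muln_gt0 => /andP [].
  have Hmn : m < n by rewrite En ltn_Pmull // prime_gt1.
  have Hle : m <= n by apply: ltnW.
  have HI := IH m Hmn Hm.
  have E1 : Rminus (rsum (mangoldt_at n) n.+1) (rsum (mangoldt_at m) n.+1) = ln (INR p).
  { rewrite -rsum_minus. transitivity (rsum (single (p ^ (logn p m).+1) (ln (INR p))) n.+1).
    - apply: rsum_ext => d _. rewrite {1}En. exact: mangoldt_step.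
    - apply: rsum_indicator. apply/ltP. rewrite ltnS. apply: dvdn_leq => //. rewrite pfactor_dvdn //.
      have Hlog : logn p (p * m) = (logn p m).+1 by rewrite lognM ?(prime_gt0 Hp) // logn_prime // eqxx add1n.
      by rewrite {1}En Hlog. }
  rewrite (mangoldt_at_extend m n Hm Hle) HI in E1.
  have P1 : Rlt 0 (INR p) by apply: lt_0_INR; apply/ltP; apply: prime_gt0.
  have P2 : Rlt 0 (INR m) by apply: lt_0_INR; apply/ltP.
  rewrite [in RHS]En. change (ln (INR (p * m))) with (ln (INR (Nat.mul p m))). rewrite mult_INR ln_mult // -E1.
  ring.
Qed.

Lemma von_mangoldt_bounds n : Rle 0 (von_mangoldt n) /\ Rle (von_mangoldt n) (ln (INR n)) \/ n = 0.
Proof.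
case: n => [|n]; [by right|left].
case: (von_mangoldt_cases n.+1) => [->|[q [j [Hq [Hj E]]]]].
- split; [exact: Rle_refl|]. rewrite -ln_1. apply: ln_le; [exact: Rlt_0_1|]. rewrite S_INR. have := pos_INR n. lra.
- rewrite E von_mangoldt_prime_power //.
  have P1 : Rle 1 (INR q) by apply: (le_INR 1); apply/leP; apply: prime_gt0.
  split; [rewrite -ln_1; apply: ln_le => //; exact: Rlt_0_1|]. apply: ln_le; [lra|]. apply: le_INR. apply/leP.
  by rewrite -{1}(expn1 q) leq_exp2l // prime_gt1.
Qed.

Lemma dvdn_spec d n : 0 < d -> (div.dvdn d n = true <-> exists k, n = Nat.mul d k).
Proof.
move=> Hd. split.
- move/dvdnP => [k ->]. exists k. by rewrite mulnC.
- move=> [k ->]. exact: dvdn_mulr.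
Qed.
End MangoldtDivisors.

Lemma von_mangoldt_pos n : 0 <= von_mangoldt n.
Proof. destruct (von_mangoldt_bounds n) as [[H _]| ->]; [exact H|]. unfold von_mangoldt. simpl. lra. Qed.

Lemma von_mangoldt_le n : von_mangoldt (S n) <= ln (INR (S n)).
Proof. destruct (von_mangoldt_bounds (S n)) as [[_ H]|H]; [exact H|discriminate]. Qed.

(** * The Dirichlet series of the von Mangoldt function *)

Definition npw (n : nat) (s : C) : C := Cexp (- s * RtoC (ln (INR n))).

Lemma npw_ypw n s : ypw n s 0 = npw (S n) s.
Proof. unfold ypw, npw. rewrite Rplus_0_r. reflexivity. Qed.

Lemma npw_mult m k s : (0 < m)%nat -> (0 < k)%nat -> npw (m * k) s = (npw m s * npw k s)%C.
Proof.
intros Hm Hk. unfold npw. rewrite <- Cexp_plus. f_equal. rewrite mult_INR, ln_mult by (apply lt_0_INR; assumption).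
rewrite RtoC_plus. ring.
Qed.

Lemma npw_Cmod n s : Cmod (npw n s) = exp (- Re s * ln (INR n)).
Proof. apply Cmod_Cexp_opp. Qed.

Definition lam (s : C) (k : nat) : C := (RtoC (von_mangoldt (S k)) * npw (S k) s)%C.
(* -zeta'/zeta on Re s > 1. *)
Definition LS (s : C) : C := epsilon (inhabits (RtoC 0)) (cser (lam s)).

Lemma ln_INR_nonneg k : 0 <= ln (INR (S k)).
Proof. apply (ln_Sn_le k 0). lra. Qed.

(** Half of the excess q - 1 pays for the logarithm that bounds Lambda, the other half for the
    convergence. *)
Lemma lam_sum_bound q n : 1 < q -> rsum (fun k => von_mangoldt (S k) * exp (- q * ln (INR (S k)))) n <= 2 / (q - 1) * (1 + 2 / (q - 1)).
Proof.
intros Hq. set (d := (q - 1) / 2). assert (Hd : 0 < d) by (unfold d; lra).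
apply Rle_trans with (rsum (fun k => / d * exp (- (d + 1) * ln (INR (S k)))) n).
- apply rsum_le. intros k _. pose proof (ln_INR_nonneg k) as HL.
  apply Rle_trans with ((/ d * exp (d * ln (INR (S k)))) * exp (- q * ln (INR (S k)))).
  + apply Rmult_le_compat_r; [left; apply exp_pos|]. eapply Rle_trans; [apply von_mangoldt_le|]. apply lin_le_exp; assumption.
  + rewrite Rmult_assoc, <- exp_plus. apply Rmult_le_compat_l; [left; apply Rinv_0_lt_compat, Hd|]. apply exp_le. right. unfold d. field.
- rewrite rsum_scal. replace (2 / (q - 1)) with (/ d) by (unfold d; field; lra).
  apply Rmult_le_compat_l; [left; apply Rinv_0_lt_compat, Hd|]. apply pseries_bound, Hd.
Qed.

Lemma lam_Cmod s k : Cmod (lam s k) = von_mangoldt (S k) * exp (- Re s * ln (INR (S k))).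
Proof. unfold lam. rewrite Cmod_mult, Cmod_R, npw_Cmod, Rabs_pos_eq by apply von_mangoldt_pos. reflexivity. Qed.

Lemma LS_spec s : 1 < Re s -> cser (lam s) (LS s).
Proof.
intros Hs. unfold LS. apply epsilon_spec.
destruct (cser_dominated (lam s) (fun k => von_mangoldt (S k) * exp (- Re s * ln (INR (S k)))) (2 / (Re s - 1) * (1 + 2 / (Re s - 1)))) as [l [Hl _]].
- intros k. rewrite lam_Cmod. lra.
- intros n. apply lam_sum_bound, Hs.
- exists l. exact Hl.
Qed.

Lemma LS_bound s q : 1 < q -> q <= Re s -> Cmod (LS s) <= 2 / (q - 1) * (1 + 2 / (q - 1)).
Proof.
intros Hq Hs. apply (clim_bound _ _ _ (LS_spec s ltac:(lra))). intros n.
eapply Rle_trans; [apply csum_bound; intros k _; rewrite lam_Cmod; apply Rle_refl|].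
eapply Rle_trans; [|apply (lam_sum_bound q n Hq)]. apply rsum_le. intros k _. apply Rmult_le_compat_l; [apply von_mangoldt_pos|].
apply exp_le. pose proof (ln_INR_nonneg k). nra.
Qed.

Lemma div_succ N d : (0 < d)%nat -> (S N / d = N / d + (if div.dvdn d (S N) then 1 else 0))%nat.
Proof.
intros Hd. destruct (div.dvdn d (S N)) eqn:E.
- apply dvdn_spec in E; [|apply ssrbool.introT with (P := (0 < d)%nat); [apply ssrnat.ltP|exact Hd]].
  destruct E as [k Ek]. rewrite Ek. rewrite (Nat.mul_comm d k), Nat.div_mul by lia.
  destruct k as [|k]; [lia|]. replace N with (k * d + (d - 1))%nat by nia. rewrite Nat.div_add_l by lia. rewrite (Nat.div_small (d - 1)) by lia. lia.
- pose proof (Nat.div_mod N d ltac:(lia)) as H. pose proof (Nat.mod_upper_bound N d ltac:(lia)) as Hb.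
  set (q := (N / d)%nat) in *. set (r := (N mod d)%nat) in *.
  destruct (Nat.eq_dec (S r) d) as [Er|Er].
  + exfalso. assert (T : div.dvdn d (S N) = true); [|congruence].
    apply dvdn_spec; [apply ssrbool.introT with (P := (0 < d)%nat); [apply ssrnat.ltP|exact Hd]|]. exists (S q). lia.
  + rewrite Nat.add_0_r. symmetry. apply (Nat.div_unique (S N) d q (S r)); lia.
Qed.

Definition Zp (s : C) (M : nat) : C := csum (fun k => npw (S k) s) M.

Lemma csum_le_extend a n m : (n <= m)%nat -> (forall k, (n <= k < m)%nat -> a k = RtoC 0) -> csum a m = csum a n.
Proof.
intros H. induction H as [|m H IH]; intros Ha; [reflexivity|]. simpl. rewrite IH, Ha; [ring|lia|]. intros k Hk. apply Ha. lia.
Qed.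

Lemma mangoldt_csum M n (x : C) : (RtoC (rsum (fun k => mangoldt_at M (S k)) n) * x)%C =
  csum (fun m => if div.dvdn (S m) M then RtoC (von_mangoldt (S m)) * x else RtoC 0)%C n.
Proof.
induction n as [|n IH]; simpl; [ring|]. rewrite <- IH, RtoC_plus. unfold mangoldt_at.
destruct (div.dvdn (S n) M); ring.
Qed.

(** The relation log = Lambda convolved with 1, as an exact identity between partial sums, so that
    no infinite series is rearranged. In passing from N to N + 1 the quotient by m + 1 grows exactly
    when m + 1 divides N + 1. *)
Lemma log_convolution s N :
  csum (fun k => RtoC (ln (INR (S k))) * npw (S k) s)%C N = csum (fun m => lam s m * Zp s (N / S m))%C N.
Proof.
induction N as [|N IH]; [reflexivity|].
change (csum (fun k => RtoC (ln (INR (S k))) * npw (S k) s)%C (S N)) with (csum (fun k => RtoC (ln (INR (S k))) * npw (S k) s)%C N + RtoC (ln (INR (S N))) * npw (S N) s)%C.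
rewrite IH. rewrite <- (csum_le_extend (fun m => lam s m * Zp s (N / S m))%C N (S N)).
2:{ lia. }
2:{ intros k Hk. rewrite Nat.div_small by lia. unfold Zp. simpl. ring. }
assert (E : (RtoC (ln (INR (S N))) * npw (S N) s)%C = csum (fun m => if div.dvdn (S m) (S N) then RtoC (von_mangoldt (S m)) * npw (S N) s else RtoC 0)%C (S N)).
{ rewrite <- (sum_mangoldt_divisors (S N) eq_refl), rsum_shift.
  assert (E0 : mangoldt_at (S N) 0 = 0) by (unfold mangoldt_at, von_mangoldt; simpl; destruct (div.dvdn 0 (S N)); reflexivity).
  rewrite E0, Rplus_0_l. apply mangoldt_csum. }
rewrite E, <- csum_plus. apply csum_ext. intros m Hm.
rewrite (div_succ N (S m)) by lia. destruct (div.dvdn (S m) (S N)) eqn:Ed.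
- rewrite Nat.add_1_r. change (Zp s (S (N / S m))) with (Zp s (N / S m) + npw (S (N / S m)) s)%C.
  assert (EN : (S N = S m * S (N / S m))%nat).
  { pose proof (div_succ N (S m) ltac:(lia)) as D. rewrite Ed in D.
    apply dvdn_spec in Ed; [|reflexivity]. destruct Ed as [k Ek]. rewrite Ek in D at 1. rewrite Nat.mul_comm, Nat.div_mul in D by lia. rewrite Ek, D. f_equal. lia. }
  rewrite EN. rewrite npw_mult by lia. unfold lam. ring.
- rewrite Nat.add_0_r. ring.
Qed.

Lemma Zp_tail s M : 1 < Re s -> (0 < M)%nat -> Cmod (zetaE s - Zp s M) <= / (Re s - 1) * exp (- (Re s - 1) * ln (INR M)).
Proof.
intros Hs HM. destruct M as [|n]; [lia|]. set (p := Re s - 1) in *.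
apply (clim_bound (fun k => Zp s (S n + k) - Zp s (S n))%C).
- apply clim_minus; [|apply clim_const]. intros e He. destruct (zetaE_series s Hs e He) as [N HN]. exists N. intros k Hk.
  replace (Zp s (S n + k)) with (csum (fun k => ypw k s 0) (S n + k)) by (apply csum_ext; intros; apply npw_ypw). apply HN. lia.
- intros k. eapply Rle_trans; [|apply (pseries_tail p n k); unfold p; lra].
  replace (Zp s (S n + k) - Zp s (S n))%C with (csum (fun j => npw (S (S (n + j))) s) k).
  + apply csum_bound. intros j _. rewrite npw_Cmod. right. f_equal. unfold p. ring.
  + induction k as [|k IH]; [rewrite Nat.add_0_r; simpl; ring|]. rewrite Nat.add_succ_r. simpl csum. rewrite IH.
    change (Zp s (S (S n + k))) with (Zp s (S n + k) + npw (S (S n + k)) s)%C. simpl Nat.add. ring.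
Qed.

Lemma exp_neg_to_0 (p e : R) : 0 < p -> 0 < e -> exists N, forall n, (N <= n)%nat -> exp (- p * ln (INR (S n))) < e.
Proof.
intros Hp He. destruct (ypw_to_0 (RtoC p) Hp e He) as [N HN]. exists N. intros n Hn. specialize (HN n Hn).
replace (ypw n (RtoC p) 0 - 0)%C with (ypw n (RtoC p) 0) in HN by ring. unfold ypw in HN. rewrite Cmod_Cexp_opp, Rplus_0_r in HN. exact HN.
Qed.

(** By [log_convolution] the partial sums of the derivative series would be those of -LS times zeta
    if each truncated [Zp s (N / S m)] were replaced by its limit; the error made by this
    replacement is O(N^(-p/2)) with p = Re s - 1. *)
Lemma zetaE_logder s : 1 < Re s -> cder zetaE s (- (LS s * zetaE s)).
Proof.
intros Hs. destruct (zetaE_der_series s Hs) as [l [Hl Hser]]. apply (cder_eq _ _ l); [|exact Hl].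
apply (clim_unique _ _ _ Hser).
apply (clim_ext (fun N => - csum (fun m => lam s m * Zp s (N / S m)) N)%C).
{ intros N. rewrite <- log_convolution. replace (- csum (fun k => RtoC (ln (INR (S k))) * npw (S k) s) N)%C with ((- (1)) * csum (fun k => RtoC (ln (INR (S k))) * npw (S k) s) N)%C by ring.
  rewrite <- csum_scal. apply csum_ext. intros k _. rewrite npw_ypw. ring. }
apply clim_opp.
apply (clim_ext (fun N => csum (lam s) N * zetaE s - csum (fun m => lam s m * (zetaE s - Zp s (N / S m))) N)%C).
{ intros N. transitivity (zetaE s * csum (lam s) N - csum (fun m => lam s m * (zetaE s - Zp s (N / S m))) N)%C; [ring|].
  rewrite <- (csum_scal (zetaE s) (lam s)), <- csum_minus.
  apply csum_ext. intros k _. ring. }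
replace (LS s * zetaE s)%C with (zetaE s * LS s - 0)%C by ring.
apply clim_minus; [apply (clim_ext (fun N => zetaE s * csum (lam s) N)%C); [intros; ring|apply clim_scal, LS_spec, Hs]|].
set (p := Re s - 1). assert (Hp : 0 < p) by (unfold p; lra).
(* The saving (N/m)^(-p) is used only to the power 1/2, giving N^(-p/2) m^(p/2); the sum over m then
   has exponent Re s - p/2 = q > 1. *)
set (q := 1 + p / 2). set (B := 2 / (q - 1) * (1 + 2 / (q - 1))).
assert (HB : 0 < B). { unfold B. assert (0 < 2 / (q - 1)) by (apply Rdiv_lt_0_compat; unfold q; lra). nra. }
set (K := / p * exp (p / 2 * ln 2) * B). assert (HK : 0 < K).
{ unfold K. apply Rmult_lt_0_compat; [apply Rmult_lt_0_compat; [apply Rinv_0_lt_compat, Hp|apply exp_pos]|exact HB]. }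
intros e He. destruct (exp_neg_to_0 (p / 2) (e / K)) as [N0 HN0]; [lra|apply Rdiv_lt_0_compat; assumption|].
exists (S N0). intros [|n] Hn; [lia|]. specialize (HN0 n ltac:(lia)). set (N := S n) in *.
match goal with |- Cmod (Cminus ?x (RtoC 0)) < e => replace (Cminus x (RtoC 0)) with x by ring end.
apply Rle_lt_trans with (K * exp (- (p / 2) * ln (INR N))).
2:{ apply Rlt_div_r in HN0; [lra|exact HK]. }
apply Rle_trans with (rsum (fun m => (/ p * exp (p / 2 * ln 2) * exp (- (p / 2) * ln (INR N))) * (von_mangoldt (S m) * exp (- q * ln (INR (S m))))) N).
2:{ rewrite rsum_scal. unfold K. replace (/ p * exp (p / 2 * ln 2) * B * exp (- (p / 2) * ln (INR N))) with (/ p * exp (p / 2 * ln 2) * exp (- (p / 2) * ln (INR N)) * B) by ring.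
  apply Rmult_le_compat_l; [|apply lam_sum_bound; unfold q; lra].
  apply Rmult_le_pos; [apply Rmult_le_pos; [left; apply Rinv_0_lt_compat, Hp|left; apply exp_pos]|left; apply exp_pos]. }
apply csum_bound. intros m Hm. rewrite Cmod_mult, lam_Cmod.
assert (HM : (0 < N / S m)%nat) by (apply Nat.div_str_pos; lia).
pose proof (Zp_tail s (N / S m) Hs HM) as T. fold p in T.
set (M := (N / S m)%nat) in *.
assert (HMN : (N <= 2 * (S m * M))%nat).
{ unfold M. pose proof (Nat.div_mod N (S m) ltac:(lia)). pose proof (Nat.mod_upper_bound N (S m) ltac:(lia)). fold M in H |- *. nia. }
assert (HlnM : ln (INR N) <= ln 2 + (ln (INR (S m)) + ln (INR M))).
{ rewrite <- !ln_mult by (try apply Rmult_lt_0_compat; try lra; apply lt_0_INR; lia).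
  apply ln_le; [apply lt_0_INR; lia|]. apply le_INR in HMN. rewrite !mult_INR in HMN. exact HMN. }
assert (HM0 : 0 <= ln (INR M)) by (rewrite <- ln_1; apply ln_le; [lra|apply (le_INR 1); lia]).
apply Rle_trans with (von_mangoldt (S m) * exp (- Re s * ln (INR (S m))) * (/ p * exp (- p * ln (INR M)))).
- apply Rmult_le_compat_l; [apply Rmult_le_pos; [apply von_mangoldt_pos|left; apply exp_pos]|exact T].
- replace (von_mangoldt (S m) * exp (- Re s * ln (INR (S m))) * (/ p * exp (- p * ln (INR M)))) with (/ p * von_mangoldt (S m) * (exp (- Re s * ln (INR (S m))) * exp (- p * ln (INR M)))) by ring.
  replace (/ p * exp (p / 2 * ln 2) * exp (- (p / 2) * ln (INR N)) * (von_mangoldt (S m) * exp (- q * ln (INR (S m))))) with (/ p * von_mangoldt (S m) * (exp (p / 2 * ln 2) * exp (- (p / 2) * ln (INR N)) * exp (- q * ln (INR (S m))))) by ring.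
  apply Rmult_le_compat_l; [apply Rmult_le_pos; [left; apply Rinv_0_lt_compat, Hp|apply von_mangoldt_pos]|].
  rewrite <- !exp_plus. apply exp_le. unfold q. replace (Re s) with (1 + p) by (unfold p; ring). nra.
Qed.

(** * Zero-free region Re s >= 1 *)

Definition others (a : C) (L : list C) : list C := filter (fun b => if Ceq_dec b a then false else true) L.

Lemma lprod_order L (a z : C) : lprod lin L z = (Cpow (z - a) (count_occ Ceq_dec L a) * lprod lin (others a L) z)%C.
Proof.
induction L as [|b L IH]; simpl; [ring|]. rewrite IH. destruct (Ceq_dec b a) as [->|Hn]; simpl; unfold lin at 1; [ring|].
unfold lin at 2. ring.
Qed.

Lemma others_neq a L z : (forall b, In b L -> b <> z \/ b = a) -> lprod lin (others a L) z <> 0.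
Proof.
intros H. apply lprod_neq_0. intros b Hb. unfold others in Hb. rewrite filter_In in Hb. destruct Hb as [Hb1 Hb2].
destruct (Ceq_dec b a); [discriminate|]. destruct (H b Hb1) as [h|h]; [|contradiction]. unfold lin. intro E. apply Ceq_minus in E. congruence.
Qed.

(** Collecting the factors of L equal to z - a leaves a cofactor without a zero at a, because G has
    none in the box. *)
Lemma zero_order H L G (a : C) : zero_factor H L G -> in_box H a ->
  exists g : C -> C, (forall z, Dz z = (Cpow (z - a) (count_occ Ceq_dec L a) * g z)%C) /\ g a <> 0 /\
   (forall z, in_box H z -> cdiff g z) /\ (Dz a = 0 -> (1 <= count_occ Ceq_dec L a)%nat) /\ (Dz a <> 0 -> count_occ Ceq_dec L a = O).
Proof.
intros [HL [E HG]] Ha. exists (fun z => lprod lin (others a L) z * G z)%C. repeat split.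
- intros z. rewrite E, (lprod_order L a z). ring.
- apply Cmult_neq_0; [|apply HG, Ha]. apply others_neq. intros b _. destruct (Ceq_dec b a); tauto.
- intros z Hz. apply cdiff_mult; [apply lprod_cdiff; intros; apply cdiff_sub_id|apply HG, Hz].
- intros H0. destruct (count_occ Ceq_dec L a) eqn:Ec; [|lia]. exfalso.
  assert (Hn : lprod lin L a <> 0).
  { rewrite (lprod_order L a a), Ec. apply Cmult_neq_0; [apply C1_nz|]. apply others_neq. intros b _. destruct (Ceq_dec b a); tauto. }
  rewrite E in H0. apply (Cmult_neq_0 _ _ Hn (proj2 (HG a Ha))). exact H0.
- intros H0. apply count_occ_not_In. intros Hin. apply H0, (HL a Hin).
Qed.

Lemma in_box_half (H : R) (a : C) : 1 <= Re a <= 2 -> Rabs (Im a) + 1 <= H -> forall z, disc a (/ 2) z -> in_box H z.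
Proof.
intros Ha HH z Hz. unfold disc in Hz. pose proof (re_le_Cmod (z - a)) as B1. pose proof (im_le_Cmod (z - a)) as B2.
apply Rabs_le_between in B1. unfold Cminus in B1, B2. rewrite re_plus, re_opp in B1. rewrite im_plus, im_opp in B2. fold (z - a)%C in B1, B2.
split; [lra|]. pose proof (Rabs_triang (Im z + - Im a) (Im a)) as T. replace (Im z + - Im a + Im a) with (Im z) in T by ring. lra.
Qed.

(** Writing Dz = (z - a)^m g with g(a) <> 0, the logarithmic derivative at a + e is m/e + g'/g, and
    g'/g is bounded near a. Only points to the right of a occur, where Dz'/Dz can be compared with
    [LS]. *)
Lemma logder_pole (a : C) : 1 <= Re a <= 2 -> exists m B e0, 0 < e0 /\
  (Dz a = 0 -> (1 <= m)%nat) /\ (Dz a <> 0 -> m = O) /\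
  forall e, 0 < e < e0 -> Dz (a + RtoC e) <> 0 /\ Cmod (dC Dz (a + RtoC e) / Dz (a + RtoC e) - RtoC (INR m / e)) <= B.
Proof.
intros Ha. set (H := Rabs (Im a) + 1). assert (HH : 0 <= H) by (unfold H; pose proof (Rabs_pos (Im a)); lra).
destruct (zero_factor_exists H HH) as [L [G HF]].
pose proof (in_box_half H a Ha (Rle_refl _)) as Hbox.
assert (Ha0 : disc a (/ 2) a) by (unfold disc; rewrite Cmod_0_minus; lra).
destruct (zero_order H L G a HF (Hbox a Ha0)) as [g [Eg [Hga [Hgd [Hm1 Hm0]]]]].
set (m := count_occ Ceq_dec L a) in *.
assert (Hgh : holo (disc a (/ 2)) g) by (intros z Hz; apply Hgd, Hbox, Hz).
pose proof (dC_holo_disc a (/ 2) g Hgh) as Hg'.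
assert (Cq : ccont (fun z => dC g z / g z)%C a) by (apply ccont_div; [apply cdiff_ccont, Hg', Ha0|apply cdiff_ccont, Hgh, Ha0|exact Hga]).
destruct (proj1 (locally_C_iff _ _) (filter_and _ _ (ccont_bound _ _ Cq) (ccont_lower g a (cdiff_ccont _ _ (Hgh a Ha0)) Hga))) as [d [Hd HB]].
exists m, (Cmod (dC g a / g a) + 1), (Rmin d (/ 2)). split; [apply Rmin_glb_lt; lra|]. split; [exact Hm1|]. split; [exact Hm0|].
intros e [He1 He2].
assert (He3 : e < d) by (eapply Rlt_le_trans; [exact He2|apply Rmin_l]). assert (He4 : e < / 2) by (eapply Rlt_le_trans; [exact He2|apply Rmin_r]).
set (s := (a + RtoC e)%C). assert (Es : (s - a)%C = RtoC e) by (unfold s; ring).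
assert (Ec : Cmod (s - a) = e) by (rewrite Es, Cmod_R, Rabs_pos_eq; lra).
destruct (HB s ltac:(lra)) as [B1 B2].
assert (Hgs : g s <> 0) by (apply Cmod_gt_0; pose proof (Cmod_ge_0 (g a)); lra).
assert (He0 : RtoC e <> 0) by (apply RtoC_neq_0; lra).
assert (Hsd : disc a (/ 2) s) by (unfold disc; lra).
split.
- rewrite Eg, Es. apply Cmult_neq_0; [apply Cpow_nz, He0|exact Hgs].
- assert (Ed : dC Dz s = (RtoC (INR m) * Cpow (s - a) (pred m) * 1 * g s + Cpow (s - a) m * dC g s)%C).
  { apply dC_eq. apply (cder_ext_loc (fun z => Cpow (z - a) m * g z)%C); [apply filter_forall; intros; symmetry; apply Eg|].
    apply (cder_mult (fun z => Cpow (z - a) m)); [apply (cder_pow (fun z => z - a)%C), cder_sub_id|apply dC_cder, Hgh, Hsd]. }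
  rewrite Ed, (Eg s), Es, RtoC_div by lra.
  match goal with |- Cmod ?X <= _ => replace X with (dC g s / g s)%C; [lra|] end.
  assert (Hp : Cpow (RtoC e) (pred m) <> 0) by (apply Cpow_nz, He0).
  destruct m as [|k]; simpl pred in *.
  + simpl. field. repeat split; assumption.
  + rewrite Cpow_S. field. repeat split; assumption.
Qed.

Lemma Dz_logder s : 1 < Re s -> Dz s <> 0 -> (dC Dz s / Dz s)%C = (/ (s - 1) - LS s)%C.
Proof.
intros Hs HD. assert (Hs1 : s <> 1) by (intros ->; simpl in Hs; lra). pose proof (Cminus_neq_0 _ _ Hs1) as Hs2.
assert (E : dC Dz s = (1 * zetaE s + (s - 1) * (- (LS s * zetaE s)))%C).
{ apply dC_eq. apply (cder_ext_loc (fun s => (s - 1) * zetaE s)%C).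
  - apply locally_C_iff. exists (Cmod (s - 1)). split; [apply Cmod_gt_0, Hs2|]. intros w Hw. symmetry. apply Dz_zetaE. intros ->. rewrite Cmod_minus_sym in Hw. lra.
  - apply (cder_mult (fun s => s - 1)%C zetaE); [apply cder_sub_id|apply zetaE_logder, Hs]. }
rewrite E. rewrite Dz_zetaE in * by exact Hs1. assert (zetaE s <> 0) by (intro E0; apply HD; rewrite E0; ring).
field. split; assumption.
Qed.

Lemma Re_RtoC_plus (a : C) (e : R) : Re (a + RtoC e) = Re a + e.
Proof. rewrite re_plus. reflexivity. Qed.

(** For Re s >= 2 the lower bound applies. Otherwise a zero would make Dz'/Dz unbounded to the right
    of s, while it equals 1/(s - 1) - LS there and [LS] is bounded. *)
Lemma Dz_neq_0_gt1 s : 1 < Re s -> Dz s <> 0.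
Proof.
intros Hs E0. destruct (Rle_dec 2 (Re s)) as [h|h].
{ pose proof (Dz_lower s h) as Lo. rewrite E0, Cmod_0 in Lo. pose proof (re_le_Cmod (s - 1)) as A.
  unfold Cminus in A. rewrite re_plus, re_opp in A. simpl in A. fold (s - 1)%C in A. rewrite Rabs_pos_eq in A; unfold Re in *; lra. }
destruct (logder_pole s ltac:(lra)) as [m [B [e0 [He0 [Hm [_ Hp]]]]]]. specialize (Hm E0).
set (M := / (Re s - 1) + 2 / (Re s - 1) * (1 + 2 / (Re s - 1))).
assert (HM : forall e, 0 < e < e0 -> / e <= M + B).
{ intros e He. destruct (Hp e He) as [N1 N2]. rewrite Dz_logder in N2; [|rewrite Re_RtoC_plus; lra|exact N1].
  assert (A1 : Cmod (/ (s + RtoC e - 1) - LS (s + RtoC e)) <= M).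
  { unfold Cminus at 1. eapply Rle_trans; [apply Cmod_triangle|]. rewrite Cmod_opp. unfold M. apply Rplus_le_compat.
    - assert (Hr : Re s - 1 <= Cmod (s + RtoC e - 1)).
      { pose proof (re_le_Cmod (s + RtoC e - 1)) as A. unfold Cminus in A. rewrite re_plus, re_opp, Re_RtoC_plus in A. simpl (Re 1) in A. fold (s + RtoC e - 1)%C in A. rewrite Rabs_pos_eq in A; lra. }
      rewrite Cmod_inv by (apply Cmod_gt_0; lra). apply Rinv_le_contravar; lra.
    - apply LS_bound; [exact Hs|rewrite Re_RtoC_plus; lra]. }
  pose proof (Cmod_le_minus (RtoC (INR m / e)) (/ (s + RtoC e - 1) - LS (s + RtoC e))) as T.
  rewrite (Cmod_minus_sym (RtoC (INR m / e)) _), Cmod_R in T.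
  assert (/ e <= Rabs (INR m / e)).
  { eapply Rle_trans; [|apply Rle_abs]. unfold Rdiv. rewrite <- (Rmult_1_l (/ e)) at 1. apply Rmult_le_compat_r; [left; apply Rinv_0_lt_compat; lra|]. apply (le_INR 1), Hm. }
  lra. }
set (Q := Rmax (M + B) 1 + 1). assert (HQ : 1 < Q /\ M + B < Q) by (unfold Q; pose proof (Rmax_l (M + B) 1); pose proof (Rmax_r (M + B) 1); lra).
set (e := Rmin (e0 / 2) (/ Q)). assert (HiQ : 0 < / Q) by (apply Rinv_0_lt_compat; lra).
assert (He : 0 < e < e0) by (unfold e; split; [apply Rmin_glb_lt; lra|eapply Rle_lt_trans; [apply Rmin_l|lra]]).
pose proof (HM e He). assert (Q <= / e). { replace Q with (/ / Q) by (field; lra). apply Rinv_le_contravar; [lra|apply Rmin_r]. }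
lra.
Qed.

(** Termwise positivity from 3 + 4 cos u + cos 2u = 2 (1 + cos u)^2, passed to the limit of the
    partial sums. *)
Lemma three_four_one (s t : R) : 1 < s -> 0 <= 3 * Re (LS (RtoC s)) + 4 * Re (LS (s, t)) + Re (LS (s, 2 * t)).
Proof.
intros Hs.
assert (Hl : clim (fun n => RtoC 3 * csum (lam (RtoC s)) n + RtoC 4 * csum (lam (s, t)) n + csum (lam (s, 2 * t)%R) n)%C
  (RtoC 3 * LS (RtoC s) + RtoC 4 * LS (s, t) + LS (s, 2 * t)%R)%C).
{ apply clim_plus; [apply clim_plus; apply clim_scal|]; apply LS_spec; exact Hs. }
replace (3 * Re (LS (RtoC s)) + 4 * Re (LS (s, t)) + Re (LS (s, 2 * t))) with (Re (RtoC 3 * LS (RtoC s) + RtoC 4 * LS (s, t) + LS (s, (2 * t)%R))%C) by (rewrite !re_plus, !re_scal_l; reflexivity).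
apply Rnot_lt_le. intros Hneg. set (Lim := (RtoC 3 * LS (RtoC s) + RtoC 4 * LS (s, t) + LS (s, (2 * t)%R))%C) in *.
destruct (Hl (- Re Lim) ltac:(lra)) as [N HN]. specialize (HN N (Nat.le_refl _)).
set (u := (RtoC 3 * csum (lam (RtoC s)) N + RtoC 4 * csum (lam (s, t)) N + csum (lam (s, (2 * t)%R)) N)%C) in *.
assert (Hu : 0 <= Re u).
{ unfold u. clear. induction N as [|n IH]; [simpl; lra|]. simpl csum.
  set (A := csum (lam (RtoC s)) n) in *. set (B := csum (lam (s, t)) n) in *. set (D := csum (lam (s, 2 * t)) n) in *.
  replace (RtoC 3 * (A + lam (RtoC s) n) + RtoC 4 * (B + lam (s, t) n) + (D + lam (s, (2 * t)%R) n))%C with ((RtoC 3 * A + RtoC 4 * B + D) + (RtoC 3 * lam (RtoC s) n + RtoC 4 * lam (s, t) n + lam (s, (2 * t)%R) n))%C by ring.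
  rewrite re_plus. apply Rplus_le_le_0_compat; [exact IH|]. rewrite !re_plus, !re_scal_l. unfold lam. rewrite !re_scal_l. unfold npw, Cexp.
  set (l := ln (INR (S n))). simpl.
  replace (- s * 0 + - 0 * l) with 0 by ring.
  replace (- s * 0 + - t * l) with (- (t * l)) by ring. replace (- s * 0 + - (2 * t) * l) with (- (2 * (t * l))) by ring.
  replace (- s * l - - 0 * 0) with (- s * l) by ring. replace (- s * l - - t * 0) with (- s * l) by ring. replace (- s * l - - (2 * t) * 0) with (- s * l) by ring.
  rewrite cos_0.
  rewrite !cos_neg, cos_2a_cos. pose proof (von_mangoldt_pos (S n)) as V. pose proof (exp_pos (- s * l)) as X.
  set (c := cos (t * l)). set (v := von_mangoldt (S n)) in *. set (x := exp (- s * l)) in *.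
  replace (3 * (v * (x * 1)) + 4 * (v * (x * c)) + v * (x * (2 * c * c - 1))) with (v * x * (2 * ((1 + c) * (1 + c)))) by ring.
  apply Rmult_le_pos; [apply Rmult_le_pos; lra|]. apply Rmult_le_pos; [lra|apply Rle_0_sqr]. }
pose proof (re_le_Cmod (u - Lim)) as A. unfold Cminus in A. rewrite re_plus, re_opp in A. fold (u - Lim)%C in A.
apply Rabs_le_between in A. lra.
Qed.

(** As e tends to 0 from above, [LS] at 1 + e behaves like 1/e, at 1 + e + it like -m1/e with m1 >=
    1, and at 1 + e + 2it like -m2/e; since 3 - 4 m1 - m2 <= -1, the nonnegative expression of
    [three_four_one] would become negative. *)
Lemma Dz_neq_0_line t : Dz (1, t) <> 0.
Proof.
intros E0. assert (Ht : t <> 0). { intros ->. change (Dz 1 = 0) in E0. rewrite Dz_1 in E0. exact (C1_nz E0). }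
destruct (logder_pole (RtoC 1) ltac:(simpl; lra)) as [m0 [B0 [e0 [He0 [_ [Hm0 Hp0]]]]]].
rewrite Hm0 in Hp0 by (rewrite Dz_1; apply C1_nz). clear Hm0.
destruct (logder_pole (1, t) ltac:(simpl; lra)) as [m1 [B1 [e1 [He1 [Hm1 [_ Hp1]]]]]]. specialize (Hm1 E0).
destruct (logder_pole (1, 2 * t) ltac:(simpl; lra)) as [m2 [B2 [e2 [He2 [_ [_ Hp2]]]]]].
assert (Hat : 0 < Rabs t) by (apply Rabs_pos_lt, Ht).
set (K := 3 * B0 + 4 * (B1 + / Rabs t) + (B2 + / Rabs t)).
assert (HB : 0 <= B0 /\ 0 <= B1 /\ 0 <= B2).
{ split; [|split]; [destruct (Hp0 (e0 / 2) ltac:(lra)) as [_ X]|destruct (Hp1 (e1 / 2) ltac:(lra)) as [_ X]|destruct (Hp2 (e2 / 2) ltac:(lra)) as [_ X]]; (eapply Rle_trans; [apply Cmod_ge_0|exact X]). }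
assert (HiT : 0 < / Rabs t) by (apply Rinv_0_lt_compat, Hat).
assert (HK : 0 <= K) by (unfold K; lra).
assert (Hall : forall e, 0 < e -> e < e0 -> e < e1 -> e < e2 -> / e <= K).
{ intros e He H0 H1 H2.
  assert (Est : forall (y : R) m B, (Cmod (dC Dz ((1, y) + RtoC e)%C / Dz ((1, y) + RtoC e)%C - RtoC (INR m / e)) <= B) -> Dz ((1, y) + RtoC e)%C <> 0 ->
     Re (LS (1 + e, y)) <= Re (/ (e, y))%C - INR m / e + B).
  { intros y m B HB' HN. rewrite Dz_logder in HB'; [|simpl; lra|exact HN].
    replace ((1, y) + RtoC e)%C with ((1 + e, y) : C) in HB' by (apply C_ext; simpl; ring).
    replace (((1 + e)%R, y) - 1)%C with ((e, y) : C) in HB' by (apply C_ext; simpl; ring).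
    match type of HB' with Cmod ?X <= _ => pose proof (re_le_Cmod X) as A end. apply Rabs_le_between in A.
    unfold Cminus in A. rewrite !re_plus, !re_opp, re_RtoC in A. unfold Cminus in HB'. lra. }
  destruct (Hp0 e ltac:(lra)) as [N0 X0]. destruct (Hp1 e ltac:(lra)) as [N1 X1]. destruct (Hp2 e ltac:(lra)) as [N2 X2].
  pose proof (Est 0 O B0 X0 N0) as Y0. pose proof (Est t m1 B1 X1 N1) as Y1. pose proof (Est (2 * t) m2 B2 X2 N2) as Y2.
  pose proof (three_four_one (1 + e) t ltac:(lra)) as P. change (RtoC (1 + e)) with ((1 + e, 0) : C) in P.
  assert (R0 : Re (/ (e, 0))%C = / e).
  { change ((e, 0) : C) with (RtoC e). rewrite <- RtoC_inv by lra. reflexivity. }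
  assert (RB : forall y, 0 < Rabs y -> Re (/ (e, y))%C <= / Rabs y).
  { intros y Hy. eapply Rle_trans; [apply Rle_abs|]. eapply Rle_trans; [apply re_le_Cmod|].
    pose proof (im_le_Cmod (e, y)) as A. simpl in A. rewrite Cmod_inv by (apply Cmod_gt_0; lra). apply Rinv_le_contravar; assumption. }
  pose proof (RB t Hat) as R1.
  assert (R2 : Re (/ (e, 2 * t)%R)%C <= / Rabs t).
  { eapply Rle_trans; [apply RB|]; rewrite Rabs_mult, (Rabs_pos_eq 2) by lra; [lra|]. apply Rinv_le_contravar; lra. }
  assert (Hie : 0 < / e) by (apply Rinv_0_lt_compat, He).
  assert (M1 : / e <= INR m1 / e). { unfold Rdiv. rewrite <- (Rmult_1_l (/ e)) at 1. apply Rmult_le_compat_r; [lra|]. apply (le_INR 1), Hm1. }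
  assert (M2 : 0 <= INR m2 / e). { apply Rmult_le_pos; [apply pos_INR|lra]. }
  simpl (INR 0) in Y0. unfold Rdiv in Y0 at 1. rewrite Rmult_0_l in Y0. unfold K. lra. }
set (e := Rmin (Rmin (e0 / 2) (e1 / 2)) (Rmin (e2 / 2) (/ (K + 1)))).
assert (Hk1 : 0 < / (K + 1)) by (apply Rinv_0_lt_compat; lra).
assert (He : 0 < e) by (unfold e; repeat apply Rmin_glb_lt; lra).
assert (L0 : e <= e0 / 2) by (unfold e; eapply Rle_trans; [apply Rmin_l|apply Rmin_l]).
assert (L1 : e <= e1 / 2) by (unfold e; eapply Rle_trans; [apply Rmin_l|apply Rmin_r]).
assert (L2 : e <= e2 / 2) by (unfold e; eapply Rle_trans; [apply Rmin_r|apply Rmin_l]).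
assert (L3 : e <= / (K + 1)) by (unfold e; eapply Rle_trans; [apply Rmin_r|apply Rmin_r]).
pose proof (Hall e He ltac:(lra) ltac:(lra) ltac:(lra)) as A.
assert (K + 1 <= / e). { replace (K + 1) with (/ / (K + 1)) by (field; lra). apply Rinv_le_contravar; assumption. }
lra.
Qed.

(** Nonvanishing on Re s >= 1 makes the right boundary of the critical strip automatic, so
    positivity of the real part is all that has to be tracked afterwards. *)
Lemma Dz_zero_iff rho : nontrivial_zero rho <-> 0 < Re rho /\ Dz rho = 0.
Proof.
split.
- intros [H1 H2]. split; [lra|]. assert (Hn : rho <> 1) by (intros ->; simpl in H1; lra).
  rewrite Dz_zetaE, <- zeta_eq, H2 by exact Hn. ring.
- intros [H1 H2].
  assert (Hlt : Re rho < 1).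
  { apply Rnot_le_lt. intros Hge. destruct (Rle_lt_or_eq_dec _ _ Hge) as [h|h]; [exact (Dz_neq_0_gt1 _ h H2)|].
    destruct rho as [x y]. simpl in h. subst x. exact (Dz_neq_0_line y H2). }
  assert (Hn : rho <> 1) by (intros ->; simpl in Hlt; lra). split; [lra|].
  rewrite zeta_eq by exact Hn. rewrite Dz_zetaE in H2 by exact Hn. pose proof (Cminus_neq_0 _ _ Hn) as Hn2.
  transitivity ((rho - 1) * zetaE rho / (rho - 1))%C; [field; exact Hn2|]. rewrite H2. field. exact Hn2.
Qed.

Lemma RH_Dz : riemann_hypothesis -> forall a, 0 < Re a -> Dz a = 0 -> Re a = 1 / 2.
Proof. intros RH a H1 H2. apply RH, Dz_zero_iff. split; assumption. Qed.

(** * Zeros under the Riemann Hypothesis *)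

(** The cofactor is only asked to be continuous: this already determines m, and it passes easily
    through complex conjugation and between zeta and Dz. *)
Definition dz_order (a : C) (m : nat) : Prop :=
  exists g : C -> C, g a <> 0 /\ ccont g a /\ locally a (fun z => Dz z = (Cpow (z - a) m * g z)%C).

Lemma locally_punctured (a : C) (P : C -> Prop) : locally a P -> exists d, 0 < d /\ forall e, 0 < e < d -> P (a + RtoC e)%C.
Proof.
intros H. apply locally_C_iff in H. destruct H as [d [Hd H]]. exists d. split; [exact Hd|]. intros e He. apply H.
replace (a + RtoC e - a)%C with (RtoC e) by ring. rewrite Cmod_R, Rabs_pos_eq; lra.
Qed.

(** Cancelling (z - a)^m along a + e gives g = e^(k-m) h, which tends to 0 as e does, against g(a)
    <> 0. *)
Lemma order_unique_lt (a : C) (m k : nat) (g h : C -> C) : (m < k)%nat -> g a <> 0 -> ccont g a -> ccont h a ->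
  locally a (fun z => Cpow (z - a) m * g z = Cpow (z - a) k * h z)%C -> False.
Proof.
intros Hmk Hga Cg Ch Hl.
destruct (locally_punctured _ _ (filter_and _ _ Hl (filter_and _ _ (ccont_lower g a Cg Hga) (ccont_bound h a Ch)))) as [d [Hd HP]].
set (M := Cmod (h a) + 1). assert (HM : 0 < M) by (unfold M; pose proof (Cmod_ge_0 (h a)); lra).
pose proof (proj1 (Cmod_gt_0 _) Hga) as Hgp.
set (e := Rmin (Rmin (d / 2) (/ 2)) (Cmod (g a) / (4 * M))).
assert (Hq : 0 < Cmod (g a) / (4 * M)) by (apply Rdiv_lt_0_compat; lra).
assert (He : 0 < e) by (unfold e; repeat apply Rmin_glb_lt; lra).
assert (L1 : e <= d / 2) by (unfold e; eapply Rle_trans; [apply Rmin_l|apply Rmin_l]).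
assert (L2 : e <= / 2) by (unfold e; eapply Rle_trans; [apply Rmin_l|apply Rmin_r]).
assert (L3 : e <= Cmod (g a) / (4 * M)) by (unfold e; apply Rmin_r).
destruct (HP e ltac:(lra)) as [E [A B]]. fold M in B. replace (a + RtoC e - a)%C with (RtoC e) in E by ring.
set (z := (a + RtoC e)%C) in *.
assert (He0 : RtoC e <> 0) by (apply RtoC_neq_0; lra).
replace k with (m + S (k - m - 1))%nat in E by lia. rewrite Cpow_add_r in E.
assert (E2 : g z = (Cpow (RtoC e) (S (k - m - 1)) * h z)%C).
{ assert (Hp : Cpow (RtoC e) m <> 0) by (apply Cpow_nz, He0).
  transitivity (Cpow (RtoC e) m * g z / Cpow (RtoC e) m)%C; [field; exact Hp|]. rewrite E. field. exact Hp. }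
assert (A2 : Cmod (g z) <= e * M).
{ rewrite E2, Cpow_S, !Cmod_mult, Cmod_pow, Cmod_R, Rabs_pos_eq by lra. rewrite Rmult_assoc. apply Rmult_le_compat_l; [lra|].
  rewrite <- (Rmult_1_l M). apply Rmult_le_compat; [apply pow_le; lra|apply Cmod_ge_0| |lra].
  rewrite <- (pow1 (k - m - 1)). apply pow_incr. lra. }
assert (e * M <= Cmod (g a) / 4). { apply (Rmult_le_compat_r M) in L3; [|lra]. replace (Cmod (g a) / (4 * M) * M) with (Cmod (g a) / 4) in L3 by (field; lra). exact L3. }
lra.
Qed.

Lemma dz_order_unique a m k : dz_order a m -> dz_order a k -> m = k.
Proof.
intros [g [G1 [G2 G3]]] [h [H1 [H2 H3]]].
destruct (Nat.lt_trichotomy m k) as [h0|[h0|h0]]; [exfalso|exact h0|exfalso].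
- apply (order_unique_lt a m k g h h0 G1 G2 H2). generalize (filter_and _ _ G3 H3). apply filter_imp. intros z [A B]. congruence.
- apply (order_unique_lt a k m h g h0 H1 H2 G2). generalize (filter_and _ _ G3 H3). apply filter_imp. intros z [A B]. congruence.
Qed.

Lemma locally_Re_pos (a : C) : 0 < Re a -> locally a (fun z => 0 < Re z).
Proof.
intros H. apply locally_C_iff. exists (Re a). split; [exact H|]. intros w Hw.
pose proof (re_le_Cmod (w - a)) as A. apply Rabs_le_between in A. unfold Cminus in A. rewrite re_plus, re_opp in A. fold (w - a)%C in A. lra.
Qed.

Lemma locally_Cconj (a : C) (P : C -> Prop) : locally (Cconj a) P -> locally a (fun z => P (Cconj z)).
Proof.
intros H. apply locally_C_iff in H. destruct H as [d [Hd H]]. apply locally_C_iff. exists d. split; [exact Hd|]. intros w Hw. apply H.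
rewrite <- Cminus_conj, Cmod_conj. exact Hw.
Qed.

Lemma ccont_conj_conj (g : C -> C) a : ccont g (Cconj a) -> ccont (fun z => Cconj (g (Cconj z))) a.
Proof.
intros H e He. generalize (locally_Cconj a _ (H e He)). apply filter_imp. intros z Hz. rewrite <- Cminus_conj, Cmod_conj. exact Hz.
Qed.

Lemma dz_order_conj a m : 0 < Re a -> dz_order a m -> dz_order (Cconj a) m.
Proof.
intros Ha [g [G1 [G2 G3]]]. exists (fun z => Cconj (g (Cconj z))). split; [|split].
- intros E. rewrite Cconj_conj in E. apply G1. rewrite <- (Cconj_conj (g a)), E. apply C_ext; simpl; ring.
- apply ccont_conj_conj. rewrite Cconj_conj. exact G2.
- rewrite <- (Cconj_conj a) in G3. pose proof (locally_Cconj (Cconj a) _ G3) as G4.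
  assert (Ha' : 0 < Re (Cconj a)) by (rewrite re_conj; exact Ha).
  generalize (filter_and _ _ G4 (locally_Re_pos _ Ha')). apply filter_imp. intros z [A B].
  rewrite Dz_conj in A by exact B. rewrite Cconj_conj in A. apply (f_equal Cconj) in A. rewrite Cconj_conj in A. rewrite A.
  rewrite Cmult_conj, Cpow_conj, Cminus_conj, Cconj_conj. reflexivity.
Qed.

Lemma dz_order_factor H L G a : zero_factor H L G -> in_box H a -> dz_order a (count_occ Ceq_dec L a).
Proof.
intros HF Ha. destruct (zero_order H L G a HF Ha) as [g [E [Hg [Hd _]]]]. exists g. split; [exact Hg|].
split; [apply cdiff_ccont, Hd, Ha|]. apply filter_forall. exact E.
Qed.

Lemma locally_neq (a b : C) : a <> b -> locally a (fun z => z <> b).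
Proof.
intros H. apply locally_C_iff. exists (Cmod (a - b)). split; [apply Cmod_gt_0, Cminus_neq_0, H|]. intros w Hw ->. rewrite Cmod_minus_sym in Hw. lra.
Qed.

Lemma zeta_order_dz (a : C) m : a <> 1 -> is_zero_of_order zeta a m -> dz_order a m.
Proof.
intros Ha [g [G1 G2]]. exists (fun z => (z - 1) * g z)%C. split; [|split].
- apply Cmult_neq_0; [apply Cminus_neq_0, Ha|exact G1].
- apply ccont_mult; [apply ccont_sub_id|]. destruct (locally_singleton _ _ G2) as [D _]. apply C_differentiable_iff in D. apply cdiff_ccont, D.
- generalize (filter_and _ _ G2 (locally_neq a 1 Ha)). apply filter_imp. intros z [[_ E] Hz]. rewrite Dz_zetaE, <- zeta_eq, E by exact Hz. ring.
Qed.

Section ZeroLists.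
Hypothesis RH : riemann_hypothesis.

Lemma zero_in_box H a : 0 < Re a -> Dz a = 0 -> Rabs (Im a) <= H -> in_box H a.
Proof. intros H1 H2 H3. pose proof (RH_Dz RH a H1 H2) as E. split; [rewrite E; lra|exact H3]. Qed.

Definition in_upper (T : R) (a : C) : bool := if Rlt_dec 0 (Im a) then if Rle_dec (Im a) T then true else false else false.
Definition in_lower (T : R) (a : C) : bool := in_upper T (Cconj a).

Lemma in_upper_spec T a : in_upper T a = true <-> 0 < Im a <= T.
Proof.
unfold in_upper. destruct (Rlt_dec 0 (Im a)); [destruct (Rle_dec (Im a) T)|]; split; intros; try reflexivity; try discriminate; lra.
Qed.

Lemma count_occ_filter (p : C -> bool) L a : count_occ Ceq_dec (filter p L) a = if p a then count_occ Ceq_dec L a else O.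
Proof.
induction L as [|b L IH]; simpl; [destruct (p a); reflexivity|].
destruct (p b) eqn:Eb; simpl; destruct (Ceq_dec b a) as [->|Hn]; rewrite ?IH, ?Eb; try reflexivity; destruct (p a); congruence.
Qed.

(** [zero_list] is a choice, so a list must be exhibited before anything is known about it. RH
    places all zeros up to height T in the box of a factorisation, whose list then carries the right
    multiplicities. *)
Lemma zero_list_exists T : 0 <= T -> exists l, is_zero_list T l.
Proof.
intros HT. destruct (zero_factor_exists (T + 1) ltac:(lra)) as [L [G HF]]. exists (filter (in_upper T) L).
intros rho. split.
- intros [H1 H2]. rewrite count_occ_filter. rewrite (proj2 (in_upper_spec T rho) H2).
  pose proof (proj1 (Dz_zero_iff rho) H1) as [HR HD].
  assert (Hb : in_box (T + 1) rho) by (apply zero_in_box; try assumption; rewrite Rabs_pos_eq; lra).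
  destruct (zero_order _ L G rho HF Hb) as [g [E [Hg [Hd _]]]].
  assert (Hn : rho <> 1) by (intros ->; destruct H1 as [H1 _]; simpl in H1; lra).
  exists (fun z => g z / (z - 1))%C. split.
  + apply Cmult_neq_0; [exact Hg|]. intro E0. apply C1_nz. rewrite <- (Cinv_r (rho - 1)) by (apply Cminus_neq_0, Hn). rewrite E0. ring.
  + assert (Hloc : locally rho (in_box (T + 1))).
    { pose proof (RH_Dz RH rho HR HD) as ER. apply locally_C_iff. exists (/ 10). split; [lra|]. intros w Hw.
      pose proof (re_le_Cmod (w - rho)) as B1. pose proof (im_le_Cmod (w - rho)) as B2. apply Rabs_le_between in B1. apply Rabs_le_between in B2.
      unfold Cminus in B1, B2. rewrite re_plus, re_opp in B1. rewrite im_plus, im_opp in B2. fold (w - rho)%C in B1, B2.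
      split; [lra|]. apply Rabs_le. lra. }
    generalize (filter_and _ _ Hloc (locally_neq rho 1 Hn)). apply filter_imp. intros z [Hz1 Hz2]. split.
    * apply C_differentiable_iff. apply cdiff_div; [apply Hd, Hz1|apply cdiff_sub_id|apply Cminus_neq_0, Hz2].
    * rewrite zeta_eq by exact Hz2. pose proof (Cminus_neq_0 _ _ Hz2) as Hz3.
      transitivity (Dz z / (z - 1))%C; [rewrite Dz_zetaE by exact Hz2; field; exact Hz3|]. rewrite E. field. exact Hz3.
- intros Hno Hin. apply Hno. rewrite filter_In in Hin. destruct Hin as [H1 H2]. apply in_upper_spec in H2.
  destruct (proj1 HF rho H1) as [A B]. split; [apply Dz_zero_iff; tauto|exact H2].
Qed.

Lemma zero_list_spec T : 0 <= T -> is_zero_list T (zero_list T).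
Proof. intros HT. unfold zero_list. apply epsilon_spec, zero_list_exists, HT. Qed.

Lemma zero_list_In T a : 0 <= T -> In a (zero_list T) -> a = (1 / 2, Im a) /\ 0 < Im a <= T /\ Dz a = 0.
Proof.
intros HT Ha. destruct (zero_list_spec T HT a) as [_ H].
assert (Hz : nontrivial_zero a /\ 0 < Im a <= T) by (apply NNPP; intros Hn; exact (H Hn Ha)).
destruct Hz as [H1 H2]. split; [|split; [exact H2|apply Dz_zero_iff, H1]]. pose proof (RH a H1) as E. rewrite <- E. destruct a; reflexivity.
Qed.

(** Both lists give every point its order of vanishing, and the order is unique; hence sums over
    [zero_list] can be exchanged for sums over the list of any factorisation that reaches height
    T. *)
Lemma zero_list_perm H L G T : zero_factor H L G -> 0 <= T -> T <= H -> Permutation (filter (in_upper T) L) (zero_list T).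
Proof.
intros HF HT HTH. apply (Permutation_count_occ Ceq_dec). intros a. rewrite count_occ_filter.
destruct (zero_list_spec T HT a) as [S1 S2].
destruct (in_upper T a) eqn:Eu.
- apply in_upper_spec in Eu. destruct (classic (nontrivial_zero a)) as [Hz|Hz].
  + pose proof (proj1 (Dz_zero_iff a) Hz) as [HR HD].
    apply (dz_order_unique a).
    * apply (dz_order_factor H L G a HF). apply zero_in_box; try assumption. rewrite Rabs_pos_eq; lra.
    * apply zeta_order_dz; [intros ->; destruct Hz as [Hz _]; simpl in Hz; lra|]. apply S1. tauto.
  + rewrite (proj1 (count_occ_not_In Ceq_dec L a)), (proj1 (count_occ_not_In Ceq_dec (zero_list T) a)); [reflexivity|apply S2; tauto|].
    intros Hin. apply Hz, Dz_zero_iff. destruct (proj1 HF a Hin). tauto.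
- symmetry. apply count_occ_not_In. apply S2. intros [_ Hu]. apply in_upper_spec in Hu. congruence.
Qed.

Lemma Cconj_inj a b : Cconj a = Cconj b -> a = b.
Proof. intros E. rewrite <- (Cconj_conj a), E, Cconj_conj. reflexivity. Qed.

Lemma zero_list_perm_conj H L G T : zero_factor H L G -> 0 <= T -> T <= H -> Permutation (filter (in_lower T) L) (map Cconj (zero_list T)).
Proof.
intros HF HT HTH. apply (Permutation_trans (l' := map Cconj (filter (in_upper T) L))); [|apply Permutation_map, (zero_list_perm H L G T); assumption].
apply (Permutation_count_occ Ceq_dec). intros a. rewrite count_occ_filter.
rewrite <- (Cconj_conj a) at 3. rewrite <- (count_occ_map Cconj Ceq_dec Ceq_dec Cconj_inj), count_occ_filter. unfold in_lower.
destruct (in_upper T (Cconj a)) eqn:Eu; [|reflexivity].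
apply in_upper_spec in Eu. rewrite im_conj in Eu.
destruct (classic (0 < Re a /\ Dz a = 0)) as [[HR HD]|Hz].
- apply (dz_order_unique a).
  + apply (dz_order_factor H L G a HF). apply zero_in_box; try assumption. rewrite <- Rabs_Ropp, Rabs_pos_eq; lra.
  + rewrite <- (Cconj_conj a) at 1. apply dz_order_conj; [rewrite re_conj; exact HR|]. apply (dz_order_factor H L G _ HF).
    apply zero_in_box; [rewrite re_conj; exact HR|rewrite Dz_conj, HD by exact HR; apply Cconj_RtoC|rewrite im_conj, Rabs_pos_eq; lra].
- rewrite (proj1 (count_occ_not_In Ceq_dec L a)), (proj1 (count_occ_not_In Ceq_dec L (Cconj a))); [reflexivity| |].
  + intros Hin. destruct (proj1 HF _ Hin) as [A B]. rewrite re_conj in B. rewrite Dz_conj in A by exact B. apply Hz. split; [exact B|].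
    rewrite <- (Cconj_conj (Dz a)), A. apply Cconj_RtoC.
  + intros Hin. destruct (proj1 HF _ Hin). tauto.
Qed.

(** * Ordinates of the zeros and their local density *)

Definition gam (T : R) : list R := map Im (zero_list T).

Lemma gam_range T g : 0 <= T -> In g (gam T) -> 0 < g <= T.
Proof. intros HT Hg. unfold gam in Hg. apply in_map_iff in Hg. destruct Hg as [a [<- Ha]]. apply (zero_list_In T a HT Ha). Qed.

Lemma zero_list_gam T : 0 <= T -> zero_list T = map (fun g => (1 / 2, g) : C) (gam T).
Proof.
intros HT. unfold gam. rewrite map_map. rewrite <- map_id at 1. apply map_ext_in. intros a Ha. apply (zero_list_In T a HT Ha).
Qed.

Definition leb_R (u g : R) : bool := if Rle_dec g u then true else false.

Lemma filter_map_comm {A B} (f : A -> B) (p : B -> bool) l : filter p (map f l) = map f (filter (fun x => p (f x)) l).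
Proof. induction l as [|a l IH]; simpl; [reflexivity|]. destruct (p (f a)); simpl; rewrite IH; reflexivity. Qed.

Lemma filter_filter {A} (p q : A -> bool) l : filter p (filter q l) = filter (fun x => andb (q x) (p x)) l.
Proof. induction l as [|a l IH]; simpl; [reflexivity|]. destruct (q a); simpl; [destruct (p a)|]; rewrite ?IH; reflexivity. Qed.

Lemma Permutation_filter {A} (p : A -> bool) l l' : Permutation l l' -> Permutation (filter p l) (filter p l').
Proof.
intros H. induction H; simpl.
- apply perm_nil.
- destruct (p x); [apply perm_skip|]; assumption.
- destruct (p x), (p y); try apply Permutation_refl. apply perm_swap.
- eapply Permutation_trans; eassumption.
Qed.

(** The lists for different heights are independent choices, so they are related only up to order;
    both are compared with the list of one factorisation. *)
Lemma gam_nested u T : 0 <= u <= T -> Permutation (gam u) (filter (leb_R u) (gam T)).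
Proof.
intros Hu. destruct (zero_factor_exists T ltac:(lra)) as [L [G HF]].
unfold gam. rewrite filter_map_comm. apply Permutation_map.
eapply Permutation_trans; [apply Permutation_sym, (zero_list_perm T L G u HF); lra|].
eapply Permutation_trans; [|apply Permutation_filter, (zero_list_perm T L G T HF); lra].
rewrite filter_filter. replace (filter (in_upper u) L) with (filter (fun x => andb (in_upper T x) (leb_R u (Im x))) L); [apply Permutation_refl|].
apply filter_ext. intros a. unfold in_upper, leb_R. destruct (Rlt_dec 0 (Im a)); [|reflexivity].
destruct (Rle_dec (Im a) T), (Rle_dec (Im a) u); simpl; try reflexivity; lra.
Qed.

Definition window (k : R) (g : R) : bool := if Rlt_dec k g then if Rle_dec g (k + 1) then true else false else false.

Lemma window_spec k g : window k g = true <-> k < g <= k + 1.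
Proof. unfold window. destruct (Rlt_dec k g); [destruct (Rle_dec g (k + 1))|]; split; intros; try reflexivity; try discriminate; lra. Qed.

Lemma near_zeros_contains H L G t a : zero_factor H L G -> In a L -> Rabs (Im a - t) <= 9 / 10 -> In a (near_zeros t L).
Proof.
intros HF Ha Ht. apply near_zeros_In. split; [exact Ha|]. destruct (proj1 HF a Ha) as [HD HR]. pose proof (RH_Dz RH a HR HD) as E.
unfold Cmod. rewrite <- (sqrt_pow2 (9 / 5)) by lra. apply sqrt_le_1_alt. simpl. unfold Re, Im in *. rewrite E.
assert (B : (snd a - t) * (snd a - t) <= 9 / 10 * (9 / 10)).
{ replace ((snd a - t) * (snd a - t)) with (Rabs (snd a - t) * Rabs (snd a - t)) by (rewrite <- Rabs_mult, Rabs_pos_eq; [reflexivity|apply Rle_0_sqr]).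
  apply Rmult_le_compat; try apply Rabs_pos; assumption. }
unfold Rminus in B. lra.
Qed.

Lemma filter_length_le {A} (p q : A -> bool) l : (forall x, In x l -> p x = true -> q x = true) -> (length (filter p l) <= length (filter q l))%nat.
Proof.
induction l as [|a l IH]; simpl; intros H; [lia|]. specialize (IH (fun x Hx => H x (or_intror Hx))).
destruct (p a) eqn:Ep; [rewrite (H a (or_introl eq_refl) Ep); simpl; lia|]. destruct (q a); simpl; lia.
Qed.

(** Zeros with ordinate in a unit window lie vertically within 1/2 of its midpoint t; being on the
    critical line they are then within 9/5 of 2 + it, so [local_zeros] counts them. *)
Lemma window_count T k : 0 <= T -> 0 <= k -> INR (length (filter (window k) (gam T))) <= Kloc * ln (k + 6).
Proof.
intros HT Hk. set (t := k + / 2). destruct (zero_factor_exists (T + t + 2) ltac:(unfold t; lra)) as [L [G HF]].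
destruct (local_zeros _ L G t HF) as [B _]; [rewrite Rabs_pos_eq; unfold t; lra|].
eapply Rle_trans; [|eapply Rle_trans; [exact B|]].
- apply le_INR. unfold gam. rewrite filter_map_comm, length_map.
  assert (P : Permutation (filter (in_upper T) L) (zero_list T)) by (apply (zero_list_perm _ L G T HF); unfold t; lra).
  rewrite <- (Permutation_length (Permutation_filter (fun x => window k (Im x)) _ _ P)), filter_filter.
  apply filter_length_le. intros a Ha Hp. apply andb_prop in Hp. destruct Hp as [_ Hp]. apply window_spec in Hp.
  assert (Hn : In a (near_zeros t L)) by (apply (near_zeros_contains _ L G t a HF Ha); apply Rabs_le; unfold t; lra).
  apply near_zeros_In in Hn. destruct (Rle_dec (Cmod (a - (2, t))) (9 / 5)); [reflexivity|tauto].
- apply Rmult_le_compat_l; [left; apply Kloc_facts|]. apply ln_le; [pose proof (Rabs_pos t); lra|]. rewrite Rabs_pos_eq; unfold t; lra.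
Qed.
End ZeroLists.

(** * Sums over ordinates, one unit window at a time *)

Lemma window_sum (f : R -> R) (k0 : R) (ck Fk : nat -> R) (n : nat) : forall l,
  (forall g, In g l -> k0 < g <= k0 + INR n) ->
  (forall k, (k < n)%nat -> 0 <= Fk k) ->
  (forall k g, (k < n)%nat -> k0 + INR k < g <= k0 + INR k + 1 -> f g <= Fk k) ->
  (forall k, (k < n)%nat -> INR (length (filter (window (k0 + INR k)) l)) <= ck k) ->
  sumR f l <= rsum (fun k => ck k * Fk k) n.
Proof.
induction n as [|n IH]; intros l Hl HF Hf Hc.
- destruct l as [|g l]; [simpl; lra|]. exfalso. specialize (Hl g (or_introl eq_refl)). simpl in Hl. lra.
- rewrite (sumR_partition f (leb_R (k0 + INR n)) l). simpl rsum. apply Rplus_le_compat.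
  + apply IH.
    * intros g Hg. apply filter_In in Hg. destruct Hg as [H1 H2]. specialize (Hl g H1). unfold leb_R in H2. destruct (Rle_dec g (k0 + INR n)); [lra|discriminate].
    * intros; apply HF; lia.
    * intros; apply Hf; [lia|assumption].
    * intros k Hk. eapply Rle_trans; [|apply (Hc k); lia]. apply le_INR. rewrite filter_filter.
      apply filter_length_le. intros g _ Hp. apply andb_prop in Hp. tauto.
  + apply Rle_trans with (sumR (fun _ => Fk n) (filter (fun a => negb (leb_R (k0 + INR n) a)) l)).
    * apply sumR_le. intros g Hg. apply filter_In in Hg. destruct Hg as [H1 H2]. specialize (Hl g H1). rewrite S_INR in Hl. unfold leb_R in H2.
      apply Hf; [lia|]. destruct (Rle_dec g (k0 + INR n)); [discriminate|lra].
    * rewrite sumR_const. apply Rmult_le_compat_r; [apply HF; lia|]. eapply Rle_trans; [|apply (Hc n); lia]. apply le_INR.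
      apply filter_length_le. intros g Hg Hp. apply window_spec. specialize (Hl g Hg). rewrite S_INR in Hl. unfold leb_R in Hp. destruct (Rle_dec g (k0 + INR n)); [discriminate|lra].
Qed.

Lemma nat_ceil (T : R) : 0 <= T -> exists n : nat, T <= INR n <= T + 1.
Proof.
intros HT. exists (Z.to_nat (up T)). destruct (archimed T) as [H1 H2].
rewrite INR_IZR_INZ, Z2Nat.id; [lra|]. apply le_IZR. lra.
Qed.

Lemma nat_floor (T : R) : 1 <= T -> exists n : nat, (1 <= n)%nat /\ INR n <= T < INR n + 1.
Proof.
intros HT. destruct (archimed T) as [H1 H2]. exists (Z.to_nat (up T - 1)).
assert (Hz : (1 <= up T - 1)%Z). { assert (1 < up T)%Z by (apply lt_IZR; lra). lia. }
split; [lia|]. rewrite INR_IZR_INZ, Z2Nat.id by lia. rewrite minus_IZR. lra.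
Qed.

Lemma ln_nonneg x : 1 <= x -> 0 <= ln x.
Proof. intros H. rewrite <- ln_1. apply ln_le; lra. Qed.

Lemma exp_ln_minus (a b : R) : 0 < a -> 0 < b -> exp (ln a - ln b) = a / b.
Proof. intros Ha Hb. unfold Rminus. rewrite exp_plus, exp_Ropp, !exp_ln by assumption. reflexivity. Qed.

Lemma harmonic_bound n : rsum (fun k => / (1 + INR k)) (S n) <= 1 + ln (INR (S n)).
Proof.
induction n as [|n IH]; [simpl; rewrite ln_1; lra|].
change (rsum (fun k => / (1 + INR k)) (S (S n))) with (rsum (fun k => / (1 + INR k)) (S n) + / (1 + INR (S n))).
assert (Hn : 0 < INR (S n)) by (apply lt_0_INR; lia).
assert (H : / (1 + INR (S n)) <= ln (INR (S (S n))) - ln (INR (S n))).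
{ pose proof (exp_ineq1_le (ln (INR (S n)) - ln (INR (S (S n))))) as E. rewrite exp_ln_minus in E by (apply lt_0_INR; lia).
  replace (INR (S n) / INR (S (S n))) with (1 - / (1 + INR (S n))) in E by (rewrite (S_INR (S n)); field; lra). lra. }
lra.
Qed.

Lemma ln_shift_le (u : R) : 2 <= u -> ln (u + 7) <= 4 * ln u.
Proof.
intros Hu. replace (4 * ln u) with (INR 4 * ln u) by (simpl; ring). rewrite <- ln_pow by lra. apply ln_le; [lra|].
assert (4 <= u ^ 2) by nra. replace (u ^ 4) with (u ^ 2 * u ^ 2) by ring. nra.
Qed.

(** Discrete form of the fact that -(log x + 1)/x is a primitive of log x / x^2; the factor 2
    absorbs the shift by 6 and the step from k to k + 1. *)
Lemma tail_step (k : nat) : (1 <= k)%nat ->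
  ln (INR k + 6) * / INR k ^ 2 <= 2 * ((ln (INR k + 6) + 1) / INR k) - 2 * ((ln (INR (S k) + 6) + 1) / INR (S k)).
Proof.
intros Hk. rewrite S_INR. set (x := INR k). assert (Hx : 1 <= x) by (apply (le_INR 1); exact Hk).
set (L := ln (x + 6)). set (L' := ln (x + 1 + 6)).
assert (HL : 0 <= L) by (apply ln_nonneg; lra).
assert (HL' : L' - L <= / x).
{ pose proof (exp_ineq1_le (L' - L)) as E. unfold L, L' in E. rewrite exp_ln_minus in E by lra.
  replace ((x + 1 + 6) / (x + 6)) with (1 + / (x + 6)) in E by (field; lra). fold L L' in E.
  assert (/ (x + 6) <= / x) by (apply Rinv_le_contravar; lra). lra. }
apply Rmult_le_reg_r with (x ^ 2 * (x + 1)); [apply Rmult_lt_0_compat; [apply pow_lt|]; lra|].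
replace (L * / x ^ 2 * (x ^ 2 * (x + 1))) with (L * (x + 1)) by (field; lra).
replace ((2 * ((L + 1) / x) - 2 * ((L' + 1) / (x + 1))) * (x ^ 2 * (x + 1))) with (2 * x * (L + 1) - 2 * x * (x * (L' - L))) by (field; lra).
assert (x * (L' - L) <= 1). { apply Rmult_le_reg_l with (/ x); [apply Rinv_0_lt_compat; lra|]. rewrite <- Rmult_assoc, Rinv_l, Rmult_1_l, Rmult_1_r by lra. exact HL'. }
nra.
Qed.

Section ZeroCounting.
Hypothesis RH : riemann_hypothesis.

Lemma gam_count T : 2 <= T -> INR (length (gam T)) <= 8 * Kloc * (T * ln T).
Proof.
intros HT. destruct (nat_ceil T) as [n [Hn1 Hn2]]; [lra|]. pose proof Kloc_facts as [_ HK].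
assert (HlT : 0 <= ln T) by (apply ln_nonneg; lra).
pose proof (window_sum (fun _ => 1) 0 (fun k => Kloc * ln (INR k + 6)) (fun _ => 1) n (gam T)) as W.
rewrite sumR_const, Rmult_1_r in W. eapply Rle_trans; [apply W|].
- intros g Hg. pose proof (gam_range RH T g ltac:(lra) Hg). lra.
- intros; lra.
- intros; lra.
- intros k Hk. rewrite Rplus_0_l. apply window_count; [exact RH|lra|apply pos_INR].
- apply Rle_trans with (rsum (fun _ => Kloc * (4 * ln T)) n).
  + apply rsum_le. intros k Hk. rewrite Rmult_1_r. apply Rmult_le_compat_l; [lra|]. eapply Rle_trans; [|apply ln_shift_le; lra].
    apply ln_le; [pose proof (pos_INR k); lra|]. apply lt_INR in Hk. lra.
  + replace (rsum (fun _ => Kloc * (4 * ln T)) n) with (INR n * (Kloc * (4 * ln T))).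
    * assert (INR n <= 2 * T) by lra. assert (0 <= Kloc * (4 * ln T)) by (apply Rmult_le_pos; lra).
      apply Rle_trans with (2 * T * (Kloc * (4 * ln T))); [apply Rmult_le_compat_r; assumption|right; ring].
    * clear. induction n as [|n IH]; [simpl; ring|]. rewrite S_INR. simpl rsum. rewrite <- IH. ring.
Qed.

(** O(log T) zeros per window against the harmonic series. The resulting square of a logarithm
    becomes (log x)^a at height [U0]. *)
Lemma gam_recip_sum T : 2 <= T -> sumR (fun g => / (1 + g)) (gam T) <= 16 * Kloc * ln T ^ 2.
Proof.
intros HT. destruct (nat_ceil T) as [[|n] [Hn1 Hn2]]; [lra|simpl in Hn1; lra|]. pose proof Kloc_facts as [_ HK].
assert (HlT : 0 <= ln T) by (apply ln_nonneg; lra).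
eapply Rle_trans; [apply (window_sum (fun g => / (1 + g)) 0 (fun k => Kloc * ln (INR k + 6)) (fun k => / (1 + INR k)) (S n) (gam T))|].
- intros g Hg. pose proof (gam_range RH T g ltac:(lra) Hg). lra.
- intros k _. left. apply Rinv_0_lt_compat. pose proof (pos_INR k). lra.
- intros k g _ Hg. apply Rinv_le_contravar; pose proof (pos_INR k); lra.
- intros k Hk. rewrite Rplus_0_l. apply window_count; [exact RH|lra|apply pos_INR].
- apply Rle_trans with (rsum (fun k => Kloc * (4 * ln T) * / (1 + INR k)) (S n)).
  + apply rsum_le. intros k Hk. apply Rmult_le_compat_r; [left; apply Rinv_0_lt_compat; pose proof (pos_INR k); lra|].
    apply Rmult_le_compat_l; [lra|]. eapply Rle_trans; [|apply ln_shift_le; lra].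
    apply ln_le; [pose proof (pos_INR k); lra|]. apply lt_INR in Hk. lra.
  + rewrite rsum_scal.
    assert (Hh : rsum (fun k => / (1 + INR k)) (S n) <= 4 * ln T).
    { eapply Rle_trans; [apply harmonic_bound|].
      assert (A : ln (INR (S n)) <= 2 * ln T).
      { replace (2 * ln T) with (INR 2 * ln T) by (simpl; ring). rewrite <- ln_pow by lra. apply ln_le; [apply lt_0_INR; lia|]. nra. }
      assert (B : ln 2 <= ln T) by (apply ln_le; lra). pose proof ln_lt_2. lra. }
    replace (16 * Kloc * ln T ^ 2) with (Kloc * (4 * ln T) * (4 * ln T)) by ring.
    apply Rmult_le_compat_l; [apply Rmult_le_pos; lra|exact Hh].
Qed.

Lemma gam_tail_sum (U T : R) : 2 <= U -> U <= T ->
  sumR (fun g => / g ^ 2) (filter (fun g => negb (leb_R U g)) (gam T)) <= 24 * Kloc * (ln U / U).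
Proof.
intros HU HUT. pose proof Kloc_facts as [_ HK].
destruct (nat_floor U) as [m [Hm [Hm1 Hm2]]]; [lra|]. destruct (nat_ceil T) as [N [HN1 HN2]]; [lra|].
assert (Hmp : 1 <= INR m) by (apply (le_INR 1); exact Hm).
assert (HlU : / 2 < ln U). { eapply Rlt_le_trans; [exact ln_lt_2|]. apply ln_le; lra. }
eapply Rle_trans; [apply (window_sum (fun g => / g ^ 2) (INR m) (fun k => Kloc * ln (INR (m + k) + 6)) (fun k => / INR (m + k) ^ 2) N)|].
- intros g Hg. apply filter_In in Hg. destruct Hg as [H1 H2]. pose proof (gam_range RH T g ltac:(lra) H1).
  unfold leb_R in H2. destruct (Rle_dec g U); [discriminate|]. lra.
- intros k _. left. apply Rinv_0_lt_compat, pow_lt, lt_0_INR. lia.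
- intros k g _ Hg. rewrite plus_INR in *. pose proof (pos_INR k). apply Rinv_le_contravar; [apply pow_lt; lra|apply pow_incr; lra].
- intros k Hk. rewrite plus_INR. eapply Rle_trans; [|apply (window_count RH T (INR m + INR k)); [lra|pose proof (pos_INR k); lra]].
  apply le_INR. rewrite filter_filter. apply filter_length_le. intros g _ Hp. apply andb_prop in Hp. tauto.
- apply Rle_trans with (rsum (fun k => (- Kloc) * (2 * ((ln (INR (m + S k) + 6) + 1) / INR (m + S k)) - 2 * ((ln (INR (m + k) + 6) + 1) / INR (m + k)))) N).
  + apply rsum_le. intros k _. pose proof (tail_step (m + k) ltac:(lia)) as TS. rewrite Nat.add_succ_r.
    replace (Kloc * ln (INR (m + k) + 6) * / INR (m + k) ^ 2) with (Kloc * (ln (INR (m + k) + 6) * / INR (m + k) ^ 2)) by ring.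
    eapply Rle_trans; [apply Rmult_le_compat_l; [lra|exact TS]|]. right; ring.
  + rewrite rsum_scal, (rsum_telescope (fun k => 2 * ((ln (INR (m + k) + 6) + 1) / INR (m + k)))). rewrite Nat.add_0_r.
    assert (P : 0 <= (ln (INR (m + N) + 6) + 1) / INR (m + N)).
    { apply Rdiv_le_0_compat; [|apply lt_0_INR; lia]. assert (0 <= ln (INR (m + N) + 6)) by (apply ln_nonneg; pose proof (pos_INR (m + N)); lra). lra. }
    apply Rle_trans with (Kloc * (2 * ((ln (INR m + 6) + 1) / INR m))); [nra|].
    replace (24 * Kloc * (ln U / U)) with (Kloc * (2 * (12 * (ln U / U)))) by ring.
    apply Rmult_le_compat_l; [lra|]. apply Rmult_le_compat_l; [lra|].
    assert (A : ln (INR m + 6) + 1 <= 6 * ln U).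
    { assert (ln (INR m + 6) <= ln (U + 7)) by (apply ln_le; lra). pose proof (ln_shift_le U HU). lra. }
    assert (B : / INR m <= 2 / U). { apply Rle_div_r; [lra|]. apply Rmult_le_reg_l with (INR m); [lra|]. rewrite <- Rmult_assoc, Rinv_r by lra. lra. }
    unfold Rdiv. apply Rle_trans with (6 * ln U * (2 / U)); [apply Rmult_le_compat; [|left; apply Rinv_0_lt_compat; lra|exact A|exact B]|right; field; lra].
    assert (0 <= ln (INR m + 6)) by (apply ln_nonneg; lra). lra.
Qed.
End ZeroCounting.

(** * Perron's formula for the integral of psi *)

(** Integrands with poles inside the rectangle are continuous only on its boundary, so the linearity
    rules for [RI] are restated with hypotheses there. *)
Definition on_bd (a b c d : R) (z : C) : Prop :=
  inrect a b c d z /\ (Re z = a \/ Re z = b \/ Im z = c \/ Im z = d).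

Definition cont_bd (f : C -> C) a b c d := forall z, on_bd a b c d z -> ccont f z.

Ltac bd_cont Hf := intros ? ?; first [apply ccont_hline | apply ccont_vline]; apply Hf;
  unfold on_bd, inrect in *; simpl in *; unfold Rmin, Rmax in *; repeat destruct Rle_dec; intuition lra.

Lemma RI_plus_bd f g a b c d : cont_bd f a b c d -> cont_bd g a b c d ->
  RI (fun z => f z + g z)%C a b c d = (RI f a b c d + RI g a b c d)%C.
Proof.
intros Hf Hg. unfold RI. rewrite !CInt_plus; [ring|..]; first [bd_cont Hf|bd_cont Hg].
Qed.

Lemma RI_scal_bd k f a b c d : cont_bd f a b c d -> RI (fun z => k * f z)%C a b c d = (k * RI f a b c d)%C.
Proof. intros Hf. unfold RI. rewrite !CInt_scal; [ring|..]; bd_cont Hf. Qed.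

Lemma RI_ext_bd f g a b c d : (forall z, on_bd a b c d z -> f z = g z) -> RI f a b c d = RI g a b c d.
Proof.
intros H. unfold RI.
rewrite (CInt_ext (fun x => f (x, c)) (fun x => g (x, c)) a b), (CInt_ext (fun x => f (x, d)) (fun x => g (x, d)) a b),
  (CInt_ext (fun y => f (a, y)) (fun y => g (a, y)) c d), (CInt_ext (fun y => f (b, y)) (fun y => g (b, y)) c d);
  [reflexivity| | | |]; intros; apply H;
unfold on_bd, inrect in *; simpl in *; unfold Rmin, Rmax in *; repeat destruct Rle_dec; intuition lra.
Qed.

Lemma RI_minus_bd f g a b c d : cont_bd f a b c d -> cont_bd g a b c d ->
  RI (fun z => f z - g z)%C a b c d = (RI f a b c d - RI g a b c d)%C.
Proof.
intros Hf Hg. rewrite (RI_ext_bd _ (fun z => f z + (- (1)) * g z)%C) by (intros; ring).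
rewrite RI_plus_bd, RI_scal_bd; [ring|exact Hg|exact Hf|]. intros z Hz. apply ccont_mult; [apply ccont_const|apply Hg, Hz].
Qed.

Lemma le_div_of_mul (p q r : R) : 0 < r -> p * r <= q -> p <= q / r.
Proof. intros Hr H. apply (proj1 (Rle_div_r p q r Hr)), H. Qed.

Lemma div_le_of_mul (p q r : R) : 0 < r -> p <= q * r -> p / r <= q.
Proof. intros Hr H. apply (proj2 (Rle_div_l p q r Hr)), H. Qed.

Lemma atan_recip_pos (p q : R) : 0 < p -> 0 < q -> atan (p / q) + atan (q / p) = PI / 2.
Proof.
intros Hp Hq. replace (q / p) with (/ (p / q)) by (field; lra). rewrite atan_inv; [ring|]. apply Rdiv_lt_0_compat; assumption.
Qed.

Lemma Cinv_pair (x y : R) : x ^ 2 + y ^ 2 <> 0 -> (/ ((x, y) : C))%C = (x / (x ^ 2 + y ^ 2), - y / (x ^ 2 + y ^ 2)).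
Proof. intros H. reflexivity. Qed.

Lemma recip_hline (a b u y : R) : y <> 0 ->
  CInt (fun x => / (((x - u)%R, y) : C))%C a b = (ln ((b - u) ^ 2 + y ^ 2) / 2 - ln ((a - u) ^ 2 + y ^ 2) / 2, - (atan ((b - u) / y) - atan ((a - u) / y))).
Proof.
intros Hy. assert (Hp : forall x, 0 < (x - u) ^ 2 + y ^ 2) by (intros x; assert (0 < y ^ 2) by (apply pow2_gt_0, Hy); pose proof (pow2_ge_0 (x - u)); lra).
rewrite (CInt_FTC (fun x => (ln ((x - u) ^ 2 + y ^ 2) / 2, - atan ((x - u) / y)) : C)).
- apply C_ext; simpl; ring.
- intros t _. pose proof (Hp t). split.
  + rewrite Cinv_pair by lra. apply (rder_pair (fun x => ln ((x - u) ^ 2 + y ^ 2) / 2) (fun x => - atan ((x - u) / y))).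
    * auto_derive; [simpl in H; lra|]. field. simpl in *; lra.
    * auto_derive; [exact I|]. unfold Rsqr. field. split; [|exact Hy]. simpl in *. lra.
  + apply (ccont_inv (fun x => (x - u, y) : C)); [apply (ccont_pair (fun x : R => x - u) (fun _ => y)); [apply (continuous_minus (fun x : R => x) (fun _ => u)); [apply continuous_id|apply continuous_const]|apply continuous_const]|].
    intros E. apply (f_equal Im) in E. simpl in E. contradiction.
Qed.

Lemma recip_vline (x v c d : R) : x <> 0 ->
  CInt (fun y => / ((x, (y - v)%R) : C))%C c d = (atan ((d - v) / x) - atan ((c - v) / x), - (ln (x ^ 2 + (d - v) ^ 2) / 2 - ln (x ^ 2 + (c - v) ^ 2) / 2)).
Proof.
intros Hx. assert (Hp : forall y, 0 < x ^ 2 + (y - v) ^ 2) by (intros y; assert (0 < x ^ 2) by (apply pow2_gt_0, Hx); pose proof (pow2_ge_0 (y - v)); lra).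
rewrite (CInt_FTC (fun y => (atan ((y - v) / x), - (ln (x ^ 2 + (y - v) ^ 2) / 2)) : C)).
- apply C_ext; simpl; ring.
- intros t _. pose proof (Hp t). split.
  + rewrite Cinv_pair by lra. apply (rder_pair (fun y => atan ((y - v) / x)) (fun y => - (ln (x ^ 2 + (y - v) ^ 2) / 2))).
    * auto_derive; [exact I|]. unfold Rsqr. field. split; [|exact Hx]. simpl in *. lra.
    * auto_derive; [simpl in H; lra|]. field. simpl in *; lra.
  + apply (ccont_inv (fun y => (x, y - v) : C)); [apply (ccont_pair (fun _ : R => x) (fun y => y - v)); [apply continuous_const|apply (continuous_minus (fun y : R => y) (fun _ => v)); [apply continuous_id|apply continuous_const]]|].
    intros E. apply (f_equal Re) in E. simpl in E. contradiction.
Qed.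

(** Direct evaluation with logarithms and arctangents as primitives. The logarithms cancel, and the
    eight arctangents pair up at the four corners, each pair giving PI / 2. *)
Lemma RI_recip a b c d (p : C) : a < Re p < b -> c < Im p < d -> RI (fun z => / (z - p))%C a b c d = (RtoC (2 * PI) * Ci)%C.
Proof.
destruct p as [u v]. simpl. intros [Ha Hb] [Hc Hd].
assert (Eh : forall y, CInt (fun x => / ((x, y) - (u, v)))%C a b = CInt (fun x => / (((x - u)%R, (y - v)%R) : C))%C a b) by reflexivity.
assert (Ev : forall x, CInt (fun y => / ((x, y) - (u, v)))%C c d = CInt (fun y => / (((x - u)%R, (y - v)%R) : C))%C c d) by reflexivity.
unfold RI. rewrite !Eh, !Ev, !recip_hline, !recip_vline by lra.
set (a0 := a - u) in *. set (b0 := b - u) in *. set (c0 := c - v) in *. set (d0 := d - v) in *.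
assert (Ha0 : a0 < 0) by (unfold a0; lra). assert (Hb0 : 0 < b0) by (unfold b0; lra). assert (Hc0 : c0 < 0) by (unfold c0; lra). assert (Hd0 : 0 < d0) by (unfold d0; lra).
pose proof (atan_recip_pos b0 d0 Hb0 Hd0) as E1. pose proof (atan_recip_pos b0 (- c0) Hb0 ltac:(lra)) as E2.
pose proof (atan_recip_pos (- a0) (- c0) ltac:(lra) ltac:(lra)) as E3. pose proof (atan_recip_pos (- a0) d0 ltac:(lra) Hd0) as E4.
replace (b0 / - c0) with (- (b0 / c0)) in E2 by (field; lra). replace (- c0 / b0) with (- (c0 / b0)) in E2 by (field; lra).
replace (- a0 / - c0) with (a0 / c0) in E3 by (field; lra). replace (- c0 / - a0) with (c0 / a0) in E3 by (field; lra).
replace (- a0 / d0) with (- (a0 / d0)) in E4 by (field; lra). replace (d0 / - a0) with (- (d0 / a0)) in E4 by (field; lra).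
rewrite !atan_opp in E2, E4. clearbody a0 b0 c0 d0.
apply C_ext; simpl; lra.
Qed.

Lemma cont_bd_recip a b c d (p : C) : a < Re p < b -> c < Im p < d -> cont_bd (fun z => / (z - p))%C a b c d.
Proof.
intros Ha Hc z [_ Hz]. apply (ccont_inv (fun z => z - p)%C); [apply ccont_sub_id|]. apply Cminus_neq_0. intros ->. lra.
Qed.

Lemma RI_cauchy f a b c d (p : C) : (forall z, inrect a b c d z -> cdiff f z) -> a < Re p < b -> c < Im p < d ->
  RI (fun z => f z / (z - p))%C a b c d = (RtoC (2 * PI) * Ci * f p)%C.
Proof.
intros Hf Ha Hc.
assert (Hp : inrect a b c d p) by (split; rewrite Rmin_left, Rmax_right by lra; lra).
set (g := quot f p (dC f p)).
assert (Cg : forall z, inrect a b c d z -> ccont g z).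
{ intros z Hz. apply quot_cont; [apply dC_cder, Hf, Hp|apply cdiff_ccont, Hf, Hz]. }
assert (E0 : RI g a b c d = 0).
{ apply (goursat_exc g a b c d p Cg). intros z Hz Hn. apply quot_cdiff; [apply Hf, Hz|exact Hn]. }
rewrite (RI_ext_bd _ (fun z => g z + f p * / (z - p))%C).
- pose proof (cont_bd_recip a b c d p Ha Hc) as Cr.
  rewrite RI_plus_bd; [rewrite RI_scal_bd by exact Cr; rewrite E0, (RI_recip a b c d p Ha Hc); ring|intros z [Hz _]; apply Cg, Hz|].
  intros z Hz. apply ccont_mult; [apply ccont_const|exact (Cr z Hz)].
- intros z [_ Hz]. unfold g, quot. destruct (Ceq_dec z p) as [->|Hn]; [exfalso; lra|]. field. apply Cminus_neq_0, Hn.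
Qed.

Lemma RI_outside f a b c d (p : C) : (forall z, inrect a b c d z -> cdiff f z) -> ~ inrect a b c d p ->
  RI (fun z => f z / (z - p))%C a b c d = 0.
Proof.
intros Hf Hp. apply goursat. intros z Hz. apply cdiff_div; [apply Hf, Hz|apply cdiff_sub_id|]. apply Cminus_neq_0. intros ->. contradiction.
Qed.

(* Perron kernel for [psi1], the integral of psi. *)
Definition kx (x : R) (s : C) : C := (Cexp ((s + 1) * RtoC (ln x)) / (s * (s + 1)))%C.
Definition V (f : C -> C) (sigma T : R) : C := CInt (fun t => f (sigma, t)) (- T) T.

Lemma cdiff_power x z : cdiff (fun s => Cexp ((s + 1) * RtoC (ln x)))%C z.
Proof.
apply (cdiff_comp Cexp (fun s => (s + 1) * RtoC (ln x))%C); [|eexists; apply cder_Cexp].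
apply cdiff_mult; [apply cdiff_plus; [apply cdiff_id|apply cdiff_const]|apply cdiff_const].
Qed.

Lemma kx_cdiff x (s : C) : s <> 0 -> (s + 1)%C <> 0 -> cdiff (kx x) s.
Proof.
intros H1 H2. apply cdiff_div; [apply cdiff_power|apply cdiff_mult; [apply cdiff_id|apply cdiff_plus; [apply cdiff_id|apply cdiff_const]]|].
apply Cmult_neq_0; assumption.
Qed.

Lemma kx_Cmod x (s : C) : s <> 0 -> (s + 1)%C <> 0 -> Cmod (kx x s) = exp ((Re s + 1) * ln x) / (Cmod s * Cmod (s + 1)).
Proof.
intros H1 H2. unfold kx. rewrite Cmod_div, Cmod_mult, Cmod_Cexp, re_scal_r, re_plus by (apply Cmult_neq_0; assumption). reflexivity.
Qed.

Lemma kx_bound_im x s T B : 0 < T -> T <= Rabs (Im s) -> exp ((Re s + 1) * ln x) <= B -> Cmod (kx x s) <= B / T ^ 2.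
Proof.
intros HT HI HB. pose proof (im_le_Cmod s) as A1. pose proof (im_le_Cmod (s + 1)) as A2. rewrite im_plus in A2. simpl (Im 1) in A2. rewrite Rplus_0_r in A2.
assert (N1 : s <> 0) by (apply Cmod_gt_0; lra). assert (N2 : (s + 1)%C <> 0) by (apply Cmod_gt_0; lra).
rewrite kx_Cmod by assumption. pose proof (exp_pos ((Re s + 1) * ln x)). unfold Rdiv. apply Rmult_le_compat; [lra|left; apply Rinv_0_lt_compat, Rmult_lt_0_compat; lra|exact HB|].
apply Rinv_le_contravar; [apply pow_lt, HT|]. simpl. rewrite Rmult_1_r. apply Rmult_le_compat; lra.
Qed.

Lemma kx_bound_re x s T B : 1 < T -> T <= Rabs (Re s) -> exp ((Re s + 1) * ln x) <= B -> Cmod (kx x s) <= B / (T * (T - 1)).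
Proof.
intros HT HI HB. pose proof (re_le_Cmod s) as A1. pose proof (re_le_Cmod (s + 1)) as A2. rewrite re_plus in A2. simpl (Re 1) in A2.
assert (A3 : T - 1 <= Rabs (Re s + 1)) by (unfold Rabs in *; repeat destruct Rcase_abs; lra).
assert (N1 : s <> 0) by (apply Cmod_gt_0; lra). assert (N2 : (s + 1)%C <> 0) by (apply Cmod_gt_0; lra).
rewrite kx_Cmod by assumption. pose proof (exp_pos ((Re s + 1) * ln x)). unfold Rdiv. apply Rmult_le_compat; [lra|left; apply Rinv_0_lt_compat, Rmult_lt_0_compat; lra|exact HB|].
apply Rinv_le_contravar; [apply Rmult_lt_0_compat; lra|]. apply Rmult_le_compat; lra.
Qed.

Lemma Cmod_sub3 (p q r s : C) (A B D : R) : s = (p - q + r)%C -> Cmod p <= A -> Cmod q <= B -> Cmod r <= D -> Cmod s <= A + B + D.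
Proof.
intros -> H1 H2 H3. eapply Rle_trans; [apply Cmod_triangle|]. unfold Cminus. pose proof (Cmod_triangle p (- q)). rewrite Cmod_opp in H. lra.
Qed.

(** For y >= 1 the rectangle is closed far to the left, at Re s = -T, and y^(s+1) stays below y^3
    throughout; it encloses the poles at 0 and -1, with residues y and -1. The other three edges are
    small because the kernel decays quadratically. *)
Lemma perron_ge1 y T : 1 <= y -> 3 <= T -> Cmod (V (kx y) 2 T - RtoC (2 * PI * (y - 1))) <= 10 * y ^ 3 / T.
Proof.
intros Hy HT. assert (Hl : 0 <= ln y) by (apply ln_nonneg, Hy).
assert (HE : forall s, Re s <= 2 -> exp ((Re s + 1) * ln y) <= y ^ 3).
{ intros s Hs. replace (y ^ 3) with (exp (3 * ln y)); [apply exp_le; nra|]. replace (3 * ln y) with (INR 3 * ln y) by (simpl; ring). rewrite <- ln_pow, exp_ln by (try apply pow_lt; lra). reflexivity. }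
assert (Hy3 : 0 <= y ^ 3) by (apply pow_le; lra).
set (E := fun s => Cexp ((s + 1) * RtoC (ln y))%C).
assert (ER : RI (kx y) (- T) 2 (- T) T = (RtoC (2 * PI) * Ci * RtoC (y - 1))%C).
{ assert (HEd : forall z, inrect (- T) 2 (- T) T z -> cdiff E z) by (intros; apply cdiff_power).
  pose proof (RI_cauchy E (- T) 2 (- T) T 0 HEd ltac:(simpl; lra) ltac:(simpl; lra)) as R0.
  pose proof (RI_cauchy E (- T) 2 (- T) T (RtoC (- (1))) HEd ltac:(simpl; lra) ltac:(simpl; lra)) as R1.
  rewrite (RI_ext_bd _ (fun z => E z / (z - 0) - E z / (z - RtoC (- (1))))%C).
  - rewrite RI_minus_bd, R0, R1.
    + assert (E0 : E 0 = RtoC y). { unfold E. replace ((0 + 1) * RtoC (ln y))%C with (RtoC (ln y)) by ring. unfold Cexp. simpl. rewrite exp_ln, cos_0, sin_0 by lra. apply C_ext; simpl; ring. }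
      assert (E1 : E (RtoC (- (1))) = 1). { unfold E. replace ((RtoC (- (1)) + 1) * RtoC (ln y))%C with (RtoC 0) by (rewrite RtoC_opp; ring). apply Cexp_0. }
      rewrite E0, E1, RtoC_minus. ring.
    + intros z [_ Hz]. apply ccont_div; [apply cdiff_ccont, cdiff_power|apply ccont_sub_id|]. apply Cminus_neq_0. intros ->. simpl in Hz. lra.
    + intros z [_ Hz]. apply ccont_div; [apply cdiff_ccont, cdiff_power|apply ccont_sub_id|]. apply Cminus_neq_0. intros ->. simpl in Hz. lra.
  - intros z [_ Hz]. unfold kx. fold (E z).
    assert (N1 : z <> 0) by (intros ->; simpl in Hz; lra).
    assert (N2 : (z + 1)%C <> 0). { intros E0. assert (z = RtoC (- (1))) by (transitivity ((z + 1) - 1)%C; [ring|rewrite E0, RtoC_opp; ring]). subst z. simpl in Hz. lra. }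
    rewrite RtoC_opp. field. repeat split; try assumption; try (intros E0; apply N2; rewrite <- E0; ring). }
assert (Cc : forall s : C, (s <> 0) -> ((s + 1)%C <> 0) -> ccont (kx y) s) by (intros; apply cdiff_ccont, kx_cdiff; assumption).
assert (Ch : forall w, Rabs w = T -> ccont_on (fun x => kx y (x, w)) (- T) 2).
{ intros w Hw t _. apply ccont_hline, Cc; intros E0; apply (f_equal Im) in E0; simpl in E0; rewrite ?Rplus_0_r in E0; subst w; rewrite Rabs_R0 in Hw; lra. }
assert (Hh : forall w, Rabs w = T -> Cmod (CInt (fun x => kx y (x, w)) (- T) 2) <= 2 * y ^ 3 / T).
{ intros w Hw. apply Rle_trans with ((2 - - T) * (y ^ 3 / T ^ 2)).
  - apply CInt_bound; [lra|apply Ch, Hw|]. intros t Ht. apply kx_bound_im; [lra|simpl; lra|apply HE; simpl; lra].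
  - apply le_div_of_mul; [lra|]. replace ((2 - - T) * (y ^ 3 / T ^ 2) * T) with (y ^ 3 * ((2 + T) / T)) by (field; lra). rewrite (Rmult_comm 2).
    apply Rmult_le_compat_l; [exact Hy3|]. apply div_le_of_mul; lra. }
assert (Hv : Cmod (CInt (fun t => kx y (- T, t)) (- T) T) <= 3 * y ^ 3 / T).
{ apply Rle_trans with ((T - - T) * (y ^ 3 / (T * (T - 1)))).
  - apply CInt_bound; [lra| |].
    + intros t _. apply ccont_vline, Cc; intros E0; apply (f_equal Re) in E0; simpl in E0; lra.
    + intros t _. apply kx_bound_re; [lra|simpl; rewrite Rabs_Ropp, Rabs_pos_eq; lra|apply HE; simpl; lra].
  - apply le_div_of_mul; [lra|]. replace ((T - - T) * (y ^ 3 / (T * (T - 1))) * T) with (y ^ 3 * (2 * T / (T - 1))) by (field; lra). rewrite (Rmult_comm 3).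
    apply Rmult_le_compat_l; [exact Hy3|]. apply div_le_of_mul; lra. }
pose proof (Hh T (Rabs_pos_eq T ltac:(lra))) as H1. pose proof (Hh (- T) ltac:(rewrite Rabs_Ropp, Rabs_pos_eq; lra)) as H2.
apply Rle_trans with (2 * y ^ 3 / T + 2 * y ^ 3 / T + 3 * y ^ 3 / T).
2:{ unfold Rdiv. assert (0 <= y ^ 3 * / T) by (apply Rmult_le_pos; [exact Hy3|left; apply Rinv_0_lt_compat; lra]). lra. }
apply (Cmod_sub3 (- Ci * CInt (fun x => kx y (x, T)) (- T) 2)%C (- Ci * CInt (fun x => kx y (x, (- T)%R)) (- T) 2)%C (CInt (fun t => kx y (- T, t)) (- T) T)).
- unfold RI in ER. unfold V.
  assert (CC : (Ci * Ci = - (1))%C) by (apply C_ext; simpl; ring).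
  set (h1 := CInt (fun x => kx y (x, - T)) (- T) 2) in *. set (h2 := CInt (fun x => kx y (x, T)) (- T) 2) in *.
  set (v1 := CInt (fun t => kx y (- T, t)) (- T) T) in *. set (v0 := CInt (fun t => kx y (2, t)) (- T) T) in *.
  assert (E2 : (Ci * v0 = RtoC (2 * PI) * Ci * RtoC (y - 1) - h1 + h2 + Ci * v1)%C).
  { rewrite <- ER. ring. }
  rewrite RtoC_mult. transitivity (- (Ci * Ci) * v0 - RtoC (2 * PI) * RtoC (y - 1))%C; [rewrite CC; ring|].
  transitivity (- Ci * (Ci * v0) - RtoC (2 * PI) * RtoC (y - 1))%C; [ring|]. rewrite E2.
  transitivity (- Ci * h2 - - Ci * h1 - (Ci * Ci) * v1 - (Ci * Ci + 1) * (RtoC (2 * PI) * RtoC (y - 1)))%C; [ring|]. rewrite CC. ring.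
- rewrite Cmod_mult, Cmod_opp, Cmod_Ci, Rmult_1_l. exact H1.
- rewrite Cmod_mult, Cmod_opp, Cmod_Ci, Rmult_1_l. exact H2.
- exact Hv.
Qed.

(** For y <= 1 the rectangle is closed to the right, where there are no poles and |y^(s+1)| is at
    most y^3. *)
Lemma perron_lt1 y T : 0 < y <= 1 -> 3 <= T -> Cmod (V (kx y) 2 T) <= 10 * y ^ 3 / T.
Proof.
intros Hy HT. assert (Hl : ln y <= 0) by (rewrite <- ln_1; apply ln_le; lra).
assert (HE : forall s, 2 <= Re s -> exp ((Re s + 1) * ln y) <= y ^ 3).
{ intros s Hs. replace (y ^ 3) with (exp (3 * ln y)); [apply exp_le; nra|]. replace (3 * ln y) with (INR 3 * ln y) by (simpl; ring). rewrite <- ln_pow, exp_ln by (try apply pow_lt; lra). reflexivity. }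
assert (Hy3 : 0 <= y ^ 3) by (apply pow_le; lra).
assert (Cc : forall s, 2 <= Re s -> cdiff (kx y) s).
{ intros s Hs. apply kx_cdiff; intros E0; apply (f_equal Re) in E0; simpl in E0; unfold Re in *; lra. }
assert (ER : RI (kx y) 2 (2 + T) (- T) T = 0).
{ apply goursat. intros z [Hz _]. apply Cc. rewrite Rmin_left in Hz by lra. lra. }
assert (Hh : forall w, Rabs w = T -> Cmod (CInt (fun x => kx y (x, w)) 2 (2 + T)) <= 2 * y ^ 3 / T).
{ intros w Hw. apply Rle_trans with ((2 + T - 2) * (y ^ 3 / T ^ 2)).
  - apply CInt_bound; [lra| |].
    + intros t Ht. rewrite Rmin_left in Ht by lra. apply ccont_hline, cdiff_ccont, Cc. simpl. lra.
    + intros t Ht. apply kx_bound_im; [lra|simpl; lra|apply HE; simpl; lra].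
  - apply le_div_of_mul; [lra|]. replace ((2 + T - 2) * (y ^ 3 / T ^ 2) * T) with (y ^ 3) by (field; lra). lra. }
assert (Hv : Cmod (CInt (fun t => kx y (2 + T, t)) (- T) T) <= 3 * y ^ 3 / T).
{ apply Rle_trans with ((T - - T) * (y ^ 3 / ((2 + T) * (2 + T - 1)))).
  - apply CInt_bound; [lra| |].
    + intros t _. apply ccont_vline, cdiff_ccont, Cc. simpl. lra.
    + intros t _. apply kx_bound_re; [lra|simpl; rewrite Rabs_pos_eq; lra|apply HE; simpl; lra].
  - apply le_div_of_mul; [lra|]. replace ((T - - T) * (y ^ 3 / ((2 + T) * (2 + T - 1))) * T) with (y ^ 3 * (2 * T ^ 2 / ((2 + T) * (1 + T)))) by (field; lra). rewrite (Rmult_comm 3).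
    apply Rmult_le_compat_l; [exact Hy3|]. apply div_le_of_mul; [apply Rmult_lt_0_compat; lra|]. nra. }
pose proof (Hh T (Rabs_pos_eq T ltac:(lra))) as H1. pose proof (Hh (- T) ltac:(rewrite Rabs_Ropp, Rabs_pos_eq; lra)) as H2.
apply Rle_trans with (2 * y ^ 3 / T + 2 * y ^ 3 / T + 3 * y ^ 3 / T).
2:{ unfold Rdiv. assert (0 <= y ^ 3 * / T) by (apply Rmult_le_pos; [exact Hy3|left; apply Rinv_0_lt_compat; lra]). lra. }
apply (Cmod_sub3 (- Ci * CInt (fun x => kx y (x, (- T)%R)) 2 (2 + T))%C (- Ci * CInt (fun x => kx y (x, T)) 2 (2 + T))%C (CInt (fun t => kx y (2 + T, t)) (- T) T)).
- unfold RI in ER. unfold V.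
  assert (CC : (Ci * Ci = - (1))%C) by (apply C_ext; simpl; ring).
  set (h1 := CInt (fun x => kx y (x, - T)) 2 (2 + T)) in *. set (h2 := CInt (fun x => kx y (x, T)) 2 (2 + T)) in *.
  set (v1 := CInt (fun t => kx y (2 + T, t)) (- T) T) in *. set (v0 := CInt (fun t => kx y (2, t)) (- T) T) in *.
  assert (E2 : (Ci * v0 = h1 - h2 + Ci * v1)%C).
  { transitivity ((h1 - h2 + Ci * v1) - (h1 + Ci * v1 - h2 - Ci * v0))%C; [ring|]. rewrite ER. ring. }
  transitivity (- (Ci * Ci) * v0)%C; [rewrite CC; ring|]. transitivity (- Ci * (Ci * v0))%C; [ring|]. rewrite E2.
  transitivity (- Ci * h1 - - Ci * h2 - (Ci * Ci) * v1)%C; [ring|]. rewrite CC. ring.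
- rewrite Cmod_mult, Cmod_opp, Cmod_Ci, Rmult_1_l. exact H2.
- rewrite Cmod_mult, Cmod_opp, Cmod_Ci, Rmult_1_l. exact H1.
- exact Hv.
Qed.

(** * The integral of psi *)

Definition psi1_term (x : R) (k : nat) : R := von_mangoldt (S k) * Rmax 0 (x - INR (S k)).
(** The integral of psi over [0, x]. It is used in place of psi because its Perron kernel decays
    like |s|^(-2); the cut at [up x] only drops zero terms. *)
Definition psi1 (x : R) : R := rsum (psi1_term x) (Z.to_nat (up x)).

Lemma rsum_zero_tail b n m : (n <= m)%nat -> (forall k, (n <= k)%nat -> b k = 0) -> rsum b m = rsum b n.
Proof. intros H Hb. induction H as [|m H IH]; [reflexivity|]. simpl. rewrite IH, Hb by exact H. ring. Qed.

Lemma up_nat_ge x : x <= INR (Z.to_nat (up x)).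
Proof.
destruct (archimed x) as [H _]. rewrite INR_IZR_INZ. assert (IZR (up x) <= IZR (Z.of_nat (Z.to_nat (up x)))) by (apply IZR_le; lia). lra.
Qed.

Lemma psi1_eq x N : x <= INR N -> rsum (psi1_term x) N = psi1 x.
Proof.
intros HN. unfold psi1. set (M := Z.to_nat (up x)).
assert (Z0 : forall P, x <= INR P -> forall k, (P <= k)%nat -> psi1_term x k = 0).
{ intros P HP k Hk. unfold psi1_term. rewrite Rmax_left; [ring|]. apply le_INR in Hk. rewrite S_INR. lra. }
destruct (Nat.le_ge_cases N M) as [h|h].
- symmetry. apply rsum_zero_tail; [exact h|apply Z0, HN].
- apply rsum_zero_tail; [exact h|apply Z0, up_nat_ge].
Qed.

Lemma psi_eq x N : 0 <= x -> x <= INR N -> psi x = rsum (fun k => if Rle_dec (INR (S k)) x then von_mangoldt (S k) else 0) N.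
Proof.
intros Hx HN. unfold psi. destruct (base_Int_part x) as [B1 B2]. set (m := Z.to_nat (Int_part x)).
assert (Hm : INR m <= x < INR m + 1).
{ assert (0 <= Int_part x)%Z. { assert (-1 < Int_part x)%Z by (apply lt_IZR; simpl; lra). lia. }
  unfold m. rewrite INR_IZR_INZ, Z2Nat.id by assumption. lra. }
assert (HmN : (m <= N)%nat). { apply INR_le. lra. }
rewrite (rsum_zero_tail _ m N HmN).
- clearbody m. clear HN HmN B1 B2. assert (V0 : von_mangoldt 0 = 0) by reflexivity.
  assert (G : forall j, (j <= m)%nat -> sum_f_R0 von_mangoldt j = rsum (fun k => if Rle_dec (INR (S k)) x then von_mangoldt (S k) else 0) j).
  { induction j as [|j IH]; intros Hj; [simpl; exact V0|]. cbn [sum_f_R0 rsum]. rewrite IH by lia.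
    destruct (Rle_dec (INR (S j)) x) as [h|h]; [reflexivity|]. exfalso. apply h. apply le_INR in Hj. lra. }
  apply G. lia.
- intros k Hk. destruct (Rle_dec (INR (S k)) x) as [h|h]; [|reflexivity]. apply le_INR in Hk. rewrite S_INR in h. lra.
Qed.

(** The quotient is the mean of psi over [x, x + h], and psi is nondecreasing; termwise the ramp
    max(0, y - n) is compared with the step at n. *)
Lemma psi1_diff x h : 0 <= x -> 0 < h -> psi x <= (psi1 (x + h) - psi1 x) / h <= psi (x + h).
Proof.
intros Hx Hh. set (N := Z.to_nat (up (x + h))). pose proof (up_nat_ge (x + h)) as HN. fold N in HN.
rewrite <- (psi1_eq (x + h) N HN), <- (psi1_eq x N), <- rsum_minus, (psi_eq x N), (psi_eq (x + h) N) by lra.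
split.
- apply le_div_of_mul; [exact Hh|]. rewrite Rmult_comm, <- rsum_scal. apply rsum_le. intros k _. unfold psi1_term.
  pose proof (von_mangoldt_pos (S k)) as V. destruct (Rle_dec (INR (S k)) x) as [a|a].
  + rewrite !Rmax_right by lra. right. ring.
  + rewrite (Rmax_left 0 (x - _)) by lra. pose proof (Rmax_l 0 (x + h - INR (S k))). nra.
- apply div_le_of_mul; [exact Hh|]. rewrite Rmult_comm, <- rsum_scal. apply rsum_le. intros k _. unfold psi1_term.
  pose proof (von_mangoldt_pos (S k)) as V. destruct (Rle_dec (INR (S k)) (x + h)) as [a|a].
  + rewrite (Rmax_right 0 (x + h - _)) by lra. rewrite (Rmult_comm h), <- Rmult_minus_distr_l. apply Rmult_le_compat_l; [exact V|].
    pose proof (Rmax_r 0 (x - INR (S k))). lra.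
  + rewrite !Rmax_left by lra. right. ring.
Qed.

Lemma cdiff_LS s : 1 < Re s -> cdiff LS s.
Proof.
intros Hs. apply (cdiff_ext_loc (fun s => / (s - 1) - dC Dz s / Dz s)%C).
- apply locally_C_iff. exists (Re s - 1). split; [lra|]. intros w Hw.
  assert (Hw1 : 1 < Re w). { pose proof (re_le_Cmod (w - s)) as A. apply Rabs_le_between in A. unfold Cminus in A. rewrite re_plus, re_opp in A. fold (w - s)%C in A. lra. }
  rewrite (Dz_logder w Hw1 (Dz_neq_0_gt1 w Hw1)). ring.
- assert (Hs1 : s <> 1) by (intros ->; simpl in Hs; lra). apply cdiff_minus.
  + eexists. apply (cder_inv (fun s => s - 1)%C); [apply cder_sub_id|apply Cminus_neq_0, Hs1].
  + apply cdiff_div; [|apply Dz_cdiff|apply Dz_neq_0_gt1, Hs]. apply (dC_holo_disc s 1 Dz); [intros z _; apply Dz_cdiff|unfold disc; rewrite Cmod_0_minus; lra].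
Qed.

Lemma kx_line_cdiff x s : 0 < Re s -> cdiff (kx x) s.
Proof.
intros Hs. apply kx_cdiff; intros E; apply (f_equal Re) in E; rewrite ?re_plus in E; simpl in E; unfold Re in *; lra.
Qed.

Lemma kx_scale x n s : 0 < x -> (0 < n)%nat -> (npw n s * kx x s = RtoC (INR n) * kx (x / INR n) s)%C.
Proof.
intros Hx Hn. assert (Hn0 : 0 < INR n) by (apply lt_0_INR, Hn). unfold npw, kx, Cdiv. rewrite !Cmult_assoc. f_equal.
rewrite <- Cexp_plus. assert (E : RtoC (INR n) = Cexp (RtoC (ln (INR n)))).
{ unfold Cexp. simpl. rewrite exp_ln, cos_0, sin_0 by exact Hn0. apply C_ext; simpl; ring. }
rewrite E, <- Cexp_plus. f_equal. rewrite ln_div, RtoC_minus by assumption. ring.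
Qed.

Lemma V_scal k f sg T : (forall t, ccont f (sg, t)) -> V (fun s => k * f s)%C sg T = (k * V f sg T)%C.
Proof. intros Hf. unfold V. apply CInt_scal. intros t _. apply ccont_vline, Hf. Qed.
Lemma V_plus f g sg T : (forall t, ccont f (sg, t)) -> (forall t, ccont g (sg, t)) -> V (fun s => f s + g s)%C sg T = (V f sg T + V g sg T)%C.
Proof. intros Hf Hg. unfold V. apply CInt_plus; intros t _; apply ccont_vline; auto. Qed.
Lemma V_ext f g sg T : (forall t, f (sg, t) = g (sg, t)) -> V f sg T = V g sg T.
Proof. intros H. unfold V. apply CInt_ext. intros; apply H. Qed.
Lemma V_bound f sg T M : 0 <= T -> (forall t, ccont f (sg, t)) -> (forall t, - T <= t <= T -> Cmod (f (sg, t)) <= M) -> Cmod (V f sg T) <= 2 * T * M.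
Proof.
intros HT Hf HM. unfold V. replace (2 * T * M) with ((T - - T) * M) by ring. apply CInt_bound; [lra|intros t _; apply ccont_vline, Hf|exact HM].
Qed.

Lemma npw_cont n s : ccont (npw n) s.
Proof.
unfold npw. apply (ccont_comp (fun s => - s * RtoC (ln (INR n)))%C Cexp); [|apply (cder_ccont _ _ _ (cder_Cexp _))].
apply ccont_mult; [apply ccont_opp, ccont_id|apply ccont_const].
Qed.

Lemma lam_cont k s : ccont (fun s => lam s k) s.
Proof. unfold lam. apply ccont_mult; [apply ccont_const|apply npw_cont]. Qed.

(** Scaling turns the n-th term into n Lambda(n) times the kernel at y = x/n, whose truncation error
    10 y^3 / T becomes 10 x^3 / (T n^2) after the factor n, which is summable against Lambda(n). *)
Lemma V_term x k T : 1 <= x -> 3 <= T ->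
  Cmod (V (fun s => lam s k * kx x s)%C 2 T - RtoC (2 * PI * psi1_term x k)) <= 10 * x ^ 3 / T * (von_mangoldt (S k) * exp (- 2 * ln (INR (S k)))).
Proof.
intros Hx HT. set (n := S k). assert (Hn : 0 < INR n) by (apply lt_0_INR; unfold n; lia).
assert (Hn1 : 1 <= INR n) by (apply (le_INR 1); unfold n; lia).
set (y := x / INR n). assert (Hy : 0 < y) by (apply Rdiv_lt_0_compat; lra).
pose proof (von_mangoldt_pos n) as HV.
assert (Ck : forall t, ccont (kx y) (2, t)) by (intros t; apply cdiff_ccont, kx_line_cdiff; simpl; lra).
assert (E : V (fun s => lam s k * kx x s)%C 2 T = (RtoC (von_mangoldt n * INR n) * V (kx y) 2 T)%C).
{ rewrite <- V_scal by exact Ck. apply V_ext. intros t. unfold lam. fold n. rewrite <- Cmult_assoc, kx_scale by (try lra; unfold n; lia). rewrite RtoC_mult. fold y. ring. }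
assert (Ex : exp (- 2 * ln (INR n)) = / INR n ^ 2).
{ replace (- 2 * ln (INR n)) with (- (INR 2 * ln (INR n))) by (simpl; ring). rewrite exp_Ropp, <- ln_pow, exp_ln by (try apply pow_lt; lra). reflexivity. }
rewrite Ex.
assert (G : forall m, Cmod (V (kx y) 2 T - RtoC (2 * PI * m)) <= 10 * y ^ 3 / T -> psi1_term x k = von_mangoldt n * INR n * m ->
  Cmod (V (fun s => lam s k * kx x s)%C 2 T - RtoC (2 * PI * psi1_term x k)) <= 10 * x ^ 3 / T * (von_mangoldt n * / INR n ^ 2)).
{ intros m Hm Em. rewrite E, Em. replace (RtoC (von_mangoldt n * INR n) * V (kx y) 2 T - RtoC (2 * PI * (von_mangoldt n * INR n * m)))%C with (RtoC (von_mangoldt n * INR n) * (V (kx y) 2 T - RtoC (2 * PI * m)))%C by (rewrite !RtoC_mult; ring).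
  rewrite Cmod_mult, Cmod_R, Rabs_pos_eq by (apply Rmult_le_pos; lra).
  apply Rle_trans with (von_mangoldt n * INR n * (10 * y ^ 3 / T)); [apply Rmult_le_compat_l; [apply Rmult_le_pos; lra|exact Hm]|].
  right. unfold y. field. lra. }
destruct (Rle_dec (INR n) x) as [h|h].
- apply (G (y - 1)).
  + apply perron_ge1; [|exact HT]. unfold y. apply le_div_of_mul; lra.
  + unfold psi1_term. fold n. rewrite Rmax_right by lra. unfold y. field. lra.
- apply (G 0).
  + rewrite Rmult_0_r. replace (V (kx y) 2 T - RtoC 0)%C with (V (kx y) 2 T) by ring. apply perron_lt1; [|exact HT]. split; [exact Hy|]. unfold y. apply div_le_of_mul; lra.
  + unfold psi1_term. fold n. rewrite Rmax_left by lra. ring.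
Qed.

(** On the finite segment the series for [LS] converges uniformly, so sum and integral may be
    exchanged up to e. The constant 60 is 10 times the bound 6 for the sum of Lambda(n) / n^2 that
    [lam_sum_bound] gives at q = 2. *)
Lemma V_LS_kx x T : 1 <= x -> 3 <= T -> Cmod (V (fun s => LS s * kx x s)%C 2 T - RtoC (2 * PI * psi1 x)) <= 60 * x ^ 3 / T.
Proof.
intros Hx HT. set (b := fun k => von_mangoldt (S k) * exp (- 2 * ln (INR (S k)))).
assert (Hb0 : forall k, 0 <= b k) by (intros k; apply Rmult_le_pos; [apply von_mangoldt_pos|left; apply exp_pos]).
assert (Hb6 : forall n, rsum b n <= 6). { intros n. eapply Rle_trans; [apply (lam_sum_bound 2 n); lra|]. right. field. }
destruct (rsum_bounded_cv b 6 Hb0 Hb6) as [l [Hl1 [_ Hl2]]].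
assert (Hx3 : 0 < x ^ 3) by (apply pow_lt; lra).
assert (Ck : forall t, ccont (kx x) (2, t)) by (intros t; apply cdiff_ccont, kx_line_cdiff; simpl; lra).
assert (CL : forall t, ccont LS (2, t)) by (intros t; apply cdiff_ccont, cdiff_LS; simpl; lra).
assert (Cl : forall k t, ccont (fun s => lam s k * kx x s)%C (2, t)) by (intros; apply ccont_mult; [apply lam_cont|apply Ck]).
assert (CS : forall N t, ccont (fun s => csum (lam s) N) (2, t)).
{ induction N as [|N IH]; intros t; [apply (ccont_const (RtoC 0))|]. apply (ccont_plus (fun s => csum (lam s) N) (fun s => lam s N)); [apply IH|apply lam_cont]. }
assert (EN : forall N, V (fun s => csum (lam s) N * kx x s)%C 2 T = csum (fun k => V (fun s => lam s k * kx x s)%C 2 T) N).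
{ induction N as [|N IH].
  - simpl. unfold V. rewrite (CInt_ext _ (fun _ => 0%C)) by (intros; ring). rewrite CInt_const. ring.
  - simpl csum. rewrite <- IH, <- V_plus; [apply V_ext; intros; ring| |apply Cl]. intros t. apply ccont_mult; [apply CS|apply Ck]. }
apply le_epsilon. intros e He.
destruct (Hl2 (e / (2 * T * x ^ 3))) as [N0 HN0]; [apply Rdiv_lt_0_compat; [exact He|apply Rmult_lt_0_compat; lra]|].
set (N := max N0 (Z.to_nat (up x))).
assert (HNx : x <= INR N). { eapply Rle_trans; [apply up_nat_ge|]. apply le_INR. unfold N. lia. }
specialize (HN0 N ltac:(unfold N; lia)).
assert (T1 : Cmod (V (fun s => LS s * kx x s)%C 2 T - V (fun s => csum (lam s) N * kx x s)%C 2 T) <= e).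
{ replace (V (fun s => LS s * kx x s)%C 2 T - V (fun s => csum (lam s) N * kx x s)%C 2 T)%C with (V (fun s => (LS s - csum (lam s) N) * kx x s)%C 2 T).
  2:{ replace (V (fun s => LS s * kx x s)%C 2 T) with (V (fun s => (LS s - csum (lam s) N) * kx x s + csum (lam s) N * kx x s)%C 2 T) by (apply V_ext; intros; ring).
      rewrite V_plus; [ring| |]; intros t; apply ccont_mult; try apply Ck; [apply ccont_minus; [apply CL|apply CS]|apply CS]. }
  apply Rle_trans with (2 * T * (e / (2 * T * x ^ 3) * x ^ 3)).
  - apply V_bound; [lra| |].
    + intros t. apply ccont_mult; [apply ccont_minus; [apply CL|apply CS]|apply Ck].
    + intros t _. rewrite Cmod_mult. apply Rmult_le_compat; try apply Cmod_ge_0.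
      * apply Rle_trans with (l - rsum b N); [|lra].
        apply (clim_bound (fun M => csum (lam (2, t)) (N + M) - csum (lam (2, t)) N)%C).
        -- apply clim_minus; [|apply clim_const]. intros d Hd. destruct (LS_spec (2, t) ltac:(simpl; lra) d Hd) as [M0 HM0]. exists M0. intros M HM. apply HM0. lia.
        -- intros M. eapply Rle_trans; [apply (csum_tail_bound (lam (2, t)) b); [lia|]|].
           ++ intros k. rewrite lam_Cmod. apply Rle_refl.
           ++ pose proof (Hl1 (N + M)%nat). lra.
      * assert (N1 : ((2, t) : C) <> 0) by (intros E; apply (f_equal Re) in E; simpl in E; lra).
        assert (N2 : ((2, t) + 1)%C <> 0) by (intros E; apply (f_equal Re) in E; simpl in E; lra).
        rewrite kx_Cmod by assumption. apply div_le_of_mul; [apply Rmult_lt_0_compat; apply Cmod_gt_0; assumption|].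
        assert (Ex : exp ((2 + 1) * ln x) = x ^ 3).
        { replace ((2 + 1) * ln x) with (INR 3 * ln x) by (simpl; ring). rewrite <- ln_pow, exp_ln by (try apply pow_lt; lra). reflexivity. }
        apply Rle_trans with (x ^ 3 * 1); [rewrite Rmult_1_r; right; exact Ex|]. apply Rmult_le_compat_l; [lra|].
        pose proof (re_le_Cmod (2, t)) as A1. pose proof (re_le_Cmod ((2, t) + 1)) as A2. change (Re (2, t)) with 2 in A1. change (Re ((2, t) + 1)) with (2 + 1) in A2. rewrite Rabs_pos_eq in A1 by lra. rewrite Rabs_pos_eq in A2 by lra.
        apply Rle_trans with (1 * 1); [lra|]. apply Rmult_le_compat; [lra|lra| |].
        -- eapply Rle_trans; [|exact A1]. lra.
        -- eapply Rle_trans; [|exact A2]. lra.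
  - right. field. lra. }
assert (T2 : Cmod (V (fun s => csum (lam s) N * kx x s)%C 2 T - RtoC (2 * PI * psi1 x)) <= 60 * x ^ 3 / T).
{ rewrite EN, <- (psi1_eq x N HNx).
  replace (csum (fun k => V (fun s => lam s k * kx x s)%C 2 T) N - RtoC (2 * PI * rsum (psi1_term x) N))%C with (csum (fun k => V (fun s => lam s k * kx x s)%C 2 T - RtoC (2 * PI * psi1_term x k))%C N).
  - eapply Rle_trans; [apply csum_bound; intros k _; apply V_term; assumption|].
    rewrite (rsum_scal (10 * x ^ 3 / T) b). replace (60 * x ^ 3 / T) with (10 * x ^ 3 / T * 6) by (field; lra).
    apply Rmult_le_compat_l; [|apply Hb6]. apply Rdiv_le_0_compat; lra.
  - clear. induction N as [|N IH]; [simpl; rewrite Rmult_0_r; ring|]. simpl csum. simpl rsum. rewrite IH, Rmult_plus_distr_l, RtoC_plus. ring. }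
pose proof (Cmod_triangle_minus (V (fun s => LS s * kx x s)%C 2 T) (V (fun s => csum (lam s) N * kx x s)%C 2 T) (RtoC (2 * PI * psi1 x))). lra.
Qed.

(** * The explicit formula *)

(* The average of y^s / s over y in [x, x + h]. *)
Definition Kh (x h : R) (s : C) : C := ((kx (x + h) s - kx x s) / RtoC h)%C.

Lemma Kh_cdiff x h s : h <> 0 -> 0 < Re s -> cdiff (Kh x h) s.
Proof.
intros Hh Hs. apply cdiff_div; [apply cdiff_minus; apply kx_line_cdiff, Hs|apply cdiff_const|apply RtoC_neq_0, Hh].
Qed.

Lemma rder_real_power (w : C) (y : R) : 0 < y -> rder (fun y => Cexp (w * RtoC (ln y))) y (w * Cexp ((w - 1) * RtoC (ln y))).
Proof.
intros Hy. eapply rder_eq; [|apply (rder_comp (fun z => Cexp (w * z)) (fun y => RtoC (ln y)));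
 [apply (rder_pair ln (fun _ => 0) y (/ y) 0); [auto_derive; [exact Hy|ring]|apply (is_derive_const (V := R_NormedModule))]|
  apply (cder_comp Cexp (fun z => w * z)%C); [apply cder_scal, cder_id|apply cder_Cexp]]].
replace ((w - 1) * RtoC (ln y))%C with (w * RtoC (ln y) + RtoC (- ln y))%C by (rewrite RtoC_opp; ring).
rewrite Cexp_plus. replace (Cexp (RtoC (- ln y))) with (RtoC (/ y)).
- change ((/ y, 0) : C) with (RtoC (/ y)). ring.
- unfold Cexp. simpl. rewrite exp_Ropp, exp_ln by exact Hy. rewrite cos_0, sin_0. apply C_ext; simpl; ring.
Qed.

(** The difference of the powers y^(s+1) at x + h and x is the integral of (s + 1) y^s; the factor s
    + 1 cancels against the kernel, so averaging costs nothing compared with y^s / s. *)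
Lemma Kh_bound x h (s : C) : 0 < x -> 0 < h -> 0 <= Re s -> s <> 0 -> (s + 1)%C <> 0 ->
  Cmod (Kh x h s) <= exp (Re s * ln (x + h)) / Cmod s.
Proof.
intros Hx Hh Hs N1 N2.
assert (Nh : RtoC h <> 0) by (apply RtoC_neq_0; lra).
set (g := fun y => ((s + 1) * Cexp (s * RtoC (ln y)))%C).
assert (Cg : ccont_on g x (x + h)).
{ intros t Ht. rewrite Rmin_left in Ht by lra. apply ccont_mult; [apply ccont_const|]. apply (rder_ccont _ _ _ (rder_real_power s t ltac:(lra))). }
assert (E : (Cexp ((s + 1) * RtoC (ln (x + h))) - Cexp ((s + 1) * RtoC (ln x)))%C = CInt g x (x + h)).
{ symmetry. apply (CInt_FTC (fun y => Cexp ((s + 1) * RtoC (ln y)))). intros t Ht. split; [|apply Cg, Ht].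
  rewrite Rmin_left in Ht by lra. unfold g. eapply rder_eq; [|apply rder_real_power; lra]. f_equal. f_equal. ring. }
assert (B : Cmod (CInt g x (x + h)) <= (x + h - x) * (Cmod (s + 1) * exp (Re s * ln (x + h)))).
{ apply CInt_bound; [lra|exact Cg|]. intros t Ht. unfold g. rewrite Cmod_mult, Cmod_Cexp, re_scal_r.
  apply Rmult_le_compat_l; [apply Cmod_ge_0|]. apply exp_le. apply Rmult_le_compat_l; [exact Hs|]. apply ln_le; lra. }
unfold Kh, kx. replace ((Cexp ((s + 1) * RtoC (ln (x + h))) / (s * (s + 1)) - Cexp ((s + 1) * RtoC (ln x)) / (s * (s + 1))) / RtoC h)%C
 with (CInt g x (x + h) / (s * (s + 1) * RtoC h))%C.
- rewrite Cmod_div, !Cmod_mult, Cmod_R, Rabs_pos_eq by (try lra; repeat apply Cmult_neq_0; assumption).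
  pose proof (proj1 (Cmod_gt_0 _) N1). pose proof (proj1 (Cmod_gt_0 _) N2).
  apply div_le_of_mul; [repeat apply Rmult_lt_0_compat; assumption|]. eapply Rle_trans; [exact B|]. right. field. lra.
- rewrite <- E. field. repeat split; assumption.
Qed.

(** The two terms are bounded separately. The loss of 1/h buys a second power of |s|, which makes
    the sum over high zeros converge. *)
Lemma Kh_bound2 x h (s : C) : 0 < x -> 0 < h -> 0 <= Re s -> s <> 0 -> (s + 1)%C <> 0 ->
  Cmod (Kh x h s) <= 2 * exp ((Re s + 1) * ln (x + h)) / (h * (Cmod s * Cmod (s + 1))).
Proof.
intros Hx Hh Hs N1 N2. unfold Kh. rewrite Cmod_div, Cmod_R, Rabs_pos_eq by (try lra; apply RtoC_neq_0; lra).
pose proof (proj1 (Cmod_gt_0 _) N1). pose proof (proj1 (Cmod_gt_0 _) N2).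
apply div_le_of_mul; [exact Hh|]. unfold Cminus. eapply Rle_trans; [apply Cmod_triangle|]. rewrite Cmod_opp, !kx_Cmod by assumption.
assert (exp ((Re s + 1) * ln x) <= exp ((Re s + 1) * ln (x + h))) by (apply exp_le; apply Rmult_le_compat_l; [lra|apply ln_le; lra]).
apply Rle_trans with (exp ((Re s + 1) * ln (x + h)) / (Cmod s * Cmod (s + 1)) + exp ((Re s + 1) * ln (x + h)) / (Cmod s * Cmod (s + 1))).
- apply Rplus_le_compat_l. unfold Rdiv. apply Rmult_le_compat_r; [left; apply Rinv_0_lt_compat, Rmult_lt_0_compat; assumption|assumption].
- right. field. lra.
Qed.

Lemma Kh_1 x h : 0 < x -> 0 < h -> Kh x h 1 = RtoC (x + h / 2).
Proof.
intros Hx Hh. assert (E : forall y, 0 < y -> kx y 1 = RtoC (y ^ 2 / 2)).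
{ intros y Hy. unfold kx. replace (Cexp ((1 + 1) * RtoC (ln y))) with (RtoC (y ^ 2)).
  - rewrite RtoC_div by lra. f_equal. replace (1 * (1 + 1))%C with (RtoC 2); [reflexivity|]. apply C_ext; simpl; ring.
  - unfold Cexp. simpl. replace ((1 + 1) * ln y - (0 + 0) * 0) with (INR 2 * ln y) by (simpl; ring).
    replace ((1 + 1) * 0 + (0 + 0) * ln y) with 0 by ring. rewrite <- ln_pow, exp_ln, cos_0, sin_0 by (try apply pow_lt; lra). apply C_ext; simpl; ring. }
unfold Kh. rewrite !E by lra. rewrite <- RtoC_minus, <- RtoC_div by lra. f_equal. field. lra.
Qed.

Lemma Kh_conj x h (s : C) : 0 < h -> s <> 0 -> (s + 1)%C <> 0 -> Kh x h (Cconj s) = Cconj (Kh x h s).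
Proof.
intros Hh N1 N2. assert (E : forall y, kx y (Cconj s) = Cconj (kx y s)).
{ intros y. unfold kx. rewrite Cdiv_conj by (apply Cmult_neq_0; assumption). rewrite <- Cexp_conj, !Cmult_conj, !Cplus_conj, !Cconj_RtoC. reflexivity. }
unfold Kh. rewrite !E, Cdiv_conj, Cminus_conj, Cconj_RtoC by (apply RtoC_neq_0; lra). reflexivity.
Qed.

(** Induction on the number of points: if some point lies in [a, a + 2d), it is dropped and the
    search restarts at a + 2d; otherwise a + d is far from all points beyond a. *)
Lemma gap (d : R) : 0 < d -> forall n (l : list R) (a : R), (length l <= n)%nat ->
  exists t, a + d <= t <= a + (2 * INR n + 1) * d /\ forall g, In g l -> a <= g -> d <= Rabs (t - g).
Proof.
intros Hd. induction n as [|n IH]; intros l a Hn.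
- exists (a + d). split; [simpl; lra|]. destruct l; [intros g []|simpl in Hn; lia].
- destruct (classic (exists g, In g l /\ a <= g < a + 2 * d)) as [[g0 [Hg1 Hg2]]|Hno].
  + set (p := fun g => if Rle_dec (a + 2 * d) g then true else false).
    assert (Hp : forall g, p g = true <-> a + 2 * d <= g) by (intros g; unfold p; destruct (Rle_dec (a + 2 * d) g); split; intros; try reflexivity; try discriminate; lra).
    destruct (IH (filter p l) (a + 2 * d)) as [t [Ht1 Ht2]].
    { assert (L1 : (length (filter p l) < length l)%nat); [|lia].
      rewrite <- (filter_length p l). assert (Hin : In g0 (filter (fun x => negb (p x)) l)).
      { apply filter_In. split; [exact Hg1|]. destruct (p g0) eqn:E; [apply Hp in E; lra|reflexivity]. }
      destruct (filter (fun x => negb (p x)) l); [destruct Hin|simpl; lia]. }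
    exists t. rewrite S_INR. split; [lra|]. intros g Hg Hag. destruct (p g) eqn:E.
    * apply Ht2; [apply filter_In; split; assumption|apply Hp, E].
    * assert (g < a + 2 * d). { apply Rnot_le_lt. intros h. apply Hp in h. congruence. } rewrite Rabs_pos_eq; lra.
  + exists (a + d). rewrite S_INR. pose proof (pos_INR n). split; [nra|]. intros g Hg Hag.
    assert (a + 2 * d <= g). { apply Rnot_lt_le. intros h. apply Hno. exists g. split; [exact Hg|lra]. }
    rewrite Rabs_left1; lra.
Qed.

(** This is -zeta'/zeta with its pole at 1 made explicit; on Re s > 1 it coincides with [LS]. *)
Definition Phi (s : C) : C := (/ (s - 1) - dC Dz s / Dz s)%C.

(** * The contour integral of -zeta'/zeta *)

Section Contour.
Hypothesis RH : riemann_hypothesis.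

(** There are O(log T) zeros with |Im| in [T, T + 1], so a pigeonhole argument leaves a height at
    distance at least a constant over log T from all of them, above and below the real axis at
    once. *)
Lemma good_height T H L G : 2 <= T -> T + 4 <= H -> zero_factor H L G ->
  exists T' eta, T <= T' <= T + 1 /\ 0 < eta /\ / eta <= 4 * Kloc * ln (T + 7) + 2 /\
    forall a, In a L -> eta <= Rabs (Rabs (Im a) - T').
Proof.
intros HT HH HF.
set (p := fun a : C => if Rle_dec T (Rabs (Im a)) then if Rle_dec (Rabs (Im a)) (T + 1) then true else false else false).
assert (Hp : forall a, p a = true <-> T <= Rabs (Im a) <= T + 1).
{ intros a. unfold p. destruct (Rle_dec T (Rabs (Im a))); [destruct (Rle_dec (Rabs (Im a)) (T + 1))|]; split; intros; try reflexivity; try discriminate; lra. }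
set (l := map (fun a => Rabs (Im a)) (filter p L)). set (n := length l).
assert (Hn : INR n <= 2 * Kloc * ln (T + 7)).
{ unfold n, l. rewrite length_map.
  destruct (local_zeros H L G (T + / 2) HF) as [B1 _]; [rewrite Rabs_pos_eq; lra|].
  destruct (local_zeros H L G (- (T + / 2)) HF) as [B2 _]; [rewrite Rabs_Ropp, Rabs_pos_eq; lra|].
  rewrite Rabs_Ropp in B2. rewrite Rabs_pos_eq in B1, B2 by lra.
  assert (C1 : (length (filter p L) <= length (near_zeros (T + / 2) L) + length (near_zeros (- (T + / 2)) L))%nat).
  { assert (D : forall a, In a L -> p a = true -> In a (near_zeros (T + / 2) L) \/ In a (near_zeros (- (T + / 2)) L)).
    { intros a Ha Hpa. apply Hp in Hpa. destruct (Rle_dec 0 (Im a)) as [h|h].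
      - left. apply (near_zeros_contains RH H L G _ a HF Ha). rewrite Rabs_pos_eq in Hpa by exact h. apply Rabs_le. lra.
      - right. apply (near_zeros_contains RH H L G _ a HF Ha). rewrite Rabs_left in Hpa by lra. apply Rabs_le. lra. }
    rewrite <- (filter_length (fun a => if Rle_dec 0 (Im a) then true else false) (filter p L)), !filter_filter.
    apply Nat.add_le_mono.
    - unfold near_zeros. apply filter_length_le. intros a Ha Hq. apply andb_prop in Hq. destruct Hq as [Q1 Q2]. apply Hp in Q1.
      destruct (Rle_dec 0 (Im a)) as [h|h]; [|discriminate]. rewrite Rabs_pos_eq in Q1 by exact h.
      assert (Hin : In a (near_zeros (T + / 2) L)) by (apply (near_zeros_contains RH H L G _ a HF Ha); apply Rabs_le; lra).
      apply near_zeros_In in Hin. destruct (Rle_dec (Cmod (a - (2, T + / 2))) (9 / 5)); [reflexivity|tauto].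
    - unfold near_zeros. apply filter_length_le. intros a Ha Hq. apply andb_prop in Hq. destruct Hq as [Q1 Q2]. apply Hp in Q1.
      destruct (Rle_dec 0 (Im a)) as [h|h]; [discriminate|]. rewrite Rabs_left in Q1 by lra.
      assert (Hin : In a (near_zeros (- (T + / 2)) L)) by (apply (near_zeros_contains RH H L G _ a HF Ha); apply Rabs_le; lra).
      apply near_zeros_In in Hin. destruct (Rle_dec (Cmod (a - (2, - (T + / 2)))) (9 / 5)); [reflexivity|tauto]. }
  apply le_INR in C1. rewrite plus_INR in C1.
  pose proof Kloc_facts as [_ HK]. assert (ln (T + / 2 + 5) <= ln (T + 7)) by (apply ln_le; lra). nra. }
(* The relation (2n + 2) d = 1 keeps t between T + d and T + 1 - d, so ordinates outside [T, T + 1]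
   are at distance at least d as well. *)
set (d := / (2 * INR n + 2)). pose proof (pos_INR n) as Pn. assert (Hd : 0 < d) by (apply Rinv_0_lt_compat; lra).
assert (Ed : (2 * INR n + 2) * d = 1) by (unfold d; field; lra).
destruct (gap d Hd n l T (Nat.le_refl _)) as [t [Ht1 Ht2]].
exists t, d. split; [lra|]. split; [exact Hd|]. split; [unfold d; rewrite Rinv_inv; lra|].
intros a Ha. destruct (p a) eqn:E.
- rewrite Rabs_minus_sym. apply Ht2; [|apply Hp in E; lra]. unfold l. apply in_map_iff. exists a. split; [reflexivity|]. apply filter_In. tauto.
- assert (Hc : Rabs (Im a) < T \/ T + 1 < Rabs (Im a)).
  { destruct (Rlt_dec (Rabs (Im a)) T); [left; assumption|]. right. apply Rnot_le_lt. intros h. assert (p a = true) by (apply Hp; lra). congruence. }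
  destruct Hc; [rewrite Rabs_left1; lra|rewrite Rabs_pos_eq; lra].
Qed.

Lemma logder_bound H L G t (z : C) (eta : R) : zero_factor H L G -> Rabs t + 2 <= H -> Cmod (z - (2, t)) <= 7 / 4 -> 0 < eta ->
  (forall a, In a L -> eta <= Cmod (z - a)) ->
  Cmod (dC Dz z / Dz z) <= (1 + / eta) * (Kloc * ln (Rabs t + 5)).
Proof.
intros HF Ht Hz Heta Ha. destruct (local_zeros H L G t HF Ht) as [B1 B2].
assert (Hne : forall a, In a L -> z <> a). { intros a Hin ->. specialize (Ha a Hin). rewrite Cmod_0_minus in Ha. lra. }
specialize (B2 z Hz Hne). set (S := sumC (fun a => / (z - a))%C (near_zeros t L)) in *.
assert (BS : Cmod S <= / eta * (Kloc * ln (Rabs t + 5))).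
{ apply Rle_trans with (sumR (fun _ => / eta) (near_zeros t L)).
  - apply sumC_bound. intros a Hin. apply near_zeros_In in Hin. destruct Hin as [Hin _].
    rewrite Cmod_inv by (apply Cminus_neq_0, Hne, Hin). apply Rinv_le_contravar; [exact Heta|apply Ha, Hin].
  - rewrite sumR_const, Rmult_comm. apply Rmult_le_compat_l; [left; apply Rinv_0_lt_compat, Heta|exact B1]. }
pose proof (Cmod_le_minus (dC Dz z / Dz z) S). lra.
Qed.

Lemma Dz_neq_0_off (L : list C) G H z : zero_factor H L G -> in_box H z -> (forall a, In a L -> z <> a) -> Dz z <> 0.
Proof.
intros [_ [E HG]] Hz Ha. rewrite E. apply Cmult_neq_0; [|apply HG, Hz]. apply lprod_neq_0. intros a Hin. apply Cminus_neq_0, Ha, Hin.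
Qed.

Lemma logder_expand L G H z : zero_factor H L G -> in_box H z -> (forall a, In a L -> z <> a) ->
  (dC Dz z / Dz z = sumC (fun a => / (z - a)) L + dC G z / G z)%C.
Proof.
intros [_ [E HG]] Hz Ha.
assert (Hn : forall a, In a L -> cder (lin a) z 1 /\ lin a z <> 0) by (intros a Hin; split; [apply cder_sub_id|apply Cminus_neq_0, Ha, Hin]).
assert (Ep : lprod lin L z <> 0) by (apply lprod_neq_0; intros a Hin; apply (Hn a Hin)).
destruct (HG z Hz) as [HGd HGz].
assert (Ed : dC Dz z = (lprod lin L z * sumC (fun a => 1 / lin a z) L * G z + lprod lin L z * dC G z)%C).
{ apply dC_eq. apply (cder_ext_loc (fun z => lprod lin L z * G z)%C).
  - apply filter_forall. intros w. symmetry. apply E.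
  - apply (cder_mult (lprod lin L) G); [|apply dC_cder, HGd]. apply (lprod_cder lin (fun _ => RtoC 1)). exact Hn. }
assert (Es : sumC (fun a => 1 / lin a z)%C L = sumC (fun a => / (z - a))%C L).
{ clear. induction L as [|a l IH]; [reflexivity|]. simpl. rewrite IH. unfold lin, Cdiv. ring. }
rewrite Ed, (E z), Es. field. split; assumption.
Qed.

Definition below (T : R) (a : C) : bool := if Rlt_dec (Rabs (Im a)) T then true else false.

(** Induction over the poles, with [RI_cauchy] for those inside and [RI_outside] for the others.
    Continuity on the boundary is carried along because additivity in the induction step asks for
    it. *)
Lemma RI_sum_poles (K : C -> C) (T : R) (L : list C) : 0 < T ->
  (forall z, inrect (/ 4) 2 (- T) T z -> cdiff K z) ->
  (forall a, In a L -> Re a = 1 / 2 /\ Rabs (Im a) <> T) ->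
  RI (fun z => K z * sumC (fun a => / (z - a)) L)%C (/ 4) 2 (- T) T = (RtoC (2 * PI) * Ci * sumC K (filter (below T) L))%C /\
  cont_bd (fun z => K z * sumC (fun a => / (z - a)) L)%C (/ 4) 2 (- T) T.
Proof.
intros HT HK. induction L as [|a L IH]; intros Ha.
- split.
  + rewrite (RI_ext_bd _ (fun _ => RtoC 0)) by (intros; simpl; ring). unfold RI. rewrite !CInt_const. simpl. ring.
  + intros z [Hz _]. apply ccont_mult; [apply cdiff_ccont, HK, Hz|apply (ccont_const (RtoC 0))].
- destruct IH as [IH1 IH2]; [intros; apply Ha; right; assumption|]. destruct (Ha a (or_introl eq_refl)) as [Ha1 Ha2].
  assert (Hne : forall z, on_bd (/ 4) 2 (- T) T z -> (z - a)%C <> 0).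
  { intros z [_ Hz]. apply Cminus_neq_0. intros ->. destruct Hz as [h|[h|[h|h]]]; try lra; apply Ha2; rewrite h; [rewrite Rabs_Ropp|]; apply Rabs_pos_eq; lra. }
  assert (C1 : cont_bd (fun z => K z / (z - a))%C (/ 4) 2 (- T) T).
  { intros z Hz. apply ccont_div; [apply cdiff_ccont, HK, (proj1 Hz)|apply ccont_sub_id|apply Hne, Hz]. }
  assert (EE : forall z, (K z * sumC (fun a => / (z - a)) (a :: L) = K z / (z - a) + K z * sumC (fun a => / (z - a)) L)%C) by (intros; simpl; unfold Cdiv; ring).
  split.
  + rewrite (RI_ext_bd _ (fun z => K z / (z - a) + K z * sumC (fun a => / (z - a)) L)%C) by (intros; apply EE).
    rewrite RI_plus_bd, IH1 by assumption. simpl filter. unfold below at 2. destruct (Rlt_dec (Rabs (Im a)) T) as [h|h].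
    * rewrite RI_cauchy; [simpl; ring|exact HK|lra|]. unfold Rabs in h; destruct Rcase_abs; lra.
    * rewrite RI_outside; [ring|exact HK|]. intros [_ Hin]. rewrite Rmin_left, Rmax_right in Hin by lra. apply Ha2.
      assert (T <= Rabs (Im a)) by lra. assert (Rabs (Im a) <= T) by (apply Rabs_le; lra). lra.
  + intros z Hz. apply (ccont_ext_loc (fun z => K z / (z - a) + K z * sumC (fun a => / (z - a)) L)%C).
    * apply filter_forall. intros; symmetry; apply EE.
    * apply ccont_plus; [apply C1, Hz|apply IH2, Hz].
Qed.

(** Phi is split into 1/(z - 1), the finite sum of 1/(z - a) over L and the holomorphic G'/G. Under
    RH every a has real part 1/2, so none lies on the vertical edges and those below height T are
    enclosed. *)
Lemma RI_Phi_K (K : C -> C) H L G T : zero_factor H L G -> 2 <= T -> T + 1 <= H ->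
  (forall z, inrect (/ 4) 2 (- T) T z -> cdiff K z) -> (forall a, In a L -> Rabs (Im a) <> T) ->
  RI (fun z => Phi z * K z)%C (/ 4) 2 (- T) T = (RtoC (2 * PI) * Ci * (K 1 - sumC K (filter (below T) L)))%C.
Proof.
intros HF HT HH HK Ha.
assert (HaR : forall a, In a L -> Re a = 1 / 2 /\ Rabs (Im a) <> T).
{ intros a Hin. destruct (proj1 HF a Hin) as [H1 H2]. split; [apply (RH_Dz RH a H2 H1)|apply Ha, Hin]. }
destruct (RI_sum_poles K T L ltac:(lra) HK HaR) as [E1 C1].
assert (Hbox : forall z, inrect (/ 4) 2 (- T) T z -> forall w, disc z (/ 10) w -> in_box H w).
{ intros z [Hz1 Hz2] w Hw. rewrite Rmin_left, Rmax_right in Hz1, Hz2 by lra. unfold disc in Hw.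
  pose proof (re_le_Cmod (w - z)) as B1. pose proof (im_le_Cmod (w - z)) as B2. apply Rabs_le_between in B1. apply Rabs_le_between in B2.
  unfold Cminus in B1, B2. rewrite re_plus, re_opp in B1. rewrite im_plus, im_opp in B2. fold (w - z)%C in B1, B2. split; [lra|apply Rabs_le; lra]. }
assert (Hself : forall z, disc z (/ 10) z) by (intros; unfold disc; rewrite Cmod_0_minus; lra).
assert (HGq : forall z, inrect (/ 4) 2 (- T) T z -> cdiff (fun z => K z * (dC G z / G z))%C z).
{ intros z Hz. pose proof (Hbox z Hz) as Hb. apply cdiff_mult; [apply HK, Hz|]. apply cdiff_div.
  - apply (dC_holo_disc z (/ 10) G); [intros w Hw; apply HF, Hb, Hw|apply Hself].
  - apply HF, Hb, Hself.
  - apply HF, Hb, Hself. }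
assert (E2 : RI (fun z => K z * (dC G z / G z))%C (/ 4) 2 (- T) T = 0) by (apply goursat, HGq).
assert (E3 : RI (fun z => K z / (z - 1))%C (/ 4) 2 (- T) T = (RtoC (2 * PI) * Ci * K 1)%C) by (apply RI_cauchy; [exact HK|simpl; lra|simpl; lra]).
assert (C3 : cont_bd (fun z => K z / (z - 1))%C (/ 4) 2 (- T) T).
{ intros z [Hz1 Hz2]. apply ccont_div; [apply cdiff_ccont, HK, Hz1|apply ccont_sub_id|]. apply Cminus_neq_0. intros ->. simpl in Hz2. lra. }
rewrite (RI_ext_bd _ (fun z => K z / (z - 1) - (K z * sumC (fun a => / (z - a)) L + K z * (dC G z / G z)))%C).
- rewrite RI_minus_bd, RI_plus_bd, E1, E2, E3; [ring|exact C1|intros z [Hz _]; apply cdiff_ccont, HGq, Hz|exact C3|].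
  intros z Hz. apply ccont_plus; [apply C1, Hz|apply cdiff_ccont, HGq, (proj1 Hz)].
- intros z [Hz1 Hz2]. unfold Phi. rewrite (logder_expand L G H z HF).
  + unfold Cdiv. ring.
  + apply (Hbox z Hz1), Hself.
  + intros a Hin ->. destruct (HaR a Hin) as [R1 R2]. destruct Hz2 as [h|[h|[h|h]]]; try lra; apply R2; rewrite h; [rewrite Rabs_Ropp|]; apply Rabs_pos_eq; lra.
Qed.
End Contour.

(** * Estimates on the edges of the contour *)

Lemma ln_le_8 x : 1 <= x -> ln x <= 8 * exp (ln x / 8).
Proof. intros Hx. pose proof (exp_ineq1_le (ln x / 8)). lra. Qed.

Lemma recip_edge_bound (t : R) : / Cmod ((/ 4, t) : C) <= 8 / (1 + 4 * Rabs t).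
Proof.
pose proof (re_le_Cmod (/ 4, t)) as A. pose proof (im_le_Cmod (/ 4, t)) as B. simpl in A, B. rewrite Rabs_pos_eq in A by lra.
pose proof (Rabs_pos t). unfold Rdiv. replace (8 * / (1 + 4 * Rabs t)) with (/ ((1 + 4 * Rabs t) / 8)) by (field; lra).
apply Rinv_le_contravar; lra.
Qed.

(** The majorant 8 / (1 + 4|t|) of 1/|s| on Re s = 1/4 has an explicit primitive on each half-line,
    so integrating along the edge loses only log T. *)
Lemma edge_integral (f : R -> C) (M T : R) : 0 <= M -> 0 <= T -> (forall t, ccont f t) ->
  (forall t, Rabs t <= T -> Cmod (f t) <= M * (8 / (1 + 4 * Rabs t))) -> Cmod (CInt f (- T) T) <= M * (4 * ln (1 + 4 * T)).
Proof.
intros HM HT Hc Hf.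
assert (I1 : is_RInt (fun t => M * (8 / (1 + 4 * t))) 0 T (M * (2 * ln (1 + 4 * T)))).
{ replace (M * (2 * ln (1 + 4 * T))) with (minus ((fun t => M * (2 * ln (1 + 4 * t))) T) ((fun t => M * (2 * ln (1 + 4 * t))) 0)).
  - apply (is_RInt_derive (V := R_CompleteNormedModule) (fun t => M * (2 * ln (1 + 4 * t)))).
    + intros t Ht. rewrite Rmin_left in Ht by lra. auto_derive; [lra|field; lra].
    + intros t Ht. rewrite Rmin_left in Ht by lra. apply (ex_derive_continuous (V := R_NormedModule)). auto_derive. lra.
  - unfold minus, plus, opp. simpl. rewrite Rmult_0_r, Rplus_0_r, ln_1. ring. }
assert (I2 : is_RInt (fun t => M * (8 / (1 - 4 * t))) (- T) 0 (M * (2 * ln (1 + 4 * T)))).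
{ replace (M * (2 * ln (1 + 4 * T))) with (minus ((fun t => - (M * (2 * ln (1 - 4 * t)))) 0) ((fun t => - (M * (2 * ln (1 - 4 * t)))) (- T))).
  - apply (is_RInt_derive (V := R_CompleteNormedModule) (fun t => - (M * (2 * ln (1 - 4 * t))))).
    + intros t Ht. rewrite Rmax_right in Ht by lra. auto_derive; [lra|field; lra].
    + intros t Ht. rewrite Rmax_right in Ht by lra. apply (ex_derive_continuous (V := R_NormedModule)). auto_derive. lra.
  - unfold minus, plus, opp. simpl. rewrite Rmult_0_r, Rminus_0_r, ln_1. replace (1 - 4 * - T) with (1 + 4 * T) by ring. ring. }
rewrite <- (CInt_Chasles f (- T) 0 T) by (intros; apply Hc).
eapply Rle_trans; [apply Cmod_triangle|]. replace (M * (4 * ln (1 + 4 * T))) with (M * (2 * ln (1 + 4 * T)) + M * (2 * ln (1 + 4 * T))) by ring.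
apply Rplus_le_compat.
- rewrite <- (is_RInt_unique _ _ _ _ I2). apply CInt_bound_fun; [lra|intros t _; apply Hc|eexists; exact I2|].
  intros t Ht. replace (1 - 4 * t) with (1 + 4 * Rabs t) by (rewrite Rabs_left1; lra). apply Hf. rewrite Rabs_left1; lra.
- rewrite <- (is_RInt_unique _ _ _ _ I1). apply CInt_bound_fun; [lra|intros t _; apply Hc|eexists; exact I1|].
  intros t Ht. replace (1 + 4 * t) with (1 + 4 * Rabs t) by (rewrite Rabs_pos_eq; lra). apply Hf. rewrite Rabs_pos_eq; lra.
Qed.

Lemma V_LS_Kh x h T : 1 <= x -> 0 < h -> 3 <= T ->
  Cmod (V (fun s => LS s * Kh x h s)%C 2 T - RtoC (2 * PI * ((psi1 (x + h) - psi1 x) / h))) <= 120 * (x + h) ^ 3 / (T * h).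
Proof.
intros Hx Hh HT. pose proof (V_LS_kx (x + h) T ltac:(lra) HT) as A. pose proof (V_LS_kx x T Hx HT) as B.
assert (Nh : RtoC h <> 0) by (apply RtoC_neq_0; lra).
assert (Ck : forall y t, ccont (kx y) (2, t)) by (intros; apply cdiff_ccont, kx_line_cdiff; simpl; lra).
assert (CL : forall y t, ccont (fun s => LS s * kx y s)%C (2, t)) by (intros; apply ccont_mult; [apply cdiff_ccont, cdiff_LS; simpl; lra|apply Ck]).
set (V1 := V (fun s => LS s * kx (x + h) s)%C 2 T) in *. set (V2 := V (fun s => LS s * kx x s)%C 2 T) in *.
assert (E : V (fun s => LS s * Kh x h s)%C 2 T = ((V1 - V2) / RtoC h)%C).
{ rewrite (V_ext _ (fun s => / RtoC h * (LS s * kx (x + h) s) + (- / RtoC h) * (LS s * kx x s))%C) by (intros; unfold Kh, Cdiv; ring).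
  rewrite V_plus by (intros; apply ccont_mult; [apply ccont_const|apply CL]). rewrite !V_scal by (intros; apply CL). fold V1 V2. unfold Cdiv. ring. }
rewrite E. replace ((V1 - V2) / RtoC h - RtoC (2 * PI * ((psi1 (x + h) - psi1 x) / h)))%C
  with (((V1 - RtoC (2 * PI * psi1 (x + h))) - (V2 - RtoC (2 * PI * psi1 x))) / RtoC h)%C.
- rewrite Cmod_div, Cmod_R, Rabs_pos_eq by (try exact Nh; lra). apply div_le_of_mul; [exact Hh|].
  unfold Cminus at 1. eapply Rle_trans; [apply Cmod_triangle|]. rewrite Cmod_opp.
  assert (x ^ 3 <= (x + h) ^ 3) by (apply pow_incr; lra).
  assert (60 * x ^ 3 / T <= 60 * (x + h) ^ 3 / T) by (unfold Rdiv; apply Rmult_le_compat_r; [left; apply Rinv_0_lt_compat; lra|lra]).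
  apply Rle_trans with (60 * (x + h) ^ 3 / T + 60 * (x + h) ^ 3 / T); [lra|]. right. field. lra.
- unfold Rdiv. rewrite !RtoC_mult, RtoC_minus, RtoC_inv by lra. field. exact Nh.
Qed.

(** [zero_list] holds only zeros with positive ordinate, and conjugation reflects them below the
    axis; possible zeros on the real axis are kept apart and bounded in [real_zeros_bound]. *)
Definition on_real (a : C) : bool := if Req_EM_T (Im a) 0 then true else false.

Lemma sumC_below_split (K : C -> C) (T : R) (L : list C) : 0 < T -> (forall a, In a L -> Rabs (Im a) <> T) ->
  sumC K (filter (below T) L) = (sumC K (filter (in_upper T) L) + sumC K (filter (in_lower T) L) + sumC K (filter on_real L))%C.
Proof.
intros HT Ha. rewrite <- !sumC_filter_if, <- !sumC_plus. apply sumC_ext. intros a Hin. specialize (Ha a Hin).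
unfold below, in_lower, in_upper, on_real. rewrite im_conj. unfold Rabs in *.
destruct Rcase_abs; repeat destruct Rlt_dec; repeat destruct Rle_dec; destruct Req_EM_T; try ring; exfalso; lra.
Qed.

Section Explicit.
Hypothesis RH : riemann_hypothesis.
Variables (x h : R) (Hx : 2 <= x) (Hh : 1 <= h <= x).
Variables (L : list C) (G : C -> C) (T eta : R).
Hypothesis HF : zero_factor (x ^ 4 + 5) L G.
Hypothesis HT : x ^ 4 <= T <= x ^ 4 + 1.
Hypothesis Heta : 0 < eta.
Hypothesis Heta2 : / eta <= 4 * Kloc * ln (x ^ 4 + 7) + 2.
Hypothesis HL : forall a, In a L -> eta <= Rabs (Rabs (Im a) - T).

Lemma x4_ge : 16 <= x ^ 4 /\ x ^ 2 * 4 <= x ^ 4.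
Proof. assert (4 <= x ^ 2) by nra. replace (x ^ 4) with (x ^ 2 * x ^ 2) by ring. nra. Qed.

Lemma ln_T5 : 0 <= ln (T + 5) /\ ln (T + 5) <= ln (x ^ 4 + 7) /\ ln (x ^ 4 + 7) <= 16 * ln x.
Proof.
pose proof x4_ge as [A _]. split; [apply ln_nonneg; lra|]. split; [apply ln_le; lra|].
eapply Rle_trans; [apply ln_shift_le; lra|]. rewrite ln_pow by lra. simpl. lra.
Qed.

Lemma line_height (z : C) (a : C) : Rabs (Im z) = T -> In a L -> eta <= Cmod (z - a).
Proof.
intros Hz Ha. eapply Rle_trans; [apply (HL a Ha)|]. eapply Rle_trans; [|apply im_le_Cmod]. unfold Cminus. rewrite im_plus, im_opp.
rewrite <- Hz. fold (Im z - Im a). rewrite Rabs_minus_sym. apply Rabs_triang_inv2.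
Qed.

Lemma Phi_horizontal (z : C) : / 4 <= Re z <= 2 -> Rabs (Im z) = T -> Cmod (Phi z) <= 1 + (1 + / eta) * (Kloc * ln (T + 5)).
Proof.
intros Hz HzT. pose proof x4_ge as [A _]. unfold Phi, Cminus at 1. eapply Rle_trans; [apply Cmod_triangle|]. rewrite Cmod_opp.
apply Rplus_le_compat.
- assert (B : T <= Cmod (z - 1)).
  { rewrite <- HzT. replace (Im z) with (Im (z - 1)%C) by (unfold Im, Cminus, Cplus, Copp; simpl; ring). apply im_le_Cmod. }
  rewrite Cmod_inv by (apply Cmod_gt_0; lra). replace 1 with (/ 1) at 2 by apply Rinv_1. apply Rinv_le_contravar; lra.
- rewrite <- HzT. apply (logder_bound (x ^ 4 + 5) L G (Im z) z eta HF); [lra| |exact Heta|intros a Ha; apply line_height; assumption].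
  replace (z - (2, Im z))%C with (RtoC (Re z - 2)) by (destruct z; apply C_ext; simpl; ring). rewrite Cmod_R, Rabs_left1; lra.
Qed.

Lemma Kh_horizontal (z : C) : / 4 <= Re z <= 2 -> Rabs (Im z) = T -> Cmod (Kh x h z) <= 4 * x ^ 2 / T.
Proof.
intros Hz HzT. pose proof x4_ge as [A _]. pose proof (im_le_Cmod z) as B. rewrite HzT in B.
assert (N1 : z <> 0) by (apply Cmod_gt_0; lra).
assert (N2 : (z + 1)%C <> 0). { intros E. apply (f_equal Re) in E. rewrite re_plus in E. simpl in E. lra. }
eapply Rle_trans; [apply Kh_bound; try assumption; lra|]. unfold Rdiv. apply Rmult_le_compat; [left; apply exp_pos|left; apply Rinv_0_lt_compat; lra| |apply Rinv_le_contravar; lra].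
assert (Hl : 0 <= ln (x + h)) by (apply ln_nonneg; lra).
apply Rle_trans with (exp (INR 2 * ln (x + h))); [apply exp_le, Rmult_le_compat_r; [exact Hl|simpl; lra]|].
rewrite <- ln_pow, exp_ln by (try apply pow_lt; lra). replace (4 * x ^ 2) with ((2 * x) ^ 2) by ring. apply pow_incr. lra.
Qed.

Lemma Phi_cont (z : C) : Dz z <> 0 -> z <> 1 -> ccont Phi z.
Proof.
intros H1 H2. apply ccont_minus.
- apply (ccont_inv (fun z => z - 1)%C); [apply ccont_sub_id|apply Cminus_neq_0, H2].
- apply ccont_div; [|apply cdiff_ccont, Dz_cdiff|exact H1]. apply cdiff_ccont, (dC_holo_disc z 1 Dz); [intros w _; apply Dz_cdiff|unfold disc; rewrite Cmod_0_minus; lra].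
Qed.

Lemma Dz_neq_0_RH (z : C) : 0 < Re z -> Re z <> 1 / 2 -> Dz z <> 0.
Proof. intros H1 H2 E. apply H2, (RH_Dz RH z H1 E). Qed.

(** On these edges Phi is O(log^2 x) thanks to the choice of height, crudely O(x^2), and Kh is O(x^2
    / T). Taking T of order x^4 makes the product bounded. *)
Lemma horizontal_bound (u : R) : Rabs u = T ->
  Cmod (CInt (fun s => (Phi (s, u) * Kh x h (s, u))%C) (/ 4) 2) <= 7 * (1 + 16 * Kloc * (3 + 64 * Kloc)).
Proof.
intros Hu. pose proof x4_ge as [A A2]. pose proof Kloc_facts as [_ HK]. destruct ln_T5 as [L1 [L2 L3]].
assert (Lx : ln x <= x) by (pose proof (exp_ineq1_le (ln x)) as E; rewrite exp_ln in E by lra; lra).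
assert (P2 : 4 <= x ^ 2) by nra.
eapply Rle_trans; [apply (CInt_bound _ (/ 4) 2 (x ^ 2 * (1 + 16 * Kloc * (3 + 64 * Kloc)) * (4 * x ^ 2 / T))); [lra| |]|].
- intros t Ht. rewrite Rmin_left, Rmax_right in Ht by lra. apply (ccont_hline (fun z => Phi z * Kh x h z)%C). apply ccont_mult; [apply Phi_cont|apply cdiff_ccont, Kh_cdiff; simpl; lra].
  + apply (Dz_neq_0_off L G (x ^ 4 + 5) _ HF); [split; simpl; lra|]. intros a Ha E.
    pose proof (line_height (t, u) a ltac:(simpl; exact Hu) Ha) as B. rewrite E, Cmod_0_minus in B. lra.
  + intros E. apply (f_equal Im) in E. simpl in E. rewrite E, Rabs_R0 in Hu. lra.
- intros t Ht. rewrite Cmod_mult. apply Rmult_le_compat; try apply Cmod_ge_0; [|apply Kh_horizontal; simpl; lra].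
  eapply Rle_trans; [apply Phi_horizontal; simpl; lra|].
  assert (B1 : 1 + / eta <= (3 + 64 * Kloc) * x). { assert (4 * Kloc * ln (x ^ 4 + 7) <= 4 * Kloc * (16 * x)) by (apply Rmult_le_compat_l; lra). nra. }
  assert (B2 : Kloc * ln (T + 5) <= 16 * Kloc * x). { replace (16 * Kloc * x) with (Kloc * (16 * x)) by ring. apply Rmult_le_compat_l; lra. }
  assert (0 < / eta) by (apply Rinv_0_lt_compat, Heta).
  assert (B3 : (1 + / eta) * (Kloc * ln (T + 5)) <= (3 + 64 * Kloc) * x * (16 * Kloc * x)).
  { apply Rmult_le_compat; [lra|apply Rmult_le_pos; lra|exact B1|exact B2]. }
  nra.
- set (M := 1 + 16 * Kloc * (3 + 64 * Kloc)). assert (HM : 0 < M) by (unfold M; nra).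
  replace ((2 - / 4) * (x ^ 2 * M * (4 * x ^ 2 / T))) with (7 * M * (x ^ 4 / T)) by (field; lra).
  rewrite <- (Rmult_1_r (7 * M)) at 2. apply Rmult_le_compat_l; [lra|]. apply div_le_of_mul; lra.
Qed.

(** On Re s = 1/4 the kernel has size x^(1/4) / |s|, and the logarithmic derivative is O(log x)
    since all zeros are at distance at least 1/4. The integral is O(x^(1/4) log^2 x), which fits
    into sqrt x. *)
Lemma left_bound : Cmod (V (fun s => Phi s * Kh x h s)%C (/ 4) T) <= (3 + 80 * Kloc) * 4096 * exp (ln x / 2).
Proof.
pose proof x4_ge as [A A2]. pose proof Kloc_facts as [_ HK]. destruct ln_T5 as [L1 [L2 L3]].
assert (Lx : / 2 < ln x) by (eapply Rlt_le_trans; [exact ln_lt_2|apply ln_le; lra]).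
set (M := (4 / 3 + 5 * (Kloc * (16 * ln x))) * exp (/ 4 * ln (x + h))).
assert (HM0 : 0 <= 4 / 3 + 5 * (Kloc * (16 * ln x))) by nra.
eapply Rle_trans; [apply (edge_integral _ M T)|].
- apply Rmult_le_pos; [exact HM0|left; apply exp_pos].
- lra.
- intros t. apply (ccont_vline (fun z => Phi z * Kh x h z)%C). apply ccont_mult; [apply Phi_cont|apply cdiff_ccont, Kh_cdiff; simpl; lra].
  + apply Dz_neq_0_RH; simpl; lra.
  + intros E. apply (f_equal Re) in E. simpl in E. lra.
- intros t Ht. rewrite Cmod_mult. unfold M. rewrite Rmult_assoc. apply Rmult_le_compat; try apply Cmod_ge_0.
  + unfold Phi, Cminus at 1. eapply Rle_trans; [apply Cmod_triangle|]. rewrite Cmod_opp. apply Rplus_le_compat.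
    * pose proof (re_le_Cmod (((/ 4)%R, t) - 1)) as B. simpl in B. rewrite Rabs_left in B by lra.
      rewrite Cmod_inv by (apply Cmod_gt_0; simpl; lra). replace (4 / 3) with (/ (3 / 4)) by field. apply Rinv_le_contravar; simpl in *; lra.
    * replace 5 with (1 + / / 4) by field. eapply Rle_trans; [apply (logder_bound (x ^ 4 + 5) L G t (/ 4, t) (/ 4) HF)|].
      -- lra.
      -- replace (((/ 4)%R, t) - (2, t))%C with (RtoC (- (7 / 4))) by (apply C_ext; simpl; field). rewrite Cmod_R, Rabs_left; lra.
      -- lra.
      -- intros a Ha. destruct (proj1 HF a Ha) as [Z1 Z2]. pose proof (RH_Dz RH a Z2 Z1) as R. eapply Rle_trans; [|apply re_le_Cmod]. unfold Cminus. rewrite re_plus, re_opp, R. simpl. rewrite Rabs_left; lra.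
      -- apply Rmult_le_compat_l; [lra|]. apply Rmult_le_compat_l; [lra|]. eapply Rle_trans; [|exact (Rle_trans _ _ _ L2 L3)]. apply ln_le; [pose proof (Rabs_pos t); lra|lra].
  + eapply Rle_trans; [apply Kh_bound; simpl; try lra|].
    * intros E. apply (f_equal Re) in E. simpl in E. lra.
    * intros E. apply (f_equal Re) in E. simpl in E. lra.
    * simpl. apply Rmult_le_compat_l; [left; apply exp_pos|]. apply recip_edge_bound.
- assert (B1 : ln (1 + 4 * T) <= 8 * ln x).
  { replace (8 * ln x) with (INR 8 * ln x) by (simpl; ring). rewrite <- ln_pow by lra. apply ln_le; [lra|]. replace (x ^ 8) with (x ^ 4 * x ^ 4) by ring. nra. }
  assert (B0 : 0 <= ln (1 + 4 * T)) by (apply ln_nonneg; lra).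
  assert (B2 : exp (/ 4 * ln (x + h)) <= 2 * exp (ln x / 4)).
  { rewrite <- (exp_ln 2) at 1 by lra. rewrite <- exp_plus. apply exp_le.
    assert (ln (x + h) <= ln 2 + ln x) by (rewrite <- ln_mult by lra; apply ln_le; lra). assert (0 < ln 2) by (pose proof ln_lt_2; lra). lra. }
  assert (B3 : 4 / 3 + 5 * (Kloc * (16 * ln x)) <= (3 + 80 * Kloc) * ln x) by nra.
  (* With q = x^(1/8) one has log x <= 8q and x^(1/4) = q^2, so x^(1/4) log^2 x is at most 64 q^4 =
     64 sqrt x. *)
  pose proof (ln_le_8 x ltac:(lra)) as B4. set (q := exp (ln x / 8)) in *. assert (Hq : 0 < q) by apply exp_pos.
  assert (E4 : exp (ln x / 4) = q * q) by (unfold q; rewrite <- exp_plus; f_equal; field).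
  assert (E2 : exp (ln x / 2) = (q * q) * (q * q)) by (rewrite <- E4, <- exp_plus; f_equal; field).
  rewrite E2. rewrite E4 in B2. unfold M.
  assert (LL : ln x * ln x <= 64 * (q * q)) by nra.
  apply Rle_trans with ((3 + 80 * Kloc) * ln x * (2 * (q * q)) * (4 * (8 * ln x))).
  + apply Rmult_le_compat; [apply Rmult_le_pos; [exact HM0|left; apply exp_pos]|lra| |lra].
    apply Rmult_le_compat; [exact HM0|left; apply exp_pos|exact B3|exact B2].
  + replace ((3 + 80 * Kloc) * ln x * (2 * (q * q)) * (4 * (8 * ln x))) with ((3 + 80 * Kloc) * (64 * (q * q)) * (ln x * ln x)) by ring.
    assert (0 <= (3 + 80 * Kloc) * (64 * (q * q))) by (apply Rmult_le_pos; nra).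
    apply Rle_trans with ((3 + 80 * Kloc) * (64 * (q * q)) * (64 * (q * q))); [apply Rmult_le_compat_l; assumption|].
    assert (0 < q * q * (q * q)) by (apply Rmult_lt_0_compat; nra). nra.
Qed.

Lemma real_zeros_bound : Cmod (sumC (Kh x h) (filter on_real L)) <= Kloc * ln 5 * (4 * exp (ln x / 2)).
Proof.
pose proof x4_ge as [A A2]. pose proof Kloc_facts as [_ HK].
apply Rle_trans with (sumR (fun _ => 4 * exp (ln x / 2)) (filter on_real L)).
- apply sumC_bound. intros a Ha. apply filter_In in Ha. destruct Ha as [Ha Hr]. destruct (proj1 HF a Ha) as [Z1 Z2].
  pose proof (RH_Dz RH a Z2 Z1) as R. unfold on_real in Hr. destruct (Req_EM_T (Im a) 0) as [I|]; [|discriminate].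
  eapply Rle_trans; [apply Kh_bound; try lra|].
  + intros E. apply (f_equal Re) in E. simpl in E. lra.
  + intros E. apply (f_equal Re) in E. rewrite re_plus in E. simpl in E. lra.
  + replace a with (RtoC (1 / 2)) by (destruct a; simpl in *; subst; reflexivity). rewrite Cmod_R, Rabs_pos_eq by lra. simpl.
    assert (exp (1 / 2 * ln (x + h)) <= 2 * exp (ln x / 2)); [|lra].
    replace (2 * exp (ln x / 2)) with (exp (ln 2 + ln x / 2)) by (rewrite exp_plus, exp_ln by lra; reflexivity). apply exp_le.
    assert (ln (x + h) <= ln 2 + ln x) by (rewrite <- ln_mult by lra; apply ln_le; lra). assert (0 < ln 2) by (pose proof ln_lt_2; lra). lra.
- rewrite sumR_const. apply Rmult_le_compat_r; [pose proof (exp_pos (ln x / 2)); lra|].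
  destruct (local_zeros (x ^ 4 + 5) L G 0 HF) as [B _]; [rewrite Rabs_R0; lra|]. rewrite Rabs_R0, Rplus_0_l in B.
  eapply Rle_trans; [|exact B]. apply le_INR. apply filter_length_le. intros a Ha Hr.
  unfold on_real in Hr. destruct (Req_EM_T (Im a) 0) as [I|]; [|discriminate].
  assert (Hin : In a (near_zeros 0 L)) by (apply (near_zeros_contains RH (x ^ 4 + 5) L G 0 a HF Ha); rewrite I; apply Rabs_le; lra).
  apply near_zeros_In in Hin. destruct (Rle_dec (Cmod (a - (2, 0))) (9 / 5)); [reflexivity|tauto].
Qed.

(** The residue theorem on the contour, solved for the integral along Re s = 2, which Perron's
    formula identifies with the averaged psi. Conjugate zeros combine into twice a real part; the
    other edges and the real zeros go into the error. *)
Lemma explicit_aux :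
  Rabs ((psi1 (x + h) - psi1 x) / h - (x + h / 2) + 2 * Re (sumC (fun g => Kh x h (1 / 2, g)) (gam T)))
  <= (1000 + 14 * (1 + 16 * Kloc * (3 + 64 * Kloc)) + (3 + 80 * Kloc) * 4096 + 32 * Kloc * ln 5) * exp (ln x / 2).
Proof.
pose proof x4_ge as [A A2]. pose proof Kloc_facts as [_ HK].
assert (HaT : forall a, In a L -> Rabs (Im a) <> T).
{ intros a Ha E. pose proof (HL a Ha) as B. rewrite E, Rminus_diag, Rabs_R0 in B. lra. }
assert (HKd : forall z, inrect (/ 4) 2 (- T) T z -> cdiff (Kh x h) z).
{ intros z [Hz _]. rewrite Rmin_left in Hz by lra. apply Kh_cdiff; lra. }
pose proof (RI_Phi_K RH (Kh x h) (x ^ 4 + 5) L G T HF ltac:(lra) ltac:(lra) HKd HaT) as ER.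
rewrite Kh_1, (sumC_below_split _ T L ltac:(lra) HaT) in ER by lra.
rewrite (sumC_perm _ _ _ (zero_list_perm RH _ L G T HF ltac:(lra) ltac:(lra))), (sumC_perm _ _ _ (zero_list_perm_conj RH _ L G T HF ltac:(lra) ltac:(lra))) in ER.
rewrite sumC_map, (zero_list_gam RH T), !sumC_map in ER by lra.
rewrite (sumC_ext (fun a => Kh x h (Cconj (1 / 2, a))) (fun a => Cconj (Kh x h (1 / 2, a)))) in ER.
2:{ intros g _. apply Kh_conj; [lra| |]; intros E; apply (f_equal Re) in E; simpl in E; lra. }
rewrite sumC_conj in ER. set (S := sumC (fun g => Kh x h (1 / 2, g)) (gam T)) in *.
pose proof real_zeros_bound as B5. set (S0 := sumC (Kh x h) (filter on_real L)) in *.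
pose proof (horizontal_bound T (Rabs_pos_eq T ltac:(lra))) as B1. pose proof (horizontal_bound (- T) ltac:(rewrite Rabs_Ropp, Rabs_pos_eq; lra)) as B2.
pose proof left_bound as B3. pose proof (V_LS_Kh x h T ltac:(lra) ltac:(lra) ltac:(lra)) as B4.
set (D := (psi1 (x + h) - psi1 x) / h) in *.
rewrite <- (V_ext (fun s => Phi s * Kh x h s)%C) in B4.
2:{ intros t. unfold Phi. rewrite (Dz_logder (2, t)); [ring|simpl; lra|apply Dz_neq_0_gt1; simpl; lra]. }
unfold RI in ER. fold (V (fun s => Phi s * Kh x h s)%C 2 T) (V (fun s => Phi s * Kh x h s)%C (/ 4) T) in ER.
set (V2 := V (fun s => Phi s * Kh x h s)%C 2 T) in *. set (V1 := V (fun s => Phi s * Kh x h s)%C (/ 4) T) in *.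
set (h1 := CInt (fun s => (Phi (s, (- T)%R) * Kh x h (s, (- T)%R))%C) (/ 4) 2) in *. set (h2 := CInt (fun s => (Phi (s, T) * Kh x h (s, T))%C) (/ 4) 2) in *.
assert (ES : (S + Cconj S)%C = RtoC (2 * Re S)) by (clearbody S; destruct S; apply C_ext; simpl; ring).
assert (EQ : RtoC (2 * PI * (D - (x + h / 2) + 2 * Re S)) = (- (V2 - RtoC (2 * PI * D)) + Ci * h1 - Ci * h2 + V1 - RtoC (2 * PI) * S0)%C).
{ assert (CC : (Ci * Ci = - (1))%C) by (apply C_ext; simpl; ring).
  rewrite ES in ER. assert (E2 : (Ci * (Ci * V2) = Ci * (RtoC (2 * PI) * Ci * (RtoC (x + h / 2) - (RtoC (2 * Re S) + S0)) - h1 + h2 + Ci * V1))%C) by (rewrite <- ER; ring).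
  assert (E3 : V2 = (RtoC (2 * PI) * (RtoC (x + h / 2) - (RtoC (2 * Re S) + S0)) + Ci * h1 - Ci * h2 + V1)%C).
  { transitivity (- (Ci * (Ci * V2)))%C; [transitivity (- (Ci * Ci) * V2)%C; [rewrite CC; ring|ring]|]. rewrite E2.
    transitivity (- (Ci * Ci) * (RtoC (2 * PI) * (RtoC (x + h / 2) - (RtoC (2 * Re S) + S0))) + Ci * h1 - Ci * h2 - (Ci * Ci) * V1)%C; [ring|]. rewrite CC. ring. }
  rewrite E3. rewrite RtoC_mult, RtoC_plus, RtoC_minus, (RtoC_mult (2 * PI) D). ring. }
pose proof PI_4 as P4. pose proof PI2_1 as P2. assert (P1 : 1 <= 2 * PI) by lra.
set (E := D - (x + h / 2) + 2 * Re S) in *. set (q := exp (ln x / 2)) in *.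
assert (Hq : 1 <= q). { unfold q. rewrite <- exp_0. apply exp_le. assert (0 <= ln x) by (apply ln_nonneg; lra). lra. }
(* The truncation error is at most 120 (2x)^3 / (T h) with T >= x^4 and h >= 1, hence at most
   960. *)
assert (B4' : Cmod (V2 - RtoC (2 * PI * D)) <= 960).
{ eapply Rle_trans; [exact B4|]. apply div_le_of_mul; [apply Rmult_lt_0_compat; lra|].
  assert ((x + h) ^ 3 <= (2 * x) ^ 3) by (apply pow_incr; lra).
  assert (x ^ 4 * 1 <= T * h) by (apply Rmult_le_compat; lra). assert (8 * x ^ 3 <= 8 * x ^ 4) by (replace (x ^ 4) with (x * x ^ 3) by ring; assert (0 < x ^ 3) by (apply pow_lt; lra); nra).
  replace ((2 * x) ^ 3) with (8 * x ^ 3) in * by ring. lra. }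
assert (EB : Cmod (RtoC (2 * PI * E)) <= 960 + 7 * (1 + 16 * Kloc * (3 + 64 * Kloc)) + 7 * (1 + 16 * Kloc * (3 + 64 * Kloc)) + (3 + 80 * Kloc) * 4096 * q + 8 * (Kloc * ln 5 * (4 * q))).
{ rewrite EQ. unfold Cminus at 1 2.
  eapply Rle_trans; [apply Cmod_triangle|]. apply Rplus_le_compat.
  - eapply Rle_trans; [apply Cmod_triangle|]. apply Rplus_le_compat; [|exact B3].
    eapply Rle_trans; [apply Cmod_triangle|]. apply Rplus_le_compat; [|rewrite Cmod_opp, Cmod_mult, Cmod_Ci, Rmult_1_l; exact B1].
    eapply Rle_trans; [apply Cmod_triangle|]. rewrite Cmod_opp, Cmod_mult, Cmod_Ci, Rmult_1_l. apply Rplus_le_compat; assumption.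
  - rewrite Cmod_opp, Cmod_mult, Cmod_R, Rabs_pos_eq by lra. apply Rmult_le_compat; [lra|apply Cmod_ge_0|lra|exact B5]. }
rewrite Cmod_R, Rabs_mult, Rabs_pos_eq in EB by lra. pose proof (Rabs_pos E).
apply Rle_trans with (2 * PI * Rabs E); [nra|]. eapply Rle_trans; [exact EB|].
set (W := 1 + 16 * Kloc * (3 + 64 * Kloc)) in *. assert (0 < W) by (unfold W; nra). nra.
Qed.
End Explicit.

Lemma explicit_formula : riemann_hypothesis -> exists C, 0 <= C /\ forall x h, 2 <= x -> 1 <= h <= x -> exists T, x ^ 4 <= T <= x ^ 4 + 1 /\
  Rabs ((psi1 (x + h) - psi1 x) / h - (x + h / 2) + 2 * Re (sumC (fun g => Kh x h (1 / 2, g)) (gam T))) <= C * exp (ln x / 2).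
Proof.
intros RH. pose proof Kloc_facts as [_ HK]. eexists. split; [|intros x h Hx Hh].
2:{ assert (2 <= x ^ 4) by (pose proof (pow_incr 2 x 4 ltac:(lra)); lra). destruct (zero_factor_exists (x ^ 4 + 5)) as [L [G HF]]; [lra|].
  destruct (good_height RH (x ^ 4) (x ^ 4 + 5) L G) as [T [eta [H1 [H2 [H3 H4]]]]]; [lra|lra|exact HF|].
  exists T. split; [exact H1|]. apply (explicit_aux RH x h Hx Hh L G T eta); assumption. }
assert (0 < ln 5) by (rewrite <- ln_1; apply ln_increasing; lra). assert (0 < Kloc * ln 5) by (apply Rmult_lt_0_compat; assumption). nra.
Qed.

(** * Summation by parts and a Sobolev inequality *)

Lemma list_max_exists (l : list R) : l <> nil -> exists m, In m l /\ forall g, In g l -> g <= m.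
Proof.
induction l as [|a l IH]; [congruence|]. intros _. destruct l as [|b l].
- exists a. split; [left; reflexivity|]. intros g [->|[]]. lra.
- destruct IH as [m [H1 H2]]; [discriminate|]. destruct (Rle_dec a m) as [h|h].
  + exists m. split; [right; exact H1|]. intros g [->|Hg]; [exact h|apply H2, Hg].
  + exists a. split; [left; reflexivity|]. intros g [->|Hg]; [lra|]. specialize (H2 g Hg). lra.
Qed.

(* Summation by parts without sorting: [D] is the chain of consecutive distinct breakpoints from [A] to [B]. *)
Lemma abel_repr (n : nat) : forall (l : list R) (A B : R), (length l <= n)%nat -> A <= B -> (forall g, In g l -> A < g <= B) ->
  exists D : list (R * R),
    (forall p, In p D -> A <= fst p <= snd p /\ snd p <= B) /\
    (forall psi : R -> R, sumR (fun p => psi (snd p) - psi (fst p)) D = psi B - psi A) /\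
    (forall phi e : R -> C, (sumC (fun g => phi g * e g) l =
       phi B * sumC e l - sumC (fun p => (phi (snd p) - phi (fst p)) * sumC e (filter (leb_R (fst p)) l)) D)%C).
Proof.
induction n as [|n IH]; intros l A B Hn HAB Hl.
- destruct l as [|a l]; [|simpl in Hn; lia]. exists ((A, B) :: nil). repeat split.
  + destruct H as [<-|[]]. simpl. lra.
  + destruct H as [<-|[]]. simpl. lra.
  + destruct H as [<-|[]]. simpl. lra.
  + intros. simpl. ring.
  + intros. simpl. ring.
- destruct l as [|a0 l0]; [apply (IH nil A B); [simpl; lia|exact HAB|exact Hl]|].
  destruct (list_max_exists (a0 :: l0)) as [m [Hm1 Hm2]]; [discriminate|].
  set (l := a0 :: l0) in *. set (p := fun g : R => if Rlt_dec g m then true else false).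
  assert (Hp : forall g, p g = true <-> g < m) by (intros g; unfold p; destruct (Rlt_dec g m); split; intros; try reflexivity; try discriminate; lra).
  pose proof (Hl m Hm1) as Hm.
  destruct (IH (filter p l) A m) as [D [D1 [D2 D3]]].
  + assert (L1 : (length (filter p l) < length l)%nat); [|lia].
    rewrite <- (filter_length p l). assert (Hin : In m (filter (fun x => negb (p x)) l)).
    { apply filter_In. split; [exact Hm1|]. destruct (p m) eqn:E; [apply Hp in E; lra|reflexivity]. }
    destruct (filter (fun x => negb (p x)) l); [destruct Hin|simpl; lia].
  + lra.
  + intros g Hg. apply filter_In in Hg. destruct Hg as [G1 G2]. apply Hp in G2. specialize (Hl g G1). lra.
  + exists ((m, B) :: D). split; [|split].
    * intros q [<-|Hq]; [simpl; lra|]. specialize (D1 q Hq). lra.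
    * intros psi. simpl. rewrite D2. ring.
    * intros phi e. rewrite (sumC_partition (fun g => phi g * e g)%C p l), D3.
      assert (E1 : sumC (fun g => phi g * e g)%C (filter (fun x => negb (p x)) l) = (phi m * sumC e (filter (fun x => negb (p x)) l))%C).
      { rewrite <- sumC_scal. apply sumC_ext. intros g Hg. apply filter_In in Hg. destruct Hg as [G1 G2]. replace g with m; [reflexivity|].
        specialize (Hm2 g G1). destruct (p g) eqn:E; [discriminate|]. destruct (Rlt_dec g m) as [h|h]; [apply Hp in h; congruence|lra]. }
      rewrite E1. change (sumC (fun p0 => (phi (snd p0) - phi (fst p0)) * sumC e (filter (leb_R (fst p0)) l)) ((m, B) :: D))%C with
        ((phi B - phi m) * sumC e (filter (leb_R m) l) + sumC (fun p0 => (phi (snd p0) - phi (fst p0)) * sumC e (filter (leb_R (fst p0)) l)) D)%C.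
      assert (E2 : filter (leb_R m) l = l).
      { apply forallb_filter_id, forallb_forall. intros g Hg. unfold leb_R. destruct (Rle_dec g m) as [|h]; [reflexivity|]. exfalso. apply h, Hm2, Hg. }
      (* Breakpoints below m see the same partial sums with or without the copies of m; an interval
         starting at m is degenerate and contributes 0. *)
      assert (E3 : sumC (fun p0 => (phi (snd p0) - phi (fst p0)) * sumC e (filter (leb_R (fst p0)) (filter p l)))%C D =
                   sumC (fun p0 => (phi (snd p0) - phi (fst p0)) * sumC e (filter (leb_R (fst p0)) l))%C D).
      { apply sumC_ext. intros q Hq. specialize (D1 q Hq). destruct (Req_EM_T (fst q) m) as [h|h].
        - replace (snd q) with (fst q) by lra. ring.
        - f_equal. f_equal. rewrite filter_filter. apply filter_ext. intros g. unfold leb_R, p. destruct (Rle_dec g (fst q)), (Rlt_dec g m); simpl; try reflexivity. lra. }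
      rewrite E2, E3, (sumC_partition e p l). ring.
Qed.

(** [psi] dominates the variation of [phi], so the increments over the breakpoints telescope to psi
    B - psi A once every partial sum is bounded by M. *)
Lemma abel_bound (l : list R) (A B M : R) (phi e : R -> C) (psi : R -> R) : A <= B -> (forall g, In g l -> A < g <= B) ->
  (forall s t, A <= s <= t -> t <= B -> Cmod (phi t - phi s) <= psi t - psi s) ->
  (forall u, A <= u <= B -> Cmod (sumC e (filter (leb_R u) l)) <= M) ->
  Cmod (sumC (fun g => phi g * e g)%C l) <= M * (Cmod (phi B) + (psi B - psi A)).
Proof.
intros HAB Hl Hphi HM. destruct (abel_repr (length l) l A B (Nat.le_refl _) HAB Hl) as [D [D1 [D2 D3]]].
rewrite D3. unfold Cminus at 1. eapply Rle_trans; [apply Cmod_triangle|]. rewrite Cmod_opp, Rmult_plus_distr_l. apply Rplus_le_compat.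
- rewrite Cmod_mult, Rmult_comm. apply Rmult_le_compat_r; [apply Cmod_ge_0|]. specialize (HM B ltac:(lra)).
  rewrite forallb_filter_id in HM; [exact HM|]. apply forallb_forall. intros g Hg. unfold leb_R. destruct (Rle_dec g B) as [|h]; [reflexivity|]. exfalso. apply h, Hl, Hg.
- rewrite <- D2, <- sumR_scal. apply sumC_bound. intros p Hp. destruct (D1 p Hp) as [P1 P2]. rewrite Cmod_mult, Rmult_comm.
  apply Rmult_le_compat; try apply Cmod_ge_0; [apply HM; lra|apply Hphi; lra].
Qed.

Lemma sumC_cauchy_weighted {I : Type} (d : I -> R) (X : I -> C) (D : list I) : (forall p, In p D -> 0 <= d p) ->
  Cmod (sumC (fun p => RtoC (d p) * X p)%C D) ^ 2 <= sumR d D * sumR (fun p => d p * Cmod (X p) ^ 2) D.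
Proof.
induction D as [|p D IH]; intros Hd; [simpl; rewrite Cmod_0; lra|].
cbn [sumC sumR fold_right]. fold (sumC (fun p => RtoC (d p) * X p)%C D) (sumR d D) (sumR (fun p => d p * Cmod (X p) ^ 2) D).
specialize (IH (fun q Hq => Hd q (or_intror Hq))). pose proof (Hd p (or_introl eq_refl)) as Hp.
assert (HS : 0 <= sumR d D) by (apply sumR_nonneg; intros; apply Hd; right; assumption).
set (Y := sumC (fun p => RtoC (d p) * X p)%C D) in *. set (sd := sumR d D) in *. set (q := sumR (fun p => d p * Cmod (X p) ^ 2) D) in *.
assert (Hq : 0 <= q) by (apply sumR_nonneg; intros; apply Rmult_le_pos; [apply Hd; right; assumption|apply pow2_ge_0]).
assert (T : Cmod (RtoC (d p) * X p + Y) <= d p * Cmod (X p) + Cmod Y).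
{ eapply Rle_trans; [apply Cmod_triangle|]. rewrite Cmod_mult, Cmod_R, Rabs_pos_eq by exact Hp. lra. }
pose proof (Cmod_ge_0 (X p)). pose proof (Cmod_ge_0 Y). set (x := Cmod (X p)) in *. set (y := Cmod Y) in *. set (dp := d p) in *.
assert (T2 : Cmod (RtoC dp * X p + Y) ^ 2 <= (dp * x + y) ^ 2) by (apply pow_incr; split; [apply Cmod_ge_0|exact T]).
eapply Rle_trans; [exact T2|].
assert (G : 2 * (x * y) <= sd * x ^ 2 + q).
{ destruct (Req_dec sd 0) as [h|h].
  - rewrite h, Rmult_0_l in IH. assert (y <= 0) by nra. assert (Ey : y = 0) by lra. rewrite Ey, h. lra.
  - assert (y ^ 2 / sd <= q) by (apply div_le_of_mul; lra). assert (0 <= (sd * x - y) ^ 2 / sd) by (apply Rdiv_le_0_compat; [apply pow2_ge_0|lra]).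
    replace ((sd * x - y) ^ 2 / sd) with (sd * x ^ 2 - 2 * (x * y) + y ^ 2 / sd) in H2 by (field; lra). lra. }
assert (dp * (2 * (x * y)) <= dp * (sd * x ^ 2 + q)) by (apply Rmult_le_compat_l; assumption). nra.
Qed.

(** Let q = A^2 + B^2. The derivative of -(d - t) q(t) integrates to d q(0), and 2 |f f'| <= lam f^2
    + f'^2 / lam bounds the term containing q'. The parameter lam stays free so that it can be
    matched to the ratio between f' and f. *)
Lemma sobolev (A B A' B' : R -> R) (d lam : R) : 0 < d -> 0 < lam ->
  (forall t, is_derive A t (A' t)) -> (forall t, is_derive B t (B' t)) -> (forall t, continuous A' t) -> (forall t, continuous B' t) ->
  A 0 ^ 2 + B 0 ^ 2 <= (/ d + lam) * RInt (fun t => A t ^ 2 + B t ^ 2) 0 d + / lam * RInt (fun t => A' t ^ 2 + B' t ^ 2) 0 d.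
Proof.
intros Hd Hl DA DB CA' CB'.
assert (CA : forall t, continuous A t) by (intros t; apply (ex_derive_continuous (V := R_NormedModule)); eexists; apply DA).
assert (CB : forall t, continuous B t) by (intros t; apply (ex_derive_continuous (V := R_NormedModule)); eexists; apply DB).
assert (Csq : forall f : R -> R, (forall t, continuous f t) -> forall t, continuous (fun t => f t ^ 2) t).
{ intros f Hf t. apply (continuous_ext (fun t => f t * f t)); [intros; simpl; ring|]. apply (continuous_mult f f); apply Hf. }
set (q := fun t => A t ^ 2 + B t ^ 2). set (r := fun t => A' t ^ 2 + B' t ^ 2).
assert (Cq : forall t, continuous q t) by (intros t; apply (continuous_plus (fun t => A t ^ 2) (fun t => B t ^ 2)); apply Csq; assumption).
assert (Cr : forall t, continuous r t) by (intros t; apply (continuous_plus (fun t => A' t ^ 2) (fun t => B' t ^ 2)); apply Csq; assumption).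
assert (Iq : ex_RInt q 0 d) by (apply (ex_RInt_continuous (V := R_CompleteNormedModule)); intros; apply Cq).
assert (Ir : ex_RInt r 0 d) by (apply (ex_RInt_continuous (V := R_CompleteNormedModule)); intros; apply Cr).
set (g := fun t => q t - (d - t) * (2 * (A t * A' t + B t * B' t))).
assert (Cg : forall t, continuous g t).
{ intros t. apply (continuous_minus q (fun t => (d - t) * (2 * (A t * A' t + B t * B' t)))); [apply Cq|].
  apply (continuous_mult (fun t => d - t) (fun t => 2 * (A t * A' t + B t * B' t))).
  - apply (continuous_minus (fun _ : R => d) (fun t : R => t)); [apply continuous_const|apply continuous_id].
  - apply (continuous_scal_r 2 (fun t => A t * A' t + B t * B' t)). apply (continuous_plus (fun t => A t * A' t) (fun t => B t * B' t)).
    + apply (continuous_mult A A'); auto.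
    + apply (continuous_mult B B'); auto. }
assert (Ig : is_RInt g 0 d (d * q 0)).
{ replace (d * q 0) with (minus ((fun t => - ((d - t) * q t)) d) ((fun t => - ((d - t) * q t)) 0)).
  - apply (is_RInt_derive (V := R_CompleteNormedModule) (fun t => - ((d - t) * q t))); [|intros; apply Cg].
    intros t _. unfold q, g. specialize (DA t). specialize (DB t). auto_derive; [split; [eexists; exact DA|split; [eexists; exact DB|exact I]]|].
    rewrite (is_derive_unique (fun x : R => A x) t _ DA), (is_derive_unique (fun x : R => B x) t _ DB). unfold q. ring.
  - unfold minus, plus, opp. simpl. ring. }
assert (Bd : d * q 0 <= RInt (fun t => (1 + d * lam) * q t + d / lam * r t) 0 d).
{ rewrite <- (is_RInt_unique _ _ _ _ Ig). apply RInt_le; [lra|eexists; exact Ig| |].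
  - apply (ex_RInt_plus (V := R_NormedModule)); apply (ex_RInt_scal (V := R_NormedModule)); assumption.
  - intros t Ht. unfold g.
    assert (Y : - (2 * (A t * A' t + B t * B' t)) <= lam * q t + / lam * r t).
    { assert (P1 : 0 <= / lam * ((lam * A t + A' t) ^ 2 + (lam * B t + B' t) ^ 2)) by (apply Rmult_le_pos; [left; apply Rinv_0_lt_compat, Hl|pose proof (pow2_ge_0 (lam * A t + A' t)); pose proof (pow2_ge_0 (lam * B t + B' t)); lra]).
      replace (/ lam * ((lam * A t + A' t) ^ 2 + (lam * B t + B' t) ^ 2)) with (lam * q t + / lam * r t + 2 * (A t * A' t + B t * B' t)) in P1 by (unfold q, r; field; lra). lra. }
    assert (N : 0 <= lam * q t + / lam * r t).
    { unfold q, r. pose proof (pow2_ge_0 (A t)). pose proof (pow2_ge_0 (B t)). pose proof (pow2_ge_0 (A' t)). pose proof (pow2_ge_0 (B' t)).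
      apply Rplus_le_le_0_compat; apply Rmult_le_pos; try lra. left. apply Rinv_0_lt_compat, Hl. }
    replace ((1 + d * lam) * q t + d / lam * r t) with (q t + d * (lam * q t + / lam * r t)) by (field; lra).
    assert ((d - t) * - (2 * (A t * A' t + B t * B' t)) <= (d - t) * (lam * q t + / lam * r t)) by (apply Rmult_le_compat_l; lra). nra. }
rewrite (RInt_plus (V := R_CompleteNormedModule) (fun t => (1 + d * lam) * q t) (fun t => d / lam * r t)) in Bd by (apply (ex_RInt_scal (V := R_NormedModule)); assumption).
rewrite (RInt_scal (V := R_CompleteNormedModule) q), (RInt_scal (V := R_CompleteNormedModule) r) in Bd by assumption.
unfold plus, scal in Bd. simpl in Bd. unfold mult in Bd. simpl in Bd.
apply Rmult_le_reg_l with d; [exact Hd|]. eapply Rle_trans; [exact Bd|]. right. unfold r, q. field. lra.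
Qed.

(** * Mean squares of sums over zeros and F *)

Lemma list_prod_map {A B : Type} (f : A -> B) (l l' : list A) :
  list_prod (map f l) (map f l') = map (fun p => (f (fst p), f (snd p))) (list_prod l l').
Proof.
induction l as [|a l IH]; [reflexivity|]. simpl. rewrite map_app, !map_map, IH. reflexivity.
Qed.

Lemma sumC_app {A : Type} (f : A -> C) l l' : sumC f (l ++ l') = (sumC f l + sumC f l')%C.
Proof. induction l as [|a l IH]; simpl; [ring|]. rewrite IH. ring. Qed.

Lemma sumC_list_prod {A : Type} (f g : A -> C) (l l' : list A) :
  (sumC f l * sumC g l')%C = sumC (fun p => f (fst p) * g (snd p))%C (list_prod l l').
Proof.
induction l as [|a l IH]; simpl; [ring|]. rewrite sumC_app, sumC_map, <- IH. simpl. rewrite sumC_scal. ring.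
Qed.

Lemma fold_sumC {A : Type} (f : A -> C) l : fold_right Cplus (RtoC 0) (map f l) = sumC f l.
Proof. induction l as [|a l IH]; simpl; [reflexivity|rewrite IH; reflexivity]. Qed.

Lemma CInt_sumC {A : Type} (f : A -> R -> C) (l : list A) a b : (forall p, In p l -> forall t, ccont (f p) t) ->
  CInt (fun t => sumC (fun p => f p t) l) a b = sumC (fun p => CInt (f p) a b) l /\ forall t, ccont (fun t => sumC (fun p => f p t) l) t.
Proof.
induction l as [|p l IH]; intros Hf.
- split; [simpl; rewrite CInt_const; ring|intros t; apply (ccont_const (RtoC 0))].
- destruct IH as [I1 I2]; [intros; apply Hf; right; assumption|]. split.
  + simpl. rewrite CInt_plus, I1; [reflexivity| |]; intros t _; [apply Hf; left; reflexivity|apply I2].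
  + intros t. apply (ccont_plus (f p) (fun t => sumC (fun p => f p t) l)); [apply Hf; left; reflexivity|apply I2].
Qed.

Definition cis (g v : R) : C := Cexp (RtoC v * (0, g)).

Lemma cis_Cmod g v : Cmod (cis g v) = 1.
Proof. unfold cis. rewrite Cmod_Cexp. simpl. replace (v * 0 - 0 * g) with 0 by ring. apply exp_0. Qed.

Lemma rder_cis g v : rder (cis g) v ((0, g) * cis g v).
Proof. apply rder_Cexp_line. Qed.

Lemma cis_cont g v : ccont (cis g) v.
Proof. apply (rder_ccont _ _ _ (rder_cis g v)). Qed.

Lemma cis_plus g v t : cis g (v + t) = (cis g v * cis g t)%C.
Proof. unfold cis. rewrite <- Cexp_plus, RtoC_plus. f_equal. ring. Qed.

Lemma cis_conj g v : Cconj (cis g v) = cis (- g) v.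
Proof. unfold cis. rewrite <- Cexp_conj, Cmult_conj, Cconj_RtoC. f_equal; apply C_ext; simpl; ring. Qed.

Lemma cis_mult g g' v : (cis g v * cis g' v)%C = cis (g + g') v.
Proof. unfold cis. rewrite <- Cexp_plus. f_equal. apply C_ext; simpl; ring. Qed.

(** For l = [gam T] and v = log y this is the sum of y^(i gamma) over the zeros up to T. *)
Definition E (l : list R) (v : R) : C := sumC (fun g => cis g v) l.

Lemma E_cont l v : ccont (E l) v.
Proof. apply (CInt_sumC cis l 0 0). intros p _ t. apply cis_cont. Qed.

Lemma E_sq l v : RtoC (Cmod (E l v) ^ 2) = sumC (fun p => cis (fst p - snd p) v) (list_prod l l).
Proof.
rewrite Cmod2_conj. unfold E. rewrite <- sumC_conj, sumC_list_prod. apply sumC_ext. intros p _. rewrite cis_conj, cis_mult. reflexivity.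
Qed.

Lemma F_gam beta x T : 0 < x -> F beta x T = sumC (fun p => cis (fst p - snd p) (ln x) * RtoC (w beta (fst p - snd p)))%C (list_prod (gam T) (gam T)).
Proof.
intros Hx. unfold F, gam. rewrite fold_sumC, list_prod_map, sumC_map. apply sumC_ext. intros p _. cbn [fst snd]. f_equal.
rewrite cpow_Cexp. unfold cis. f_equal. ring.
Qed.

Lemma CInt_exp_decay (b u A : R) : 0 < b ->
  CInt (fun t => Cexp (RtoC t * (- b, u)%R)) 0 A = ((Cexp (RtoC A * (- b, u)%R) - 1) / (- b, u)%R)%C.
Proof.
intros Hb. assert (N : ((- b, u)%R : C) <> 0) by (intros H; apply (f_equal Re) in H; simpl in H; lra).
rewrite (CInt_FTC (fun t => Cexp (RtoC t * (- b, u)%R) / (- b, u)%R)%C).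
- replace (RtoC 0 * (- b, u)%R)%C with (RtoC 0) by ring. rewrite Cexp_0. unfold Cdiv. ring.
- intros t _. split; [|apply (rder_ccont _ _ _ (rder_Cexp_line _ _))].
  destruct (rder_Cexp_line (- b, u)%R t) as [p [P1 [P2 P3]]]. exists (fun t => p t / (- b, u)%R)%C. split; [|split].
  + apply ccont_div; [exact P1|apply ccont_const|exact N].
  + rewrite P2. field. exact N.
  + revert P3. apply filter_imp. intros s Es. unfold Cdiv. transitivity ((Cexp (RtoC s * (- b, u)%R) - Cexp (RtoC t * (- b, u)%R)) * / (- b, u)%R)%C; [ring|]. rewrite Es. ring.
Qed.

Lemma CInt_RtoC (f : R -> R) a b : (forall t, continuous f t) -> CInt (fun t => RtoC (f t)) a b = RtoC (RInt f a b).
Proof.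
intros Hf. rewrite CInt_pair by (intros t _; apply ccont_RtoC, Hf). simpl. unfold RtoC. f_equal.
rewrite RInt_const. unfold scal. simpl. unfold mult. simpl. ring.
Qed.

Lemma E_sq_cont l v sg t : continuous (fun t => Cmod (E l (v + sg * t)) ^ 2) t.
Proof.
apply (continuous_ext (fun t => Cmod (E l (v + sg * t)) * Cmod (E l (v + sg * t)))); [intros; simpl; ring|].
assert (Ct : continuous (fun t => Cmod (E l (v + sg * t))) t).
{ apply (continuous_comp (fun t => v + sg * t) (fun s => Cmod (E l s))); [apply (ex_derive_continuous (V := R_NormedModule)); auto_derive; exact I|apply ccont_Cmod, E_cont]. }
apply (continuous_mult (fun t => Cmod (E l (v + sg * t))) (fun t => Cmod (E l (v + sg * t)))); exact Ct.
Qed.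

(** A one-sided Laplace transform of |E|^2, stopped at A: squaring gives a double sum over pairs,
    and each pair contributes an elementary exponential integral. Both signs sg occur because the
    weight in F is two-sided. *)
Lemma one_sided (l : list R) (b v sg A : R) : 0 < b -> (sg = 1 \/ sg = -1) ->
  RtoC (RInt (fun t => exp (- b * t) * Cmod (E l (v + sg * t)) ^ 2) 0 A) =
  sumC (fun p => cis (fst p - snd p) v * ((Cexp (RtoC A * (- b, sg * (fst p - snd p))%R) - 1) / (- b, sg * (fst p - snd p))%R))%C (list_prod l l).
Proof.
intros Hb Hs.
assert (C1 : forall p t, ccont (fun t => cis (fst p - snd p) v * Cexp (RtoC t * (- b, sg * (fst p - snd p))%R))%C t).
{ intros p t. apply ccont_mult; [apply ccont_const|apply (rder_ccont _ _ _ (rder_Cexp_line _ _))]. }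
destruct (CInt_sumC (fun (p : R * R) t => cis (fst p - snd p) v * Cexp (RtoC t * (- b, sg * (fst p - snd p))%R))%C (list_prod l l) 0 A) as [I1 I2]; [intros; apply C1|].
assert (EQ : forall t, RtoC (exp (- b * t) * Cmod (E l (v + sg * t)) ^ 2) = sumC (fun p => cis (fst p - snd p) v * Cexp (RtoC t * (- b, sg * (fst p - snd p))%R))%C (list_prod l l)).
{ intros t. rewrite RtoC_mult, E_sq, <- sumC_scal. apply sumC_ext. intros p _. rewrite cis_plus. unfold cis at 2.
  replace (RtoC (exp (- b * t))) with (Cexp (RtoC (- b * t))) by (unfold Cexp; simpl; rewrite cos_0, sin_0; apply C_ext; simpl; ring).
  transitivity (cis (fst p - snd p) v * (Cexp (RtoC (- b * t)) * Cexp (RtoC (sg * t) * (0, (fst p - snd p)%R))))%C; [ring|]. rewrite <- Cexp_plus. f_equal. f_equal. apply C_ext; simpl; ring. }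
rewrite <- CInt_RtoC.
- rewrite (CInt_ext _ _ 0 A (fun t _ => EQ t)), I1. apply sumC_ext. intros p _.
  rewrite CInt_scal by (intros t _; apply (rder_ccont _ _ _ (rder_Cexp_line _ _))). rewrite CInt_exp_decay by exact Hb. reflexivity.
- intros t. apply (continuous_mult (fun t => exp (- b * t)) (fun t => Cmod (E l (v + sg * t)) ^ 2)).
  + apply (ex_derive_continuous (V := R_NormedModule)). auto_derive. exact I.
  + apply E_sq_cont.
Qed.

(** w(u) is the integral over real t of beta exp(-2 beta |t|) exp(iut); the two fractions are the
    contributions of the two half-lines. *)
Lemma w_split (beta u : R) : 0 < beta ->
  (RtoC beta * (- (1) / (- (2 * beta), 1 * u)%R + - (1) / (- (2 * beta), -1 * u)%R))%C = RtoC (w beta u).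
Proof.
intros Hb. assert (P : 0 < 4 * beta ^ 2 + u ^ 2) by (pose proof (pow2_ge_0 u); assert (0 < beta ^ 2) by (apply pow_lt, Hb); lra).
unfold w. unfold Cdiv. rewrite !Cinv_pair by (intros H; nra). apply C_ext; simpl; field; simpl in P; nra.
Qed.

Lemma tail_bound (b A u : R) : 0 < b -> Cmod (Cexp (RtoC A * (- b, u)%R) / (- b, u)%R) <= exp (- b * A) / b.
Proof.
intros Hb. assert (N : ((- b, u)%R : C) <> 0) by (intros H; apply (f_equal Re) in H; simpl in H; lra).
rewrite Cmod_div, Cmod_Cexp by exact N. simpl. replace (A * - b - 0 * u) with (- b * A) by ring.
unfold Rdiv. apply Rmult_le_compat_l; [left; apply exp_pos|]. apply Rinv_le_contravar; [exact Hb|].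
pose proof (re_le_Cmod (- b, u)%R) as B. simpl in B. rewrite Rabs_left in B; lra.
Qed.

(** The integral over the other half-line is nonnegative and is dropped. Stopping at a finite A
    avoids improper integrals, at the price of exp(-2 beta A) per pair. *)
Lemma ms_trunc (l : list R) (beta v A : R) : 0 < beta -> 0 <= A ->
  beta * RInt (fun t => exp (- (2 * beta) * t) * Cmod (E l (v + 1 * t)) ^ 2) 0 A <=
  Cmod (sumC (fun p => cis (fst p - snd p) v * RtoC (w beta (fst p - snd p)))%C (list_prod l l)) + INR (length (list_prod l l)) * exp (- (2 * beta) * A).
Proof.
intros Hb HA. set (P := list_prod l l).
set (J1 := RInt (fun t => exp (- (2 * beta) * t) * Cmod (E l (v + 1 * t)) ^ 2) 0 A).
set (J2 := RInt (fun t => exp (- (2 * beta) * t) * Cmod (E l (v + -1 * t)) ^ 2) 0 A).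
pose proof (one_sided l (2 * beta) v 1 A ltac:(lra) (or_introl eq_refl)) as E1. pose proof (one_sided l (2 * beta) v (-1) A ltac:(lra) (or_intror eq_refl)) as E2.
fold J1 P in E1. fold J2 P in E2.
assert (P2 : 0 <= J2).
{ apply RInt_ge_0; [exact HA| |].
  - apply (ex_RInt_continuous (V := R_CompleteNormedModule)). intros t _. apply (continuous_mult (fun t => exp (- (2 * beta) * t)) (fun t => Cmod (E l (v + -1 * t)) ^ 2)); [|apply E_sq_cont].
    apply (ex_derive_continuous (V := R_NormedModule)). auto_derive. exact I.
  - intros t _. apply Rmult_le_pos; [left; apply exp_pos|apply pow2_ge_0]. }
set (R := fun (p : R * R) => (RtoC beta * (Cexp (RtoC A * (- (2 * beta), 1 * (fst p - snd p))%R) / (- (2 * beta), 1 * (fst p - snd p))%R + Cexp (RtoC A * (- (2 * beta), -1 * (fst p - snd p))%R) / (- (2 * beta), -1 * (fst p - snd p))%R))%C).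
assert (EQ : RtoC (beta * (J1 + J2)) = (sumC (fun p => cis (fst p - snd p) v * RtoC (w beta (fst p - snd p))) P + sumC (fun p => cis (fst p - snd p) v * R p) P)%C).
{ rewrite RtoC_mult, RtoC_plus, E1, E2, <- !sumC_plus, <- sumC_scal. apply sumC_ext. intros p _. rewrite <- w_split by exact Hb. unfold R, Cdiv. ring. }
assert (B : Cmod (sumC (fun p => cis (fst p - snd p) v * R p)%C P) <= INR (length P) * exp (- (2 * beta) * A)).
{ rewrite <- sumR_const. apply sumC_bound. intros p _. rewrite Cmod_mult, cis_Cmod, Rmult_1_l. unfold R. rewrite Cmod_mult, Cmod_R, Rabs_pos_eq by lra.
  apply Rle_trans with (beta * (exp (- (2 * beta) * A) / (2 * beta) + exp (- (2 * beta) * A) / (2 * beta))); [|right; field; lra].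
  apply Rmult_le_compat_l; [lra|]. eapply Rle_trans; [apply Cmod_triangle|]. apply Rplus_le_compat; apply tail_bound; lra. }
apply Rle_trans with (beta * (J1 + J2)); [apply Rmult_le_compat_l; lra|].
apply Rle_trans with (Cmod (RtoC (beta * (J1 + J2)))); [rewrite Cmod_R; apply Rle_abs|].
rewrite EQ. eapply Rle_trans; [apply Cmod_triangle|]. apply Rplus_le_compat_l, B.
Qed.

Lemma exp_neg_le_inv y : 0 < y -> exp (- y) <= / y.
Proof. intros Hy. rewrite exp_Ropp. apply Rinv_le_contravar; [exact Hy|]. pose proof (exp_ineq1_le y). lra. Qed.

(** On [0, 1/beta] the weight exp(-2 beta t) is at least exp(-2), and the error in [ms_trunc] tends
    to 0 as A grows, while F and the window do not depend on A. *)
Lemma mean_square_F (beta x T : R) : 0 < beta -> 0 < x ->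
  beta * RInt (fun t => Cmod (E (gam T) (ln x + 1 * t)) ^ 2) 0 (/ beta) <= exp 2 * Cmod (F beta x T).
Proof.
intros Hb Hx. rewrite F_gam by exact Hx. set (l := gam T). set (v := ln x).
set (W := Cmod (sumC (fun p => cis (fst p - snd p) v * RtoC (w beta (fst p - snd p)))%C (list_prod l l))).
assert (Hib : 0 < / beta) by (apply Rinv_0_lt_compat, Hb).
assert (Cq : forall t, continuous (fun t => exp (- (2 * beta) * t) * Cmod (E l (v + 1 * t)) ^ 2) t).
{ intros t. apply (continuous_mult (fun t => exp (- (2 * beta) * t)) (fun t => Cmod (E l (v + 1 * t)) ^ 2)); [|apply E_sq_cont].
  apply (ex_derive_continuous (V := R_NormedModule)). auto_derive. exact I. }
assert (Ex : forall a b, ex_RInt (fun t => exp (- (2 * beta) * t) * Cmod (E l (v + 1 * t)) ^ 2) a b) by (intros; apply (ex_RInt_continuous (V := R_CompleteNormedModule)); intros; apply Cq).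
assert (Eq : forall a b, ex_RInt (fun t => Cmod (E l (v + 1 * t)) ^ 2) a b) by (intros; apply (ex_RInt_continuous (V := R_CompleteNormedModule)); intros; apply E_sq_cont).
apply Rmult_le_reg_l with (exp (- (2))); [apply exp_pos|]. rewrite <- (Rmult_assoc _ (exp 2)), <- exp_plus. replace (- (2) + 2) with 0 by ring. rewrite exp_0, Rmult_1_l.
apply Rle_trans with (beta * RInt (fun t => exp (- (2 * beta) * t) * Cmod (E l (v + 1 * t)) ^ 2) 0 (/ beta)).
{ rewrite <- Rmult_assoc, (Rmult_comm _ beta), Rmult_assoc. apply Rmult_le_compat_l; [lra|].
  change (exp (- (2)) * RInt (fun t => Cmod (E l (v + 1 * t)) ^ 2) 0 (/ beta)) with (scal (exp (- (2))) (RInt (fun t => Cmod (E l (v + 1 * t)) ^ 2) 0 (/ beta))).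
  rewrite <- (RInt_scal (V := R_CompleteNormedModule)) by apply Eq.
  apply RInt_le; [lra|apply (ex_RInt_scal (V := R_NormedModule)), Eq|apply Ex|]. intros t Ht. unfold scal. simpl. unfold mult. simpl.
  apply Rmult_le_compat_r; [apply (pow2_ge_0 (Cmod (E l (v + 1 * t))))|]. apply exp_le.
  assert (beta * t <= beta * / beta) by (apply Rmult_le_compat_l; lra). rewrite Rinv_r in H by lra. lra. }
apply le_epsilon. intros e He. set (n := INR (length (list_prod l l))). assert (Hn : 0 <= n) by apply pos_INR.
(* Large enough that n exp(-2 beta A) <= n / (2 beta A) < e, where n counts the pairs. *)
set (A := / beta + (n + 1) / (2 * beta * e)).
assert (HA : / beta < A). { unfold A. assert (0 < (n + 1) / (2 * beta * e)) by (apply Rdiv_lt_0_compat; [lra|repeat apply Rmult_lt_0_compat; lra]). lra. }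
apply Rle_trans with (beta * RInt (fun t => exp (- (2 * beta) * t) * Cmod (E l (v + 1 * t)) ^ 2) 0 A).
{ apply Rmult_le_compat_l; [lra|]. rewrite <- (RInt_Chasles (V := R_CompleteNormedModule) _ 0 (/ beta) A) by apply Ex.
  assert (0 <= RInt (fun t => exp (- (2 * beta) * t) * Cmod (E l (v + 1 * t)) ^ 2) (/ beta) A).
  { apply RInt_ge_0; [lra|apply Ex|]. intros t _. apply Rmult_le_pos; [left; apply exp_pos|apply pow2_ge_0]. }
  unfold plus. simpl. apply Rle_trans with (RInt (fun t => exp (- (2 * beta) * t) * Cmod (E l (v + 1 * t)) ^ 2) 0 (/ beta) + 0); [rewrite Rplus_0_r; apply Rle_refl|apply Rplus_le_compat_l; assumption]. }
eapply Rle_trans; [apply ms_trunc; lra|]. fold W n. apply Rplus_le_compat_l.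
assert (HA2 : (n + 1) / e <= 2 * beta * A).
{ unfold A. apply Rle_trans with (2 * beta * ((n + 1) / (2 * beta * e))); [right; field; lra|]. apply Rmult_le_compat_l; lra. }
assert (P0 : 0 < (n + 1) / e) by (apply Rdiv_lt_0_compat; lra).
apply Rle_trans with (n * / ((n + 1) / e)).
- apply Rmult_le_compat_l; [exact Hn|]. replace (- (2 * beta) * A) with (- (2 * beta * A)) by ring. eapply Rle_trans; [apply exp_neg_le_inv; lra|]. apply Rinv_le_contravar; assumption.
- replace (n * / ((n + 1) / e)) with (e * n / (n + 1)) by (field; lra). apply div_le_of_mul; nra.
Qed.

Lemma RInt_sumR {I : Type} (f : I -> R -> R) (D : list I) a b : (forall p t, continuous (f p) t) ->
  is_RInt (fun t => sumR (fun p => f p t) D) a b (sumR (fun p => RInt (f p) a b) D).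
Proof.
intros Hf. induction D as [|p D IH].
- simpl. pose proof (is_RInt_const (V := R_NormedModule) a b 0) as H. unfold scal in H; simpl in H; unfold mult in H; simpl in H. rewrite Rmult_0_r in H. exact H.
- apply (is_RInt_plus (V := R_NormedModule) (f p) (fun t => sumR (fun p => f p t) D)); [|exact IH].
  apply (RInt_correct (V := R_CompleteNormedModule)), (ex_RInt_continuous (V := R_CompleteNormedModule)). intros; apply Hf.
Qed.

(** * Comparison of powers and logarithms *)

Lemma one_le_Rpower s b : 1 <= s -> 0 <= b -> 1 <= Rpower s b.
Proof. intros Hs Hb. unfold Rpower. rewrite <- exp_0. apply exp_le. apply Rmult_le_pos; [exact Hb|apply ln_nonneg, Hs]. Qed.

Lemma Rpower_le_exponent s b c : 1 <= s -> b <= c -> Rpower s b <= Rpower s c.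
Proof. intros Hs Hb. unfold Rpower. apply exp_le. apply Rmult_le_compat_r; [apply ln_nonneg, Hs|exact Hb]. Qed.

Lemma Rpower_pos s b : 0 < Rpower s b.
Proof. apply exp_pos. Qed.

Lemma ln3_ge_1 : 1 <= ln 3.
Proof. rewrite <- (ln_exp 1). apply ln_le; [apply exp_pos|apply exp_1_lt_3]. Qed.

Lemma ln3_le_2 : ln 3 <= 2.
Proof. pose proof (exp_ineq1_le (ln 3)) as A. rewrite exp_ln in A by lra. lra. Qed.

(** The function u (log u)^b is increasing up to a constant. The case of interest is negative b:
    with r = T/u one has log T = log u + log r <= 2 sqrt r log u, so exchanging log T for log u
    costs at most (log T / log u)^2 <= 4r. *)
Lemma power_ratio (b u T : R) : -2 <= b -> 3 <= u <= T -> u * Rpower (ln u) b <= 4 * (T * Rpower (ln T) b).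
Proof.
intros Hb Hu. pose proof ln3_ge_1 as L3. assert (Lu : 1 <= ln u) by (pose proof (ln_le 3 u ltac:(lra) ltac:(lra)); lra).
assert (LT : ln u <= ln T) by (apply ln_le; lra).
set (r := T / u). assert (Hr : 1 <= r) by (apply le_div_of_mul; lra).
set (d := ln (ln T) - ln (ln u)). assert (Hd : 0 <= d) by (unfold d; pose proof (ln_le (ln u) (ln T) ltac:(lra) LT); lra).
assert (E1 : Rpower (ln u) b = Rpower (ln T) b * exp (- b * d)) by (unfold Rpower, d; rewrite <- exp_plus; f_equal; ring).
assert (E2 : exp (- b * d) <= 4 * r).
{ apply Rle_trans with (exp (2 * d)); [apply exp_le; nra|]. replace (2 * d) with (d + d) by ring. rewrite exp_plus. unfold d. rewrite exp_ln_minus by lra.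
  assert (Q : ln T / ln u <= 2 * sqrt r).
  { apply div_le_of_mul; [lra|]. assert (Er : ln T = ln u + ln r) by (unfold r; rewrite ln_div by lra; ring).
    assert (Hs : 1 <= sqrt r) by (rewrite <- sqrt_1; apply sqrt_le_1_alt; lra).
    assert (Ls : ln r <= 2 * (sqrt r - 1)).
    { rewrite <- (sqrt_sqrt r) at 1 by lra. rewrite ln_mult by lra. pose proof (exp_ineq1_le (ln (sqrt r))) as A. rewrite exp_ln in A by lra. lra. }
    rewrite Er. nra. }
  assert (Q0 : 0 <= ln T / ln u) by (apply Rdiv_le_0_compat; lra).
  replace (4 * r) with (2 * sqrt r * (2 * sqrt r)) by (pose proof (sqrt_sqrt r ltac:(lra)); nra). apply Rmult_le_compat; assumption. }
rewrite E1. assert (ET : u * r = T) by (unfold r; field; lra). pose proof (Rpower_pos (ln T) b) as P.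
apply Rle_trans with (u * (Rpower (ln T) b * (4 * r))); [apply Rmult_le_compat_l; [lra|]; apply Rmult_le_compat_l; lra|]. right. rewrite <- ET. ring.
Qed.

Lemma ln_sq_le_sqrt T : 1 <= T -> ln T ^ 2 <= 16 * exp (ln T / 2).
Proof.
intros HT. pose proof (sq_le_exp (/ 2) (ln T) ltac:(lra) (ln_nonneg T HT)) as A. replace (/ 2 * ln T) with (ln T / 2) in A by (unfold Rdiv; ring). lra.
Qed.

Lemma ln_cube_le T : 1 <= T -> ln T ^ 3 <= 27 * T.
Proof.
intros HT. pose proof (lin_le_exp (/ 3) (ln T) ltac:(lra) (ln_nonneg T HT)) as A. pose proof (ln_nonneg T HT) as L.
assert (B : ln T ^ 3 <= (/ / 3 * exp (/ 3 * ln T)) ^ 3) by (apply pow_incr; split; assumption).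
eapply Rle_trans; [exact B|]. rewrite Rinv_inv, Rpow_mult_distr. replace (exp (/ 3 * ln T) ^ 3) with T; [lra|].
simpl. rewrite Rmult_1_r, <- !exp_plus. replace (/ 3 * ln T + (/ 3 * ln T + / 3 * ln T)) with (ln T) by field. rewrite exp_ln; lra.
Qed.

(** * Mean squares of the exponential sum and of its derivative *)

Definition Q (l : list R) (v d : R) : R := RInt (fun t => Cmod (E l (v + 1 * t)) ^ 2) 0 d.

Lemma Q_ex l v a b : ex_RInt (fun t => Cmod (E l (v + 1 * t)) ^ 2) a b.
Proof. apply (ex_RInt_continuous (V := R_CompleteNormedModule)). intros; apply E_sq_cont. Qed.

Lemma Q_mono l v d d' : 0 <= d <= d' -> Q l v d <= Q l v d'.
Proof.
intros Hd. unfold Q. rewrite <- (RInt_Chasles (V := R_CompleteNormedModule) _ 0 d d') by apply Q_ex.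
assert (0 <= RInt (fun t => Cmod (E l (v + 1 * t)) ^ 2) d d') by (apply RInt_ge_0; [lra|apply Q_ex|intros; apply pow2_ge_0]).
unfold plus; simpl. apply Rle_trans with (RInt (fun t => Cmod (E l (v + 1 * t)) ^ 2) 0 d + 0); [rewrite Rplus_0_r; apply Rle_refl|apply Rplus_le_compat_l; assumption].
Qed.

Lemma E_trivial l v : Cmod (E l v) <= INR (length l).
Proof.
rewrite <- (Rmult_1_r (INR (length l))), <- sumR_const. apply sumC_bound. intros g _. rewrite cis_Cmod. lra.
Qed.

Lemma Q_trivial l v d N : 0 <= d -> INR (length l) <= N -> Q l v d <= d * N ^ 2.
Proof.
intros Hd HN. unfold Q. replace (d * N ^ 2) with (RInt (fun _ => N ^ 2) 0 d) by (rewrite RInt_const; unfold scal; simpl; unfold mult; simpl; ring).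
apply RInt_le; [exact Hd|apply Q_ex|apply ex_RInt_const|]. intros t _. apply pow_incr. split; [apply Cmod_ge_0|]. eapply Rle_trans; [apply E_trivial|exact HN].
Qed.

Definition E1 (l : list R) (v : R) : C := sumC (fun g => (0, g) * cis g v)%C l.

Lemma E_components l v t :
  is_derive (fun t => Re (E l (v + 1 * t))) t (Re (E1 l (v + 1 * t))) /\ is_derive (fun t => Im (E l (v + 1 * t))) t (Im (E1 l (v + 1 * t))).
Proof.
assert (EQ : forall g t, cis g (v + 1 * t) = (cos (g * (v + t)), sin (g * (v + t)))).
{ intros g s. unfold cis, Cexp. simpl. replace ((v + 1 * s) * 0 - 0 * g) with 0 by ring. rewrite exp_0. apply C_ext; simpl; rewrite Rmult_1_l; f_equal; ring. }
induction l as [|g l [IH1 IH2]].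
- split; simpl; apply (is_derive_const (V := R_NormedModule)).
- split.
  + apply (is_derive_ext (fun t => cos (g * (v + t)) + Re (E l (v + 1 * t)))); [intros s; unfold E; cbn [sumC fold_right]; rewrite EQ; reflexivity|].
    replace (Re (E1 (g :: l) (v + 1 * t))) with (- g * sin (g * (v + t)) + Re (E1 l (v + 1 * t))).
    * apply (is_derive_plus (V := R_NormedModule) (fun t => cos (g * (v + t))) (fun t => Re (E l (v + 1 * t)))); [|exact IH1]. auto_derive; [exact I|ring].
    * unfold E1. cbn [sumC fold_right]. rewrite EQ, re_plus. simpl. fold (sumC (fun g => (0, g) * cis g (v + 1 * t))%C l). ring.
  + apply (is_derive_ext (fun t => sin (g * (v + t)) + Im (E l (v + 1 * t)))); [intros s; unfold E; cbn [sumC fold_right]; rewrite EQ; reflexivity|].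
    replace (Im (E1 (g :: l) (v + 1 * t))) with (g * cos (g * (v + t)) + Im (E1 l (v + 1 * t))).
    * apply (is_derive_plus (V := R_NormedModule) (fun t => sin (g * (v + t))) (fun t => Im (E l (v + 1 * t)))); [|exact IH2]. auto_derive; [exact I|ring].
    * unfold E1. cbn [sumC fold_right]. rewrite EQ, im_plus. simpl. fold (sumC (fun g => (0, g) * cis g (v + 1 * t))%C l). ring.
Qed.

Lemma E1_cont l v : ccont (E1 l) v.
Proof. apply (CInt_sumC (fun g v => (0, g) * cis g v)%C l 0 0). intros g _ t. apply ccont_mult; [apply ccont_const|apply cis_cont]. Qed.

Lemma cont_shift (f : R -> C) v t : (forall v, ccont f v) -> ccont (fun t => f (v + 1 * t)) t.
Proof.
intros Hf e He. specialize (Hf (v + 1 * t) e He).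
assert (Cv : continuous (fun t => v + 1 * t) t) by (apply (ex_derive_continuous (V := R_NormedModule)); auto_derive; exact I).
exact (Cv _ Hf).
Qed.

Lemma Cmod_sq (z : C) : Cmod z ^ 2 = Re z ^ 2 + Im z ^ 2.
Proof. unfold Cmod. rewrite pow2_sqrt; [reflexivity|]. pose proof (pow2_ge_0 (fst z)). pose proof (pow2_ge_0 (snd z)). lra. Qed.

Lemma sobolev_E l v d lam : 0 < d -> 0 < lam ->
  Cmod (E l v) ^ 2 <= (/ d + lam) * Q l v d + / lam * RInt (fun t => Cmod (E1 l (v + 1 * t)) ^ 2) 0 d.
Proof.
intros Hd Hl. pose proof (sobolev (fun t => Re (E l (v + 1 * t))) (fun t => Im (E l (v + 1 * t))) (fun t => Re (E1 l (v + 1 * t))) (fun t => Im (E1 l (v + 1 * t))) d lam Hd Hl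
 (fun t => proj1 (E_components l v t)) (fun t => proj2 (E_components l v t))) as S.
assert (X1 : forall t, continuous (fun t => Re (E1 l (v + 1 * t))) t) by (intros t; apply (ccont_Re (fun t => E1 l (v + 1 * t))), cont_shift, E1_cont).
assert (X2 : forall t, continuous (fun t => Im (E1 l (v + 1 * t))) t) by (intros t; apply (ccont_Im (fun t => E1 l (v + 1 * t))), cont_shift, E1_cont).
specialize (S X1 X2). cbv beta in S. rewrite Rmult_0_r, Rplus_0_r, <- Cmod_sq in S.
rewrite (RInt_ext _ (fun t => Cmod (E l (v + 1 * t)) ^ 2)) in S by (intros; symmetry; apply Cmod_sq).
rewrite (RInt_ext (fun t => Re (E1 l (v + 1 * t)) ^ 2 + Im (E1 l (v + 1 * t)) ^ 2) (fun t => Cmod (E1 l (v + 1 * t)) ^ 2)) in S by (intros; symmetry; apply Cmod_sq). exact S.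
Qed.

(** Summation by parts writes [E1], the derivative of [E], as i times a weighted sum of differences
    between the full sum and its partial sums, with nonnegative weights of total T. Cauchy-Schwarz
    against these weights moves the square inside, so only mean squares of partial sums over the
    window enter. *)
Lemma E1_mean_square (l : list R) (T v d M : R) : 0 < T -> 0 < d -> (forall g, In g l -> 0 < g <= T) ->
  (forall u, 0 <= u <= T -> Q (filter (leb_R u) l) v d <= M) ->
  RInt (fun t => Cmod (E1 l (v + 1 * t)) ^ 2) 0 d <= 4 * T ^ 2 * M.
Proof.
intros HT Hd Hl HM. destruct (abel_repr (length l) l 0 T (Nat.le_refl _) ltac:(lra) Hl) as [D [D1 [D2 D3]]].
assert (Hfull : filter (leb_R T) l = l).
{ apply forallb_filter_id, forallb_forall. intros g Hg. unfold leb_R. destruct (Rle_dec g T) as [|h]; [reflexivity|]. exfalso. apply h, Hl, Hg. }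
set (dp := fun p : R * R => snd p - fst p).
assert (Hdp : forall p, In p D -> 0 <= dp p) by (intros p Hp; unfold dp; specialize (D1 p Hp); lra).
assert (Sd : sumR dp D = T) by (unfold dp; rewrite (D2 (fun x => x)); ring).
set (f := fun (p : R * R) t => dp p * (2 * Cmod (E l (v + 1 * t)) ^ 2 + 2 * Cmod (E (filter (leb_R (fst p)) l) (v + 1 * t)) ^ 2)).
assert (Cf : forall p t, continuous (f p) t).
{ intros p t. apply (continuous_scal_r (dp p) (fun t => 2 * Cmod (E l (v + 1 * t)) ^ 2 + 2 * Cmod (E (filter (leb_R (fst p)) l) (v + 1 * t)) ^ 2)).
  apply (continuous_plus (fun t => 2 * Cmod (E l (v + 1 * t)) ^ 2) (fun t => 2 * Cmod (E (filter (leb_R (fst p)) l) (v + 1 * t)) ^ 2));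
  [apply (continuous_scal_r 2 (fun t => Cmod (E l (v + 1 * t)) ^ 2))|apply (continuous_scal_r 2 (fun t => Cmod (E (filter (leb_R (fst p)) l) (v + 1 * t)) ^ 2))]; apply E_sq_cont. }
pose proof (RInt_sumR f D 0 d Cf) as I1.
assert (Pt : forall t, Cmod (E1 l (v + 1 * t)) ^ 2 <= T * sumR (fun p => f p t) D).
{ intros t. set (y := v + 1 * t).
  assert (R1 : E1 l y = (Ci * sumC (fun p => RtoC (dp p) * (E l y - E (filter (leb_R (fst p)) l) y)) D)%C).
  { unfold E1. rewrite (sumC_ext _ (fun g => Ci * (RtoC g * cis g y))%C) by (intros g _; replace ((0, g) : C) with (Ci * RtoC g)%C by (apply C_ext; simpl; ring); ring).
    rewrite sumC_scal. f_equal. rewrite (D3 RtoC (fun g => cis g y)). fold (E l y).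
    rewrite (sumC_ext (fun p => RtoC (dp p) * (E l y - E (filter (leb_R (fst p)) l) y))%C (fun p => RtoC (dp p) * E l y + (- (1)) * (RtoC (dp p) * E (filter (leb_R (fst p)) l) y))%C) by (intros; ring).
    rewrite sumC_plus, sumC_scal. replace (sumC (fun p => RtoC (dp p) * E l y)%C D) with (RtoC T * E l y)%C.
    - rewrite (sumC_ext (fun p => (RtoC (snd p) - RtoC (fst p)) * sumC (fun g => cis g y) (filter (leb_R (fst p)) l))%C (fun p => RtoC (dp p) * E (filter (leb_R (fst p)) l) y)%C); [ring|].
      intros p _. unfold dp, E. rewrite RtoC_minus. reflexivity.
    - rewrite <- Sd. clear. induction D as [|p D IH]; simpl; [ring|]. rewrite <- IH, RtoC_plus. ring. }
  rewrite R1, Cmod_mult, Cmod_Ci, Rmult_1_l. eapply Rle_trans; [apply sumC_cauchy_weighted, Hdp|]. rewrite Sd. apply Rmult_le_compat_l; [lra|].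
  apply sumR_le. intros p Hp. unfold f. apply Rmult_le_compat_l; [apply Hdp, Hp|]. fold y.
  set (z1 := E l y). set (z2 := E (filter (leb_R (fst p)) l) y). pose proof (Cmod_triangle z1 (- z2)) as T1. rewrite Cmod_opp in T1. fold (z1 - z2)%C in T1.
  pose proof (Cmod_ge_0 (z1 - z2)). pose proof (pow2_ge_0 (Cmod z1 - Cmod z2)). assert (Cmod (z1 - z2) ^ 2 <= (Cmod z1 + Cmod z2) ^ 2) by (apply pow_incr; lra). nra. }
apply Rle_trans with (RInt (fun t => T * sumR (fun p => f p t) D) 0 d).
- apply RInt_le; [lra| |apply (ex_RInt_scal (V := R_NormedModule)); eexists; exact I1|intros; apply Pt].
  apply (ex_RInt_continuous (V := R_CompleteNormedModule)). intros t _. apply (continuous_ext (fun t => Cmod (E1 l (v + 1 * t)) * Cmod (E1 l (v + 1 * t)))); [intros; simpl; ring|].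
  apply (continuous_mult (fun t => Cmod (E1 l (v + 1 * t))) (fun t => Cmod (E1 l (v + 1 * t)))); apply (ccont_Cmod (fun t => E1 l (v + 1 * t))), cont_shift, E1_cont.
- rewrite (RInt_scal (V := R_CompleteNormedModule) (fun t => sumR (fun p => f p t) D)) by (eexists; exact I1). rewrite (is_RInt_unique _ _ _ _ I1).
  unfold scal; simpl; unfold mult; simpl. replace (4 * (T * (T * 1)) * M) with (T * (T * (4 * M))) by ring. apply Rmult_le_compat_l; [lra|].
  rewrite <- Sd, (Rmult_comm (sumR dp D)), <- sumR_scal. apply sumR_le. intros p Hp.
  assert (EI : RInt (f p) 0 d = dp p * (2 * Q l v d + 2 * Q (filter (leb_R (fst p)) l) v d)).
  { apply is_RInt_unique. unfold f. apply (is_RInt_scal (V := R_NormedModule) (fun t => 2 * Cmod (E l (v + 1 * t)) ^ 2 + 2 * Cmod (E (filter (leb_R (fst p)) l) (v + 1 * t)) ^ 2)).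
    apply (is_RInt_plus (V := R_NormedModule) (fun t => 2 * Cmod (E l (v + 1 * t)) ^ 2) (fun t => 2 * Cmod (E (filter (leb_R (fst p)) l) (v + 1 * t)) ^ 2));
    apply (is_RInt_scal (V := R_NormedModule) (fun t => Cmod (E _ (v + 1 * t)) ^ 2)); apply (RInt_correct (V := R_CompleteNormedModule)), Q_ex. }
  rewrite EI, (Rmult_comm (4 * M)). apply Rmult_le_compat_l; [apply Hdp, Hp|].
  pose proof (HM T ltac:(lra)) as B1. rewrite Hfull in B1. pose proof (HM (fst p) ltac:(specialize (D1 p Hp); lra)). lra.
Qed.

(** * Use of the hypothesis on F *)

Section FBound.
Variable a : R.
Hypothesis Ha : 0 < a <= 3 / 2.
Hypothesis RH : riemann_hypothesis.
Hypothesis HF : forall c1 c2 : R, 0 < c1 -> 0 < c2 ->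
     exists K : R, forall x T : R,
       2 <= x -> 3 <= T ->
       c1 * (T ^ 2 / (ln T) ^ 4) <= x ->
       x <= c2 * Rpower T (Rpower (ln T) ((2 - a) / a)) ->
       Cmod (F (Rpower (ln T) (3 - 2 * a)) x T) <= K * (T * ln T).

(* Below [U0] the trivial bound for the exponential sum is used; above it (and up to [Zc]) the hypothesis on F applies
   at all x <= e^v <= 2x, where s = ln x. *)
Definition U0 (s : R) : R := 3 * exp (Rpower s (a / 2)).
Definition Zc (s : R) : R := exp (s / 2) * s.

Lemma U0_ge s : 3 <= U0 s.
Proof. unfold U0. pose proof (exp_ineq1_le (Rpower s (a / 2))). pose proof (Rpower_pos s (a / 2)). lra. Qed.

Lemma ln_U0 s : ln (U0 s) = ln 3 + Rpower s (a / 2).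
Proof. unfold U0. rewrite ln_mult, ln_exp by (try apply exp_pos; lra). reflexivity. Qed.

Lemma ln_Zc s : 1 <= s -> ln (Zc s) = s / 2 + ln s.
Proof. intros Hs. unfold Zc. rewrite ln_mult, ln_exp by (try apply exp_pos; lra). reflexivity. Qed.

(** Since u / log^2 u is increasing up to a constant, it suffices to look at u = [Zc s], where it is
    at most 4 sqrt x / log x with x = exp s. The constant 1/256 is 1/16^2. *)
Lemma range_low s u : 1 <= s -> 3 <= u <= Zc s -> / 256 * (u ^ 2 / ln u ^ 4) <= exp s.
Proof.
intros Hs Hu. pose proof ln3_ge_1 as L3. assert (Lu : 1 <= ln u) by (pose proof (ln_le 3 u ltac:(lra) ltac:(lra)); lra).
pose proof (power_ratio (-2) u (Zc s) ltac:(lra) Hu) as PR.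
assert (R2 : forall y, 1 <= y -> Rpower y (-2) = / y ^ 2).
{ intros y Hy. replace (-2) with (- INR 2) by (simpl; ring). rewrite Rpower_Ropp, Rpower_pow by lra. reflexivity. }
pose proof (ln_nonneg s Hs) as Ls. assert (LZ : s / 2 <= ln (Zc s)) by (rewrite ln_Zc by exact Hs; lra).
assert (LZ1 : 1 <= ln (Zc s)) by (pose proof (ln_le u (Zc s) ltac:(lra) ltac:(lra)); lra).
rewrite !R2 in PR by lra.
assert (B : u * / ln u ^ 2 <= 16 * (exp (s / 2) / s)).
{ eapply Rle_trans; [exact PR|]. assert (/ ln (Zc s) ^ 2 <= 4 / s ^ 2).
  { replace (4 / s ^ 2) with (/ (s / 2) ^ 2) by (field; lra). apply Rinv_le_contravar; [apply pow_lt; lra|apply pow_incr; lra]. }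
  apply Rle_trans with (4 * (Zc s * (4 / s ^ 2))); [|unfold Zc; right; field; lra].
  apply Rmult_le_compat_l; [lra|]. apply Rmult_le_compat_l; [lra|assumption]. }
assert (B0 : 0 <= u * / ln u ^ 2) by (apply Rmult_le_pos; [lra|left; apply Rinv_0_lt_compat, pow_lt; lra]).
replace (u ^ 2 / ln u ^ 4) with ((u * / ln u ^ 2) ^ 2) by (field; lra).
assert (B2 : (u * / ln u ^ 2) ^ 2 <= (16 * (exp (s / 2) / s)) ^ 2) by (apply pow_incr; split; assumption).
assert (Es : exp s = exp (s / 2) * exp (s / 2)) by (rewrite <- exp_plus; f_equal; field).
assert (B3 : (16 * (exp (s / 2) / s)) ^ 2 <= 256 * exp s).
{ replace ((16 * (exp (s / 2) / s)) ^ 2) with (256 * exp s / s ^ 2) by (rewrite Es; field; lra).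
  apply div_le_of_mul; [apply pow_lt; lra|]. pose proof (exp_pos s). assert (1 <= s ^ 2) by nra. nra. }
lra.
Qed.

(** The bound unwinds to log x <= (log u)^(2/a), which holds because log u >= s^(a/2) from the
    height [U0] on; the factor 2 covers v up to s + log 2. *)
Lemma range_high s v u : 1 <= s -> v <= s + ln 2 -> U0 s <= u -> exp v <= 2 * Rpower u (Rpower (ln u) ((2 - a) / a)).
Proof.
intros Hs Hv Hu. pose proof (U0_ge s) as G. pose proof ln3_ge_1 as L3.
assert (Lu : Rpower s (a / 2) <= ln u). { apply Rle_trans with (ln (U0 s)); [rewrite ln_U0; lra|apply ln_le; lra]. }
assert (Lu1 : 1 <= ln u) by (pose proof (ln_le 3 u ltac:(lra) ltac:(lra)); lra).
apply Rle_trans with (exp (s + ln 2)); [apply exp_le, Hv|]. rewrite exp_plus, exp_ln, Rmult_comm by lra. apply Rmult_le_compat_l; [lra|].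
unfold Rpower at 1. apply exp_le.
replace (Rpower (ln u) ((2 - a) / a) * ln u) with (Rpower (ln u) (2 / a)).
2:{ rewrite <- (Rpower_1 (ln u)) at 3 by lra. rewrite <- Rpower_plus. f_equal. field. lra. }
apply Rle_trans with (Rpower (Rpower s (a / 2)) (2 / a)).
- rewrite Rpower_mult. replace (a / 2 * (2 / a)) with 1 by (field; lra). rewrite Rpower_1; lra.
- apply Rle_Rpower_l; [|split; [apply Rpower_pos|exact Lu]]. apply Rdiv_le_0_compat; lra.
Qed.

(* [beta] is nondecreasing because 3 - 2a >= 0, so the window 1/beta(T) lies inside the window 1/beta(u) that F controls at height u. *)
Lemma Q_bound : exists M, 0 <= M /\ forall s v T u, 1 <= s -> s <= v <= s + ln 2 -> U0 s ^ 4 <= T <= Zc s -> 0 <= u <= T ->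
  Q (gam u) v (/ Rpower (ln T) (3 - 2 * a)) <= M * (T * Rpower (ln T) (2 * a - 2)).
Proof.
destruct (HF (/ 256) 2 ltac:(lra) ltac:(lra)) as [K HK]. pose proof Kloc_facts as [_ HKl].
exists (4 * (exp 2 * Rabs K) + 1024 * Kloc ^ 2). pose proof (exp_pos 2) as P2. pose proof (Rabs_pos K) as PK.
assert (K2 : 0 <= Kloc ^ 2) by apply pow2_ge_0.
split; [apply Rplus_le_le_0_compat; [apply Rmult_le_pos; [lra|apply Rmult_le_pos; lra]|lra]|].
intros s v T u Hs Hv HT Hu. pose proof (U0_ge s) as G. pose proof ln3_ge_1 as L3.
assert (GT : 3 <= T). { apply Rle_trans with (U0 s ^ 4); [|lra]. pose proof (pow_incr 3 (U0 s) 4 ltac:(lra)). lra. }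
assert (LT : 1 <= ln T) by (pose proof (ln_le 3 T ltac:(lra) ltac:(lra)); lra).
pose proof (Rpower_pos (ln T) (2 * a - 2)) as PT. pose proof (Rpower_pos (ln T) (3 - 2 * a)) as PB.
assert (PTT : 0 <= T * Rpower (ln T) (2 * a - 2)) by (apply Rmult_le_pos; lra).
rewrite Rmult_plus_distr_r. destruct (Rle_dec (U0 s) u) as [h|h].
- assert (Gu : 3 <= u) by lra. assert (Lu : 1 <= ln u) by (pose proof (ln_le 3 u ltac:(lra) ltac:(lra)); lra).
  pose proof (Rpower_pos (ln u) (3 - 2 * a)) as PBu.
  apply Rle_trans with (Q (gam u) v (/ Rpower (ln u) (3 - 2 * a))).
  { apply Q_mono. split; [left; apply Rinv_0_lt_compat, PB|]. apply Rinv_le_contravar; [exact PBu|]. apply Rle_Rpower_l; [lra|]. split; [lra|apply ln_le; lra]. }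
  assert (Ey : 2 <= exp v). { pose proof (exp_ineq1_le v). lra. }
  specialize (HK (exp v) u Ey Gu). assert (B : Cmod (F (Rpower (ln u) (3 - 2 * a)) (exp v) u) <= K * (u * ln u)).
  { apply HK; [|apply (range_high s); lra]. apply Rle_trans with (exp s); [apply range_low; lra|apply exp_le; lra]. }
  pose proof (mean_square_F (Rpower (ln u) (3 - 2 * a)) (exp v) u PBu (exp_pos v)) as MS. rewrite ln_exp in MS. fold (Q (gam u) v (/ Rpower (ln u) (3 - 2 * a))) in MS.
  assert (C1 : K * (u * ln u) <= Rabs K * (u * ln u)) by (apply Rmult_le_compat_r; [apply Rmult_le_pos; lra|apply Rle_abs]).
  assert (C2 : Q (gam u) v (/ Rpower (ln u) (3 - 2 * a)) <= exp 2 * Rabs K * (u * Rpower (ln u) (2 * a - 2))).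
  { apply Rmult_le_reg_l with (Rpower (ln u) (3 - 2 * a)); [exact PBu|]. eapply Rle_trans; [exact MS|].
    replace (Rpower (ln u) (3 - 2 * a) * (exp 2 * Rabs K * (u * Rpower (ln u) (2 * a - 2)))) with (exp 2 * (Rabs K * (u * (Rpower (ln u) (3 - 2 * a) * Rpower (ln u) (2 * a - 2))))) by ring.
    rewrite <- Rpower_plus. replace (3 - 2 * a + (2 * a - 2)) with 1 by ring. rewrite Rpower_1 by lra. apply Rmult_le_compat_l; lra. }
  pose proof (power_ratio (2 * a - 2) u T ltac:(lra) ltac:(lra)) as PR.
  assert (0 <= 1024 * Kloc ^ 2 * (T * Rpower (ln T) (2 * a - 2))) by (apply Rmult_le_pos; lra).
  assert (exp 2 * Rabs K * (u * Rpower (ln u) (2 * a - 2)) <= exp 2 * Rabs K * (4 * (T * Rpower (ln T) (2 * a - 2)))) by (apply Rmult_le_compat_l; [apply Rmult_le_pos; lra|exact PR]).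
  lra.
- assert (N : INR (length (gam u)) <= 8 * Kloc * (U0 s * ln (U0 s))).
  { eapply Rle_trans; [|apply (gam_count RH (U0 s)); lra]. apply le_INR. rewrite (Permutation_length (gam_nested RH u (U0 s) ltac:(lra))). apply List.filter_length_le. }
  eapply Rle_trans; [apply (Q_trivial _ _ _ (8 * Kloc * (U0 s * ln (U0 s)))); [left; apply Rinv_0_lt_compat, PB|exact N]|].
  assert (LU : 0 <= ln (U0 s)) by (apply ln_nonneg; lra).
  assert (B1 : ln (U0 s) <= ln T). { apply ln_le; [lra|]. apply Rle_trans with (U0 s ^ 4); [|lra]. replace (U0 s ^ 4) with (U0 s * U0 s ^ 3) by ring. pose proof (pow_R1_Rle (U0 s) 3 ltac:(lra)). nra. }
  assert (B2 : U0 s ^ 2 <= exp (ln T / 2)).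
  { replace (U0 s ^ 2) with (exp (INR 4 * ln (U0 s) / 2)).
    - apply exp_le. rewrite <- ln_pow by lra. assert (ln (U0 s ^ 4) <= ln T) by (apply ln_le; [apply pow_lt|]; lra). lra.
    - replace (INR 4 * ln (U0 s) / 2) with (INR 2 * ln (U0 s)) by (simpl; field). rewrite <- ln_pow, exp_ln by (try apply pow_lt; lra). reflexivity. }
  pose proof (ln_sq_le_sqrt T ltac:(lra)) as B3.
  assert (ET : exp (ln T / 2) * exp (ln T / 2) = T) by (rewrite <- exp_plus; replace (ln T / 2 + ln T / 2) with (ln T) by field; apply exp_ln; lra).
  assert (B4 : (U0 s * ln (U0 s)) ^ 2 <= 16 * T).
  { rewrite Rpow_mult_distr. apply Rle_trans with (exp (ln T / 2) * (16 * exp (ln T / 2))); [|right; rewrite <- ET at 3; ring].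
    apply Rmult_le_compat; try apply pow2_ge_0; [exact B2|]. eapply Rle_trans; [|exact B3]. apply pow_incr. lra. }
  assert (B5 : / Rpower (ln T) (3 - 2 * a) <= Rpower (ln T) (2 * a - 2)).
  { rewrite <- Rpower_Ropp. apply Rpower_le_exponent; lra. }
  assert (0 <= 4 * (exp 2 * Rabs K) * (T * Rpower (ln T) (2 * a - 2))) by (apply Rmult_le_pos; [apply Rmult_le_pos; [lra|apply Rmult_le_pos; lra]|exact PTT]).
  apply Rle_trans with (Rpower (ln T) (2 * a - 2) * (64 * Kloc ^ 2 * (16 * T))); [|lra].
  apply Rmult_le_compat; [left; apply Rinv_0_lt_compat, PB|apply pow2_ge_0|exact B5|].
  replace ((8 * Kloc * (U0 s * ln (U0 s))) ^ 2) with (64 * Kloc ^ 2 * (U0 s * ln (U0 s)) ^ 2) by ring. apply Rmult_le_compat_l; lra.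
Qed.

Lemma E_perm l l' v : Permutation l l' -> E l v = E l' v.
Proof. apply sumC_perm. Qed.

Lemma Q_perm l l' v d : Permutation l l' -> Q l v d = Q l' v d.
Proof. intros P. unfold Q. apply RInt_ext. intros t _. rewrite (E_perm l l' _ P). reflexivity. Qed.

(** Sobolev with d = 1/beta and lam = T: both terms are O(T B) for B = M T (log T)^(2a-2), because
    beta <= (log T)^3 <= 27 T and the integral of the squared derivative is at most 4 T^2 B. The
    square root gives T (log T)^(a-1). *)
Lemma E_bound : exists C, 0 <= C /\ forall s v T, 1 <= s -> s <= v <= s + ln 2 -> U0 s ^ 4 <= T <= Zc s ->
  Cmod (E (gam T) v) <= C * (T * Rpower (ln T) (a - 1)).
Proof.
destruct Q_bound as [M [HM0 HM]]. exists (sqrt (32 * M)). split; [apply sqrt_pos|]. intros s v T Hs Hv HT.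
pose proof (U0_ge s) as G. pose proof ln3_ge_1 as L3.
assert (GT : 3 <= T). { apply Rle_trans with (U0 s ^ 4); [|lra]. pose proof (pow_incr 3 (U0 s) 4 ltac:(lra)). lra. }
assert (LT : 1 <= ln T) by (pose proof (ln_le 3 T ltac:(lra) ltac:(lra)); lra).
set (be := Rpower (ln T) (3 - 2 * a)) in *. assert (Hbe : 0 < be) by apply Rpower_pos.
set (B := M * (T * Rpower (ln T) (2 * a - 2))).
pose proof (Rpower_pos (ln T) (2 * a - 2)) as PT. pose proof (Rpower_pos (ln T) (a - 1)) as PT1.
assert (HB : 0 <= B) by (apply Rmult_le_pos; [exact HM0|apply Rmult_le_pos; lra]).
assert (HQ : forall u, 0 <= u <= T -> Q (filter (leb_R u) (gam T)) v (/ be) <= B).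
{ intros u Hu. rewrite <- (Q_perm _ _ v (/ be) (gam_nested RH u T Hu)). apply (HM s v T u); assumption. }
assert (HQT : Q (gam T) v (/ be) <= B) by (apply (HM s v T T); try assumption; lra).
pose proof (E1_mean_square (gam T) T v (/ be) B ltac:(lra) (Rinv_0_lt_compat _ Hbe) (fun g Hg => gam_range RH T g ltac:(lra) Hg) HQ) as S1.
pose proof (sobolev_E (gam T) v (/ be) T (Rinv_0_lt_compat _ Hbe) ltac:(lra)) as S2. rewrite Rinv_inv in S2.
assert (Bbe : be <= 27 * T).
{ apply Rle_trans with (ln T ^ 3); [|apply ln_cube_le; lra]. replace (ln T ^ 3) with (Rpower (ln T) 3); [apply Rpower_le_exponent; lra|].
  replace 3 with (INR 3) at 1 by (simpl; ring). apply Rpower_pow. lra. }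
assert (S3 : Cmod (E (gam T) v) ^ 2 <= 32 * T * B).
{ eapply Rle_trans; [exact S2|]. apply Rle_trans with (28 * T * B + / T * (4 * T ^ 2 * B)); [|right; field; lra].
  apply Rplus_le_compat.
  - apply Rmult_le_compat; [lra| |lra|exact HQT]. unfold Q. apply RInt_ge_0; [left; apply Rinv_0_lt_compat, Hbe|apply Q_ex|intros; apply pow2_ge_0].
  - apply Rmult_le_compat_l; [left; apply Rinv_0_lt_compat; lra|exact S1]. }
apply Rsqr_incr_0_var; [|apply Rmult_le_pos; [apply sqrt_pos|apply Rmult_le_pos; lra]]. unfold Rsqr.
replace (Cmod (E (gam T) v) * Cmod (E (gam T) v)) with (Cmod (E (gam T) v) ^ 2) by ring. eapply Rle_trans; [exact S3|]. right.
unfold B. replace (Rpower (ln T) (2 * a - 2)) with (Rpower (ln T) (a - 1) * Rpower (ln T) (a - 1)) by (rewrite <- Rpower_plus; f_equal; ring).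
transitivity ((sqrt (32 * M) * sqrt (32 * M)) * (T * Rpower (ln T) (a - 1) * (T * Rpower (ln T) (a - 1)))); [rewrite sqrt_sqrt by lra; ring|ring].
Qed.
End FBound.

(** * Sums over zeros in the explicit formula *)

(** By the mean value theorem the increment of y^a over a step log 2 is a log 2 times an
    intermediate value of y^(a-1), and passing to the right end costs at most a factor 2. It lets
    the dyadic sum of (log V)^(a-1) telescope to (log x)^a, also when a < 1. *)
Lemma Rpower_increment a y : 0 < a <= 3 / 2 -> 1 <= y ->
  Rpower (y + ln 2) (a - 1) <= 2 / (a * ln 2) * (Rpower (y + ln 2) a - Rpower y a).
Proof.
intros Ha Hy. assert (L2 : 0 < ln 2) by (pose proof ln_lt_2; lra).
assert (L21 : ln 2 <= 1) by (pose proof (exp_ineq1_le (ln 2)) as A; rewrite exp_ln in A by lra; lra).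
destruct (MVT_gen (fun t => Rpower t a) y (y + ln 2) (fun t => a * Rpower t (a - 1))) as [c [Hc E]].
- intros t Ht. rewrite Rmin_left in Ht by lra. apply is_derive_Reals. apply derivable_pt_lim_power. lra.
- intros t Ht. rewrite Rmin_left in Ht by lra. apply derivable_continuous_pt. eexists. apply derivable_pt_lim_power. lra.
- rewrite Rmin_left, Rmax_right in Hc by lra. cbv beta in E. rewrite E. replace (y + ln 2 - y) with (ln 2) by ring.
  replace (2 / (a * ln 2) * (a * Rpower c (a - 1) * ln 2)) with (2 * Rpower c (a - 1)) by (field; lra).
  pose proof (Rpower_pos c (a - 1)) as Pc.
  assert (Hr : 0 <= ln (y + ln 2) - ln c <= ln 2).
  { split; [pose proof (ln_le c (y + ln 2) ltac:(lra) ltac:(lra)); lra|]. assert (ln (y + ln 2) <= ln (2 * c)) by (apply ln_le; lra). rewrite ln_mult in H by lra. lra. }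
  replace (Rpower (y + ln 2) (a - 1)) with (Rpower c (a - 1) * exp ((a - 1) * (ln (y + ln 2) - ln c))) by (unfold Rpower; rewrite <- exp_plus; f_equal; ring).
  rewrite (Rmult_comm 2). apply Rmult_le_compat_l; [lra|]. rewrite <- (exp_ln 2) at 2 by lra. apply exp_le. nra.
Qed.

Lemma Kh_exp_integral x h (s : C) : 0 < x -> 0 < h -> s <> 0 -> (s + 1)%C <> 0 ->
  Kh x h s = (CInt (fun t => Cexp (RtoC t * (s + 1)) * / s)%C (ln x) (ln (x + h)) / RtoC h)%C.
Proof.
intros Hx Hh N1 N2. assert (Nh : RtoC h <> 0) by (apply RtoC_neq_0; lra).
assert (E : CInt (fun t => (s + 1) * Cexp (RtoC t * (s + 1)))%C (ln x) (ln (x + h)) = (Cexp (RtoC (ln (x + h)) * (s + 1)) - Cexp (RtoC (ln x) * (s + 1)))%C).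
{ apply (CInt_FTC (fun t => Cexp (RtoC t * (s + 1)))%C). intros t _. split; [apply rder_Cexp_line|]. apply ccont_mult; [apply ccont_const|apply (rder_ccont _ _ _ (rder_Cexp_line _ _))]. }
rewrite (CInt_ext _ (fun t => / (s * (s + 1)) * ((s + 1) * Cexp (RtoC t * (s + 1))))%C) by (intros; field; split; assumption).
rewrite CInt_scal by (intros t _; apply ccont_mult; [apply ccont_const|apply (rder_ccont _ _ _ (rder_Cexp_line _ _))]). rewrite E.
unfold Kh, kx. rewrite !(Cmult_comm (s + 1) (RtoC _)). field. repeat split; assumption.
Qed.

Lemma half_neq (g : R) : ((1 / 2, g) : C) <> 0 /\ (((1 / 2)%R, g) + 1)%C <> 0.
Proof. split; intros E; apply (f_equal Re) in E; simpl in E; lra. Qed.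

Lemma ln_double_bounds x h : 0 < x -> 0 < h <= x -> ln x <= ln (x + h) <= ln x + ln 2 /\ ln (x + h) - ln x <= h / x.
Proof.
intros Hx Hh. split; [split; [apply ln_le; lra|rewrite Rplus_comm, <- ln_mult by lra; apply ln_le; lra]|].
pose proof (exp_ineq1_le (ln (x + h) - ln x)) as A. rewrite exp_ln_minus in A by lra. replace ((x + h) / x) with (1 + h / x) in A by (field; lra). lra.
Qed.

Lemma exp_three_halves x h : 0 < x -> 0 < h <= x -> exp (3 / 2 * ln (x + h)) <= 4 * (x * exp (ln x / 2)).
Proof.
intros Hx Hh. destruct (ln_double_bounds x h Hx Hh) as [[_ B] _]. assert (L2 : 0 < ln 2) by (pose proof ln_lt_2; lra).
apply Rle_trans with (exp (ln 2 + ln 2 + (ln x + ln x / 2))); [apply exp_le; lra|]. rewrite !exp_plus, !exp_ln by lra. lra.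
Qed.

(** [Kh] is 1/h times the integral over log x <= t <= log (x + h) of exp(3t/2) exp(i g t) / rho, so
    a bound on the sum that is uniform in t passes to the integral. The interval has length at most
    h/x, and the weight is at most 4 x^(3/2). *)
Lemma Kh_sum_average (x h B : R) (l : list R) : 0 < x -> 0 < h <= x ->
  (forall t, ln x <= t <= ln x + ln 2 -> Cmod (sumC (fun g => / ((1 / 2)%R, g) * cis g t)%C l) <= B) ->
  Cmod (sumC (fun g => Kh x h (1 / 2, g)) l) <= 4 * exp (ln x / 2) * B.
Proof.
intros Hx Hh HB. destruct (ln_double_bounds x h Hx Hh) as [[B1 B2] B3]. assert (Nh : RtoC h <> 0) by (apply RtoC_neq_0; lra).
assert (HB0 : 0 <= B) by (eapply Rle_trans; [apply Cmod_ge_0|apply (HB (ln x)); lra]).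
assert (Cg : forall (g t : R), ccont (fun t => Cexp (RtoC t * ((1 / 2, g)%R + 1)) * / ((1 / 2)%R, g))%C t).
{ intros g t. apply ccont_mult; [apply (rder_ccont _ _ _ (rder_Cexp_line _ _))|apply ccont_const]. }
destruct (CInt_sumC (fun (g t : R) => Cexp (RtoC t * ((1 / 2, g)%R + 1)) * / ((1 / 2)%R, g))%C l (ln x) (ln (x + h)) (fun g _ t => Cg g t)) as [I1 I2].
assert (EQ : (sumC (fun g : R => Kh x h ((1 / 2)%R, g)) l = / RtoC h * CInt (fun t => sumC (fun g => Cexp (RtoC t * ((1 / 2, g)%R + 1)) * / ((1 / 2)%R, g))%C l) (ln x) (ln (x + h)))%C).
{ rewrite I1, <- sumC_scal. apply sumC_ext. intros g _. rewrite Kh_exp_integral by (try apply half_neq; lra). unfold Cdiv. ring. }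
rewrite EQ, Cmod_mult, Cmod_inv, Cmod_R, Rabs_pos_eq by (try exact Nh; lra).
assert (Bd : Cmod (CInt (fun t => sumC (fun g => Cexp (RtoC t * ((1 / 2, g)%R + 1)) * / ((1 / 2)%R, g))%C l) (ln x) (ln (x + h))) <= (ln (x + h) - ln x) * (exp (3 / 2 * ln (x + h)) * B)).
{ apply CInt_bound; [exact B1|intros t _; apply I2|]. intros t Ht.
  replace (sumC (fun g => Cexp (RtoC t * ((1 / 2, g)%R + 1)) * / ((1 / 2)%R, g))%C l) with (RtoC (exp (3 / 2 * t)) * sumC (fun g => / ((1 / 2)%R, g) * cis g t) l)%C.
  - rewrite Cmod_mult, Cmod_R, Rabs_pos_eq by (left; apply exp_pos). apply Rmult_le_compat; [left; apply exp_pos|apply Cmod_ge_0|apply exp_le; lra|apply HB; lra].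
  - rewrite <- sumC_scal. apply sumC_ext. intros g _. unfold cis.
    replace (RtoC t * ((1 / 2, g)%R + 1))%C with (RtoC (3 / 2 * t) + RtoC t * (0, g))%C by (apply C_ext; simpl; field).
    rewrite Cexp_plus. replace (Cexp (RtoC (3 / 2 * t))) with (RtoC (exp (3 / 2 * t))); [ring|]. unfold Cexp. simpl. rewrite cos_0, sin_0. apply C_ext; simpl; ring. }
pose proof (exp_three_halves x h Hx Hh) as E3.
apply Rle_trans with (/ h * (h / x * (4 * (x * exp (ln x / 2)) * B))).
- apply Rmult_le_compat_l; [left; apply Rinv_0_lt_compat; lra|]. eapply Rle_trans; [exact Bd|]. apply Rmult_le_compat; [lra|apply Rmult_le_pos; [left; apply exp_pos|exact HB0]|exact B3|].
  apply Rmult_le_compat_r; assumption.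
- right. field. lra.
Qed.

Definition seg (V W g : R) : bool := andb (leb_R W g) (negb (leb_R V g)).

Lemma seg_spec V W g : seg V W g = true <-> V < g <= W.
Proof.
unfold seg, leb_R. destruct (Rle_dec g W), (Rle_dec g V); simpl; split; intros; try reflexivity; try discriminate; lra.
Qed.

Lemma sumC_seg_split (f : R -> C) l U V W : U <= V <= W -> sumC f (filter (seg U W) l) = (sumC f (filter (seg U V) l) + sumC f (filter (seg V W) l))%C.
Proof.
intros H. rewrite <- !sumC_filter_if, <- sumC_plus. apply sumC_ext. intros g _. unfold seg, leb_R.
repeat destruct Rle_dec; simpl; try ring; exfalso; lra.
Qed.

Lemma sumC_leb_split (f : R -> C) l U W : U <= W -> sumC f (filter (leb_R W) l) = (sumC f (filter (leb_R U) l) + sumC f (filter (seg U W) l))%C.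
Proof.
intros H. rewrite <- !sumC_filter_if, <- sumC_plus. apply sumC_ext. intros g _. unfold seg, leb_R.
repeat destruct Rle_dec; simpl; try ring; exfalso; lra.
Qed.

(** Makes -1/u a majorant for the variation of the weight 1/(1/2 + iu) in [abel_bound]. *)
Lemma inv_half_diff (s t : R) : 0 < s <= t -> Cmod (/ ((1 / 2)%R, t) - / ((1 / 2)%R, s))%C <= - / t - - / s.
Proof.
intros H. destruct (half_neq s) as [N1 _]. destruct (half_neq t) as [N2 _].
replace (/ ((1 / 2)%R, t) - / ((1 / 2)%R, s))%C with ((0, (s - t)%R) / (((1 / 2)%R, t) * ((1 / 2)%R, s)))%C.
- rewrite Cmod_div, Cmod_mult by (apply Cmult_neq_0; assumption).
  replace (Cmod (0, (s - t)%R)) with (t - s).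
  + pose proof (im_le_Cmod ((1 / 2)%R, t)) as A. pose proof (im_le_Cmod ((1 / 2)%R, s)) as B. simpl in A, B. rewrite Rabs_pos_eq in A, B by lra.
    replace (- / t - - / s) with ((t - s) / (t * s)) by (field; lra). unfold Rdiv at 1 4. apply Rmult_le_compat_l; [lra|].
    apply Rinv_le_contravar; [apply Rmult_lt_0_compat; lra|apply Rmult_le_compat; lra].
  + replace ((0, (s - t)%R) : C) with (Ci * RtoC (s - t))%C by (apply C_ext; simpl; ring). rewrite Cmod_mult, Cmod_Ci, Cmod_R, Rabs_left1; lra.
- replace ((0, (s - t)%R) : C) with (((1 / 2)%R, s) - ((1 / 2)%R, t))%C by (apply C_ext; simpl; ring). field. split; assumption.
Qed.

(** * Zeros in the middle range, block by block *)

Section Final.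
Variable a : R.
Hypothesis Ha : 0 < a <= 3 / 2.
Hypothesis RH : riemann_hypothesis.

Lemma E_seg (u V T' t : R) : 0 <= V <= u -> u <= T' -> sumC (fun g => cis g t) (filter (seg V u) (gam T')) = (E (gam u) t - E (gam V) t)%C.
Proof.
intros HV Hu. rewrite (E_perm _ _ t (gam_nested RH u T' ltac:(lra))), (E_perm _ _ t (gam_nested RH V T' ltac:(lra))).
unfold E. rewrite (sumC_leb_split _ _ V u) by lra. ring.
Qed.

Variables (C0 s T' : R).
Hypothesis HC0 : 0 <= C0.
Hypothesis Hs : 1 <= s.
Hypothesis HT' : Zc s <= T'.
Hypothesis HE : forall v T, s <= v <= s + ln 2 -> U0 a s ^ 4 <= T <= Zc s -> Cmod (E (gam T) v) <= C0 * (T * Rpower (ln T) (a - 1)).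

Lemma U1_ge : 3 <= U0 a s ^ 4 /\ U0 a s <= U0 a s ^ 4.
Proof.
pose proof (U0_ge a s) as G. pose proof (pow_incr 3 (U0 a s) 3 ltac:(lra)) as P. replace (U0 a s ^ 4) with (U0 a s * U0 a s ^ 3) by ring. nra.
Qed.

(** On a block V < g <= W <= 2V the partial sums of [cis] are O(V (log 2V)^(a-1)), and the weight
    1/rho has size and variation O(1/V). The result is stated as an increment of the a-th power of
    the logarithm so that consecutive blocks telescope. *)
Lemma block_bound V W t : s <= t <= s + ln 2 -> U0 a s ^ 4 <= V -> V <= W <= 2 * V -> W <= Zc s ->
  Cmod (sumC (fun g => / ((1 / 2)%R, g) * cis g t)%C (filter (seg V W) (gam T'))) <=
  32 * C0 / (a * ln 2) * (Rpower (ln V + ln 2) a - Rpower (ln V) a).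
Proof.
intros Ht HV HW HZ. destruct U1_ge as [G _]. pose proof ln3_ge_1 as L3. assert (L2 : 0 < ln 2) by (pose proof ln_lt_2; lra).
assert (LV : 1 <= ln V) by (pose proof (ln_le 3 V ltac:(lra) ltac:(lra)); lra).
assert (E2V : ln (2 * V) = ln V + ln 2) by (rewrite ln_mult by lra; ring).
set (X := Rpower (ln V + ln 2) (a - 1)). assert (HX : 0 < X) by apply Rpower_pos.
assert (HEu : forall u, V <= u <= W -> Cmod (E (gam u) t) <= 8 * C0 * V * X).
{ intros u Hu. eapply Rle_trans; [apply HE; lra|]. pose proof (power_ratio (a - 1) u (2 * V) ltac:(lra) ltac:(lra)) as PR. rewrite E2V in PR. fold X in PR.
  apply Rle_trans with (C0 * (4 * (2 * V * X))); [apply Rmult_le_compat_l; assumption|right; ring]. }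
apply Rle_trans with (16 * C0 * V * X * (Cmod (/ ((1 / 2)%R, W)) + (- / W - - / V))).
- apply (abel_bound _ V W _ (fun g => / ((1 / 2)%R, g))%C (fun g => cis g t) (fun u => - / u)).
  + lra.
  + intros g Hg. apply filter_In in Hg. apply seg_spec, Hg.
  + intros x y H1 H2. apply inv_half_diff. lra.
  + intros u Hu. rewrite filter_filter.
    rewrite (filter_ext (fun x => andb (seg V W x) (leb_R u x)) (seg V u)).
    * rewrite E_seg by lra. unfold Cminus. eapply Rle_trans; [apply Cmod_triangle|]. rewrite Cmod_opp.
      pose proof (HEu u Hu). pose proof (HEu V ltac:(lra)). lra.
    * intros g. unfold seg, leb_R. repeat destruct Rle_dec; simpl; try reflexivity; exfalso; lra.
- assert (BW : Cmod (/ ((1 / 2)%R, W)) <= / W).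
  { rewrite Cmod_inv by apply half_neq. apply Rinv_le_contravar; [lra|]. pose proof (im_le_Cmod ((1 / 2)%R, W)) as A. simpl in A. rewrite Rabs_pos_eq in A; lra. }
  assert (P : 0 <= 16 * C0 * V * X) by (apply Rmult_le_pos; [nra|lra]).
  apply Rle_trans with (16 * C0 * V * X * (/ V)); [apply Rmult_le_compat_l; lra|].
  replace (16 * C0 * V * X * / V) with (16 * C0 * X) by (field; lra).
  pose proof (Rpower_increment a (ln V) Ha LV) as RI. fold X in RI.
  apply Rle_trans with (16 * C0 * (2 / (a * ln 2) * (Rpower (ln V + ln 2) a - Rpower (ln V) a))); [apply Rmult_le_compat_l; lra|].
  right. field. lra.
Qed.

(** Each block advances log V by log 2, so the increments from [block_bound] add up without loss;
    the last block may be incomplete. *)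
Lemma dyadic_bound (n : nat) t : s <= t <= s + ln 2 -> forall V W, U0 a s ^ 4 <= V -> V <= W -> W <= V * 2 ^ n -> W <= Zc s ->
  Cmod (sumC (fun g => / ((1 / 2)%R, g) * cis g t)%C (filter (seg V W) (gam T'))) <=
  32 * C0 / (a * ln 2) * (Rpower (ln V + INR n * ln 2) a - Rpower (ln V) a).
Proof.
intros Ht. assert (L2 : 0 < ln 2) by (pose proof ln_lt_2; lra). destruct U1_ge as [G _]. pose proof ln3_ge_1 as L3.
assert (K0 : 0 <= 32 * C0 / (a * ln 2)) by (apply Rdiv_le_0_compat; [lra|apply Rmult_lt_0_compat; lra]).
induction n as [|n IH]; intros V W HV HW Hn HZ.
- simpl in Hn. assert (W = V) by lra. subst W. replace (filter (seg V V) (gam T')) with (@nil R).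
  + simpl. rewrite Cmod_0, Rmult_0_l, Rplus_0_r. lra.
  + symmetry. induction (gam T') as [|g l IHl]; [reflexivity|]. simpl. destruct (seg V V g) eqn:Es; [apply seg_spec in Es; lra|exact IHl].
- assert (LV : 1 <= ln V) by (pose proof (ln_le 3 V ltac:(lra) ltac:(lra)); lra).
  assert (E2V : ln (2 * V) = ln V + ln 2) by (rewrite ln_mult by lra; ring). pose proof (pos_INR n) as Pn. rewrite S_INR.
  assert (M : Rpower (ln V + ln 2) a <= Rpower (ln V + (INR n + 1) * ln 2) a) by (apply Rle_Rpower_l; [lra|split; [lra|nra]]).
  destruct (Rle_dec W (2 * V)) as [h|h].
  + eapply Rle_trans; [apply block_bound; lra|]. apply Rmult_le_compat_l; [exact K0|lra].
  + rewrite (sumC_seg_split _ _ V (2 * V) W) by lra. eapply Rle_trans; [apply Cmod_triangle|].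
    pose proof (block_bound V (2 * V) t Ht HV ltac:(lra) ltac:(lra)) as B1.
    assert (Hn' : W <= 2 * V * 2 ^ n) by (simpl in Hn; lra).
    pose proof (IH (2 * V) W ltac:(lra) ltac:(lra) Hn' HZ) as B2. rewrite E2V in B2.
    replace (ln V + (INR n + 1) * ln 2) with (ln V + ln 2 + INR n * ln 2) by ring. lra.
Qed.

(** With about log Zc / log 2 blocks the final logarithm is at most log U1 + log Zc + log 2 <= 5s,
    which stays below the 8s of the constant. *)
Lemma middle_bound t : s <= t <= s + ln 2 -> U0 a s ^ 4 <= Zc s ->
  Cmod (sumC (fun g => / ((1 / 2)%R, g) * cis g t)%C (filter (seg (U0 a s ^ 4) (Zc s)) (gam T'))) <=
  32 * C0 / (a * ln 2) * Rpower 8 a * Rpower s a.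
Proof.
intros Ht HU. assert (L2 : 0 < ln 2) by (pose proof ln_lt_2; lra). destruct U1_ge as [G _]. pose proof ln3_ge_1 as L3.
assert (L21 : ln 2 <= 1) by (pose proof (exp_ineq1_le (ln 2)) as A; rewrite exp_ln in A by lra; lra).
assert (K0 : 0 <= 32 * C0 / (a * ln 2)) by (apply Rdiv_le_0_compat; [lra|apply Rmult_lt_0_compat; lra]).
set (U1 := U0 a s ^ 4) in *. assert (LU : 1 <= ln U1) by (pose proof (ln_le 3 U1 ltac:(lra) ltac:(lra)); lra).
assert (LZ : ln U1 <= ln (Zc s)) by (apply ln_le; lra).
assert (LZ2 : ln (Zc s) <= 2 * s) by (rewrite ln_Zc by exact Hs; pose proof (exp_ineq1_le (ln s)) as A; rewrite exp_ln in A by lra; lra).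
destruct (nat_ceil (ln (Zc s) / ln 2)) as [n [N1 N2]]; [apply Rdiv_le_0_compat; lra|].
assert (N3 : ln (Zc s) <= INR n * ln 2). { apply Rmult_le_reg_r with (/ ln 2); [apply Rinv_0_lt_compat, L2|]. rewrite Rmult_assoc, Rinv_r, Rmult_1_r by lra. exact N1. }
assert (N4 : INR n * ln 2 <= ln (Zc s) + ln 2). { replace (ln (Zc s) + ln 2) with ((ln (Zc s) / ln 2 + 1) * ln 2) by (field; lra). apply Rmult_le_compat_r; lra. }
assert (N5 : Zc s <= U1 * 2 ^ n).
{ rewrite <- (exp_ln (Zc s)) at 1 by lra. rewrite <- (exp_ln (2 ^ n)) by (apply pow_lt; lra). rewrite ln_pow by lra.
  apply Rle_trans with (1 * exp (INR n * ln 2)); [rewrite Rmult_1_l; apply exp_le, N3|]. apply Rmult_le_compat_r; [left; apply exp_pos|lra]. }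
eapply Rle_trans; [apply (dyadic_bound n t Ht U1 (Zc s)); [apply Rle_refl|exact HU|exact N5|apply Rle_refl]|].
  rewrite Rmult_assoc. apply Rmult_le_compat_l; [exact K0|]. rewrite Rpower_mult_distr by lra.
  apply Rle_trans with (Rpower (ln U1 + INR n * ln 2) a); [pose proof (Rpower_pos (ln U1) a); lra|]. apply Rle_Rpower_l; [lra|]. lra.
Qed.
End Final.

Lemma half_Cmod_lower g : 0 < g -> (1 + g) / 3 <= Cmod ((1 / 2)%R, g) /\ g <= Cmod ((1 / 2)%R, g) /\ g <= Cmod (((1 / 2)%R, g) + 1)%C.
Proof.
intros Hg. pose proof (im_le_Cmod ((1 / 2)%R, g)) as A. pose proof (re_le_Cmod ((1 / 2)%R, g)) as B. pose proof (im_le_Cmod (((1 / 2)%R, g) + 1)%C) as D.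
simpl in A, B, D. rewrite Rabs_pos_eq in A, B by lra. rewrite Rplus_0_r, Rabs_pos_eq in D by lra. split; [lra|split; assumption].
Qed.

(** * Low and high zeros *)

Section Zeros.
Variable a : R.
Hypothesis Ha : 0 < a <= 3 / 2.
Hypothesis RH : riemann_hypothesis.

(** Here |Kh| is O(sqrt x / (1 + g)), so the sum is O(sqrt x log^2 U1), and log U1 is O((log
    x)^(a/2)) by the choice of [U0]. *)
Lemma low_zeros x h T : 1 <= ln x -> 0 < x -> 0 < h <= x -> U0 a (ln x) ^ 4 <= T ->
  Cmod (sumC (fun g => Kh x h (1 / 2, g)) (filter (leb_R (U0 a (ln x) ^ 4)) (gam T))) <= 13824 * Kloc * (exp (ln x / 2) * Rpower (ln x) a).
Proof.
intros Hs Hx Hh HT. set (s := ln x) in *. pose proof (U0_ge a s) as G. set (U1 := U0 a s ^ 4) in *.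
assert (GU : 3 <= U1) by (unfold U1; pose proof (pow_incr 3 (U0 a s) 4 ltac:(lra)); lra). pose proof Kloc_facts as [_ HK].
rewrite <- (sumC_perm _ _ _ (gam_nested RH U1 T ltac:(lra))).
assert (Ex : exp (1 / 2 * ln (x + h)) <= 2 * exp (s / 2)).
{ destruct (ln_double_bounds x h Hx Hh) as [[_ B] _]. assert (0 < ln 2) by (pose proof ln_lt_2; lra).
  replace (2 * exp (s / 2)) with (exp (ln 2 + s / 2)) by (rewrite exp_plus, exp_ln by lra; reflexivity). apply exp_le. fold s in B. lra. }
apply Rle_trans with (sumR (fun g => 6 * exp (s / 2) * / (1 + g)) (gam U1)).
- apply sumC_bound. intros g Hg. pose proof (gam_range RH U1 g ltac:(lra) Hg) as R. destruct (half_neq g) as [N1 N2]. destruct (half_Cmod_lower g ltac:(lra)) as [A _].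
  eapply Rle_trans; [apply Kh_bound; try assumption; try lra; simpl; lra|]. simpl (Re _).
  apply div_le_of_mul; [lra|]. replace (6 * exp (s / 2) * / (1 + g) * Cmod ((1 / 2)%R, g)) with (2 * exp (s / 2) * (Cmod ((1 / 2)%R, g) * 3 / (1 + g))) by (field; lra).
  pose proof (exp_pos (s / 2)). assert (1 <= Cmod ((1 / 2)%R, g) * 3 / (1 + g)) by (apply le_div_of_mul; lra). nra.
- rewrite sumR_scal. pose proof (gam_recip_sum RH U1 ltac:(lra)) as B. pose proof (exp_pos (s / 2)) as P.
  assert (LU : 0 <= ln U1 <= 12 * Rpower s (a / 2)).
  { split; [apply ln_nonneg; lra|]. unfold U1. rewrite ln_pow, ln_U0 by lra. pose proof ln3_le_2. pose proof (one_le_Rpower s (a / 2) Hs ltac:(lra)). simpl. lra. }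
  assert (LU2 : ln U1 ^ 2 <= 144 * Rpower s a).
  { replace (Rpower s a) with (Rpower s (a / 2) * Rpower s (a / 2)) by (rewrite <- Rpower_plus; f_equal; field).
    replace (144 * (Rpower s (a / 2) * Rpower s (a / 2))) with ((12 * Rpower s (a / 2)) ^ 2) by ring. apply pow_incr, LU. }
  apply Rle_trans with (6 * exp (s / 2) * (16 * Kloc * (144 * Rpower s a))); [|right; ring].
  apply Rmult_le_compat_l; [lra|]. eapply Rle_trans; [exact B|]. apply Rmult_le_compat_l; lra.
Qed.

(** The averaged kernel is O(x^(3/2) / (h g^2)), and the sum of 1/g^2 beyond Z = sqrt x log x is
    O(log Z / Z) = O(1 / sqrt x). With h >= sqrt x this leaves sqrt x. *)
Lemma high_zeros x h T : 2 <= ln x -> 0 < x -> exp (ln x / 2) <= h <= x -> Zc (ln x) <= T ->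
  Cmod (sumC (fun g => Kh x h (1 / 2, g)) (filter (fun g => negb (leb_R (Zc (ln x)) g)) (gam T))) <= 384 * Kloc * exp (ln x / 2).
Proof.
intros Hs Hx Hh HT. set (s := ln x) in *. set (Z := Zc s) in *. pose proof Kloc_facts as [_ HK]. pose proof (exp_pos (s / 2)) as P.
assert (GZ : 2 <= Z) by (unfold Z, Zc; pose proof (exp_ineq1_le (s / 2)); nra).
apply Rle_trans with (sumR (fun g => 8 * (x * exp (s / 2)) / h * / g ^ 2) (filter (fun g => negb (leb_R Z g)) (gam T))).
- apply sumC_bound. intros g Hg. apply filter_In in Hg. destruct Hg as [Hg _]. pose proof (gam_range RH T g ltac:(lra) Hg) as R.
  destruct (half_neq g) as [N1 N2]. destruct (half_Cmod_lower g ltac:(lra)) as [_ [A1 A2]].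
  eapply Rle_trans; [apply Kh_bound2; try assumption; try lra; simpl; lra|]. simpl (Re _). replace (1 / 2 + 1) with (3 / 2) by field.
  pose proof (exp_three_halves x h Hx ltac:(lra)) as E3. fold s in E3.
  replace (8 * (x * exp (s / 2)) / h * / g ^ 2) with (2 * (4 * (x * exp (s / 2))) / (h * g ^ 2)) by (field; lra).
  assert (G2 : 0 < g ^ 2) by (apply pow_lt; lra). assert (GG : g ^ 2 <= Cmod ((1 / 2)%R, g) * Cmod (((1 / 2)%R, g) + 1)%C) by (simpl; rewrite Rmult_1_r; apply Rmult_le_compat; lra).
  unfold Rdiv. apply Rmult_le_compat; [pose proof (exp_pos (3 / 2 * ln (x + h))); lra| |lra|].
  + left. apply Rinv_0_lt_compat. apply Rmult_lt_0_compat; [lra|]. eapply Rlt_le_trans; [exact G2|exact GG].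
  + apply Rinv_le_contravar; [apply Rmult_lt_0_compat; lra|]. apply Rmult_le_compat_l; [lra|exact GG].
- rewrite sumR_scal. pose proof (gam_tail_sum RH Z T GZ HT) as B.
  assert (XE : x = exp (s / 2) * exp (s / 2)) by (unfold s; rewrite <- exp_plus; replace (ln x / 2 + ln x / 2) with (ln x) by field; rewrite exp_ln; lra).
  assert (XH : x / h <= exp (s / 2)) by (apply div_le_of_mul; [lra|]; rewrite XE at 1; apply Rmult_le_compat_l; lra).
  assert (LZ : ln Z <= 2 * s) by (unfold Z; rewrite ln_Zc by lra; pose proof (exp_ineq1_le (ln s)) as A; rewrite exp_ln in A by lra; lra).
  assert (LZZ : ln Z / Z <= 2 / exp (s / 2)).
  { unfold Z at 2. unfold Zc. apply div_le_of_mul; [nra|]. replace (2 / exp (s / 2) * (exp (s / 2) * s)) with (2 * s) by (field; lra). exact LZ. }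
  assert (LZ0 : 0 <= ln Z / Z) by (apply Rdiv_le_0_compat; [apply ln_nonneg|]; lra).
  assert (XH0 : 0 < x / h) by (apply Rdiv_lt_0_compat; lra).
  apply Rle_trans with (8 * exp (s / 2) * (x / h) * (24 * Kloc * (ln Z / Z))); [replace (8 * (x * exp (s / 2)) / h) with (8 * exp (s / 2) * (x / h)) by (field; lra); apply Rmult_le_compat_l; [apply Rmult_le_pos; lra|exact B]|].
  apply Rle_trans with (8 * exp (s / 2) * exp (s / 2) * (24 * Kloc * (2 / exp (s / 2)))); [|right; field; lra].
  apply Rmult_le_compat; [apply Rmult_le_pos; lra|apply Rmult_le_pos; lra|apply Rmult_le_compat_l; lra|apply Rmult_le_compat_l; lra].
Qed.
End Zeros.

(** The threshold is 331776 = 24^4: since a/2 <= 3/4 it gives 24 s^(3/4) <= s, so log (U0^4) = 4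
    (log 3 + s^(a/2)) <= 12 s^(3/4) <= s/2. *)
Lemma U0_le_Zc a s : 0 < a <= 3 / 2 -> 331776 <= s -> U0 a s ^ 4 <= Zc s.
Proof.
intros Ha Hs. pose proof (U0_ge a s) as G. pose proof ln3_le_2 as L3.
assert (P1 : Rpower s (a / 2) <= Rpower s (3 / 4)) by (apply Rpower_le_exponent; lra).
assert (P2 : 24 <= Rpower s (1 / 4)).
{ replace 24 with (Rpower 331776 (1 / 4)); [apply Rle_Rpower_l; lra|].
  replace 331776 with (Rpower 24 (INR 4)) by (rewrite Rpower_pow; lra). rewrite Rpower_mult. replace (INR 4 * (1 / 4)) with 1 by (simpl; field). apply Rpower_1. lra. }
assert (P3 : Rpower s (3 / 4) * Rpower s (1 / 4) = s) by (rewrite <- Rpower_plus; replace (3 / 4 + 1 / 4) with 1 by field; apply Rpower_1; lra).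
pose proof (one_le_Rpower s (3 / 4) ltac:(lra) ltac:(lra)) as P4.
rewrite <- (exp_ln (U0 a s ^ 4)) by (apply pow_lt; lra). rewrite ln_pow, ln_U0 by lra.
apply Rle_trans with (exp (s / 2)); [apply exp_le; simpl; nra|]. unfold Zc. pose proof (exp_pos (s / 2)). nra.
Qed.

(** * From averages of psi to psi itself *)

Section Conclusion.
Variable a : R.
Hypothesis Ha : 0 < a <= 3 / 2.
Hypothesis RH : riemann_hypothesis.
Hypothesis HF : forall c1 c2 : R, 0 < c1 -> 0 < c2 ->
     exists K : R, forall x T : R,
       2 <= x -> 3 <= T ->
       c1 * (T ^ 2 / (ln T) ^ 4) <= x ->
       x <= c2 * Rpower T (Rpower (ln T) ((2 - a) / a)) ->
       Cmod (F (Rpower (ln T) (3 - 2 * a)) x T) <= K * (T * ln T).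

Lemma zeros_bound : exists C, 0 <= C /\ forall x h T, 0 < x -> 331776 <= ln x -> exp (ln x / 2) <= h <= x -> x ^ 4 <= T ->
  Cmod (sumC (fun g => Kh x h (1 / 2, g)) (gam T)) <= C * (exp (ln x / 2) * Rpower (ln x) a).
Proof.
destruct (E_bound a Ha RH HF) as [C0 [HC0 HE]]. assert (L2 : 0 < ln 2) by (pose proof ln_lt_2; lra). pose proof Kloc_facts as [_ HK].
set (C1 := 32 * C0 / (a * ln 2) * Rpower 8 a).
assert (HC1 : 0 <= C1) by (apply Rmult_le_pos; [apply Rdiv_le_0_compat; [lra|apply Rmult_lt_0_compat; lra]|left; apply Rpower_pos]).
exists (13824 * Kloc + 4 * C1 + 384 * Kloc). split; [lra|]. intros x h T Hx Hs Hh HT. set (s := ln x) in *.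
assert (P : 0 < exp (s / 2)) by apply exp_pos. pose proof (U0_le_Zc a s Ha Hs) as UZ. pose proof (U0_ge a s) as GU.
assert (ZT : Zc s <= T).
{ apply Rle_trans with (x ^ 4); [|exact HT]. rewrite <- (exp_ln (x ^ 4)) by (apply pow_lt; lra). rewrite ln_pow by lra. fold s.
  rewrite <- (exp_ln (Zc s)) by (unfold Zc; nra). apply exp_le. rewrite ln_Zc by lra.
  pose proof (exp_ineq1_le (ln s)) as A. rewrite exp_ln in A by lra. simpl. lra. }
rewrite (sumC_partition _ (leb_R (Zc s)) (gam T)), (sumC_leb_split _ _ _ _ UZ).
pose proof (low_zeros a Ha RH x h T ltac:(fold s; lra) Hx ltac:(lra) ltac:(fold s; lra)) as B1. fold s in B1.
pose proof (high_zeros a Ha RH x h T ltac:(fold s; lra) Hx ltac:(fold s; lra) ltac:(fold s; lra)) as B3. fold s in B3.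
assert (B2 : Cmod (sumC (fun g => Kh x h (1 / 2, g)) (filter (seg (U0 a s ^ 4) (Zc s)) (gam T))) <= 4 * exp (s / 2) * (C1 * Rpower s a)).
{ apply Kh_sum_average; [exact Hx|lra|]. intros t Ht. fold s in Ht. unfold C1.
  apply (middle_bound a Ha RH C0 s T HC0); try lra; try assumption. intros v u Hv Hu. apply (HE s v u); lra. }
pose proof (one_le_Rpower s a ltac:(lra) ltac:(lra)) as PR.
assert (B3' : 384 * Kloc * exp (s / 2) <= 384 * Kloc * (exp (s / 2) * Rpower s a)) by (apply Rmult_le_compat_l; nra).
eapply Rle_trans; [apply Cmod_triangle|]. eapply Rle_trans; [apply Rplus_le_compat; [apply Cmod_triangle|exact B3]|]. lra.
Qed.

(** The step h may exceed the square root of the starting point, because the lower half of the final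
    sandwich starts at x - h with h = sqrt x. *)
Lemma averaged_bound : exists C, 0 <= C /\ forall x h, 0 < x -> 331776 <= ln x -> exp (ln x / 2) <= h <= x ->
  Rabs ((psi1 (x + h) - psi1 x) / h - (x + h / 2)) <= C * (exp (ln x / 2) * Rpower (ln x) a).
Proof.
destruct zeros_bound as [C1 [HC1 H1]]. destruct (explicit_formula RH) as [C2 [HC2 H2]].
exists (C2 + 2 * C1). split; [lra|]. intros x h Hx Hs Hh.
assert (X2 : 2 <= x) by (rewrite <- (exp_ln x) by exact Hx; pose proof (exp_ineq1_le (ln x)); lra).
assert (h1 : 1 <= h) by (pose proof (exp_ineq1_le (ln x / 2)); lra).
destruct (H2 x h X2 ltac:(lra)) as [T [HT B2]]. specialize (H1 x h T Hx Hs Hh ltac:(lra)).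
pose proof (re_le_Cmod (sumC (fun g => Kh x h (1 / 2, g)) (gam T))) as B3.
pose proof (one_le_Rpower (ln x) a ltac:(lra) ltac:(lra)) as PR. pose proof (exp_pos (ln x / 2)) as P.
set (S := Re (sumC (fun g => Kh x h (1 / 2, g)) (gam T))) in *. set (D := (psi1 (x + h) - psi1 x) / h - (x + h / 2)) in *.
assert (B4 : C2 * exp (ln x / 2) <= C2 * (exp (ln x / 2) * Rpower (ln x) a)) by (apply Rmult_le_compat_l; nra).
pose proof (Rabs_triang (D + 2 * S) (- (2 * S))) as T1. replace (D + 2 * S + - (2 * S)) with D in T1 by ring.
rewrite Rabs_Ropp, Rabs_mult, (Rabs_pos_eq 2) in T1 by lra. lra.
Qed.
End Conclusion.

Theorem corollary1 (a : R) (Ha : 0 < a <= 3 / 2)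
  (RH : riemann_hypothesis)
  (HF : forall c1 c2 : R, 0 < c1 -> 0 < c2 ->
     exists K : R, forall x T : R,
       2 <= x -> 3 <= T ->
       c1 * (T ^ 2 / (ln T) ^ 4) <= x ->
       x <= c2 * Rpower T (Rpower (ln T) ((2 - a) / a)) ->
       Cmod (F (Rpower (ln T) (3 - 2 * a)) x T) <= K * (T * ln T)) :
  exists K x0 : R, forall x : R, x0 <= x ->
    Rabs (psi_error x) <= K * (Rpower x (1 / 2) * Rpower (ln x) a).
Proof.
destruct (averaged_bound a Ha RH HF) as [C [HC H]].
(* Beyond this threshold x - h >= x/2 >= exp 331776 for h = sqrt x, so the averaged bound applies at
   x - h too. The extra 1 in the constant absorbs the h/2 of the averages. *)
exists (C + 1), (2 * exp 331776). intros x Hx. pose proof (exp_ineq1_le 331776) as E0.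
assert (Hx2 : exp 331776 <= x / 2) by lra.
assert (Hs : 331776 <= ln x) by (rewrite <- (ln_exp 331776); apply ln_le; [apply exp_pos|lra]).
set (s := ln x) in *. set (h := exp (s / 2)).
assert (Hh : h * h = x) by (unfold h; rewrite <- exp_plus; replace (s / 2 + s / 2) with s by field; apply exp_ln; lra).
assert (Hh1 : 100 <= h) by (unfold h; pose proof (exp_ineq1_le (s / 2)); lra).
assert (Hhx : h <= x / 2) by nra.
assert (E1 : Rpower x (1 / 2) = h) by (unfold Rpower, h; f_equal; fold s; field).
rewrite E1. pose proof (one_le_Rpower s a ltac:(lra) ltac:(lra)) as PR.
set (B := h * Rpower s a). assert (HB : h <= B) by (unfold B; nra).
(* psi x lies below its mean over [x, x + h] and above its mean over [x - h, x]. *)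
destruct (psi1_diff x h ltac:(lra) ltac:(lra)) as [U _]. destruct (psi1_diff (x - h) h ltac:(lra) ltac:(lra)) as [_ L].
replace (x - h + h) with x in L by ring.
pose proof (H x h ltac:(lra) Hs ltac:(fold s h; lra)) as A1. fold s h B in A1.
set (y := x - h) in *. assert (Hy : 331776 <= ln y) by (rewrite <- (ln_exp 331776); apply ln_le; [apply exp_pos|unfold y; lra]).
assert (Ly : ln y <= s) by (apply ln_le; unfold y; lra).
assert (hy : exp (ln y / 2) <= h) by (apply exp_le; lra).
pose proof (H y h ltac:(unfold y; lra) Hy ltac:(unfold y in *; lra)) as A2.
replace (y + h) with x in A2 by (unfold y; ring).
assert (A3 : C * (exp (ln y / 2) * Rpower (ln y) a) <= C * B).
{ apply Rmult_le_compat_l; [exact HC|]. unfold B. apply Rmult_le_compat; [left; apply exp_pos|left; apply Rpower_pos|exact hy|apply Rle_Rpower_l; lra]. }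
apply Rabs_le_between in A1. assert (A4 := Rle_trans _ _ _ A2 A3). apply Rabs_le_between in A4.
unfold psi_error. apply Rabs_le. unfold y in *. lra.
Qed.
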